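(* Let $\Omega\subset\mathbb{R}^n$ be a bounded $C^{1,1}$ domain, $s\in(0,1)$, $\alpha\in(0,1)$. Let $g\in C^\alpha_{\rm loc}(\Omega\times\mathbb{R})$ satisfy $g\ge0$ and assume that there exist $c>0$ and a finite exponent $q\in[1,2^*]$ such that $|g(x,t)|\le c(1+|t|^{q-1})$ for a.e. $x\in\Omega$ and all $t\in\mathbb{R}$. Let $u\in X_0^1$ be a weak solution of $$-\Delta u+(-\Delta)^s u=g(x,u)\ \text{ in }\Omega,\qquad u=0\ \text{ in }\mathbb{R}^n\setminus\Omega .$$ Then $u\in C^{2,\alpha}_{\rm loc}(\Omega)\cap C(\mathbb{R}^n)$. Furthermore, if $u\not\equiv0$ in $\mathbb{R}^n$, then $u>0$ in $\Omega$.
   Context: $2^*:=\frac{2n}{n-2}$ if $n>2$ and $2^*:=\infty$ if $n\le 2$. Set $[u]_s:=\big(\iint_{\mathbb{R}^{2n}}\frac{|u(x)-u(y)|^2}{|x-y|^{n+2s}}\,dx\,dy\big)^{1/2}$. The space $X_0^1$ consists of Lebesgue measurable $u:\mathbb{R}^n\to\mathbb{R}$ with $u|_\Omega\in H_0^1(\Omega)$ (the closure of $C_c^\infty(\Omega)$ in $H^1(\Omega)$), $[u]_s<\infty$ and $u=0$ a.e. in $\mathbb{R}^n\setminus\Omega$. A weak solution is $u\in X_0^1$ such that $$\int_\Omega\nabla u\cdot\nabla\varphi\,dx+\iint_{\mathbb{R}^{2n}}\frac{(u(x)-u(y))(\varphi(x)-\varphi(y))}{|x-y|^{n+2s}}\,dx\,dy=\int_\Omega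 g(x,u(x))\varphi(x)\,dx\quad\forall\varphi\in X_0^1$$ (the normalization constant of the fractional term is set to $1$). Functions are identified with their continuous representatives. *)

(* Defs.v *)
From HB Require Import structures.
From mathcomp Require Import all_boot all_order all_algebra.
From mathcomp Require Import all_classical all_reals all_analysis.

Set Implicit Arguments.
Unset Strict Implicit.
Unset Printing Implicit Defensive.

Import Order.TTheory GRing.Theory Num.Theory.
Import numFieldNormedType.Exports.

Local Open Scope classical_set_scope.
Local Open Scope ring_scope.

(* The sigma-algebra of R^n = 'rV[R]_n is generated by the n coordinates, as
   the library does for n.-tuple; it is the Borel sigma-algebra. *)
Section measurable_rV.
Context {R : realType} (n : nat).

Definition rV_coord (i : 'I_n) (x : 'rV[R]_n) : measurableTypeR R := x ord0 i.

Let rV_set0 : g_sigma_preimage rV_coord set0.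
Proof. exact: sigma_algebra0. Qed.

Let rV_setC A : g_sigma_preimage rV_coord A -> g_sigma_preimage rV_coord (~` A).
Proof. exact: sigma_algebraC. Qed.

Let rV_bigcup (F : (set 'rV[R]_n)^nat) :
  (forall i, g_sigma_preimage rV_coord (F i)) ->
  g_sigma_preimage rV_coord (\bigcup_i F i).
Proof. exact: sigma_algebra_bigcup. Qed.

HB.instance Definition _ := @isMeasurable.Build default_measure_display
  'rV[R]_n (g_sigma_preimage rV_coord) rV_set0 rV_setC rV_bigcup.

Lemma measurable_rV_coord (i : 'I_n) : measurable_fun setT (rV_coord i).
Proof.
move=> _ Y mY; rewrite setTI; apply: sub_sigma_algebra => /=.
rewrite -bigcup_seq/=; exists i => /=; first by rewrite mem_index_enum.
by exists Y => //; rewrite setTI.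
Qed.

Lemma measurable_fun_rVP d (T : measurableType d) (f : T -> 'rV[R]_n) :
  (forall i, measurable_fun setT (rV_coord i \o f)) -> measurable_fun setT f.
Proof.
move=> mf; apply: (@measurability _ _ _ _ _ _
  (\big[setU/set0]_(i < n) preimage_set_system setT (rV_coord i) measurable)).
  by [].
move=> _ [B + <-]; rewrite -bigcup_seq => -[i _ [Y mY <-]].
by rewrite !setTI -comp_preimage -[X in measurable X]setTI; exact: mf.
Qed.

End measurable_rV.

Section lebesgue_rV.
Context {R : realType}.

Definition rV_cons (n : nat) (p : measurableTypeR R * 'rV[R]_n) : 'rV[R]_n.+1 :=
  row_mx (p.1%:M : 'rV_1) p.2.

Lemma rV_cons0 (n : nat) p : @rV_cons n p ord0 ord0 = p.1.
Proof.
by rewrite /rV_cons mxE; case: splitP => // j _; rewrite mxE !ord1 mulr1n.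
Qed.

Lemma rV_consS (n : nat) p i : @rV_cons n p ord0 (lift ord0 i) = p.2 ord0 i.
Proof.
rewrite /rV_cons mxE; case: splitP => [[[|//] ?] //|j /= ij].
by congr (p.2 _ _); apply/val_inj; case: ij.
Qed.

Lemma measurable_rV_cons (n : nat) : measurable_fun setT (@rV_cons n).
Proof.
apply: measurable_fun_rVP => i; have [j ->|->] := unliftP ord0 i.
  rewrite (_ : _ \o _ = rV_coord j \o snd); last first.
    by apply/funext => p /=; rewrite /rV_coord rV_consS.
  by apply: measurableT_comp => //; exact: measurable_rV_coord.
rewrite (_ : _ \o _ = fst); first exact: measurable_fst.
by apply/funext => p /=; rewrite /rV_coord rV_cons0.
Qed.

Section step.
Variables (n : nat) (m : {sigma_finite_measure set 'rV[R]_n -> \bar R}).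

Definition lebesgue_rV_step : set 'rV[R]_n.+1 -> \bar R :=
  pushforward (@lebesgue_measure R \x m)%E (@rV_cons n).

Let step0 : lebesgue_rV_step set0 = 0%E.
Proof. by rewrite /lebesgue_rV_step /pushforward preimage_set0 measure0. Qed.

Let step_ge0 A : (0 <= lebesgue_rV_step A)%E.
Proof. exact: (measure_ge0 (@lebesgue_measure R \x m)%E). Qed.

Let step_sigma_additive : semi_sigma_additive lebesgue_rV_step.
Proof.
have mc (A : set 'rV[R]_n.+1) :
    measurable A -> measurable (@rV_cons n @^-1` A).
  by move=> mA; rewrite -[X in measurable X]setTI; exact: measurable_rV_cons.
move=> F mF tF mUF; rewrite /lebesgue_rV_step /pushforward preimage_bigcup.
apply: measure_semi_sigma_additive.
- by move=> k; exact: mc.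
- apply/trivIsetP => /= i j _ _ ij; rewrite -preimage_setI.
  by move/trivIsetP : tF => /(_ _ _ _ _ ij) ->//; rewrite preimage_set0.
- by rewrite -preimage_bigcup; exact: mc.
Qed.

HB.instance Definition _ := isMeasure.Build _ _ _ lebesgue_rV_step
  step0 step_ge0 step_sigma_additive.

Let step_sigma_finite : sigma_finite setT lebesgue_rV_step.
Proof.
pose h (x : 'rV[R]_n.+1) : measurableTypeR R * 'rV[R]_n :=
  (rV_coord ord0 x, \row_i x ord0 (lift ord0 i)).
have mh : measurable_fun setT h.
  apply/measurable_fun_pairP; split; first exact: measurable_rV_coord.
  apply: measurable_fun_rVP => i.
  rewrite (_ : _ \o _ = rV_coord (lift ord0 i)); last first.
    by apply/funext => x /=; rewrite /rV_coord mxE.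
  exact: measurable_rV_coord.
have hK p : h (rV_cons p) = p.
  case: p => a x; congr pair; rewrite /= ?/rV_coord ?rV_cons0//.
  by apply/rowP => i; rewrite mxE rV_consS.
have /sigma_finiteP[F [FT ndF Foo]] := sigma_finiteT (@lebesgue_measure R).
have /sigma_finiteP[G [GT ndG Goo]] := sigma_finiteT m.
exists (fun k => h @^-1` (F k `*` G k)).
  rewrite -preimage_bigcup; apply/seteqP; split => // x _.
  have [i _ Fi] : (\bigcup_i F i) (h x).1 by rewrite -FT.
  have [j _ Gj] : (\bigcup_j G j) (h x).2 by rewrite -GT.
  exists (maxn i j) => //; split.
    by move: Fi; exact/subsetPset/ndF/leq_maxl.
  by move: Gj; exact/subsetPset/ndG/leq_maxr.
move=> k; have [mF Fk] := Foo k; have [mG Gk] := Goo k.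
have mFG : measurable (F k `*` G k) by exact: measurableX.
split; first by rewrite -[X in measurable X]setTI; exact: mh.
rewrite /lebesgue_rV_step /pushforward -comp_preimage.
rewrite (_ : h \o _ = id); last by apply/funext => p; exact: hK.
by rewrite preimage_id product_measure1E// lte_mul_pinfty// ge0_fin_numE.
Qed.

HB.instance Definition _ := Measure_isSigmaFinite.Build _ _ _ lebesgue_rV_step
  step_sigma_finite.

End step.

Fixpoint lebesgue_rV (n : nat) : {sigma_finite_measure set 'rV[R]_n -> \bar R} :=
  if n is k.+1 then lebesgue_rV_step (lebesgue_rV k) else dirac (0 : 'rV[R]_0).

Lemma lebesgue_rV_box (n : nat) (a b : 'I_n -> R) : (forall i, a i <= b i) ->
  lebesgue_rV n [set x | forall i, x ord0 i \in `[a i, b i]] =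
  (\prod_(i < n) (b i - a i))%:E.
Proof.
elim: n a b => [|n IH] a b ab.
  rewrite big_ord0 /= diracE mem_set// => -[].
  by [].
rewrite big_ord_recl EFinM /= /lebesgue_rV_step /pushforward.
set B := [set x : 'rV[R]_n | forall i,
  x ord0 i \in `[a (lift ord0 i), b (lift ord0 i)]].
rewrite (_ : _ @^-1` _ = `[a ord0, b ord0]%classic `*` B); last first.
  apply/seteqP; split => -[t x] /=.
    move=> h; split; first by have := h ord0; rewrite rV_cons0.
    by move=> i; have := h (lift ord0 i); rewrite rV_consS.
  move=> [ht hx] i; have [j ->|->] := unliftP ord0 i; first by rewrite rV_consS.
  by rewrite rV_cons0.
have mB : measurable B.
  rewrite (_ : B = \bigcap_(i in [set: 'I_n])
    (rV_coord i @^-1` `[a (lift ord0 i), b (lift ord0 i)]%classic)).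
    apply: fin_bigcap_measurable => // i _.
    by rewrite -[X in measurable X]setTI; exact: measurable_rV_coord.
  by apply/seteqP; split => x /= h i; [move=> _|]; exact: h.
rewrite product_measure1E//; congr (_ * _)%E; last exact: IH.
transitivity (lebesgue_measure `[a ord0, b ord0]%classic); first by [].
rewrite lebesgue_measure_itv/= lte_fin.
have := ab ord0; rewrite le_eqVlt => /orP[/eqP->|->]; last by rewrite EFinB.
by rewrite ltxx subrr.
Qed.

End lebesgue_rV.

Section lebesgue_measurable.
Context {R : realType} (n : nat).

(* The completion of the Borel sigma-algebra. The library integral of a
   function that is measurable only for the completion is its usual Lebesgue
   integral: the supremum over Borel simple functions is unaffected by null
   sets. *)
Definition lebesgue_measurable_set (A : set 'rV[R]_n) :=
  exists2 B, measurable B &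
    (lebesgue_rV n).-negligible ((A `\` B) `|` (B `\` A)).

Definition lebesgue_measurable_fun (D : set 'rV[R]_n) (f : 'rV[R]_n -> R) :=
  forall Y : set R, measurable Y -> lebesgue_measurable_set (D `&` f @^-1` Y).

End lebesgue_measurable.

Section function_spaces.
Context {R : realType}.

(* The library norm of 'rV[R]_n is the sup norm. *)
Definition euclidean_norm (n : nat) (x : 'rV[R]_n) : R :=
  Num.sqrt (\sum_(i < n) x ord0 i ^+ 2).

Definition partial (n : nat) (i : 'I_n) (f : 'rV[R]_n -> R) : 'rV[R]_n -> R :=
  fun x => 'D_(delta_mx ord0 i) f x.

(* C^k(U), for U open *)
Fixpoint Ck (n k : nat) (U : set 'rV[R]_n) (f : 'rV[R]_n -> R) : Prop :=
  (forall x, U x -> {for x, continuous f}) /\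
  if k is k'.+1 then
    forall i, (forall x, U x -> derivable f x (delta_mx ord0 i)) /\
              Ck k' U (partial i f)
  else True.

Definition holder (V : normedModType R) (a : R) (K : set V) (f : V -> R) :=
  exists C : R, forall x y, K x -> K y -> `|f x - f y| <= C * `|x - y| `^ a.

(* The norm of V is irrelevant up to the constant, so the sup norms of R^n
   and of R^n * R are as good as the Euclidean ones. *)
Definition holder_loc (V : normedModType R) (a : R) (U : set V) (f : V -> R) :=
  forall K : set V, compact K -> K `<=` U -> holder a K f.

Definition C2_holder_loc (n : nat) (a : R) (U : set 'rV[R]_n)
    (f : 'rV[R]_n -> R) :=
  Ck 2 U f /\ forall i j, holder_loc a U (partial i (partial j f)).

Definition Cc_smooth (n : nat) (U : set 'rV[R]_n) (f : 'rV[R]_n -> R) :=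
  [/\ forall k, Ck k setT f,
      compact (closure [set x | f x != 0]) &
      closure [set x | f x != 0] `<=` U].

Definition C11 (n : nat) (f : 'rV[R]_n -> R) :=
  Ck 1 setT f /\ forall i, lipschitz (partial i f).

End function_spaces.

Section domains.
Context {R : realType} (n : nat).

(* Near x0, and in the orthonormal coordinates y = x *m Q, U is the strict
   epigraph of a C^{1,1} function of the coordinates other than y_k. *)
Definition C11_boundary_at (U : set 'rV[R]_n) (x0 : 'rV[R]_n) :=
  exists (Q : 'M[R]_n) (k : 'I_n) (h : 'rV[R]_n.-1 -> R) (r : R),
    [/\ Q *m Q^T = 1%:M, C11 h, 0 < r &
        forall x, ball x0 r x ->
          (U x <-> h (col' k (x *m Q)) < (x *m Q) ord0 k)].

Definition bounded_C11_domain (U : set 'rV[R]_n) :=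
  [/\ open U, connected U, U !=set0, bounded_set U &
      forall x0, (closure U `\` U) x0 -> C11_boundary_at U x0].

End domains.

Section sobolev.
Context {R : realType} (n : nat).
Implicit Types (U : set 'rV[R]_n) (u w f phi : 'rV[R]_n -> R).
Local Notation mu := (lebesgue_rV n : {measure set 'rV[R]_n -> \bar R}).

Definition L2 U f :=
  lebesgue_measurable_fun U f /\ (\int[mu]_(x in U) (f x ^+ 2)%:E < +oo)%E.

Definition is_weak_partial U (i : 'I_n) u w := forall phi, Cc_smooth U phi ->
  \int[mu]_(x in U) (u x * partial i phi x) =
  - \int[mu]_(x in U) (w x * phi x).

Definition H1 U u :=
  L2 U u /\ forall i, exists2 w, L2 U w & is_weak_partial U i u w.

(* A choice of the weak derivative, which is unique up to null sets. *)
Definition weak_partial U (i : 'I_n) u : 'rV[R]_n -> R :=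
  xget (cst 0) [set w | L2 U w /\ is_weak_partial U i u w].

Definition H1_norm U u : R := Num.sqrt
  (\int[mu]_(x in U) (u x ^+ 2 + \sum_(i < n) weak_partial U i u x ^+ 2)).

Definition H10 U u := H1 U u /\
  forall e : R, 0 < e ->
    exists2 phi, Cc_smooth U phi & H1_norm U (u \- phi) < e.

Definition gagliardo (s : R) u : \bar R :=
  ((\int[(mu \x mu)%E]_p ((`|u p.1 - u p.2| ^+ 2) /
      (euclidean_norm (p.1 - p.2) `^ (n%:R + 2 * s)))%:E) `^ 2^-1)%E.

Definition X10 (s : R) U u :=
  [/\ lebesgue_measurable_fun setT u, H10 U u, (gagliardo s u < +oo)%E &
      {ae mu, forall x, ~ U x -> u x = 0}].

Definition local_form U u phi : R :=
  \int[mu]_(x in U) \sum_(i < n) weak_partial U i u x * weak_partial U i phi x.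

Definition nonlocal_form (s : R) u phi : R :=
  \int[(mu \x mu)%E]_p ((u p.1 - u p.2) * (phi p.1 - phi p.2) /
    (euclidean_norm (p.1 - p.2) `^ (n%:R + 2 * s))).

Definition weak_solution (s : R) U (g : 'rV[R]_n -> R -> R) u :=
  X10 s U u /\
  forall phi, X10 s U phi ->
    local_form U u phi + nonlocal_form s u phi =
    \int[mu]_(x in U) (g x (u x) * phi x).

Definition critical_exponent : \bar R :=
  if (2 < n)%N then (2 * n%:R / (n%:R - 2))%:E else +oo%E.

End sobolev.

(* Main.v *)
(** The test functions [einv (eps * u - w)], where [einv t] is [exp (- 1 / t)] for [t > 0] and [0]
    otherwise, belong to the energy space, and monotonicity of [einv] gives the fractional term a
    sign. With [eps = -1] this yields [u >= 0]; with constant [w] it bounds the energy above each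
    level, and a Faber-Krahn inequality and a De Giorgi iteration make the high level sets null, so
    that [u] is bounded. In the interior, a radial mollifier [eta_t] satisfies
    [d/dt eta_t = t * Laplacian zeta_t] for a second radial mollifier [zeta_t]; the equation
    therefore controls [d/dt (u * D_l eta_t)] and gains [2 - 2 s] powers of [t] over the decay
    already known. Iterating up to decay [t ^ (2 + alpha)] for third derivatives gives the Hoelder
    estimate for the second derivatives. At the boundary [u] is compared with barriers vanishing
    on exterior balls. If [u] vanished at an interior point, the mollified values there would be
    nonnegative, tend to [0] with [t], and decrease for small [t] because of the nonlocal term. *)
From HB Require Import structures.
Require Import Defs.
From mathcomp Require Import all_boot all_order all_algebra.
From mathcomp Require Import all_classical all_reals all_analysis.
From mathcomp Require Import measurable_realfun ring lra zify.
Set Implicit Arguments.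
Unset Strict Implicit.
Unset Printing Implicit Defensive.
Import Order.TTheory GRing.Theory Num.Theory.
Import numFieldNormedType.Exports.
Local Open Scope classical_set_scope.
Local Open Scope ring_scope.

Local Notation leb R n := (lebesgue_rV n : {measure set 'rV[R]_n -> \bar R}).
Local Notation leb2 R n :=
  ((lebesgue_rV n \x lebesgue_rV n)%E : {measure set ('rV[R]_n * 'rV[R]_n) -> \bar R}).
Local Notation norm_bounded U := (exists M, forall x, U x -> `|x| <= M).
Local Notation "[ 'ae' m , x | P ]" :=
  (exists N, [/\ measurable N, m N = 0%E & forall x, ~ N x -> P])
  (at level 0, m at level 9, x name).

(** Three obstacles shape the proof. Test functions must be limits of smooth compactly supported
    ones, so the truncations (u - k)_+ are replaced by compositions with [einv]: it vanishes on the
    negative axis, which keeps supports inside [U], and its derivatives are bounded. At the critical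
    exponent the energy inequality alone improves nothing; smallness comes from the gradient
    integral over {u > 2^j}, which tends to 0 and makes the measures of these sets decay faster than
    any geometric sequence before De Giorgi's iteration starts. Finally, the fractional term sees
    values of [u] where no regularity is known. Its kernel is split into a bounded Lipschitz tail,
    moved to the right-hand side, and a singular part supported near the origin, which costs 2s < 2
    derivatives. Interior regularity is run twice: a bounded right-hand side yields a Lipschitz
    representative, which makes g(x, u) Hoelder continuous, and the second pass reaches C^{2,alpha}.
    Solutions are defined up to null sets only, so [u] and the right-hand side are replaced several
    times by better representatives. *)

Lemma le_of_eq d (T : porderType d) (x y : T) : x = y -> (x <= y)%O.
Proof. by move=> ->. Qed.

(** * Lebesgue measure on row vectors *)
Section rV_basics.
Context {R : realType} {n : nat}.
Local Notation V := 'rV[R]_n.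
Implicit Types (x y : V) (r : R).

Lemma coord_le_norm x i : `|x ord0 i| <= `|x|.
Proof.
rewrite -[`|x|]/(mx_norm x) mx_normrE; apply: (@le_trans _ _ (`|x (ord0, i).1 (ord0, i).2|)) => //.
exact: (le_bigmax _ (fun i : 'I_1 * 'I_n => `|x i.1 i.2|)).
Qed.

Lemma rV_norm_le x r : 0 <= r -> (forall i, `|x ord0 i| <= r) -> `|x| <= r.
Proof.
move=> r0 xr; rewrite -[`|x|]/(mx_norm x) mx_normrE; apply: bigmax_le => //= -[i j] _ /=.
by rewrite ord1.
Qed.

Lemma rV_norm_lt x r : 0 < r -> (forall i, `|x ord0 i| < r) -> `|x| < r.
Proof.
move=> r0 xr; rewrite -[`|x|]/(mx_norm x) mx_normrE; apply: bigmax_lt => //= -[i j] _ /=.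
by rewrite ord1.
Qed.

Lemma rV_ballE x r : ball x r = [set y | `|x - y| < r].
Proof. by rewrite mx_norm_ball. Qed.

Lemma measurable_rV_ball x r : measurable (ball x r : set V).
Proof.
have [r0|r0] := ltP 0 r; last first.
  rewrite (_ : ball x r = set0) // rV_ballE; apply/seteqP; split=> // y /=.
  by rewrite ltNge (le_trans r0).
have -> : (ball x r : set V) = \bigcap_(i in [set: 'I_n])
    (rV_coord i @^-1` [set t : measurableTypeR R | `|x ord0 i - t| < r]).
  rewrite rV_ballE; apply/seteqP; split => y /= h.
    move=> i _ /=; apply: le_lt_trans h; rewrite /rV_coord.
    by have := coord_le_norm (x - y) i; rewrite !mxE.
  by apply: rV_norm_lt => // i; have := h i I; rewrite /rV_coord /= !mxE.
apply: fin_bigcap_measurable => // i _.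
rewrite -[X in measurable X]setTI; apply: measurable_rV_coord => //.
rewrite (_ : [set _ | _] = `](x ord0 i - r), (x ord0 i + r)[%classic); last first.
  by apply/seteqP; split => t /=; rewrite in_itv/= ltr_norml => /andP[]; lra.
exact: measurable_itv.
Qed.

(** Measurability refers to the sigma-algebra generated by the coordinates, so open sets have to be
    recovered from it: an open set is the countable union of the balls with rational centre and
    radius 1/(m+1) that it contains. *)
Lemma open_measurable (U : set V) : open U -> measurable U.
Proof.
move=> oU.
pose F (p : 'rV[rat]_n * nat) : set V :=
  if `[< ball (map_mx ratr p.1 : V) (p.2.+1%:R^-1) `<=` U >]
  then ball (map_mx ratr p.1 : V) (p.2.+1%:R^-1) else set0.
rewrite (_ : U = \bigcup_p F p); last first.
  apply/seteqP; split => x.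
    move=> Ux; have /nbhs_ballP[e /= e0 xe] := open_nbhs_nbhs (conj oU Ux).
    have [m m_lt] : exists m : nat, m.+1%:R^-1 < e / 2.
      have [m _ hm] := near_infty_natSinv_lt (PosNum (divr_gt0 e0 (ltr0n R 2))).
      by exists m; exact: (hm m (leqnn m)).
    have /choice [q hq] (i : 'I_n) : exists q : rat, ratr q \in `](x ord0 i - m.+1%:R^-1), (x ord0 i + m.+1%:R^-1)[.
      apply: rat_in_itvoo; rewrite ltrD2l; apply: (@lt_trans _ _ 0).
        by rewrite oppr_lt0 invr_gt0.
      by rewrite invr_gt0.
    have bx : ball (map_mx ratr (\row_i q i) : V) (m.+1%:R^-1) x.
      rewrite rV_ballE/=; apply: rV_norm_lt; first by rewrite invr_gt0.
      move=> i; have := hq i; rewrite !mxE in_itv/= ltr_norml => /andP[? ?].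
      by rewrite ltrBlDl ltrBrDl; apply/andP.
    exists (\row_i q i, m) => //=; rewrite /F /=; case: ifPn => // /negP; case.
    apply/asboolP => y yb; apply: xe.
    apply: (@le_ball _ _ _ (m.+1%:R^-1 + m.+1%:R^-1)); first by move: (m.+1%:R^-1 : R) m_lt => w; lra.
    by apply: ball_triangle yb; exact: ball_sym.
  by move=> [p _]; rewrite /F; case: ifPn => // /asboolP; exact.
apply: countable_bigcupT_measurable => // p; rewrite /F; case: ifP => // _.
exact: measurable_rV_ball.
Qed.

Lemma closed_measurable (U : set V) : closed U -> measurable U.
Proof.
move=> cU; rewrite -(setCK U); apply: measurableC; apply: open_measurable.
by rewrite openC.
Qed.

Lemma continuous_measurable_rV (f : V -> R) : continuous f -> measurable_fun setT f.
Proof.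
move=> cf; apply: (measurability _ (RGenOpens.measurableE R)) => _ [_ [a [b ->] <-]].
rewrite setTI; apply: open_measurable; apply: open_comp; first by move=> x _; exact: cf.
exact: interval_open.
Qed.

Definition boxc (a b : 'I_n -> R) : set V :=
  [set x | forall i, x ord0 i \in `[a i, b i]].

Definition boxcs : set (set V) := [set A | exists a b, A = boxc a b].

Lemma measurable_boxc a b : measurable (boxc a b).
Proof.
rewrite (_ : boxc a b = \bigcap_(i in [set: 'I_n])
    (rV_coord i @^-1` `[a i, b i]%classic)).
  apply: fin_bigcap_measurable => // i _.
  by rewrite -[X in measurable X]setTI; exact: measurable_rV_coord.
by apply/seteqP; split => x /= h i; [move=> _|]; exact: h.
Qed.

Lemma bigcup_boxc : \bigcup_k boxc (fun=> - k%:R) (fun=> k%:R) = setT.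
Proof.
apply/seteqP; split=> // x _; exists (Num.trunc `|x|).+1 => //= i.
rewrite in_itv /= -ler_norml (le_trans (coord_le_norm _ _))//.
exact/ltW/truncnS_gt.
Qed.

Lemma measurable_boxcsE : (measurable : set (set V)) = <<s boxcs >>.
Proof.
apply/seteqP; split; last first.
  apply: smallest_sub; first exact: sigma_algebra_measurable.
  by move=> _ [a [b ->]]; exact: measurable_boxc.
apply: smallest_sub; first exact: smallest_sigma_algebra.
move=> A; rewrite /preimage_set_system /= -bigcup_seq => -[i _ [Y mY <-]].
suff /(_ measurableT Y mY) : measurable_fun setT (rV_coord i : g_sigma_algebraType boxcs -> measurableTypeR R) by [].
apply: (measurability _ (RGenCInfty.measurableE R)) => _ [_ [a ->] <-].
rewrite setTI (_ : _ @^-1` _ = \bigcup_k boxc (fun j => if j == i then a else - k%:R) (fun=> k%:R)).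
  by apply: bigcup_measurable => k _; apply: sub_sigma_algebra; do 2!eexists.
apply/seteqP; split=> x; rewrite /= /rV_coord in_itv /= andbT; last first.
  by move=> [k _ /(_ i)]; rewrite eqxx in_itv/= => /andP[].
move=> ax; exists (Num.trunc `|x|).+1 => //= j.
have : `|x ord0 j| <= (Num.trunc `|x|).+1%:R.
  by rewrite (le_trans (coord_le_norm _ _))//; exact/ltW/truncnS_gt.
by rewrite in_itv /= ler_norml; case: eqP => [->|] // /andP[_ ->]; rewrite andbT.
Qed.

(** Closed boxes are stable under intersection, generate the sigma-algebra and exhaust the space
    with finite measure, so uniqueness on a pi-system applies. Boxes with crossed bounds are empty
    and need a separate argument, since the product formula is assumed only for ordered bounds. *)
Lemma lebesgue_rV_unique (m1 m2 : {measure set V -> \bar R}) (c : R) :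
  (forall a b, (forall i, a i <= b i) -> m1 (boxc a b) = (c * \prod_(i < n) (b i - a i))%:E) ->
  (forall a b, (forall i, a i <= b i) -> m2 (boxc a b) = (c * \prod_(i < n) (b i - a i))%:E) ->
  forall A, measurable A -> m1 A = m2 A.
Proof.
move=> h1 h2.
have box0 (m : {measure set V -> \bar R}) a b : ~ (forall i, a i <= b i) -> m (boxc a b) = 0%E.
  move=> ab; rewrite (_ : boxc a b = set0) ?measure0//; apply/seteqP; split=> // x xab.
  by apply: ab => i; have := xab i; rewrite in_itv /= => /andP[]; exact: le_trans.
apply: (measure_unique boxcs (fun k => boxc (fun=> - k%:R) (fun=> k%:R))).
- exact: measurable_boxcsE.
- move=> _ _ [a [b ->]] [c' [d ->]]; exists (fun i => Num.max (a i) (c' i)), (fun i => Num.min (b i) (d i)).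
  apply/seteqP; split=> x /=.
    move=> [h h'] i; have := h i; have := h' i; rewrite !in_itv /= le_min ge_max.
    by move=> /andP[-> ->] /andP[-> ->].
  by move=> h; split=> i; have := h i; rewrite !in_itv /= le_min ge_max => /andP[/andP[h1' h2'] /andP[h3' h4']]; apply/andP.
- by move=> k; do 2!eexists.
- exact: bigcup_boxc.
- move=> _ [a [b ->]]; have [ab|ab] := pselect (forall i, a i <= b i).
    by rewrite h1// h2.
  by rewrite !box0.
- by move=> k; rewrite h1 ?ltry// => i; rewrite (@le_trans _ _ 0)// oppr_le0.
Qed.

End rV_basics.

Section rV_invariance.
Context {R : realType} {n : nat}.
Local Notation V := 'rV[R]_n.
Local Notation mu := (leb R n).

Lemma lebesgue_rV_boxc (a b : 'I_n -> R) : (forall i, a i <= b i) ->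
  mu (boxc a b) = (\prod_(i < n) (b i - a i))%:E.
Proof. exact: lebesgue_rV_box. Qed.

Lemma measurable_affine_rV (c : R) (h : V) : measurable_fun setT (fun x : V => c *: x + h).
Proof.
apply: measurable_fun_rVP => i.
rewrite (_ : _ \o _ = (fun x : V => c * x ord0 i + h ord0 i)); last first.
  by apply/funext => x; rewrite /rV_coord /= !mxE.
apply: measurable_funD; last exact: measurable_cst.
by apply: measurable_funM; [exact: measurable_cst|exact: measurable_rV_coord].
Qed.

Section affine.
Variables (c : R) (h : V).
Hypothesis c0 : c != 0.

Let f (x : V) := c *: x + h.
Let mf : measurable_fun setT f := measurable_affine_rV c h.
Let k : {nonneg R} := NngNum (normr_ge0 c).
Let kn : {nonneg R} := NngNum (exprn_ge0 n (normr_ge0 c)).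

Let boxc_affine (a b : 'I_n -> R) : f @^-1` boxc a b =
  boxc (fun i => if 0 < c then c^-1 * (a i - h ord0 i) else c^-1 * (b i - h ord0 i))
       (fun i => if 0 < c then c^-1 * (b i - h ord0 i) else c^-1 * (a i - h ord0 i)).
Proof.
apply/seteqP; split=> x /= hx i; move: (hx i); rewrite /f !mxE !in_itv /=;
  case: ifPn => c0' /andP[h1 h2]; apply/andP; split.
- by rewrite ler_pdivrMl// ; lra.
- by rewrite ler_pdivlMl// ; lra.
- have cn : c < 0 by rewrite lt_neqAle c0 leNgt.
  by rewrite ler_ndivrMl// ; lra.
- have cn : c < 0 by rewrite lt_neqAle c0 leNgt.
  by rewrite ler_ndivlMl// ; lra.
- by move: h1; rewrite ler_pdivrMl//; lra.
- by move: h2; rewrite ler_pdivlMl//; lra.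
- have cn : c < 0 by rewrite lt_neqAle c0 leNgt.
  by move: h2; rewrite ler_ndivlMl//; lra.
- have cn : c < 0 by rewrite lt_neqAle c0 leNgt.
  by move: h1; rewrite ler_ndivrMl//; lra.
Qed.

(** The preimage of a box is again a box, with exchanged bounds when [c] is negative, so |c|^n times
    the push-forward agrees with Lebesgue measure on boxes. Translations, reflections and dilations
    are all instances. *)
Lemma lebesgue_rV_affine (A : set V) : measurable A ->
  ((`|c| ^+ n)%:E * mu (f @^-1` A) = mu A)%E.
Proof.
move=> mA.
pose m1 : {measure set V -> \bar R} := mscale kn (pushforward mu f).
rewrite -[LHS]/(m1 mf A).
apply: (@lebesgue_rV_unique _ _ (m1 mf) mu 1) => // a b ab; last first.
  by rewrite mul1r lebesgue_rV_boxc.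
rewrite mul1r (_ : m1 mf _ = (`|c| ^+ n)%:E * mu (f @^-1` boxc a b))%E// boxc_affine lebesgue_rV_boxc.
  rewrite -EFinM; congr (_%:E).
  rewrite -[X in _ ^+ X * _ = _](card_ord n) -prodr_const -big_split /=; apply: eq_bigr => i _.
  case: ifPn => c0'; rewrite -mulrBr.
    by rewrite gtr0_norm// mulrA divff// mul1r; lra.
  have cn : c < 0 by rewrite lt_neqAle c0 leNgt.
  by rewrite ltr0_norm// mulrA mulNr divff// mulN1r; lra.
move=> i; case: ifPn => c0'.
  by rewrite ler_pM2l ?invr_gt0// lerB.
have cn : c < 0 by rewrite lt_neqAle c0 leNgt.
by rewrite ler_nM2l ?invr_lt0// lerB.
Qed.

Lemma ge0_integral_affine (g : V -> \bar R) : measurable_fun setT g ->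
  (forall x, 0 <= g x)%E ->
  ((`|c| ^+ n)%:E * \int[mu]_x g (c *: x + h)%R = \int[mu]_x g x)%E.
Proof.
move=> mg g0.
pose m1 : {measure set V -> \bar R} := mscale kn (pushforward mu f).
transitivity (\int[m1 mf]_x g x)%E.
  rewrite ge0_integral_mscale//= ge0_integral_pushforward//.
apply: eq_measure_integral => A mA _.
exact: lebesgue_rV_affine.
Qed.

Lemma integrable_affine (g : V -> \bar R) : mu.-integrable setT g ->
  mu.-integrable setT (fun x => g (c *: x + h)).
Proof.
move=> /integrableP[mg ig]; apply/integrableP; split.
  exact: (measurableT_comp mg mf).
have := @ge0_integral_affine (fun x => `|g x|)%E (measurableT_comp (@abse_measurable _ _) mg) (fun=> abse_ge0 _).
move=> e; move: ig; rewrite -e.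
case: (\int[mu]_x _)%E => [r||] //=; rewrite ?ltry //.
by rewrite gt0_muley// lte_fin exprn_gt0// normr_gt0.
Qed.

Lemma integral_affine (g : V -> \bar R) : mu.-integrable setT g ->
  ((`|c| ^+ n)%:E * \int[mu]_x g (c *: x + h)%R = \int[mu]_x g x)%E.
Proof.
move=> ig; rewrite integralE [in RHS]integralE.
have mg := measurable_int _ ig.
have mp := @ge0_integral_affine (g^\+)%E (measurable_funepos mg) (funepos_ge0 _).
have mn := @ge0_integral_affine (g^\-)%E (measurable_funeneg mg) (funeneg_ge0 _).
have nfin := integrable_neg_fin_num measurableT (integrable_affine ig).
have e1 : ((fun x => g (c *: x + h)%R)^\+ = fun x => g^\+ (c *: x + h)%R)%E.
  by apply/funext => x; rewrite !funeposE.
have e2 : ((fun x => g (c *: x + h)%R)^\- = fun x => g^\- (c *: x + h)%R)%E.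
  by apply/funext => x; rewrite !funenegE.
rewrite -mp -mn; rewrite e1; rewrite e2 in nfin *.
rewrite muleBr//; apply: fin_num_adde_defl.
by rewrite fin_numN; exact: nfin.
Qed.

End affine.

Implicit Types (f : V -> R) (h : V).

Lemma measurable_add_rV h : measurable_fun setT (fun x : V => x + h).
Proof.
by have := measurable_affine_rV 1 h; under eq_fun do rewrite scale1r.
Qed.

Lemma measurable_opp_rV h : measurable_fun setT (fun x : V => h - x).
Proof.
by have := measurable_affine_rV (-1) h; under eq_fun do rewrite scaleN1r addrC.
Qed.

Lemma measurable_scale_rV (c : R) : measurable_fun setT (fun x : V => c *: x).
Proof.
by have := measurable_affine_rV c 0; under eq_fun do rewrite addr0.
Qed.

Lemma ge0_integral_add (g : V -> \bar R) h : measurable_fun setT g ->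
  (forall x, 0 <= g x)%E -> (\int[mu]_x g (x + h)%R = \int[mu]_x g x)%E.
Proof.
move=> mg g0; have := @ge0_integral_affine 1 h (oner_neq0 _) g mg g0.
rewrite normr1 expr1n mul1e => <-.
by apply: eq_integral => x _; rewrite scale1r.
Qed.

Lemma ge0_integral_sub (g : V -> \bar R) h : measurable_fun setT g ->
  (forall x, 0 <= g x)%E -> (\int[mu]_x g (h - x)%R = \int[mu]_x g x)%E.
Proof.
move=> mg g0; have c0 : -1 != 0 :> R by rewrite oppr_eq0 oner_eq0.
have := @ge0_integral_affine (-1) h c0 g mg g0.
rewrite normrN1 expr1n mul1e => <-.
by apply: eq_integral => x _; rewrite scaleN1r addrC.
Qed.

Lemma ge0_integral_scale (g : V -> \bar R) (c : R) : 0 < c -> measurable_fun setT g ->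
  (forall x, 0 <= g x)%E ->
  ((c ^+ n)%:E * \int[mu]_x g (c *: x)%R = \int[mu]_x g x)%E.
Proof.
move=> c0 mg g0; have := @ge0_integral_affine c 0 (lt0r_neq0 c0) g mg g0.
rewrite gtr0_norm// => <-; congr (_ * _)%E.
by apply: eq_integral => x _; rewrite addr0.
Qed.

Lemma integrable_add f h : mu.-integrable setT (EFin \o f) ->
  mu.-integrable setT (EFin \o (fun x => f (x + h))).
Proof.
move=> /(@integrable_affine 1 h (oner_neq0 _)).
by apply: eq_integrable => // x _; rewrite /= scale1r.
Qed.

Lemma integrable_sub f h : mu.-integrable setT (EFin \o f) ->
  mu.-integrable setT (EFin \o (fun x => f (h - x))).
Proof.
have c0 : -1 != 0 :> R by rewrite oppr_eq0 oner_eq0.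
move=> /(@integrable_affine _ h c0).
by apply: eq_integrable => // x _; rewrite /= scaleN1r addrC.
Qed.

Lemma Rintegral_add f h : mu.-integrable setT (EFin \o f) ->
  \int[mu]_x f (x + h) = \int[mu]_x f x.
Proof.
move=> /(@integral_affine 1 h (oner_neq0 _)).
rewrite normr1 expr1n mul1e /Rintegral /= => <-; congr fine.
by apply: eq_integral => x _; rewrite scale1r.
Qed.

Lemma Rintegral_sub f h : mu.-integrable setT (EFin \o f) ->
  \int[mu]_x f (h - x) = \int[mu]_x f x.
Proof.
have c0 : -1 != 0 :> R by rewrite oppr_eq0 oner_eq0.
move=> /(@integral_affine _ h c0).
rewrite normrN1 expr1n mul1e /Rintegral /= => <-; congr fine.
by apply: eq_integral => x _; rewrite scaleN1r addrC.
Qed.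

Lemma Rintegral_scale f (c : R) : 0 < c -> mu.-integrable setT (EFin \o f) ->
  c ^+ n * (\int[mu]_x f (c *: x)) = \int[mu]_x f x.
Proof.
move=> c0 ig; have := @integral_affine c 0 (lt0r_neq0 c0) _ ig.
rewrite gtr0_norm// /Rintegral /= => <-.
under [in RHS]eq_integral do rewrite (addr0 (c *: _)).
rewrite fineM//; apply: integrable_fin_num => //.
have := @integrable_affine c 0 (lt0r_neq0 c0) _ ig.
by apply: eq_integrable => // x _; rewrite /= addr0.
Qed.

Lemma integrable_scale f (c : R) : 0 < c -> mu.-integrable setT (EFin \o f) ->
  mu.-integrable setT (EFin \o (fun x => f (c *: x))).
Proof.
move=> c0 /(@integrable_affine c 0 (lt0r_neq0 c0)).
by apply: eq_integrable => // x _; rewrite /= addr0.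
Qed.

Lemma lebesgue_rV_ball_gt0 (x : V) (r : R) : 0 < r -> (0 < mu (ball x r))%E.
Proof.
move=> r0; pose a i := x ord0 i - r / 2; pose b i := x ord0 i + r / 2.
apply: (@lt_le_trans _ _ (mu (boxc a b))).
  rewrite lebesgue_rV_boxc; last by move=> i; rewrite /a /b; lra.
  rewrite lte_fin; apply: prodr_gt0 => i _; rewrite /a /b; lra.
apply: le_measure; rewrite ?inE; [exact: measurable_boxc|exact: measurable_rV_ball|].
move=> y /= yab; rewrite rV_ballE /=; apply: rV_norm_lt => // i.
have := yab i; rewrite /a /b in_itv /= !mxE ltr_norml => /andP[? ?].
apply/andP; split; lra.
Qed.

Lemma bounded_set_le (A : set V) : bounded_set A ->
  exists2 M : R, 0 < M & forall x, A x -> `|x| <= M.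
Proof. by move=> /pinfty_ex_gt0[M M0 h]; exists M. Qed.

Lemma lebesgue_rV_bounded (A : set V) (M : R) : measurable A ->
  (forall x, A x -> `|x| <= M) -> (mu A < +oo)%E.
Proof.
move=> mA bM.
pose a (i : 'I_n) : R := - `|M|; pose b (i : 'I_n) : R := `|M|.
apply: (@le_lt_trans _ _ (mu (boxc a b))).
  apply: le_measure; rewrite ?inE//; first exact: measurable_boxc.
  move=> x Ax i; rewrite in_itv /= -ler_norml (le_trans (coord_le_norm _ _))//.
  by rewrite (le_trans (bM _ Ax))// ler_norm.
rewrite lebesgue_rV_boxc ?ltry// => i; rewrite /a /b.
by have := normr_ge0 M; lra.
Qed.

Lemma lebesgue_rV_ball_lty (x : V) (r : R) : (mu (ball x r) < +oo)%E.
Proof.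
apply: (@lebesgue_rV_bounded _ (`|x| + r)); first exact: measurable_rV_ball.
move=> y; rewrite rV_ballE /= => xy; have -> : y = x - (x - y) by rewrite opprB addrC subrK.
by rewrite (le_trans (ler_normB _ _))// lerD2l ltW.
Qed.

Lemma negligible_ball (A : set V) (x : V) (r : R) : mu.-negligible A -> 0 < r ->
  exists2 y, ball x r y & ~ A y.
Proof.
move=> [N [mN N0 AN]] r0; apply: contrapT => h.
have : (0 < mu N)%E.
  apply: lt_le_trans (lebesgue_rV_ball_gt0 x r0) _.
  apply: le_measure; rewrite ?inE//; first exact: measurable_rV_ball.
  by move=> y xy; apply: AN; apply: contrapT => nAy; apply: h; exists y.
by rewrite N0 ltxx.
Qed.

End rV_invariance.

Import HBNNSimple.

(** * Integrals up to null sets and Borel representatives *)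

Section integral_extra.
Context d (T : measurableType d) (R : realType) (m : {measure set T -> \bar R}).
Implicit Types (D N : set T).

Lemma Rintegral_sqr_ge0 D (f : T -> R) : 0 <= \int[m]_(x in D) (f x ^+ 2).
Proof. by apply: Rintegral_ge0 => x _; exact: sqr_ge0. Qed.

(** No measurability is required of [f] and [g], because functions measurable only for the completed
    sigma-algebra occur in the statement. A simple function below [f] is set to 0 on [N], which does
    not change its integral, and is then below [g]. *)
Lemma ge0_le_integral_null (f g : T -> \bar R) N : measurable N -> m N = 0%E ->
  (forall x, 0 <= f x)%E -> (forall x, 0 <= g x)%E -> (forall x, ~ N x -> f x <= g x)%E ->
  (\int[m]_x f x <= \int[m]_x g x)%E.
Proof.
move=> mN N0 f0 g0 fg; rewrite !ge0_integralTE//; apply: ub_ereal_sup => _ [h /= hf <-].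
have mNC := measurableC mN; set h' := proj_nnsfun h mNC.
have -> : sintegral m h = sintegral m h'.
  rewrite -!integralT_nnsfun.
  rewrite (ge0_negligible_integral mN)//=; last 2 first.
    by apply/measurable_EFinP.
    by move=> x _; rewrite lee_fin.
  rewrite [RHS](ge0_negligible_integral mN)//=; last 2 first.
    by apply/measurable_EFinP; apply: measurable_funM => //; exact: measurable_indic.
    by move=> x _; rewrite lee_fin; exact: mulr_ge0.
  apply: eq_integral => x /set_mem[_ Nx].
  by rewrite -[mindic _ _ _]/(\1_(~` N) x) indicE mem_set// mulr1.
apply: ereal_sup_ubound => /=; exists h' => //= x.
rewrite -[mindic _ _ _]/(\1_(~` N) x) indicE; have [Nx|Nx] := pselect (N x).
  by rewrite memNset ?mulr0//; exact.
by rewrite mem_set//= mulr1; apply: le_trans (hf x) (fg x _).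
Qed.

Lemma eq_integral_null (f g : T -> \bar R) N : measurable N -> m N = 0%E ->
  (forall x, ~ N x -> f x = g x) ->
  (\int[m]_x f x = \int[m]_x g x)%E.
Proof.
move=> mN N0 fg; rewrite integralE [in RHS]integralE.
congr (_ - _)%E; apply/eqP; rewrite eq_le; apply/andP; split;
  apply: (ge0_le_integral_null mN N0) => // x Nx; rewrite ?funeposE ?funenegE fg//.
Qed.

Lemma ae_null_set (P : T -> Prop) : {ae m, forall x, P x} ->
  [ae m, x | P x].
Proof.
by move=> [N [mN N0 PN]]; exists N; split=> // x Nx; apply: contrapT => nP; exact/Nx/PN.
Qed.

Lemma null_set_ae (P : T -> Prop) N : measurable N -> m N = 0%E ->
  (forall x, ~ N x -> P x) -> {ae m, forall x, P x}.
Proof. by move=> mN N0 h; exists N; split=> // x nP; apply: contrapT => /h. Qed.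

Lemma eq_Rintegral_null (f g : T -> R) D N : measurable N -> m N = 0%E ->
  (forall x, ~ N x -> D x -> f x = g x) ->
  \int[m]_(x in D) f x = \int[m]_(x in D) g x.
Proof.
move=> mN N0 fg; rewrite [LHS]Rintegral_mkcond [RHS]Rintegral_mkcond; congr fine.
apply: (eq_integral_null mN N0) => x Nx; rewrite /patch; case: ifPn => // /set_mem Dx.
by rewrite fg.
Qed.

Lemma le_integrable_real (f g : T -> R) D : measurable D -> measurable_fun D f ->
  (forall x, D x -> `|f x| <= g x) -> m.-integrable D (EFin \o g) -> m.-integrable D (EFin \o f).
Proof.
move=> mD mf fg; apply: le_integrable => //; first exact/measurable_EFinP.
by move=> x Dx /=; rewrite lee_fin (le_trans (fg x Dx))// ler_norm.
Qed.

Lemma integrable_abs_lty (f : T -> R) D : measurable D -> measurable_fun D f ->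
  (\int[m]_(x in D) `|f x|%:E < +oo)%E -> m.-integrable D (EFin \o f).
Proof. by move=> mD mf h; apply/integrableP; split=> //; exact/measurable_EFinP. Qed.

Lemma Rintegral_EFin (f : T -> R) D : measurable D -> m.-integrable D (EFin \o f) ->
  (\int[m]_(x in D) f x)%:E = (\int[m]_(x in D) (f x)%:E)%E.
Proof. by move=> mD ig; rewrite fineK//; exact: integrable_fin_num. Qed.

Lemma Rintegral_sum D (I : Type) (r : seq I) (P : pred I) (f : I -> T -> R) : measurable D ->
  (forall i, P i -> m.-integrable D (EFin \o f i)) ->
  \int[m]_(x in D) (\sum_(i <- r | P i) f i x) = \sum_(i <- r | P i) \int[m]_(x in D) f i x.
Proof.
move=> mD ig; elim: r => [|i r IH].
  by rewrite big_nil; under eq_Rintegral do rewrite big_nil; rewrite Rintegral_cst// mul0r.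
rewrite big_cons; under eq_Rintegral do rewrite big_cons.
case: ifPn => Pi //; rewrite RintegralD ?IH//; first exact: ig.
apply: (eq_integrable mD (fun x => \sum_(i <- r | P i) (f i x)%:E)%E).
  by move=> x _; rewrite /= sumEFin.
by apply: integrable_sum => // j Pj; exact: ig.
Qed.

Lemma Rintegral_cvg D (f_ : nat -> T -> R) (f g : T -> R) : measurable D ->
  (forall k, measurable_fun D (f_ k)) -> measurable_fun D f ->
  m.-integrable D (EFin \o g) -> (forall k x, D x -> `|f_ k x| <= g x) ->
  (forall x, D x -> f_ ^~ x @ \oo --> f x) ->
  (fun k => \int[m]_(x in D) f_ k x) @ \oo --> \int[m]_(x in D) f x.
Proof.
move=> mD mf_ mf ig fg cf.
have [|||||i1 i2 i3] := @dominated_convergence _ T R m D mD (fun k => EFin \o f_ k) (EFin \o f) (EFin \o g).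
- by move=> k; exact/measurable_EFinP.
- exact/measurable_EFinP.
- by apply: aeW => x Dx; apply: cvg_EFin; [exact: nearW|exact: cf].
- exact: ig.
- by apply: aeW => x k Dx; rewrite /= lee_fin fg.
apply: fine_cvg; rewrite -/(Rintegral _ _ _) Rintegral_EFin//.
Qed.

Lemma Rintegral0_null (f : T -> R) D : measurable D -> m.-integrable D (EFin \o f) ->
  (forall x, D x -> 0 <= f x) -> \int[m]_(x in D) f x = 0 ->
  [ae m, x | D x -> f x = 0].
Proof.
move=> mD If f0 I0; have mf := measurable_int _ If.
have : (\int[m]_(x in D) `|(EFin \o f) x| = 0)%E.
  transitivity (\int[m]_(x in D) (f x)%:E)%E.
    by apply: eq_integral => x /set_mem Dx /=; rewrite ger0_norm// f0.
  by rewrite -Rintegral_EFin// I0.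
move=> /(ae_eq_integral_abs _ mD mf) /ae_null_set[N [mN N0 h]]; exists N; split=> // x Nx Dx.
by have [] := h x Nx Dx.
Qed.

Lemma measurable_gt_set (f : T -> R) (c : R) : measurable_fun setT f -> measurable [set x | c < f x].
Proof.
move=> mf; have := mf measurableT _ (measurable_itv `]c, +oo[); rewrite setTI.
by congr measurable; apply/seteqP; split=> x /=; rewrite in_itv /= andbT.
Qed.

End integral_extra.

Section borel_version.
Context {R : realType} {n : nat}.
Local Notation V := 'rV[R]_n.
Local Notation mu := (leb R n).

Lemma lebesgue_measurable_borel (U : set V) (f : V -> R) : measurable U ->
  measurable_fun setT f -> lebesgue_measurable_fun U f.
Proof.
move=> mU mf Y mY; have mB : measurable (U `&` f @^-1` Y).
  by apply: measurableI => //; rewrite -[X in measurable X]setTI; exact: mf.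
by exists (U `&` f @^-1` Y) => //; rewrite !setDv setU0; exact: negligible_set0.
Qed.

Lemma countable_null_cover (T : countType) (N : T -> set V) :
  (forall q, measurable (N q)) -> (forall q, mu (N q) = 0%E) ->
  exists N0, [/\ measurable N0, mu N0 = 0%E & forall q, N q `<=` N0].
Proof.
move=> mN N0; pose F (k : nat) := if (unpickle k : option T) is Some q then N q else set0.
exists (\bigcup_k F k).
have mF : measurable (\bigcup_k F k).
  by apply: bigcup_measurable => k _; rewrite /F; case: unpickle.
split=> //; last by move=> q x Nx; exists (pickle q) => //; rewrite /F pickleK.
apply: (iffLR (negligibleP mu mF)); apply: negligible_bigcup => k; rewrite /F.
case: unpickle => [q|]; last exact: negligible_set0.
by exists (N q); split.
Qed.

(** For each rational [q] the set {f < q} differs from a Borel set by a null set; off the union [N0]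
    of these countably many null sets, [f] is recovered from the Borel sets. *)
Lemma borel_version (U : set V) (f : V -> R) : measurable U ->
  lebesgue_measurable_fun U f ->
  exists g : V -> R, [/\ measurable_fun setT g, forall x, ~ U x -> g x = 0 &
    [ae mu, x | U x -> f x = g x]].
Proof.
move=> mU mf.
have /choice[B hB] (q : rat) : exists B : set V, measurable B /\
    mu.-negligible ((U `&` f @^-1` `]-oo, ratr q[%classic `\` B) `|`
                    (B `\` (U `&` f @^-1` `]-oo, ratr q[%classic))).
  by have [B mB nB] := mf _ (measurable_itv `]-oo, ratr q[); exists B.
have /choice[N hN] (q : rat) : exists N : set V, [/\ measurable N, mu N = 0%E &
    forall x, ~ N x -> (B q x <-> U x /\ f x < ratr q)].
  have [_ [N [mN N0 sN]]] := hB q; exists N; split=> // x Nx; split=> [Bx|[Ux fx]].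
    apply: contrapT => h; apply: Nx; apply: sN; right; split=> // -[Ux /=].
  by apply: contrapT => h; apply: Nx; apply: sN; left; split=> //; split=> //=; rewrite in_itv.
have [||N0 [mN0 N00 N0q]] := @countable_null_cover _ N; first by move=> q; have [] := hN q.
  by move=> q; have [] := hN q.
pose g (x : V) := if `[< U x /\ ~ N0 x >] then f x else 0.
exists g; split.
- apply: (measurability _ (RGenInftyO.measurableE R)) => _ [_ [a ->] <-].
  (* Off [U] and on [N0], where [g] is 0 by default, membership in {g < a} depends only on the sign
     of [a]; elsewhere a rational is inserted between [f x] and [a]. *)
  rewrite setTI (_ : _ @^-1` _ =
    (if 0 < a then ~` U `|` N0 else set0) `|`
    \bigcup_q (if ratr q < a then (B q `&` U) `\` N0 else set0)).
    apply: measurableU.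
      by case: ifP => // _; apply: measurableU => //; exact: measurableC.
    apply: countable_bigcupT_measurable => // q; case: ifP => // _.
    apply: measurableD => //.
    by apply: measurableI => //; have [] := hB q.
  apply/seteqP; split=> x; rewrite /= in_itv /= /g.
    case: asboolP => [[Ux Nx] fa|h]; last first.
      move=> a0; left; rewrite a0; apply: contrapT => /not_orP[/contrapT Ux Nx].
      exact: h.
    have [q] := rat_in_itvoo fa; rewrite in_itv /= => /andP[fq qa].
    right; exists q => //; rewrite qa; split=> //; split=> //.
    by have [_ _ h] := hN q; apply/h => // /(N0q q).
  case=> [|[q _]]; last first.
    case: ifP => // qa [[Bx Ux] Nx].
    rewrite asboolT//; have [_ _ h] := hN q.
    by have [|_ fq] := (h x _).1 Bx; [move=> /(N0q q)|exact: lt_trans qa].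
  by case: ifPn => // a0 h; case: asboolP => // -[Ux Nx]; case: h.
- by move=> x Ux; rewrite /g asboolF// => -[].
- by exists N0; split=> // x Nx Ux; rewrite /g asboolT.
Qed.
End borel_version.

(** * Smooth functions *)
(** A single quantification over lists of directions replaces the recursion on the order in [Ck];
    [smoothP] identifies the two notions. *)
HB.lock Definition smooth (R : realType) (n : nat) (f : 'rV[R]_n -> R) : Prop :=
  forall l, continuous (foldr (@partial R n) f l) /\
  forall i x, derivable (foldr (@partial R n) f l) x (delta_mx ord0 i : 'rV[R]_n).
Arguments smooth {R n} f.

Section smooth.
Context {R : realType}.

(** The whole tower of derivatives is the witness, so that explicit families such as [expinv] or
    exponentials provide it at once. *)
Definition smooth1 (F : R -> R) := exists D : nat -> R -> R,
  D 0%N = F /\ forall k (x : R), is_derive x (1 : R) (D k) (D k.+1 x).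

Context {n : nat}.
Local Notation V := 'rV[R]_n.
Implicit Types (f g : V -> R) (x v : V) (i j : 'I_n) (l : seq 'I_n).
Local Notation e_ i := (delta_mx ord0 i : V).

Definition dpart l f : V -> R := foldr (@partial R n) f l.

Lemma smoothE f : smooth f = forall l, continuous (dpart l f) /\
  forall i x, derivable (dpart l f) x (e_ i).
Proof. by rewrite smooth.unlock. Qed.

(** This carries the one-variable mean value theorem and chain rule over to directional
    derivatives. *)
Lemma is_derive_line (f : V -> R) x v (t a : R) :
  is_derive (t *: v + x) v f a <-> is_derive t (1 : R) (fun s : R => f (s *: v + x)) a.
Proof.
pose p (s : R) := f (s *: v + x).
have E : (fun h : R => h^-1 *: ((f \o shift (t *: v + x)) (h *: v) - f (t *: v + x))) =
    (fun h : R => h^-1 *: ((p \o shift t) (h *: (1 : R)) - p t)).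
  by apply/funext => h; rewrite /p /= scalerDl addrA [h *: 1]mulr1.
have E1 : derivable f (t *: v + x) v = derivable p t (1 : R).
  by rewrite /derivable E.
have E2 : 'D_v f (t *: v + x) = 'D_(1 : R) p t by rewrite /derive E.
by split=> -[]; rewrite ?E1 ?E2 -?E1 -?E2 => h1 h2; apply: DeriveDef;
  rewrite ?E1 ?E2 -?E1 -?E2.
Qed.

Lemma is_derive_line0 (f : V -> R) x v (a : R) :
  is_derive x v f a <-> is_derive (0 : R) (1 : R) (fun s : R => f (s *: v + x)) a.
Proof. by rewrite -is_derive_line scale0r add0r. Qed.

Lemma line_MVT (f g : V -> R) x v (h : R) :
  (forall y, is_derive y v f (g y)) ->
  exists2 t : R, 0 <= t <= 1 & f (h *: v + x) - f x = h * g ((t * h) *: v + x).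
Proof.
move=> df; pose p t := f ((t * h) *: v + x).
have dp (t : R) : is_derive t (1 : R) p (g ((t * h) *: v + x) * h).
  have -> : p = (fun s => f (s *: v + x)) \o (fun t => t * h) by [].
  apply: is_derive1_comp; first exact/is_derive_line.
  have -> : (fun t : R => t * h) = h \*: id by apply/funext => y; rewrite /= mulrC.
  apply: is_derive_eq; rewrite /GRing.scale /=. exact: mulr1.
have cp : {within `[0, 1], continuous p}.
  by apply: derivable_within_continuous => t _; have [] := dp t.
have [t t01 e] := MVT_segment ler01 (fun t _ => dp t) cp.
exists t; first by move: t01; rewrite in_itv.
by move: e; rewrite /p mul1r mul0r scale0r add0r subr0 mulr1 mulrC.
Qed.

Lemma dpart_cat l l' f : dpart (l ++ l') f = dpart l (dpart l' f).
Proof. by rewrite /dpart foldr_cat. Qed.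

Lemma is_derive_partial f i x : derivable f x (e_ i) ->
  is_derive x (e_ i) f (partial i f x).
Proof. by move=> df; apply: DeriveDef. Qed.

Lemma partialE f g i : (forall x, is_derive x (e_ i) f (g x)) -> partial i f = g.
Proof. by move=> h; apply/funext => x; rewrite /partial derive_val. Qed.

Lemma smooth_dpart f l : smooth f -> smooth (dpart l f).
Proof. by rewrite !smoothE => sf l'; rewrite -dpart_cat; exact: sf. Qed.

Lemma smooth_partial f i : smooth f -> smooth (partial i f).
Proof. exact: (@smooth_dpart _ [:: i]). Qed.

Lemma smooth_continuous f : smooth f -> continuous f.
Proof. by rewrite smoothE => /(_ [::]) []. Qed.

Lemma smooth_derivable f i x : smooth f -> derivable f x (e_ i).
Proof. by rewrite smoothE => /(_ [::]) []. Qed.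

Lemma smooth_derive f i x : smooth f -> is_derive x (e_ i) f (partial i f x).
Proof. by move=> sf; apply: is_derive_partial; exact: smooth_derivable. Qed.

Lemma smooth_measurable f : smooth f -> measurable_fun setT f.
Proof. by move=> /smooth_continuous; exact: continuous_measurable_rV. Qed.

(** A coinduction principle: exhibiting a class stable under differentiation avoids formulas for
    derivatives of higher order. *)
Lemma smooth_coind (C : (V -> R) -> Prop) :
  (forall f, C f -> continuous f /\ forall i, exists2 g, C g & forall x, is_derive x (e_ i) f (g x)) ->
  forall f, C f -> smooth f.
Proof.
move=> HC f Cf; rewrite smoothE => l; suff /HC[cf df] : C (dpart l f).
  by split=> // i x; have [g _ /(_ x)[]] := df i.
elim: l => //= i l /HC[_ /(_ i)[g Cg dg]].
by rewrite (partialE dg).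
Qed.

Lemma smoothP f : smooth f <-> forall k, Ck k setT f.
Proof.
split=> [sf k|].
  elim: k f sf => [|k IH] f sf /=.
    by split=> // x _; exact: smooth_continuous.
  split=> [x _|i]; first exact: smooth_continuous.
  split=> [x _|]; first exact: smooth_derivable.
  by apply: IH; exact: smooth_partial.
move=> Cf; apply: (@smooth_coind (fun f => forall k, Ck k setT f)) Cf => {}f Cf; split.
  by move=> x; have [/(_ x I)] := Cf 0%N.
move=> i; exists (partial i f).
  by move=> k; have [_ /(_ i)[]] := Cf k.+1.
by move=> x; apply: is_derive_partial; have [_ /(_ i)[/(_ x I)]] := Cf 1%N.
Qed.

Lemma smooth1_derive F : smooth1 F -> exists F', smooth1 F' /\ forall x : R, is_derive x (1 : R) F (F' x).
Proof.
move=> [D [<- dD]]; exists (D 1%N); split; last exact: dD.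
by exists (fun k => D k.+1); split.
Qed.

Lemma smooth1_continuous F : smooth1 F -> continuous F.
Proof.
move=> /smooth1_derive[F' [_ dF]] x; apply: differentiable_continuous.
by apply/derivable1_diffP; have [] := dF x.
Qed.

Lemma smooth_cst (c : R) : smooth (fun _ : V => c).
Proof.
apply: (@smooth_coind (fun f => exists c, f = cst c)); last by exists c.
move=> _ [{}c ->]; split; first by move=> x; exact: cst_continuous.
by move=> i; exists (cst 0); [exists 0|move=> x; exact: is_derive_cst].
Qed.

(** Differentiating a sum, a product or a composition leads to combinations of the same three
    operations, so this closure is stable under partial derivatives and [smooth_coind] treats all
    operations at once. *)
Inductive smc : (V -> R) -> Prop :=
| smc_base f : smooth f -> smc f
| smc_add f g : smc f -> smc g -> smc (fun x => f x + g x)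
| smc_mul f g : smc f -> smc g -> smc (fun x => f x * g x)
| smc_comp F f : smooth1 F -> smc f -> smc (fun x => F (f x)).

Lemma smc_smooth f : smc f -> smooth f.
Proof.
apply: (@smooth_coind smc) => {}f; elim=> {f} [f sf|f g _ [cf df] _ [cg dg]|f g sf [cf df] sg [cg dg]|F f sF smf [cf df]].
- split; first exact: smooth_continuous.
  move=> i; exists (partial i f); first exact/smc_base/smooth_partial.
  by move=> x; exact: smooth_derive.
- split; first by move=> x; apply: (@continuousD _ _ _ f g); [exact: cf|exact: cg].
  move=> i; have [f' sf' df'] := df i; have [g' sg' dg'] := dg i.
  by exists (fun x => f' x + g' x); [exact: smc_add|move=> x; exact: is_deriveD].
- split; first by move=> x; apply: (@continuousM _ _ f g); [exact: cf|exact: cg].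
  move=> i; have [f' sf' df'] := df i; have [g' sg' dg'] := dg i.
  exists (fun x => f x * g' x + g x * f' x); last by move=> x; exact: is_deriveM.
  by apply: smc_add; exact: smc_mul.
- split; first by move=> x; apply: continuous_comp; [exact: cf|exact: smooth1_continuous].
  have [F' [sF' dF]] := smooth1_derive sF.
  move=> i; have [f' sf' df'] := df i; exists (fun x => F' (f x) * f' x).
    by apply: smc_mul => //; apply: smc_comp => //.
  move=> x; apply/is_derive_line0.
  apply: (@is_derive1_comp _ F (fun s => f (s *: e_ i + x))).
    by rewrite scale0r add0r.
  exact/is_derive_line0.
Qed.

Lemma smoothD f g : smooth f -> smooth g -> smooth (fun x => f x + g x).
Proof. by move=> sf sg; apply: smc_smooth; apply: smc_add; exact: smc_base. Qed.

Lemma smoothM f g : smooth f -> smooth g -> smooth (fun x => f x * g x).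
Proof. by move=> sf sg; apply: smc_smooth; apply: smc_mul; exact: smc_base. Qed.

Lemma smooth_comp F f : smooth1 F -> smooth f -> smooth (fun x => F (f x)).
Proof. by move=> sf sg; apply: smc_smooth; apply: smc_comp => //; exact: smc_base. Qed.

Lemma smoothZ (c : R) f : smooth f -> smooth (fun x => c * f x).
Proof. by apply: smoothM; exact: smooth_cst. Qed.

Lemma smoothN f : smooth f -> smooth (fun x => - f x).
Proof. by move=> /(smoothZ (-1)); under eq_fun do rewrite mulN1r. Qed.

Lemma smoothB f g : smooth f -> smooth g -> smooth (fun x => f x - g x).
Proof. by move=> sf /smoothN; exact: smoothD. Qed.

Lemma smooth_sum (I : Type) (r : seq I) (f : I -> V -> R) : (forall k, smooth (f k)) ->
  smooth (fun x => \sum_(k <- r) f k x).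
Proof.
move=> sf; elim: r => [|i r IH].
  by under eq_fun do rewrite big_nil; exact: smooth_cst.
by under eq_fun do rewrite big_cons; exact (smoothD (sf i) IH).
Qed.

Lemma is_derive_coord i j x : is_derive x (e_ j) (fun x => x ord0 i) ((i == j)%:R).
Proof.
apply/is_derive_line0.
have -> : (fun s : R => (s *: e_ j + x) ord0 i) = (fun s => (i == j)%:R * s + x ord0 i).
  by apply/funext => s; rewrite !mxE eqxx mulrC.
have -> : (fun s : R => (i == j)%:R * s + x ord0 i) = (i == j)%:R \*: id + cst (x ord0 i) by [].
by apply: is_derive_eq; rewrite addr0 /GRing.scale /= mulr1.
Qed.

Lemma smooth_coord i : smooth (fun x => x ord0 i).
Proof.
apply: (@smooth_coind (fun f => smooth f \/ f = fun x => x ord0 i)); last by right.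
move=> f [sf|->].
  split; first exact: smooth_continuous.
  move=> j; exists (partial j f); first by left; exact: smooth_partial.
  by move=> x; exact: smooth_derive.
split; first by move=> x; exact: coord_continuous.
move=> j; exists (fun=> (i == j)%:R); first by left; exact: smooth_cst.
by move=> x; exact: is_derive_coord.
Qed.

Lemma is_derive_affine f i (c : R) (h : V) x (a : R) : is_derive (c *: x + h) (e_ i) f a ->
  is_derive x (e_ i) (fun x => f (c *: x + h)) (c * a).
Proof.
move=> df; apply/is_derive_line0.
have -> : (fun s : R => f (c *: (s *: e_ i + x) + h)) =
    (fun s => f (s *: e_ i + (c *: x + h))) \o (fun s => c * s).
  by apply/funext => s /=; rewrite scalerDr scalerA addrA.
rewrite mulrC; apply: is_derive1_comp.
  by rewrite mulr0; exact/is_derive_line0.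
have -> : (fun s : R => c * s) = c \*: id by [].
by apply: is_derive_eq; rewrite /GRing.scale /= mulr1.
Qed.

Lemma smooth_affine f (c : R) (h : V) : smooth f -> smooth (fun x => f (c *: x + h)).
Proof.
move=> sf; apply: (@smooth_coind (fun g => exists a f, smooth f /\ g = fun x => a * f (c *: x + h))); last first.
  by exists 1, f; split=> //; apply/funext => x; rewrite mul1r.
move=> _ [a [{}f [{}sf ->]]]; split.
  move=> x; apply: (@continuousM _ _ (cst a) (fun x => f (c *: x + h))); first exact: cst_continuous.
  apply: (@continuous_comp _ _ _ (fun x => c *: x + h) f); last exact: smooth_continuous.
  by apply: (@continuousD _ _ _ (fun x => c *: x) (cst h)); [exact: scaler_continuous|exact: cst_continuous].
move=> i; exists (fun x => (a * c) * partial i f (c *: x + h)).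
  by exists (a * c), (partial i f); split; [exact (smooth_partial i sf)|].
move=> x; rewrite -mulrA.
have -> : (fun x => a * f (c *: x + h)) = a \*: (fun x => f (c *: x + h)) by [].
by apply: is_deriveZ; apply: is_derive_affine; exact: smooth_derive.
Qed.

Lemma dpart_affine f l (c : R) (h : V) : smooth f ->
  dpart l (fun x => f (c *: x + h)) = fun x => c ^+ size l * dpart l f (c *: x + h).
Proof.
move=> sf; elim: l => [|i l /= ->]; first by apply/funext => x; rewrite mul1r.
apply: partialE => x; rewrite exprSr -mulrA.
have -> : (fun x => c ^+ size l * dpart l f (c *: x + h)) = (c ^+ size l) \*: (fun x => dpart l f (c *: x + h)) by [].
apply: is_deriveZ; apply: is_derive_affine; apply: smooth_derive; exact: smooth_dpart.
Qed.

Lemma norm_delta_le1 i : `|e_ i| <= 1.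
Proof.
by apply: rV_norm_le => // j; rewrite !mxE eqxx /=; case: eqP; rewrite ?normr1 ?normr0.
Qed.

(** The second difference of [f] over a square of side [d] is d^2 times a mixed derivative at an
    intermediate point, in either order of differentiation, by the mean value theorem used twice.
    Continuity of the two mixed derivatives at [x] makes them agree as [d] shrinks. *)
Lemma partial_comm f i j : smooth f -> partial i (partial j f) = partial j (partial i f).
Proof.
move=> sf; apply/funext => x.
have dd f' i' h y : smooth f' -> exists2 t : R, 0 <= t <= 1 &
    f' (h *: e_ i' + y) - f' y = h * partial i' f' ((t * h) *: e_ i' + y).
  by move=> sf'; apply: line_MVT => z; exact: smooth_derive.
have key i' j' (h : R) : exists t s : R, [/\ 0 <= t <= 1, 0 <= s <= 1 &
    f (h *: e_ i' + (h *: e_ j' + x)) - f (h *: e_ i' + x) - f (h *: e_ j' + x) + f x =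
    h * h * partial j' (partial i' f) ((t * h) *: e_ j' + ((s * h) *: e_ i' + x))].
  pose p y := f (h *: e_ j' + y) - f y.
  have sq g : smooth g -> smooth (fun y => g (h *: e_ j' + y)).
    move=> sg; have := @smooth_affine g 1 (h *: e_ j') sg.
    by congr smooth; apply/funext => y; rewrite scale1r addrC.
  have sp : smooth p := smoothB (sq _ sf) sf.
  have [s s01 e1] := dd p i' h x sp.
  have pE : partial i' p = fun y => partial i' f (h *: e_ j' + y) - partial i' f y.
    apply: partialE => z.
    apply: is_deriveB; last exact: smooth_derive.
    have := @is_derive_affine f i' 1 (h *: e_ j') z _ (smooth_derive _ _ sf).
    rewrite mul1r scale1r [z + _]addrC; congr (is_derive _ _ _ _).
    by apply/funext => y; rewrite scale1r addrC.
  have [t t01 e2] := dd (partial i' f) j' h ((s * h) *: e_ i' + x) (smooth_partial _ sf).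
  exists t, s; split=> //.
  move: e1; rewrite pE e2 mulrA /p => <-.
  rewrite (addrCA (h *: e_ j') (h *: e_ i')).
  by ring.
have cont (k l : 'I_n) := @smooth_continuous _ (smooth_dpart [:: k; l] sf).
apply/eqP; rewrite -subr_eq0 -normr_eq0; apply/negP => /negP ne.
pose eps := `|partial i (partial j f) x - partial j (partial i f) x| / 2.
have e0 : 0 < eps by rewrite divr_gt0// normr_gt0 -normr_eq0.
have near (k l : 'I_n) : exists2 d : R, 0 < d & forall y, `|y| < d ->
    `|partial k (partial l f) (y + x) - partial k (partial l f) x| < eps.
  have /cvgrPdist_lt /(_ _ e0) /nbhs_ballP[d /= d0 hd] := cont k l x.
  exists d => // y yd; rewrite distrC; apply: hd; rewrite rV_ballE /=.
  by rewrite opprD addrC addrNK normrN.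
have [d1 d10 h1] := near i j; have [d2 d20 h2] := near j i.
pose d := Num.min d1 d2 / 4.
have d0 : 0 < d by rewrite divr_gt0// lt_min d10.
have [t [s [t01 s01 e1]]] := key i j d; have [t' [s' [t01' s01' e2]]] := key j i d.
have small (a b : R) (k m : 'I_n) : 0 <= a <= 1 -> 0 <= b <= 1 -> `|(a * d) *: e_ k + (b * d) *: e_ m| < 4 * d.
  move=> /andP[a0 a1] /andP[b0 b1]; apply: le_lt_trans (ler_normD _ _) _.
  have ed (p : 'I_n) (c : R) : 0 <= c -> c <= 1 -> `|(c * d) *: e_ p| <= d.
    move=> c0 c1; rewrite normrZ ger0_norm; last by rewrite mulr_ge0// ltW.
    have := ler_wpM2l (mulr_ge0 c0 (ltW d0)) (norm_delta_le1 p).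
    rewrite mulr1 => /le_trans; apply; rewrite -[leRHS]mul1r.
    by rewrite ler_wpM2r// ltW.
  by apply: le_lt_trans (lerD (ed k a a0 a1) (ed m b b0 b1)) _; clear -d0; lra.
have e3 : partial j (partial i f) ((t * d) *: e_ j + (s * d) *: e_ i + x) =
          partial i (partial j f) ((t' * d) *: e_ i + (s' * d) *: e_ j + x).
  have dd0 : d * d != 0 by rewrite mulf_neq0// lt0r_neq0.
  rewrite -(addrA ((t * d) *: e_ j)) -(addrA ((t' * d) *: e_ i)).
  apply: (mulfI dd0); refine (eq_trans (esym e1) (eq_trans _ e2)).
  rewrite (addrCA (d *: e_ i)).
  by congr (_ + _); rewrite addrAC.
have d4 : 4 * d = Num.min d1 d2 by rewrite /d; field.
have := h2 _ (lt_le_trans (small t s j i t01 s01) _); rewrite d4 ge_min lexx orbT => /(_ isT) H2.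
have := h1 _ (lt_le_trans (small t' s' i j t01' s01') _); rewrite d4 ge_min lexx => /(_ isT) H1.
have : `|partial i (partial j f) x - partial j (partial i f) x| < eps + eps.
  rewrite e3 in H2; apply: le_lt_trans (ltrD H1 H2).
  by rewrite [X in _ <= X + _]distrC; apply: ler_distD.
by rewrite /eps -splitr ltxx.
Qed.

End smooth.

(** * Flat functions built from exp(-1/t) *)

Section exp_inv.
Context {R : realType}.
Implicit Types (t x y : R) (p : {poly R}).

Lemma expR_ge_pow (m : nat) y : 0 <= y -> (0 < m)%N -> (y / m%:R) ^+ m <= expR y.
Proof.
move=> y0 m0; rewrite [in leRHS](_ : y = (y / m%:R) * m%:R); last first.
  by rewrite divfK// pnatr_eq0 -lt0n.
rewrite expRM_natr ler_pXn2r// ?nnegrE ?expR_ge0 ?divr_ge0//.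
by have := expR_ge1Dx (y / m%:R); lra.
Qed.

Lemma horner_bound p y : 1 <= y -> `|p.[y]| <= (\sum_(i < size p) `|p`_i|) * y ^+ size p.
Proof.
move=> y1; rewrite horner_coef mulr_suml (le_trans (ler_norm_sum _ _ _))//.
apply: ler_sum => i _; rewrite normrM ler_wpM2l// normrX ger0_norm ?(le_trans ler01)//.
by rewrite ler_weXn2l// ltnW.
Qed.

(** A family stable under differentiation: the derivative of p(1/t) exp(-1/t) is q(1/t) exp(-1/t)
    with q = X^2 (p - p'). *)
Definition expinv p t : R := if 0 < t then p.[t^-1] * expR (- t^-1) else 0.

(** The exponential beats every power of 1/t. The quadratic rate is what gives the derivative 0 at
    the origin. *)
Lemma expinv_bound p : exists2 C : R, 0 <= C & forall t, t <= 1 -> `|expinv p t| <= C * t ^+ 2.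
Proof.
(* The polynomial costs at most the power [k] of 1/t; the two extra powers leave the factor t^2. *)
set k := size p; pose m := (k + 2)%N.
pose S := \sum_(i < k) `|p`_i|.
have S0 : 0 <= S by apply: sumr_ge0.
exists (S * m%:R ^+ m); first by rewrite mulr_ge0// exprn_ge0.
move=> t t1; rewrite /expinv; case: ifPn => t0; last first.
  by rewrite normr0; apply: mulr_ge0; [apply: mulr_ge0 => //; exact: exprn_ge0|exact: sqr_ge0].
have y1 : 1 <= t^-1 by rewrite invf_ge1.
have y0 : 0 < t^-1 by rewrite invr_gt0.
rewrite normrM (ger0_norm (expR_ge0 _)) expRN.
apply: (@le_trans _ _ ((S * t^-1 ^+ k) / (t^-1 / m%:R) ^+ m)).
  apply: ler_pM => //; first exact: horner_bound.
  rewrite lef_pV2 ?posrE ?expR_gt0 ?exprn_gt0 ?divr_gt0// ?ltr0n ?addn2//.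
  by apply: expR_ge_pow; rewrite ?ltW// /m addn2.
  by rewrite /m addn2.
have -> // : S * t^-1 ^+ k / (t^-1 / m%:R) ^+ m = S * m%:R ^+ m * t ^+ 2.
rewrite expr_div_n invf_div -!mulrA; congr (S * _); rewrite mulrCA; congr (_ * _).
have yn0 : t^-1 != 0 by rewrite lt0r_neq0.
by rewrite /m exprD invfM mulrA divff ?expf_neq0// mul1r exprVn invrK.
Qed.

Lemma is_derive_quadratic (f : R -> R) (C : R) : f 0 = 0 ->
  (forall t, t <= 1 -> `|f t| <= C * t ^+ 2) -> is_derive (0 : R) (1 : R) f 0.
Proof.
move=> f0 fC.
have C0 : 0 <= C by have := fC 1 (lexx _); rewrite expr1n mulr1; exact: le_trans.
have H : (fun h : R => h^-1 *: ((f \o shift (0 : R)) (h *: (1 : R)) - f 0)) @ 0^' --> (0 : R).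
  apply/cvgrPdist_lt => e e0; near=> h.
  have h0 : h != 0 by near: h; exact: nbhs_dnbhs_neq.
  have h1 : `|h| < Num.min 1 (e / (C + 1)).
    near: h; apply: dnbhs0_lt; rewrite lt_min ltr01 divr_gt0//.
    by rewrite (le_lt_trans C0)// ltrDl.
  move: h1; rewrite lt_min => /andP[h1 he].
  rewrite sub0r normrN f0 subr0 /= addr0 [h *: 1]mulr1 normrM normfV.
  have hh : h <= 1 by rewrite ltW// (le_lt_trans (ler_norm _)).
  apply: le_lt_trans (_ : C * `|h| < e).
    rewrite ler_pdivrMl ?normr_gt0//; apply: le_trans (fC _ hh) _.
    by rewrite -(@real_normK _ h) ?num_real// expr2 mulrCA.
  have C1 : 0 < C + 1 by rewrite (le_lt_trans C0)// ltrDl.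
  move: he; rewrite ltr_pdivlMr// mulrDr mulr1 mulrC => /le_lt_trans; apply.
  by rewrite [leRHS]addrC lerDr.
apply: DeriveDef; first by apply/cvg_ex; exists 0.
exact: (cvg_lim _ H).
Unshelve. all: by end_near. Qed.

Lemma expinv_is_derive p t : is_derive t (1 : R) (expinv p) (expinv ('X^2 * (p - p^`())) t).
Proof.
case: (ltgtP t 0) => [t0|t0|->].
- rewrite /expinv [in X in is_derive _ _ _ X]ltNge (ltW t0) /=.
  apply: (@near_eq_is_derive _ _ _ (cst 0)) => //.
    near=> s; rewrite /expinv ltNge (_ : s <= 0)//.
    by apply: ltW; near: s; exact: lt_nbhsl.
- rewrite /expinv t0; set q := 'X^2 * _.
  apply: (@near_eq_is_derive R R R (fun s : R => p.[s^-1] * expR (- s^-1))).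
    by near=> s; rewrite (_ : 0 < s)//; near: s; exact: lt_nbhsr.
  have tn0 : t != 0 by rewrite lt0r_neq0.
  have dinv : is_derive t (1 : R) (fun s : R => s^-1) (- t^-1 ^+ 2).
    have := @is_deriveV R (fun s : R => s) t (1 : R) (1 : R) tn0 (is_derive_id _ _).
    by congr (is_derive _ _ _ _); rewrite /= /GRing.scale /= mulr1 exprVn.
  have d1 : is_derive t (1 : R) (fun s : R => p.[s^-1]) (p^`().[t^-1] * - t^-1 ^+ 2).
    exact: (@is_derive1_comp _ (horner p) (fun s => s^-1) t _ _ (is_derive_poly _ _) dinv).
  have d2 : is_derive t (1 : R) (fun s : R => expR (- s^-1)) (expR (- t^-1) * - - t^-1 ^+ 2).
    apply: (@is_derive1_comp _ expR (fun s => - s^-1) t _ _ (is_derive_expR _)).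
  have := is_deriveM d1 d2; congr (is_derive _ _ _ _).
  rewrite /q hornerM hornerXn hornerD hornerN /GRing.scale /=; ring.
- have -> : expinv ('X^2 * (p - p^`())) 0 = 0 by rewrite /expinv ltxx.
  have [C _ hC] := expinv_bound p.
  by apply: is_derive_quadratic hC; rewrite /expinv ltxx.
Unshelve. all: by end_near. Qed.

Lemma smooth1_expinv p : smooth1 (expinv p).
Proof.
exists (fun k => expinv (iter k (fun p => 'X^2 * (p - p^`())) p)); split=> // k x.
exact: expinv_is_derive.
Qed.

Definition einv t : R := if 0 < t then expR (- t^-1) else 0.

Lemma einvE : einv = expinv 1.
Proof. by apply/funext => t; rewrite /einv /expinv hornerC mul1r. Qed.

Lemma smooth1_einv : smooth1 einv.
Proof. by rewrite einvE; exact: smooth1_expinv. Qed.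

Lemma einv_ge0 t : 0 <= einv t.
Proof. by rewrite /einv; case: ifP => // _; exact: expR_ge0. Qed.

Lemma einv_gt0 t : (0 < einv t) = (0 < t).
Proof. by rewrite /einv; case: ifP => // _; rewrite ?expR_gt0 ?ltxx. Qed.

Lemma einv_le0 t : t <= 0 -> einv t = 0.
Proof. by rewrite /einv ltNge => ->. Qed.

Lemma einv_le1 t : einv t <= 1.
Proof.
rewrite /einv; case: ifPn => // t0.
by rewrite -[leRHS]expR0 ler_expR oppr_le0 invr_ge0 ltW.
Qed.

Lemma einv_ge t : 1 <= t -> expR (-1) <= einv t.
Proof.
move=> t1; have t0 := lt_le_trans ltr01 t1.
by rewrite /einv t0 ler_expR lerN2 invf_le1.
Qed.

Lemma expinv_global_bound p : exists2 C : R, 0 <= C & forall t, `|expinv p t| <= C.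
Proof.
have [C C0 hC] := expinv_bound p.
exists (C + \sum_(i < size p) `|p`_i|); first by rewrite addr_ge0// sumr_ge0.
move=> t; have [t1|t1] := leP t 1; last first.
  have t0 := lt_trans ltr01 t1.
  rewrite /expinv t0 normrM (ger0_norm (expR_ge0 _)).
  apply: (@le_trans _ _ (\sum_(i < size p) `|p`_i|)); last by rewrite lerDr.
  apply: (@le_trans _ _ ((\sum_(i < size p) `|p`_i|) * 1)); last by rewrite mulr1.
  apply: ler_pM; rewrite ?expR_ge0//; last by rewrite -expR0 ler_expR oppr_le0 invr_ge0 ltW.
  rewrite horner_coef (le_trans (ler_norm_sum _ _ _))//; apply: ler_sum => i _.
  rewrite normrM -[leRHS]mulr1 ler_wpM2l// normrX gtr0_norm ?invr_gt0//.
  by rewrite exprn_ile1// ?invr_ge0 ?ltW// invf_lt1.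
have [t0|t0] := leP t 0.
  by rewrite /expinv ltNge t0 normr0 addr_ge0// sumr_ge0.
apply: le_trans (hC _ t1) _; apply: (@le_trans _ _ (C * 1)).
  by rewrite ler_wpM2l// exprn_ile1// ltW.
by rewrite mulr1 lerDl sumr_ge0.
Qed.

End exp_inv.

(** * Compactly supported functions and integration by parts *)

Section compact_support.
Context {R : realType} {n : nat}.
Local Notation V := 'rV[R]_n.
Local Notation mu := (leb R n).
Local Notation e_ i := (delta_mx ord0 i : V).
Implicit Types (f g phi : V -> R) (x h : V).

(** The coordinates of [h] are added one at a time. In the sup norm every intermediate point stays
    within |h| of [x], and each of the [n] steps contributes M |h|. *)
Lemma lip_local f x h (M : R) : (forall i y, derivable f y (e_ i)) -> 0 <= M ->
  (forall i y, `|y - x| <= `|h| -> `|partial i f y| <= M) ->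
  `|f (h + x) - f x| <= n%:R * M * `|h|.
Proof.
move=> sf M0 df; pose P (k : nat) : V := \row_i (if (i < k)%N then h ord0 i else 0).
suff H k : (k <= n)%N -> `|f (P k + x) - f x| <= k%:R * M * `|h|.
  by have := H n (leqnn n); rewrite (_ : P n = h)//; apply/rowP => i; rewrite mxE ltn_ord.
elim: k => [_|k IH kn].
  rewrite (_ : P 0%N = 0); first by rewrite add0r subrr normr0 !mul0r.
  by apply/rowP => i; rewrite !mxE.
pose i0 := Ordinal kn.
have PS : P k.+1 + x = h ord0 i0 *: e_ i0 + (P k + x).
  rewrite addrA; congr (_ + _); apply/rowP => i; rewrite !mxE eqxx /= ltnS leq_eqVlt.
  have [-> /=|ne] := eqVneq i i0; first by rewrite eqxx ltnn addr0 mulr1.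
  have -> : (val i == k) = false by apply/negbTE; apply: contra ne => /eqP e; apply/eqP/val_inj.
  by rewrite mulr0 add0r.
have [t /andP[t0 t1] e1] := @line_MVT _ _ f (partial i0 f) (P k + x) (e_ i0) (h ord0 i0)
  (fun y => is_derive_partial (sf i0 y)).
rewrite PS -(subrKA (f (P k + x))) e1 (le_trans (ler_normD _ _))//.
rewrite -natr1 !mulrDl mul1r addrC lerD ?IH ?(ltnW kn)//.
rewrite normrM mulrC; apply: ler_pM => //; last exact: coord_le_norm.
apply: df; rewrite addrA addrK; apply: rV_norm_le => // i; rewrite !mxE eqxx /=.
have [->|ne] := eqVneq i i0; rewrite /= ?ltnn ?mulr1 ?addr0.
  by rewrite normrM (le_trans _ (coord_le_norm h i0))// ler_piMl// ger0_norm.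
by rewrite mulr0 add0r; case: ifP => _; [exact: coord_le_norm|rewrite normr0].
Qed.

Lemma smooth_lip_local f x h (M : R) : smooth f -> 0 <= M ->
  (forall i y, `|y - x| <= `|h| -> `|partial i f y| <= M) ->
  `|f (h + x) - f x| <= n%:R * M * `|h|.
Proof. by move=> sf; apply: lip_local => i y; exact: smooth_derivable. Qed.

(** A second difference is an increment of g y = f (y + h) - f y, whose partial derivatives are
    increments of those of [f]; the Lipschitz bound is used for both. *)
Lemma smooth_diff2_local f x h (M : R) : smooth f -> 0 <= M ->
  (forall i j y, `|y - x| <= 2 * `|h| -> `|partial i (partial j f) y| <= M) ->
  `|f (x + h) + f (x - h) - 2 * f x| <= n%:R ^+ 2 * M * `|h| ^+ 2.
Proof.
move=> sf M0 df; pose g y := f (y + h) - f y.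
have sft : smooth (fun y => f (y + h)).
  have := @smooth_affine _ _ f 1 h sf.
  by congr smooth; apply/funext => y; rewrite scale1r.
have sg : smooth g := smoothB sft sf.
have dg i : partial i g = fun y => partial i f (h + y) - partial i f y.
  apply: partialE => y; apply: is_deriveB; last exact: smooth_derive.
  have := @is_derive_affine _ _ f i 1 h y _ (smooth_derive i _ sf).
  rewrite mul1r scale1r [y + _]addrC; congr (is_derive _ _ _ _).
  by apply/funext => z; rewrite scale1r.
have -> : f (x + h) + f (x - h) - 2 * f x = - (g (- h + x) - g x).
  by rewrite /g [- h + x]addrC subrK; ring.
rewrite normrN.
have -> : n%:R ^+ 2 * M * `|h| ^+ 2 = n%:R * (n%:R * M * `|h|) * `|- h| by rewrite normrN; ring.
apply: smooth_lip_local => //; first by rewrite !mulr_ge0.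
move=> i y yx; rewrite dg; apply: smooth_lip_local => //; first exact: smooth_partial.
move=> j z zy; apply: df; rewrite -(subrKA y) (le_trans (ler_normD _ _))//.
by rewrite mulr_natl mulr2n lerD// -(normrN h).
Qed.

Lemma compact_bounded_rV (K : set V) : compact K -> exists2 M : R, 0 < M & forall x, K x -> `|x| <= M.
Proof. by move=> /compact_bounded /bounded_set_le. Qed.

Lemma closed_norm_le (M : R) : closed [set x : V | `|x| <= M].
Proof.
have -> : [set x : V | `|x| <= M] = (fun x : V => `|x|) @^-1` `]-oo, M]%classic.
  by apply/seteqP; split=> x /=; rewrite in_itv.
apply: preimage_closed; first by move=> x _; exact: norm_continuous.
exact: lray_closed.
Qed.

Lemma compact_closed_rV (K : set V) : compact K -> closed K.
Proof. by apply: compact_closed; exact: norm_hausdorff. Qed.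

Lemma Cc_intro (U K : set V) f : smooth f -> compact K -> K `<=` U ->
  (forall x, ~ K x -> f x = 0) -> Cc_smooth U f.
Proof.
move=> sf cK KU fK.
have cl : closure [set x | f x != 0] `<=` K.
  rewrite [X in _ `<=` X](_ : K = closure K); last first.
    by have /closure_id := compact_closed_rV cK.
  by apply: closure_subset => x /= fx; apply: contrapT => /fK e; rewrite e eqxx in fx.
split; first exact/smoothP.
  by apply: subclosed_compact cl => //; exact: closed_closure.
exact: subset_trans KU.
Qed.

Lemma Cc_elim (U : set V) f : Cc_smooth U f -> smooth f /\
  exists K, [/\ compact K, K `<=` U & forall x, ~ K x -> f x = 0].
Proof.
move=> [sf cK KU]; split; first exact/smoothP.
exists (closure [set x | f x != 0]); split=> // x nK; apply/eqP; apply: contrapT => /negP fx.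
by apply: nK; exact: subset_closure.
Qed.

(** The name stands for bounded with bounded support; one constant serves for both bounds. *)
Definition bbs f := measurable_fun setT f /\
  exists2 M : R, 0 < M & forall x, `|f x| <= M /\ (M < `|x| -> f x = 0).

Lemma bbs_integrable f : bbs f -> mu.-integrable setT (EFin \o f).
Proof.
move=> [mf [M M0 hM]].
have mB := @measurable_rV_ball R n 0 (M + 1).
have -> : EFin \o f = (EFin \o f) \_ (ball (0 : V) (M + 1)).
  apply/funext => x; rewrite patchE; case: ifPn => //; rewrite notin_setE rV_ballE /= sub0r normrN => /negP.
  rewrite -leNgt => Mx; have [_ ->//] := hM x; apply: lt_le_trans Mx; by rewrite ltrDl.
rewrite -integrable_mkcond//; apply: (@le_integrable_real _ _ _ _ _ (cst M)) => //.
- exact: measurable_funTS.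
- by move=> x _; have [] := hM x.
- apply/integrableP; split; first exact/measurable_EFinP/measurable_cst.
  under eq_integral do rewrite /= (ger0_norm (ltW M0)).
  rewrite integral_cst//= lte_mul_pinfty//; first by rewrite lee_fin ltW.
  exact: lebesgue_rV_ball_lty.
Qed.

Lemma continuous_bbs f (K : set V) : continuous f -> compact K -> (forall x, ~ K x -> f x = 0) -> bbs f.
Proof.
move=> cf cK fK; split; first exact: continuous_measurable_rV.
have [M1 M10 h1] := compact_bounded_rV cK.
have [M2 M20 h2] : exists2 M2 : R, 0 < M2 & forall x, K x -> `|f x| <= M2.
  have : compact (f @` K) by apply: continuous_compact => //; exact: continuous_subspaceT.
  move=> /compact_bounded/pinfty_ex_gt0[M M0 hM]; exists M => // x Kx.
  by apply: hM; exists x.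
exists (M1 + M2); first by rewrite addr_gt0.
move=> x; split.
  have [Kx|/fK->] := pselect (K x); last by rewrite normr0 addr_ge0// ltW.
  by rewrite (le_trans (h2 _ Kx))// lerDr ltW.
move=> Mx; apply: fK => /h1; rewrite leNgt => /negP; apply.
by apply: le_lt_trans Mx; rewrite lerDl ltW.
Qed.

Lemma Cc_bbs (U : set V) f : Cc_smooth U f -> bbs f.
Proof.
by move=> /Cc_elim[sf [K [cK _ fK]]]; apply: continuous_bbs cK fK; exact: smooth_continuous.
Qed.

Lemma compactly_supported_partial (K : set V) f i : closed K -> smooth f ->
  (forall x, ~ K x -> f x = 0) -> forall x, ~ K x -> partial i f x = 0.
Proof.
move=> cK sf fK x nKx; rewrite /partial.
have : is_derive x (e_ i) f 0.
  have d0 : is_derive x (e_ i) (cst (0 : R) : V -> R) 0 by apply: is_derive_cst.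
  apply: near_eq_is_derive d0.
  have oK : open (~` K) by exact: closed_openC.
  have := open_nbhs_nbhs (conj oK nKx); apply: filterS => y /= nKy.
  by rewrite fK.
by move=> ?; rewrite derive_val.
Qed.

Lemma Cc_partial (U : set V) f i : Cc_smooth U f -> Cc_smooth U (partial i f).
Proof.
move=> /Cc_elim[sf [K [cK KU fK]]]; apply: (@Cc_intro _ K) => //; first exact: smooth_partial.
by apply: compactly_supported_partial => //; exact: compact_closed_rV.
Qed.

Lemma Cc_dpart (U : set V) f l : Cc_smooth U f -> Cc_smooth U (dpart l f).
Proof. by move=> cf; elim: l => //= i l; exact: Cc_partial. Qed.

Lemma Cc_mul (U : set V) f g : Cc_smooth U f -> smooth g -> Cc_smooth U (fun x => f x * g x).
Proof.
move=> /Cc_elim[sf [K [cK KU fK]]] sg; apply: (@Cc_intro _ K) => //; first exact: smoothM.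
by move=> x /fK ->; rewrite mul0r.
Qed.

Lemma Cc_smoothW (U : set V) f : Cc_smooth U f -> smooth f.
Proof. by move=> /Cc_elim[]. Qed.

(** Difference quotients have integral 0 by translation invariance. They are dominated by a bounded
    function supported in a ball enlarged by the maximal step 1, so the limit can be taken under the
    integral. *)
Lemma Rintegral_partial0 (U : set V) f i : Cc_smooth U f -> \int[mu]_x partial i f x = 0.
Proof.
move=> cf; have sf := Cc_smoothW cf.
have bf := Cc_bbs cf; have [_ [M M0 hM]] := bf.
have [_ [M' M'0 hM']] := Cc_bbs (Cc_partial i cf).
pose a (k : nat) : R := k.+1%:R^-1.
have a0 k : 0 < a k by rewrite invr_gt0.
have a1 k : a k <= 1 by rewrite invf_le1// ler1n.
pose F k x := (a k)^-1 * (f (x + a k *: e_ i) - f x).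
have F0 k : \int[mu]_x F k x = 0.
  have i1 := bbs_integrable bf; have i2 := integrable_add (a k *: e_ i) i1.
  rewrite RintegralZl//; last exact: (integrableB measurableT i2 i1).
  by rewrite RintegralB// Rintegral_add// subrr mulr0.
have B k x : `|F k x| <= M' /\ (M + 1 < `|x| -> F k x = 0).
  split.
    have [t _ e1] := @line_MVT _ _ f (partial i f) x (e_ i) (a k) (fun y => smooth_derive i y sf).
    rewrite /F [x + _]addrC e1 mulrA mulVf ?mul1r ?lt0r_neq0//.
    by have [] := hM' ((t * a k) *: e_ i + x).
  move=> Mx; rewrite /F; have [_ ->] := hM x; last by apply: lt_trans Mx; rewrite ltrDl.
  have [_ ->] := hM (x + a k *: e_ i); first by rewrite subrr mulr0.
  have h1 : `|a k *: e_ i| <= 1.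
    rewrite normrZ gtr0_norm//; have := ler_pM (ltW (a0 k)) (normr_ge0 _) (a1 k) (norm_delta_le1 i).
    by rewrite mulr1.
  have := ler_normB (x + a k *: e_ i) (a k *: e_ i); rewrite addrK => h2.
  by rewrite -(ltrD2r 1); apply: lt_le_trans Mx _; apply: le_trans h2 _; rewrite lerD2l.
have H : (fun k : nat => \int[mu]_x F k x) @ \oo --> \int[mu]_x partial i f x.
 apply: (@Rintegral_cvg _ _ _ mu setT F (partial i f) (fun x => if `|x| <= M + 1 then M' else 0)) => //.
- move=> k; apply: measurable_funM; first exact: measurable_cst.
  apply: measurable_funB; last exact: smooth_measurable.
  exact: (measurableT_comp (smooth_measurable sf) (measurable_add_rV _)).
- by apply: smooth_measurable; exact: smooth_partial.
- apply: bbs_integrable; split.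
    apply: measurable_fun_ifT => //; try exact: measurable_cst.
    apply: (@measurable_fun_bool _ _ _ _ true).
    rewrite setTI; apply: closed_measurable.
    rewrite (_ : _ @^-1` _ = [set x | `|x| <= M + 1]); last by apply/seteqP; split=> y.
    exact: closed_norm_le.
  exists (M + 1 + M'); first by rewrite !addr_gt0.
  move=> x; case: ifPn => h; split; rewrite ?normr0//.
  + by rewrite gtr0_norm// lerDr addr_ge0// ltW.
  + by move=> h2; exfalso; move: (lt_le_trans h2 h); rewrite ltNge lerDl ltW.
  + by rewrite !addr_ge0// ltW.
- move=> k x _; have [h1 h2] := B k x; case: ifPn => //; rewrite -ltNge => /h2 ->.
  by rewrite normr0.
- move=> x _.
  have H : (fun h : R => h^-1 *: ((f \o shift x) (h *: e_ i) - f x)) @ 0^' --> partial i f x.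
    have /cvg_ex[l hl] := @smooth_derivable _ _ f i x sf.
    by rewrite /partial /derive (cvg_lim _ hl)//; exact: norm_hausdorff.
  have H2 : (fun k : nat => (a k)^-1 *: ((f \o shift x) (a k *: e_ i) - f x)) @ \oo --> partial i f x.
    apply: ((cvgr_dnbhsP _ 0 _).1 H a); split; first by move=> k; rewrite lt0r_neq0.
    exact: cvg_harmonic.
  rewrite (_ : (fun k => F k x) = (fun k => (a k)^-1 *: ((f \o shift x) (a k *: e_ i) - f x)))//.
  by apply/funext => k; rewrite /F /= [x + _]addrC.
have : (fun k : nat => \int[mu]_x F k x) @ \oo --> (0 : R).
  by under eq_fun do rewrite F0; exact: cvg_cst.
by move=> /(cvg_unique _ H); apply; exact: norm_hausdorff.
Qed.

Lemma partialM f g i x : smooth f -> smooth g ->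
  partial i (fun x => f x * g x) x = f x * partial i g x + g x * partial i f x.
Proof.
move=> sf sg.
have -> // : partial i (fun x => f x * g x) = (fun x => f x * partial i g x + g x * partial i f x).
by apply: partialE => y; apply: is_deriveM; exact: smooth_derive.
Qed.

Lemma smooth_bounded_on_ball f (M : R) : smooth f -> exists C : R, forall x, `|x| <= M -> `|f x| <= C.
Proof.
move=> sf; have cB : compact [set x : V | `|x| <= M].
  apply: bounded_closed_compact.
    by exists M; split; [exact: num_real|move=> M' MM' x /= /le_trans; apply; exact: ltW].
  exact: closed_norm_le.
have : compact (f @` [set x : V | `|x| <= M]).
  by apply: continuous_compact => //; apply: continuous_subspaceT; exact: smooth_continuous.
move=> /compact_bounded/pinfty_ex_gt0[C _ hC]; exists C => x xM.
by apply: hC; exists x.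
Qed.

Lemma bbs_mul_smooth f g : bbs f -> smooth g -> bbs (fun x => f x * g x).
Proof.
move=> [mf [M M0 hM]] sg; have [C hC] := smooth_bounded_on_ball M sg.
split; first by apply: measurable_funM => //; exact: smooth_measurable.
exists (M * (`|C| + 1)); first by rewrite mulr_gt0// ltr_wpDl.
move=> x; have [h1 h2] := hM x; split.
  have [/h2 ->|xM] := ltP M `|x|; first by rewrite mul0r normr0 mulr_ge0// ?ltW// addr_ge0.
  rewrite normrM ler_pM// (le_trans (hC _ xM))// (le_trans (ler_norm _))// lerDl//.
move=> h; rewrite h2 ?mul0r//; apply: le_lt_trans h.
by rewrite ler_peMr; [|exact: ltW|rewrite lerDr].
Qed.

Lemma Rintegral_by_parts (U : set V) f g i : Cc_smooth U f -> smooth g ->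
  \int[mu]_x (g x * partial i f x) = - \int[mu]_x (partial i g x * f x).
Proof.
move=> cf sg; have sf := Cc_smoothW cf.
have := Rintegral_partial0 i (Cc_mul cf sg).
under eq_Rintegral do rewrite partialM//.
rewrite RintegralD//; last 2 first.
- by apply: bbs_integrable; apply: bbs_mul_smooth; [exact: Cc_bbs cf|exact: smooth_partial].
- have := bbs_integrable (bbs_mul_smooth (Cc_bbs (Cc_partial i cf)) sg).
  by apply: eq_integrable => // x _; rewrite /= mulrC.
move=> /eqP; rewrite addrC addr_eq0 => /eqP ->; congr (- _).
by apply: eq_Rintegral => x _; rewrite mulrC.
Qed.

End compact_support.

(** * Fundamental lemma of the calculus of variations *)

Section weak_unique.
Context {R : realType} {n : nat}.
Local Notation V := 'rV[R]_n.
Local Notation mu := (leb R n).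

Lemma smooth_prod (I : Type) (r : seq I) (f : I -> V -> R) : (forall k, smooth (f k)) ->
  smooth (fun x => \prod_(k <- r) f k x).
Proof.
move=> sf; elim: r => [|i r IH].
  by under eq_fun do rewrite big_nil; exact: smooth_cst.
by under eq_fun do rewrite big_cons; exact (smoothM (sf i) IH).
Qed.

Lemma compact_boxc (a b : 'I_n -> R) : compact (boxc a b : set V).
Proof.
pose M := \sum_i (`|a i| + `|b i|).
apply: bounded_closed_compact.
  exists M; split; [exact: num_real|move=> M' MM' x xab].
  have Mi i : `|a i| + `|b i| <= M.
    by rewrite /M (bigD1 i)//= lerDl sumr_ge0// => j _; rewrite addr_ge0.
  have M0 : 0 <= M by apply: sumr_ge0 => j _; rewrite addr_ge0.
  apply: rV_norm_le; first by rewrite (le_trans M0)// ltW.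
  move=> i; apply: le_trans (ltW MM'); apply: le_trans (Mi i).
  have := xab i; rewrite in_itv /= ler_norml => /andP[h1 h2]; apply/andP; split.
    rewrite lerNl; apply: le_trans (_ : - a i <= _); first by rewrite lerN2.
    by rewrite (le_trans (ler_norm _))// normrN lerDl.
  by rewrite (le_trans h2)// (le_trans (ler_norm _))// lerDr.
rewrite (_ : boxc a b = \bigcap_(i in [set: 'I_n]) ((fun x : V => x ord0 i) @^-1` `[a i, b i]%classic)).
  apply: closed_bigI => i _; apply: preimage_closed; first by move=> x _; exact: coord_continuous.
  exact: itv_closed.
by apply/seteqP; split => x /= h i; [move=> _|]; exact: h.
Qed.

Lemma smooth1_comp_affine (F : R -> R) (c d : R) : smooth1 F -> smooth1 (fun t => F (c * t + d)).
Proof.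
move=> [D [<- dD]]; exists (fun k t => c ^+ k * D k (c * t + d)); split.
  by apply/funext => t; rewrite expr0 mul1r.
move=> k t.
have d1 : is_derive t (1 : R) (fun t => c * t + d) c.
  have -> : (fun t => c * t + d) = (c \*: id + cst d : R -> R) by [].
  by apply: is_derive_eq; rewrite addr0 /GRing.scale /= mulr1.
have := is_deriveZ (c ^+ k) (@is_derive1_comp _ (D k) (fun t => c * t + d) t _ _ (dD k (c * t + d)) d1).
by congr (is_derive _ _ _ _); rewrite /GRing.scale /= exprSr mulrAC mulrA.
Qed.

Definition boxo (a b : 'I_n -> R) : set V := [set x | forall i, x ord0 i \in `]a i, b i[].

Definition box_bump (a b : 'I_n -> R) (x : V) : R :=
  \prod_(i < n) (einv (x ord0 i - a i) * einv (b i - x ord0 i)).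

Lemma smooth_box_bump a b : smooth (box_bump a b).
Proof.
apply: smooth_prod => i; apply: smoothM; apply: smooth_comp.
- exact: smooth1_einv.
- apply: smoothB; [exact: smooth_coord|exact: smooth_cst].
- exact: smooth1_einv.
- apply: smoothB; [exact: smooth_cst|exact: smooth_coord].
Qed.

Lemma box_bump_out a b x : ~ boxo a b x -> box_bump a b x = 0.
Proof.
move=> /existsNP[i /negP]; rewrite in_itv /= negb_and -!leNgt /box_bump (bigD1 i)//=.
move=> /orP[h|h]; first by rewrite einv_le0 ?mul0r// subr_le0.
by rewrite [X in _ * X * _]einv_le0 ?mulr0 ?mul0r// subr_le0.
Qed.

Lemma box_bump_ge0 a b x : 0 <= box_bump a b x.
Proof. by apply: prodr_ge0 => i _; rewrite mulr_ge0 ?einv_ge0. Qed.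

Lemma box_bump_gt0 a b x : boxo a b x -> 0 < box_bump a b x.
Proof.
move=> h; apply: prodr_gt0 => i _; have := h i; rewrite in_itv /= => /andP[h1 h2].
by rewrite mulr_gt0 ?einv_gt0 ?subr_gt0.
Qed.

Lemma open_box_cover (U : set V) : (0 < n)%N -> open U -> exists a b : nat -> 'I_n -> R,
  (forall k, boxc (a k) (b k) `<=` U) /\ forall x, U x -> exists k, boxo (a k) (b k) x.
Proof.
move=> n0 oU.
suff [T [a [b [h1 h2]]]] : exists (T : countType) (a b : T -> 'I_n -> R),
    (forall k, boxc (a k) (b k) `<=` U) /\ forall x, U x -> exists k, boxo (a k) (b k) x.
  (* Indices that encode no box receive the bounds 1 and 0, whose box is empty because [n] is
     positive. *)
  exists (fun k => if (unpickle k : option T) is Some q then a q else fun=> 1).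
  exists (fun k => if (unpickle k : option T) is Some q then b q else fun=> 0).
  split=> [k|x /h2[k xk]]; last by exists (pickle k); rewrite pickleK.
  case: unpickle => [q|]; first exact: h1.
  by move=> x /(_ (Ordinal n0)); rewrite in_itv /= => /andP[h3 /(le_trans h3)]; rewrite ler10.
pose a0 (p : 'rV[rat]_n * nat) (i : 'I_n) : R := ratr (p.1 ord0 i) - p.2.+1%:R^-1.
pose b0 (p : 'rV[rat]_n * nat) (i : 'I_n) : R := ratr (p.1 ord0 i) + p.2.+1%:R^-1.
pose ok p := `[< boxc (a0 p) (b0 p) `<=` U >].
exists ('rV[rat]_n * nat)%type.
exists (fun p => if ok p then a0 p else fun=> 1), (fun p => if ok p then b0 p else fun=> 0).
split=> [p|x Ux].
  have [/asboolP //|_] := boolP (ok p).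
  by move=> x /(_ (Ordinal n0)); rewrite in_itv /= => /andP[h3 /(le_trans h3)]; rewrite ler10.
have /nbhs_ballP[e /= e0 xe] := open_nbhs_nbhs (conj oU Ux).
have [m m_lt] : exists m : nat, m.+1%:R^-1 < e / 2.
  have [m _ hm] := near_infty_natSinv_lt (PosNum (divr_gt0 e0 (ltr0n R 2))).
  by exists m; exact: (hm m (leqnn m)).
set w : R := m.+1%:R^-1 in m_lt.
have w0 : 0 < w by rewrite invr_gt0.
have /choice [q hq] (i : 'I_n) : exists q : rat, ratr q \in `](x ord0 i - w), (x ord0 i + w)[.
  by apply: rat_in_itvoo; move: w0; clear; lra.
have okq : ok (\row_i q i, m).
  apply/asboolP => y yb; apply: xe; rewrite rV_ballE /=; apply: rV_norm_lt => // i.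
  have := yb i; have := hq i; rewrite /a0 /b0 /= !mxE -/w !in_itv /= ltr_norml.
  move: (ratr (q i) : R) m_lt; clear => r m_lt /andP[? ?] /andP[? ?]; apply/andP; split; lra.
exists (\row_i q i, m); rewrite okq => i.
have := hq i; rewrite /a0 /b0 /= !mxE -/w !in_itv /=.
move: (ratr (q i) : R); clear => r /andP[? ?]; apply/andP; split; lra.
Qed.

Lemma compact_bigsetU (K : nat -> set V) (m : nat) : (forall k, compact (K k)) ->
  compact (\big[setU/set0]_(k < m) K k).
Proof.
move=> cK; elim: m => [|m IH]; first by rewrite big_ord0; exact: compact0.
by rewrite big_ord_recr /=; exact: compactU.
Qed.

Lemma einv_cvg (t : R) : (fun k : nat => einv (k.+1%:R * t)) @ \oo --> (if 0 < t then 1 else 0 : R).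
Proof.
case: ifPn => t0; last first.
  rewrite (_ : (fun k : nat => _) = cst 0); first exact: cvg_cst.
  by apply/funext => k; rewrite einv_le0// pmulr_rle0// leNgt.
rewrite (_ : (fun k : nat => _) = (fun k => expR (- (k.+1%:R^-1 * t^-1)))); last first.
  by apply/funext => k; rewrite /einv pmulr_rgt0// t0 invfM.
rewrite -[X in _ --> X]expR0; apply: (@cvg_comp _ _ _ (fun k : nat => - (k.+1%:R^-1 * t^-1)) expR _ (nbhs (0 : R))); last exact: continuous_expR.
rewrite -oppr0; apply: cvgN; rewrite -(mul0r (t^-1)); apply: cvgMr_tmp.
exact: cvg_harmonic.
Qed.

(** At a point of [U] the sums of the first [k] bumps are eventually bounded below by one positive
    bump, so [einv] of k + 1 times the sum tends to 1; the supports lie in finitely many closed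
    boxes. *)
Lemma smooth_exhaustion (U : set V) : (0 < n)%N -> open U -> exists chi : nat -> V -> R,
  [/\ forall k, Cc_smooth U (chi k), forall k x, 0 <= chi k x <= 1 &
      forall x, U x -> (fun k => chi k x) @ \oo --> (1 : R)].
Proof.
move=> n0 oU; have [a [b [abU Uab]]] := open_box_cover n0 oU.
pose S k x := \sum_(j < k) box_bump (a j) (b j) x.
exists (fun k x => einv (k.+1%:R * S k x)); split.
- move=> k; apply: (@Cc_intro _ _ _ (\big[setU/set0]_(j < k) boxc (a j) (b j))).
  + apply: smooth_comp; [exact: smooth1_einv|apply: smoothZ].
    by apply: smooth_sum => j; exact: smooth_box_bump.
  + have := @compact_bigsetU (fun j => boxc (a j) (b j)) k; apply => j; exact: compact_boxc.
  + by move=> x; rewrite -bigcup_seq /= => -[j _]; exact: abU.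
  + move=> x nx; rewrite einv_le0// /S big1 ?mulr0// => j _.
    apply: box_bump_out => xj; apply: nx; rewrite -bigcup_seq /=; exists j => /=.
      by rewrite mem_index_enum.
    by move=> i; have := xj i; rewrite !in_itv /= => /andP[/ltW-> /ltW->].
- by move=> k x; rewrite einv_ge0 einv_le1.
move=> x /Uab[j xj]; have c0 := box_bump_gt0 xj.
have := @einv_cvg (box_bump (a j) (b j) x); rewrite c0 => H.
apply: squeeze_cvgr; [|exact: H|exact: cvg_cst].
near=> k; rewrite einv_le1 andbT.
have jk : (j < k)%N by near: k; exists j.+1.
have le1 : box_bump (a j) (b j) x <= S k x.
  by rewrite /S (bigD1 (Ordinal jk))//= lerDl sumr_ge0// => i _; exact: box_bump_ge0.
rewrite /einv !pmulr_rgt0// c0 (lt_le_trans c0 le1) ler_expR lerN2.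
by rewrite lef_pV2 ?posrE ?mulr_gt0 ?(lt_le_trans c0 le1)// ler_wpM2l.
Unshelve. all: by end_near. Qed.

(** Smooth functions tending pointwise to the indicator of the closed box: a factor 1 - einv((k+1)
    t) is 1 for t <= 0 and tends to 0 for t > 0. *)
Definition box_cutoff (a b : 'I_n -> R) (k : nat) (x : V) : R :=
  \prod_(i < n) ((1 - einv (k.+1%:R * (a i - x ord0 i))) * (1 - einv (k.+1%:R * (x ord0 i - b i)))).

Lemma smooth_box_cutoff a b k : smooth (box_cutoff a b k).
Proof.
apply: smooth_prod => i; apply: smoothM; apply: smoothB;
  try exact: smooth_cst; apply: smooth_comp; try exact: smooth1_einv;
  apply: smoothZ; apply: smoothB; first [exact: smooth_cst|exact: smooth_coord].
Qed.

Lemma box_cutoff_itv a b k x : 0 <= box_cutoff a b k x <= 1.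
Proof.
have E (t : R) : 0 <= 1 - einv t <= 1.
  by rewrite subr_ge0 einv_le1 lerBlDr lerDl einv_ge0.
apply/andP; split.
  by apply: prodr_ge0 => i _; apply: mulr_ge0; have /andP[] := E (k.+1%:R * (a i - x ord0 i));
   have /andP[] := E (k.+1%:R * (x ord0 i - b i)).
apply: prodr_ile1 => i _; have /andP[h1 h2] := E (k.+1%:R * (a i - x ord0 i)).
have /andP[h3 h4] := E (k.+1%:R * (x ord0 i - b i)).
by rewrite mulr_ge0//= mulr_ile1.
Qed.

Lemma cvg_prod_seq (I : Type) (r : seq I) (f : I -> nat -> R) (l : I -> R) :
  (forall i, f i @ \oo --> l i) -> (fun k => \prod_(i <- r) f i k) @ \oo --> \prod_(i <- r) l i.
Proof.
move=> fl; elim: r => [|i r IH].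
  by under eq_fun do rewrite big_nil; rewrite big_nil; exact: cvg_cst.
by under eq_fun do rewrite big_cons; rewrite big_cons; exact: cvgM.
Qed.

Lemma box_cutoff_cvg a b x : (fun k => box_cutoff a b k x) @ \oo --> (\1_(boxc a b) x : R).
Proof.
have -> : \1_(boxc a b) x = \prod_(i < n) ((1 - if 0 < a i - x ord0 i then 1 else 0) * (1 - if 0 < x ord0 i - b i then 1 else 0)) :> R.
  rewrite indicE; have [xab|nx] := pselect (boxc a b x).
    rewrite mem_set// big1// => i _; have := xab i; rewrite in_itv /= !subr_gt0 !ltNge => /andP[-> ->] /=.
    by rewrite subr0 mulr1.
  rewrite memNset//; move: nx => /existsNP[i /negP].
  rewrite (bigD1 i)//= !subr_gt0 in_itv /= negb_and -!ltNge => /orP[->|->].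
    by rewrite subrr !mul0r.
  by rewrite subrr mulr0 mul0r.
by apply: cvg_prod_seq => i; apply: cvgM; apply: cvgB; try exact: cvg_cst; exact: einv_cvg.
Qed.

(** Testing with the exhaustion times a box cutoff and letting [k] grow shows that [d] has integral
    0 over every box, hence over every Borel set, in particular over the sets where it is positive
    or negative. *)
Lemma weak_zero (U : set V) (d : V -> R) : (0 < n)%N -> open U -> measurable_fun setT d ->
  mu.-integrable U (EFin \o d) ->
  (forall phi, Cc_smooth U phi -> \int[mu]_(x in U) (d x * phi x) = 0) ->
  [ae mu, x | U x -> d x = 0].
Proof.
move=> n0 oU md id dphi; have mU := open_measurable oU.
have [chi [Cchi chi01 chi1]] := smooth_exhaustion n0 oU.
have box0 a b : \int[mu]_(x in U) (d x * \1_(boxc a b) x) = 0.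
  pose F k x := d x * (chi k x * box_cutoff a b k x).
  have H : (fun k : nat => \int[mu]_(x in U) F k x) @ \oo --> \int[mu]_(x in U) (d x * \1_(boxc a b) x).
    have sF k := Cc_mul (Cchi k) (smooth_box_cutoff a b k).
    apply: (@Rintegral_cvg _ _ _ mu U F _ (fun x => `|d x|)) => //.
    + move=> k; apply: measurable_funTS; apply: measurable_funM => //.
      by apply: smooth_measurable; exact: Cc_smoothW (sF k).
    + apply: measurable_funTS; apply: measurable_funM => //.
      by apply: measurable_indic; exact: measurable_boxc.
    + exact: integrable_norm.
    + move=> k x Ux; rewrite normrM ler_piMr// normrM.
      have /andP[c0 c1] := chi01 k x; have /andP[b0 b1] := box_cutoff_itv a b k x.
      by rewrite !ger0_norm// mulr_ile1.
    + move=> x Ux; apply: cvgM; first exact: cvg_cst.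
      rewrite -[X in _ --> X]mul1r; apply: cvgM; first exact: chi1.
      exact: box_cutoff_cvg.
  have : (fun k : nat => \int[mu]_(x in U) F k x) @ \oo --> (0 : R).
    rewrite (_ : (fun k => _) = cst 0); first exact: cvg_cst.
    by apply/funext => k; apply: dphi; exact: Cc_mul (smooth_box_cutoff a b k).
  by move=> /(cvg_unique _ H); apply; exact: norm_hausdorff.
(* The sets with this property form a lambda-system containing the closed boxes, which generate the
   Borel sets and are stable under intersection. *)
pose HH (A : set V) := measurable A /\ \int[mu]_(x in U) (d x * \1_A x) = 0.
have iA A : measurable A -> mu.-integrable U (EFin \o (fun x => d x * \1_A x)).
  move=> mA; apply: (@le_integrable_real _ _ _ _ _ (fun x => `|d x|)) => //; last exact: integrable_norm.
    by apply: measurable_funTS; apply: measurable_funM => //; exact: measurable_indic.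
  by move=> x _; rewrite normrM ler_piMr// indicE ger0_norm ?ler0n// lern1 leq_b1.
have HHlim (A : nat -> set V) : nondecreasing_seq A -> (forall k, HH (A k)) -> HH (\bigcup_k A k).
  move=> ndA hA; split; first by apply: bigcup_measurable => k _; have [] := hA k.
  have H : (fun k : nat => \int[mu]_(x in U) (d x * \1_(A k) x)) @ \oo --> \int[mu]_(x in U) (d x * \1_(\bigcup_k A k) x).
    apply: (@Rintegral_cvg _ _ _ mu U _ _ (fun x => `|d x|)) => //.
    + by move=> k; apply: measurable_funTS; apply: measurable_funM => //; apply: measurable_indic; have [] := hA k.
    + apply: measurable_funTS; apply: measurable_funM => //; apply: measurable_indic.
      by apply: bigcup_measurable => k _; have [] := hA k.
    + exact: integrable_norm.
    + by move=> k x _; rewrite normrM ler_piMr// indicE ger0_norm ?ler0n// lern1 leq_b1.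
    + move=> x Ux; apply: cvgM; first exact: cvg_cst.
      rewrite indicE; have [[k0 _ Ax]|nA] := pselect ((\bigcup_k A k) x).
        rewrite mem_set; last by exists k0.
        have E : \forall k \near \oo, (1 : R) = \1_(A k) x.
          near=> k; rewrite indicE mem_set//; move: Ax; apply/subsetPset/ndA.
          by near: k; exists k0.
        exact: (cvg_trans (near_eq_cvg E) (cvg_cst _)).
      rewrite memNset// (_ : (fun k => _) = cst 0); first exact: cvg_cst.
      by apply/funext => k; rewrite indicE memNset// => Ax; apply: nA; exists k.
  have : (fun k : nat => \int[mu]_(x in U) (d x * \1_(A k) x)) @ \oo --> (0 : R).
    by rewrite (_ : (fun k => _) = cst 0); [exact: cvg_cst|apply/funext => k; have [] := hA k].
  by move=> /(cvg_unique _ H); apply; exact: norm_hausdorff.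
have HHb A : boxcs A -> HH A by move=> [a [b ->]]; split; [exact: measurable_boxc|exact: box0].
have lH : lambda_system setT HH.
  split=> //.
  - rewrite -(@bigcup_boxc R n); apply: HHlim.
      move=> i j ij; apply/subsetPset => x h k; have := h k; rewrite !in_itv /= => /andP[h1 h2].
      have : i%:R <= j%:R :> R by rewrite ler_nat.
      by move=> h3; apply/andP; split; [rewrite (le_trans _ h1)// lerN2|rewrite (le_trans h2)].
    by move=> k; apply: HHb; do 2!eexists.
  - move=> B A AB [mB HB] [mA HA]; split; first exact: measurableD.
    transitivity (\int[mu]_(x in U) (d x * \1_B x - d x * \1_A x)).
      apply: eq_Rintegral => x _; rewrite -mulrBr; congr (_ * _); rewrite !indicE.
      have [Ax|nA] := pselect (A x).
        by rewrite (mem_set Ax) (mem_set (AB _ Ax)) memNset ?subrr// => -[].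
      rewrite (memNset nA) subr0; have [Bx|nB] := pselect (B x); first by rewrite !mem_set.
      by rewrite !memNset// => -[].
    by rewrite RintegralB//; [rewrite HB HA subrr|exact: iA|exact: iA].
have Hall A : measurable A -> HH A.
  rewrite measurable_boxcsE; apply: (lambda_system_subset _ lH) => //.
    move=> _ _ [a [b ->]] [c' [e ->]]; exists (fun i => Num.max (a i) (c' i)), (fun i => Num.min (b i) (e i)).
    apply/seteqP; split=> x /=.
      move=> [h h'] i; have := h i; have := h' i; rewrite !in_itv /= le_min ge_max.
      by move=> /andP[-> ->] /andP[-> ->].
    by move=> h; split=> i; have := h i; rewrite !in_itv /= le_min ge_max => /andP[/andP[? ?] /andP[? ?]]; apply/andP.
(* Applied with [s] equal to 1 and to -1, one for each sign of [d]. *)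
have key (s : R) : s != 0 -> [ae mu, x | U x -> ~ (0 < s * d x)].
  move=> s0; pose A := [set x | 0 < s * d x].
  have mA : measurable A.
    by apply: measurable_gt_set; apply: measurable_funM.
  have [N [mN N0 h]] : [ae mu, x | U x -> s * (d x * \1_A x) = 0].
    apply: (@Rintegral0_null _ _ _ mu (fun x => s * (d x * \1_A x)) U) => //.
    - have := @integrableZl _ _ _ _ _ mU s _ (iA A mA).
      by apply: eq_integrable => // x _ /=; rewrite EFinM.
    - move=> x Ux; rewrite mulrA; have [Ax|nA] := pselect (A x).
        by rewrite mulr_ge0// ?indicE ?ler0n// ltW.
      by rewrite indicE memNset// mulr0.
    - by rewrite RintegralZl//; [have [_ ->] := Hall A mA; rewrite mulr0|exact: iA].
  exists N; split=> // x Nx Ux Ax; have := h x Nx Ux.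
  rewrite indicE mem_set// mulr1 => e; move: Ax; rewrite e ltxx//.
have [N1 [mN1 N10 h1]] := key 1 (oner_neq0 _).
have [N2 [mN2 N20 h2]] := key (-1) ltac:(by rewrite oppr_eq0 oner_eq0).
exists (N1 `|` N2); split; [exact: measurableU|exact: null_set_setU|].
move=> x /not_orP[/h1 h3 /h2 h4] Ux; move: (h3 Ux) (h4 Ux).
rewrite mul1r mulN1r oppr_gt0 => /negP; rewrite -leNgt => h5 /negP; rewrite -leNgt => h6.
by apply/eqP; rewrite eq_le h5.
Unshelve. all: by end_near. Qed.

End weak_unique.

Ltac nng := first [ assumption | done | exact: sqr_ge0 | exact: normr_ge0 | exact: powR_ge0
  | exact: ler0n | exact: expR_ge0 | (apply: ltW; assumption) | (apply: addr_ge0; nng) | (apply: exprn_ge0; nng)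
  | (apply: divr_ge0; nng) | (apply: mulr_ge0; nng) | (rewrite invr_ge0; nng) ].
Ltac psv := first [ assumption | done | exact: expR_gt0 | (apply: powR_gt0; psv) | (apply: exprn_gt0; psv)
  | (apply: divr_gt0; psv) | (apply: mulr_gt0; psv)
  | (rewrite invr_gt0; psv) | (rewrite ltr0n; done) | (apply: addr_gt0; psv)
  | (apply: ltr_wpDl; [nng | psv]) | (apply: ltr_wpDr; [nng | psv]) ].

(** * Square integrable functions *)

Section L2_general.
Context d (T : measurableType d) (R : realType) (m : {measure set T -> \bar R}).
Implicit Types (f g : T -> R).

Definition sqint f := measurable_fun setT f /\ (\int[m]_x (f x ^+ 2)%:E < +oo)%E.

Lemma sqintP f : sqint f <-> measurable_fun setT f /\ m.-integrable setT (EFin \o (fun x => f x ^+ 2)).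
Proof.
split=> -[mf h]; split=> //.
  apply: integrable_abs_lty => //; first exact: measurable_funX.
  by under eq_integral do rewrite ger0_norm ?sqr_ge0//.
have := integral_fune_lt_pinfty measurableT h; exact.
Qed.

Lemma sqint_mul f g : sqint f -> sqint g -> m.-integrable setT (EFin \o (fun x => f x * g x)).
Proof.
move=> /sqintP[mf hf] /sqintP[mg hg].
apply: (@le_integrable_real _ _ _ _ _ (fun x => f x ^+ 2 + g x ^+ 2)) => //.
- exact: measurable_funM.
- move=> x _; have := sqr_ge0 (`|f x| - `|g x|); rewrite normrM -[f x ^+ 2]real_normK ?num_real//.
  rewrite -[g x ^+ 2]real_normK ?num_real//.
  by have := mulr_ge0 (normr_ge0 (f x)) (normr_ge0 (g x)); nra.
- have := integrableD measurableT hf hg.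
  by apply: eq_integrable => // x _; rewrite /= EFinD.
Qed.

Lemma sqint_sqr f : sqint f -> m.-integrable setT (EFin \o (fun x => f x ^+ 2)).
Proof. by move=> /sqintP[]. Qed.

Lemma sqint_measurable f : sqint f -> measurable_fun setT f.
Proof. by case. Qed.

Lemma sqint_le f g : measurable_fun setT f -> sqint g -> (forall x, `|f x| <= `|g x|) -> sqint f.
Proof.
move=> mf [mg hg] fg; split=> //; apply: le_lt_trans hg; apply: ge0_le_integral => //.
- by move=> x _; rewrite lee_fin sqr_ge0.
- by apply/measurable_EFinP; exact: measurable_funX.
- by apply/measurable_EFinP; exact: measurable_funX.
- move=> x _; rewrite lee_fin -[f x ^+ 2]real_normK ?num_real// -[g x ^+ 2]real_normK ?num_real//.
  by rewrite lerXn2r ?nnegrE.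
Qed.

Lemma sqintD f g : sqint f -> sqint g -> sqint (fun x => f x + g x).
Proof.
move=> hf hg; apply/sqintP; split; first by apply: measurable_funD; case: hf; case: hg.
have := integrableD measurableT (sqint_sqr hf) (integrableD measurableT (sqint_sqr hg)
  (integrableD measurableT (sqint_mul hf hg) (sqint_mul hf hg))).
by apply: eq_integrable => // x _; rewrite /= -!EFinD; congr EFin; ring.
Qed.

Lemma sqintZ (c : R) f : sqint f -> sqint (fun x => c * f x).
Proof.
move=> hf; apply/sqintP; split; first by apply: measurable_funM => //; case: hf.
have := @integrableZl _ _ _ _ _ measurableT (c ^+ 2) _ (sqint_sqr hf).
by apply: eq_integrable => // x _; rewrite /= exprMn EFinM.
Qed.

Lemma sqintN f : sqint f -> sqint (fun x => - f x).
Proof. by move=> /(sqintZ (-1)); under eq_fun do rewrite mulN1r. Qed.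

Lemma sqintB f g : sqint f -> sqint g -> sqint (fun x => f x - g x).
Proof. by move=> hf /sqintN; exact: sqintD. Qed.

(* Cauchy-Schwarz replaced by Young's inequality with an arbitrary weight. *)
Lemma sqint_young f g (c : R) : 0 < c -> sqint f -> sqint g ->
  `|\int[m]_x (f x * g x)| <= c * (\int[m]_x (f x ^+ 2)) + c^-1 * (\int[m]_x (g x ^+ 2)).
Proof.
move=> c0 hf hg; apply: le_trans (le_normr_Rintegral measurableT (sqint_mul hf hg)) _.
have i1 := @integrableZl _ _ _ _ _ measurableT c _ (sqint_sqr hf).
have i2 := @integrableZl _ _ _ _ _ measurableT c^-1 _ (sqint_sqr hg).
rewrite -!RintegralZl//; [|exact: sqint_sqr..].
rewrite -RintegralD//.
apply: le_Rintegral => //.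
- by have := integrable_norm (sqint_mul hf hg).
- by have := integrableD measurableT i1 i2; apply: eq_integrable => // x _; rewrite /= -!EFinM.
move=> x _; rewrite normrM -[f x ^+ 2]real_normK ?num_real// -[g x ^+ 2]real_normK ?num_real//.
set a := `|f x|; set b := `|g x|.
have h2 := sqr_ge0 (c * a - b); have h1 : 0 <= a * b by apply: mulr_ge0; apply: normr_ge0.
 have h3 : 0 <= c * (a * b) by rewrite mulr_ge0// ltW.
have e1 : c * (c * a ^+ 2 + c^-1 * b ^+ 2) = c ^+ 2 * a ^+ 2 + b ^+ 2.
  by field; exact: lt0r_neq0.
by rewrite -(ler_pM2l c0) e1; lra.
Qed.

End L2_general.

(** * The space of the weak solutions *)
Section H10_borel.
Context {R : realType} {n : nat}.
Local Notation V := 'rV[R]_n.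
Local Notation mu := (leb R n).
Variable U : set V.
Hypotheses (n0 : (0 < n)%N) (oU : open U) (bU : norm_bounded U).
Implicit Types (f g u w phi : V -> R) (d : 'I_n -> V -> R).

Let mU : measurable U := open_measurable oU.

Definition zoff f := forall x, ~ U x -> f x = 0.

Lemma zoff_patch f : zoff f -> f \_ U = f.
Proof.
by move=> zf; apply/funext => x; rewrite patchE; case: ifPn => //; rewrite notin_setE => /zf.
Qed.

Lemma Rintegral_zoff f : zoff f -> \int[mu]_(x in U) f x = \int[mu]_x f x.
Proof. by move=> zf; rewrite Rintegral_mkcond zoff_patch. Qed.

Lemma integrable_zoff f : mu.-integrable setT (EFin \o f) -> mu.-integrable U (EFin \o f).
Proof. exact: integrableS. Qed.

Lemma Cc_zoff f : Cc_smooth U f -> zoff f.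
Proof. by move=> /Cc_elim[_ [K [_ KU fK]]] x nU; apply: fK => /KU. Qed.

Lemma Cc_sqint f : Cc_smooth U f -> sqint mu f.
Proof.
move=> cf; apply/sqintP; split; first exact: (smooth_measurable (Cc_smoothW cf)).
have := bbs_integrable (bbs_mul_smooth (Cc_bbs cf) (Cc_smoothW cf)).
by apply: eq_integrable => // x _; rewrite /= expr2.
Qed.

Lemma measure_U_lty : (mu U < +oo)%E.
Proof. by have [M hM] := bU; exact: lebesgue_rV_bounded hM. Qed.

Lemma sqint_integrable_U f : sqint mu f -> mu.-integrable U (EFin \o f).
Proof.
move=> hf; apply: (@le_integrable_real _ _ _ _ _ (fun x => 1 + f x ^+ 2)) => //.
- exact: measurable_funTS (sqint_measurable hf).
- move=> x _; rewrite -[f x ^+ 2]real_normK ?num_real//; have := sqr_ge0 (`|f x| - 1).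
  by move: (normr_ge0 (f x)); move: (`|f x|) => a; nra.
- have i1 : mu.-integrable U (EFin \o cst (1 : R)).
    apply/integrableP; split; first exact/measurable_EFinP/measurable_cst.
    under eq_integral do rewrite /= normr1.
    by rewrite integral_cst// mul1e measure_U_lty.
  have := integrableD mU i1 (integrable_zoff (sqint_sqr hf)).
  by apply: eq_integrable => // x _; rewrite /= EFinD.
Qed.

(** A Borel form of [H10]: the function comes with its gradient [d], both defined on the whole space
    and zero off [U], and test functions approximate both at once. Integrals then run over the whole
    space and no weak derivative has to be chosen. *)
Definition h10 u d := [/\ sqint mu u, forall i, sqint mu (d i),
  zoff u, forall i, zoff (d i) &
  forall e : R, 0 < e -> exists phi, [/\ Cc_smooth U phi,
     \int[mu]_x ((u x - phi x) ^+ 2) < e &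
     forall i, \int[mu]_x ((d i x - partial i phi x) ^+ 2) < e]].

Definition eqon f g := [ae mu, x | U x -> f x = g x].

Lemma eqon_sym f g : eqon f g -> eqon g f.
Proof. by move=> [N [mN N0 h]]; exists N; split=> // x Nx Ux; rewrite h. Qed.

Lemma eqon_trans g f h : eqon f g -> eqon g h -> eqon f h.
Proof.
move=> [N [mN N0 h1]] [N' [mN' N'0 h2]]; exists (N `|` N'); split.
- exact: measurableU.
- exact: null_set_setU.
- by move=> x /not_orP[Nx N'x] Ux; rewrite h1// h2.
Qed.

Lemma eqon_all (I : finType) (f g : I -> V -> R) : (forall i, eqon (f i) (g i)) ->
  exists N, [/\ measurable N, mu N = 0%E & forall i x, ~ N x -> U x -> f i x = g i x].
Proof.
move=> /choice[N hN]; have [||N0 [mN0 N00 sub]] := @countable_null_cover R n _ N.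
- by move=> i; have [] := hN i.
- by move=> i; have [] := hN i.
exists N0; split=> // i x nx Ux; have [_ _] := hN i; apply=> //.
by move=> /(sub i).
Qed.

Lemma Rintegral_eqon f g : eqon f g -> \int[mu]_(x in U) f x = \int[mu]_(x in U) g x.
Proof. by move=> [N [mN N0 h]]; exact: (eq_Rintegral_null mN N0). Qed.

Lemma weak_partial_unique i f (v w : V -> R) : sqint mu v -> sqint mu w ->
  is_weak_partial U i f v -> is_weak_partial U i f w -> eqon v w.
Proof.
move=> hv hw wv ww.
have [|||N [mN N0 h]] := @weak_zero _ _ U (fun x => v x - w x) n0 oU.
- by apply: measurable_funB; [case: hv|case: hw].
- exact: sqint_integrable_U (sqintB hv hw).
- move=> phi cphi; have hp := Cc_sqint cphi.
  transitivity (\int[mu]_(x in U) (v x * phi x - w x * phi x)).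
    by apply: eq_Rintegral => x _; rewrite mulrBl.
  rewrite RintegralB//; try exact: (integrable_zoff (sqint_mul _ hp)).
  by apply/eqP; rewrite subr_eq0 -eqr_opp -wv// -ww.
by exists N; split=> // x Nx Ux; apply/eqP; rewrite -subr_eq0; apply/eqP; exact: h.
Qed.

Lemma L2_borel f : L2 U f -> exists g, [/\ sqint mu g, zoff g & eqon f g].
Proof.
move=> [mf hf]; have [g [mg zg [N [mN N0 h]]]] := borel_version mU mf.
exists g; split=> //; last by exists N.
split=> //; apply: le_lt_trans hf; rewrite [leRHS]integral_mkcond.
apply: le_of_eq; apply: (eq_integral_null mN N0) => x Nx.
rewrite patchE; case: ifPn => [/set_mem Ux|]; first by rewrite h.
by rewrite notin_setE => /zg ->; rewrite expr0n.
Qed.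

Lemma sqint_L2 f g : sqint mu g -> eqon f g -> lebesgue_measurable_fun U f -> L2 U f.
Proof.
move=> [mg hg] [N [mN N0 h]] mf; split=> //; apply: le_lt_trans hg.
rewrite [leLHS]integral_mkcond; apply: (ge0_le_integral_null mN N0).
- by move=> x; rewrite patchE; case: ifP => // _; rewrite lee_fin sqr_ge0.
- by move=> x; rewrite lee_fin sqr_ge0.
- move=> x Nx; rewrite patchE; case: ifPn => [/set_mem Ux|_]; first by rewrite h.
  by rewrite lee_fin sqr_ge0.
Qed.

Lemma is_weak_partial_eqon i f f' (v v' : V -> R) : eqon f f' -> eqon v v' ->
  is_weak_partial U i f v -> is_weak_partial U i f' v'.
Proof.
move=> ff vv H phi cphi.
transitivity (\int[mu]_(x in U) (f x * partial i phi x)).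
  apply: Rintegral_eqon; have [N [mN N0 h]] := ff.
  by exists N; split=> // x Nx Ux; rewrite h.
rewrite H//; congr (- _); apply: Rintegral_eqon; have [N [mN N0 h]] := vv.
by exists N; split=> // x Nx Ux; rewrite h.
Qed.

Lemma weak_partialP i f (v : V -> R) : sqint mu v -> is_weak_partial U i f v ->
  eqon (weak_partial U i f) v.
Proof.
move=> hv wv; rewrite /weak_partial.
case: xgetP => [w -> [/= Lw ww]|/(_ v) /= h]; last first.
  exfalso; apply: h; split=> //; apply: (sqint_L2 hv).
    by exists set0; split.
  by apply: lebesgue_measurable_borel => //; case: hv.
have [w' [hw' _ ew]] := L2_borel Lw.
apply: (eqon_trans ew); apply: (weak_partial_unique hw' hv) wv.
apply: is_weak_partial_eqon ww => //; exists set0; split=> //.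
Qed.

Lemma h10_weak_partial u d i : h10 u d -> is_weak_partial U i u (d i).
Proof.
move=> [hu hd zu zd H] psi cpsi.
have hp := Cc_sqint cpsi; have hdp := Cc_sqint (Cc_partial i cpsi).
rewrite Rintegral_zoff; last by move=> x /zu ->; rewrite mul0r.
rewrite Rintegral_zoff; last by move=> x /zd ->; rewrite mul0r.
apply/eqP; rewrite -subr_eq0 opprK -normr_le0; apply/ler_addgt0Pr => e e0; rewrite add0r.
pose A := \int[mu]_x (partial i psi x ^+ 2); pose B := \int[mu]_x (psi x ^+ 2).
have A0 : 0 <= A by exact: Rintegral_sqr_ge0.
have B0 : 0 <= B by exact: Rintegral_sqr_ge0.
(* The weight in Young's inequality makes the terms with [A] and [B] at most e/4; the approximation
   is then taken within e/(4c), so the two remaining terms are at most e/4 each. *)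
pose c := 4 * (A + B + 1) / e.
have c0 : 0 < c by rewrite /c divr_gt0// mulr_gt0// ltr_wpDl// addr_ge0.
have [phi [cphi h1 h2]] := H (e / (4 * c)) (divr_gt0 e0 (mulr_gt0 (ltr0n R 4) c0)).
have sphi := Cc_sqint cphi; have sdphi := Cc_sqint (Cc_partial i cphi).
have bp : \int[mu]_x (phi x * partial i psi x) = - \int[mu]_x (partial i phi x * psi x).
  exact: (Rintegral_by_parts i cpsi (Cc_smoothW cphi)).
have -> : \int[mu]_x (u x * partial i psi x) + \int[mu]_x (d i x * psi x) =
   \int[mu]_x ((u x - phi x) * partial i psi x) + \int[mu]_x ((d i x - partial i phi x) * psi x).
  under [X in _ = X + _]eq_Rintegral do rewrite mulrBl.
  under [X in _ = _ + X]eq_Rintegral do rewrite mulrBl.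
  rewrite !RintegralB//; try exact: sqint_mul.
  by rewrite bp; ring.
apply: le_trans (ler_normD _ _) _.
have y1 := sqint_young c0 (sqintB hu sphi) hdp.
have y2 := sqint_young c0 (sqintB (hd i) sdphi) hp.
apply: le_trans (lerD y1 y2) _; rewrite -/A -/B.
have h2i := h2 i; set a := \int[mu]_x _ in h1 *; set b := \int[mu]_x _ in h2i *.
have hce : c * (e / (4 * c)) = e / 4 by field; exact: lt0r_neq0.
have ca : c * a <= e / 4 by rewrite -hce ler_wpM2l// ltW.
have cb : c * b <= e / 4 by rewrite -hce ler_wpM2l// ltW.
have cAB : c^-1 * A + c^-1 * B <= e / 4.
  rewrite -mulrDr /c invf_div mulrAC ler_pdivrMr ?mulr_gt0// ?ltr_wpDl ?addr_ge0//.
  by rewrite -subr_ge0 [X in 0 <= X](_ : _ = e); [exact: ltW|field].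
clear -ca cb cAB e0; lra.
Qed.

Lemma weak_partialB i f g (v w : V -> R) : sqint mu f -> sqint mu g -> sqint mu v -> sqint mu w ->
  is_weak_partial U i f v -> is_weak_partial U i g w ->
  is_weak_partial U i (f \- g) (fun x => v x - w x).
Proof.
move=> hf hg hv hw wf wg phi cphi.
have hp := Cc_sqint cphi; have hdp := Cc_sqint (Cc_partial i cphi).
transitivity (\int[mu]_(x in U) (f x * partial i phi x - g x * partial i phi x)).
  by apply: eq_Rintegral => x _; rewrite /= mulrBl.
transitivity (- \int[mu]_(x in U) (v x * phi x - w x * phi x)); last first.
  by congr (- _); apply: eq_Rintegral => x _; rewrite mulrBl.
rewrite !RintegralB//; try exact: (integrable_zoff (sqint_mul _ _)).
by rewrite wf// wg//; ring.
Qed.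

Lemma Cc_h10 phi : Cc_smooth U phi -> h10 phi (fun i => partial i phi).
Proof.
move=> cphi; split.
- exact: Cc_sqint.
- by move=> i; exact/Cc_sqint/Cc_partial.
- exact: Cc_zoff.
- by move=> i; exact/Cc_zoff/Cc_partial.
- move=> e e0; exists phi; split=> //.
    by under eq_Rintegral do rewrite subrr expr0n; rewrite Rintegral_cst// mul0r.
  by move=> i; under eq_Rintegral do rewrite subrr expr0n; rewrite Rintegral_cst// mul0r.
Qed.

Lemma H1_normE u d phi : h10 u d -> Cc_smooth U phi ->
  H1_norm U (u \- phi) = Num.sqrt (\int[mu]_x ((u x - phi x) ^+ 2 + \sum_i (d i x - partial i phi x) ^+ 2)).
Proof.
move=> hud cphi; have [hu hd zu zd _] := hud.
have [hp hdp zp zdp _] := Cc_h10 cphi.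
have wpe i : eqon (weak_partial U i (u \- phi)) (fun x => d i x - partial i phi x).
  apply: weak_partialP; first exact: sqintB.
  apply: weak_partialB => //; first exact: h10_weak_partial.
  exact: (h10_weak_partial i (Cc_h10 cphi)).
rewrite /H1_norm; congr Num.sqrt; have [N [mN N0 hN]] := eqon_all wpe.
rewrite -[RHS]Rintegral_zoff; last first.
  move=> x nU; rewrite zu// zp// subrr expr0n big1 ?addr0// => i _.
  by rewrite zd// zdp// subrr expr0n.
apply: (eq_Rintegral_null mN N0) => x Nx Ux /=; congr (_ + _).
by apply: eq_bigr => i _; rewrite hN.
Qed.

Lemma Rintegral_sq_sumE u d phi : h10 u d -> Cc_smooth U phi ->
  \int[mu]_x ((u x - phi x) ^+ 2 + \sum_i (d i x - partial i phi x) ^+ 2) =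
  \int[mu]_x ((u x - phi x) ^+ 2) + \sum_i \int[mu]_x ((d i x - partial i phi x) ^+ 2).
Proof.
move=> [hu hd _ _ _] cphi.
have [hp hdp _ _ _] := Cc_h10 cphi.
have is2 i : mu.-integrable setT (EFin \o (fun x => (d i x - partial i phi x) ^+ 2)).
  exact: sqint_sqr (sqintB (hd i) (hdp i)).
rewrite RintegralD//; last 2 first.
- exact: sqint_sqr (sqintB hu hp).
- have := @integrable_sum _ _ _ mu setT measurableT _ (index_enum 'I_n) xpredT _ (fun i _ => is2 i).
  by apply: eq_integrable => // x _; rewrite /= sumEFin.
by rewrite Rintegral_sum.
Qed.

(** The square of the H1 norm of u - phi is a sum of n + 1 nonnegative integrals, so an
    approximation within the square root of [e] makes each of them smaller than [e]. *)
Lemma H10_h10 u : H10 U u -> exists u' d, [/\ h10 u' d, eqon u u' &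
  forall i, eqon (weak_partial U i u) (d i)].
Proof.
move=> [[L2u H1u] happ].
have [u' [hu' zu' eu]] := L2_borel L2u.
have /choice[d hd] (i : 'I_n) : exists d : V -> R, [/\ sqint mu d, zoff d &
    eqon (weak_partial U i u) d /\ is_weak_partial U i u' d].
  have [w Lw ww] := H1u i; have [w' [hw' zw' ew]] := L2_borel Lw.
  exists w'; split=> //; split.
    apply: weak_partialP => //; apply: is_weak_partial_eqon ww => //.
    by exists set0; split.
  exact: is_weak_partial_eqon ww.
exists u', d; split=> //; last by move=> i; have [_ _ []] := hd i.
split=> //; [by move=> i; have [] := hd i|by move=> i; have [] := hd i|].
move=> e e0; have [phi cphi hphi] := happ (Num.sqrt e) ltac:(by rewrite sqrtr_gt0).
exists phi.
have [hp hdp zp zdp _] := Cc_h10 cphi.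
have wpe i : eqon (weak_partial U i (u \- phi)) (fun x => d i x - partial i phi x).
  have [hdi zdi [_ wi]] := hd i.
  apply: weak_partialP; first exact: sqintB.
  apply: (@is_weak_partial_eqon i (u' \- phi) _ (fun x => d i x - partial i phi x)).
  - have [N [mN N0 h]] := eqon_sym eu; exists N; split=> // x Nx Ux /=; by rewrite h.
  - by exists set0; split.
  - by apply: weak_partialB => //; exact: (h10_weak_partial i (Cc_h10 cphi)).
have [N [mN N0 hN]] := eqon_all wpe.
have [N' [mN' N'0 hN']] := eu.
have mNN : measurable (N `|` N') by exact: measurableU.
have NN0 : mu (N `|` N') = 0%E by exact: null_set_setU.
have E : \int[mu]_(x in U) ((u \- phi) x ^+ 2 + \sum_(i < n) weak_partial U i (u \- phi) x ^+ 2) =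
   \int[mu]_x ((u' x - phi x) ^+ 2) + \sum_i \int[mu]_x ((d i x - partial i phi x) ^+ 2).
  transitivity (\int[mu]_x ((u' x - phi x) ^+ 2 + \sum_i (d i x - partial i phi x) ^+ 2)).
    rewrite -[RHS]Rintegral_zoff; last first.
      move=> x nU; rewrite zu'// zp// subrr expr0n big1 ?addr0// => i _.
      by have [_ zdi _] := hd i; rewrite zdi// zdp// subrr expr0n.
    apply: (eq_Rintegral_null mNN NN0) => x /not_orP[Nx N'x] Ux /=; rewrite hN'//; congr (_ + _).
    by apply: eq_bigr => i _; rewrite hN.
  have is2 i : mu.-integrable setT (EFin \o (fun x => (d i x - partial i phi x) ^+ 2)).
    by have [hdi _ _] := hd i; exact: sqint_sqr (sqintB hdi (hdp i)).
  rewrite RintegralD//; last 2 first.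
  - exact: sqint_sqr (sqintB hu' hp).
  - have := @integrable_sum _ _ _ mu setT measurableT _ (index_enum 'I_n) xpredT _ (fun i _ => is2 i).
    by apply: eq_integrable => // x _; rewrite /= sumEFin.
  by rewrite Rintegral_sum.
have ge0 (f : V -> R) : 0 <= \int[mu]_x (f x ^+ 2) by exact: Rintegral_sqr_ge0.
move: hphi; rewrite /H1_norm E ltr_sqrt// => lte; split=> //.
  by apply: le_lt_trans lte; rewrite lerDl sumr_ge0.
move=> i; apply: le_lt_trans lte; rewrite -[leLHS]add0r lerD//.
by rewrite (bigD1 i)//= lerDl sumr_ge0.
Qed.

Lemma h10_H10 u d : h10 u d -> H10 U u /\ forall i, eqon (weak_partial U i u) (d i).
Proof.
move=> hud; have [hu hd zu zd H] := hud.
have L2f f : sqint mu f -> L2 U f.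
  move=> hf; apply: (sqint_L2 hf); first by exists set0; split.
  by apply: lebesgue_measurable_borel => //; case: hf.
split; last by move=> i; apply: weak_partialP => //; exact: h10_weak_partial.
split.
  split; first exact: L2f.
  by move=> i; exists (d i); [exact: L2f|exact: h10_weak_partial].
(* The squared norm consists of n + 1 integrals, one for the function and one for each
   derivative. *)
move=> e e0; pose e' := e ^+ 2 / (n%:R + 1).
have e'0 : 0 < e' by rewrite divr_gt0// exprn_gt0.
have [phi [cphi h1 h2]] := H e' e'0; exists phi => //.
rewrite (H1_normE hud cphi) (Rintegral_sq_sumE hud cphi).
rewrite -[ltRHS](ger0_norm (ltW e0)) -sqrtr_sqr ltr_sqrt ?exprn_gt0//.
apply: lt_le_trans (_ : e' + \sum_(i < n) e' <= _).
  by apply: ltr_leD => //; apply: ler_sum => i _; exact: ltW.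
rewrite sumr_const card_ord -mulr_natl -[X in X + _]mul1r -mulrDl [1 + _]addrC.
by rewrite /e' mulrC divfK// lt0r_neq0.
Qed.

End H10_borel.

(** * Weak formulation for Borel representatives *)

Section equation.
Context {R : realType} {n : nat}.
Local Notation V := 'rV[R]_n.
Local Notation mu := (leb R n).
Local Notation mu2 := (leb2 R n).
Variable s : R.
Implicit Types (u phi : V -> R) (d e : 'I_n -> V -> R).

(** The kernel |h|^(-n-2s) in the Euclidean norm; for positive [s] its value at the origin is 0. *)
Definition levy (h : V) : R := (euclidean_norm h `^ (n%:R + 2 * s))^-1.

Definition energy u phi (p : V * V) : R :=
  (u p.1 - u p.2) * (phi p.1 - phi p.2) * levy (p.1 - p.2).

Definition gagfin u := (\int[mu2]_p (energy u u p)%:E < +oo)%E.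

Lemma levy_ge0 h : 0 <= levy h.
Proof. by rewrite invr_ge0 powR_ge0. Qed.

(** This allows a function to be changed on a null set inside the double integral. *)
Lemma null_cross (N : set V) : measurable N -> mu N = 0%E ->
  exists N2 : set (V * V), [/\ measurable N2, mu2 N2 = 0%E &
    forall p, ~ N2 p -> ~ N p.1 /\ ~ N p.2].
Proof.
move=> mN N0; exists ((N `*` setT) `|` (setT `*` N)); split.
- by apply: measurableU; apply: measurableX.
- apply: null_set_setU; try exact: measurableX.
  + by rewrite [LHS](product_measure1E _ _ mN measurableT) N0 mul0e.
  + by rewrite [LHS](product_measure1E _ _ measurableT mN) N0 mule0.
- by move=> p /not_orP[h1 h2]; split=> Np; [apply: h1|apply: h2].
Qed.

Variable U : set V.
Hypotheses (n0 : (0 < n)%N) (oU : open U) (bU : norm_bounded U).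

Lemma gagliardo_lty u : (gagliardo s u < +oo)%E -> gagfin u.
Proof.
rewrite /gagliardo /gagfin => h.
rewrite (_ : (fun p => (energy u u p)%:E) = (fun p => ((`|u p.1 - u p.2| ^+ 2) /
      (euclidean_norm (p.1 - p.2) `^ (n%:R + 2 * s)))%:E)); last first.
  by apply/funext => p; rewrite /energy /levy real_normK ?num_real// expr2.
move: h; set I := integral _ _ _; case: I => [r||] // h; first exact: ltry.
by move: h; rewrite poweRyr ?invr_neq0.
Qed.

Lemma gagliardo_lty_conv u : gagfin u -> (gagliardo s u < +oo)%E.
Proof.
rewrite /gagliardo /gagfin => h.
rewrite (_ : (fun p => ((`|u p.1 - u p.2| ^+ 2) /
      (euclidean_norm (p.1 - p.2) `^ (n%:R + 2 * s)))%:E) = (fun p => (energy u u p)%:E)); last first.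
  by apply/funext => p; rewrite /energy /levy real_normK ?num_real// expr2.
move: h; set I := integral _ _ _; case: I => [r||] // h; first exact: ltry.
by rewrite /poweR; case: ifP => _; exact: ltry.
Qed.

Lemma h10_X10 phi e : h10 U phi e -> gagfin phi -> X10 s U phi.
Proof.
move=> hp gp; have [hphi _ zphi _ _] := hp; split.
- by apply: lebesgue_measurable_borel => //; case: hphi.
- by have [] := h10_H10 n0 oU bU hp.
- exact: gagliardo_lty_conv.
- exact: aeW.
Qed.

(** Leaves the formulation of the statement: from here on the solution is a Borel function vanishing
    off [U], its gradient is explicit, and only Borel test functions with explicit gradient are
    used. *)
Lemma weak_solution_borel (g : V -> R -> R) u0 : weak_solution s U g u0 ->
  exists u d, [/\ h10 U u d, {ae mu, forall x, u0 x = u x}, gagfin u &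
    forall phi e, h10 U phi e -> gagfin phi ->
      \int[mu]_x (\sum_i d i x * e i x) + \int[mu2]_p energy u phi p =
      \int[mu]_(x in U) (g x (u x) * phi x)].
Proof.
move=> [[mu0 H10u0 gu0 ae0] eq0].
have [u [d [hud eu ed]]] := H10_h10 n0 oU bU H10u0.
have [N1 [mN1 N10 h1]] := ae_null_set ae0.
have [N2 [mN2 N20 h2]] := eu.
have [hu hd zu zd _] := hud.
have mN : measurable (N1 `|` N2) by exact: measurableU.
have N0 : mu (N1 `|` N2) = 0%E by exact: null_set_setU.
have uE x : ~ (N1 `|` N2) x -> u0 x = u x.
  move=> /not_orP[nx1 nx2]; have [Ux|nU] := pselect (U x); first exact: h2.
  by rewrite h1// zu.
have [M2 [mM2 M20 hM2]] := null_cross mN N0.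
exists u, d; split=> //.
- exact: (null_set_ae mN N0).
- have := gagliardo_lty gu0; rewrite /gagfin.
  rewrite (eq_integral_null mM2 M20 (g := fun p => (energy u u p)%:E))// => p /hM2[p1 p2].
  by rewrite /energy !uE.
move=> phi e hphi gphi; have [hp he zp ze _] := hphi.
have := eq0 phi (h10_X10 hphi gphi).
have [_ ewp] := h10_H10 n0 oU bU hphi.
have -> : local_form U u0 phi = \int[mu]_x (\sum_i d i x * e i x).
  rewrite /local_form -[RHS](@Rintegral_zoff _ _ U); last first.
    by move=> x nU; rewrite big1// => i _; rewrite zd// mul0r.
  have [N3 [mN3 N30 h3]] := eqon_all ed; have [N4 [mN4 N40 h4]] := eqon_all ewp.
  apply: (@eq_Rintegral_null _ _ _ mu _ _ U (N3 `|` N4)); first exact: measurableU.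
    exact: null_set_setU.
  move=> x /not_orP[x3 x4] Ux; apply: eq_bigr => i _; by rewrite h3// h4.
have -> : nonlocal_form s u0 phi = \int[mu2]_p energy u phi p.
  rewrite /nonlocal_form; apply: (eq_Rintegral_null mM2 M20) => p /hM2[p1 p2] _.
  by rewrite /energy /levy !uE.
move=> ->; apply: (eq_Rintegral_null mN N0) => x Nx Ux.
by rewrite uE.
Qed.

End equation.

Section rint.
Context d (T : measurableType d) (R : realType) (m : {measure set T -> \bar R}).
Implicit Types (f g : T -> R).

Definition rint f := m.-integrable setT (EFin \o f).

Lemma rint_measurable f : rint f -> measurable_fun setT f.
Proof. by move=> h; apply/measurable_EFinP; case/integrableP: h. Qed.

Lemma rintD f g : rint f -> rint g -> rint (fun x => f x + g x).
Proof.
move=> hf hg; have := integrableD measurableT hf hg.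
by apply: eq_integrable => // x _; rewrite /= EFinD.
Qed.

Lemma rintZ c f : rint f -> rint (fun x => c * f x).
Proof.
move=> hf; have := @integrableZl _ _ _ _ _ measurableT c _ hf.
by apply: eq_integrable => // x _; rewrite /= EFinM.
Qed.

Lemma rintN f : rint f -> rint (fun x => - f x).
Proof. by move=> /(rintZ (-1)); under eq_fun do rewrite mulN1r. Qed.

Lemma rintB f g : rint f -> rint g -> rint (fun x => f x - g x).
Proof. by move=> hf /rintN; exact: rintD. Qed.

Lemma rint0 : rint (fun=> 0).
Proof. by have := @integrable0 _ _ _ m setT; exact. Qed.

Lemma rint_sum (I : Type) (r : seq I) (f : I -> T -> R) : (forall i, rint (f i)) ->
  rint (fun x => \sum_(i <- r) f i x).
Proof.
move=> hf; elim: r => [|i r IH]; first by under eq_fun do rewrite big_nil; exact: rint0.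
by under eq_fun do rewrite big_cons; exact: rintD.
Qed.

Lemma rint_le f g : measurable_fun setT f -> (forall x, `|f x| <= g x) -> rint g -> rint f.
Proof. by move=> mf fg; apply: le_integrable_real => // x _; exact: fg. Qed.

Lemma rint_abs f : rint f -> rint (fun x => `|f x|).
Proof. by move=> hf; have := integrable_norm hf; exact. Qed.

Lemma le_rint f g : rint f -> rint g -> (forall x, f x <= g x) -> \int[m]_x f x <= \int[m]_x g x.
Proof. by move=> hf hg fg; apply: le_Rintegral => // x _. Qed.

Lemma le_rint_ge0 f g : measurable_fun setT f -> rint g -> (forall x, 0 <= f x <= g x) ->
  \int[m]_x f x <= \int[m]_x g x.
Proof.
move=> mf hg fg; apply: le_rint => // [|x]; last by have /andP[] := fg x.
by apply: (rint_le mf _ hg) => x; have /andP[f0 ?] := fg x; rewrite ger0_norm.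
Qed.

Lemma rint_indic f A : measurable A -> rint f -> rint (fun x => f x * \1_A x).
Proof.
move=> mA hf; apply: (@rint_le _ (fun x => `|f x|)); last exact: rint_abs.
  by apply: measurable_funM; [exact: rint_measurable|exact: measurable_indic].
move=> x; rewrite normrM indicE; case: (_ \in _); rewrite ?normr1 ?normr0 ?mulr1//.
by rewrite mulr0.
Qed.

Lemma tail_integral f (p : T -> R) (e : R) : rint f -> measurable_fun setT p -> (forall x, 0 <= f x) -> 0 < e ->
  exists2 L : R, 0 < L & \int[m]_x (f x * \1_[set y | L < p y] x) < e.
Proof.
move=> hf mp f0 e0.
have h : (fun k : nat => \int[m]_x (f x * \1_[set y | k.+1%:R < p y] x)) @ \oo --> \int[m]_x (0 : R).
  apply: (@Rintegral_cvg _ _ _ m setT _ _ f) => //.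
  - move=> k; apply: measurable_funM; first exact: rint_measurable.
    by apply: measurable_indic; exact: measurable_gt_set.
  - move=> k x _; rewrite normrM ger0_norm// indicE; case: (_ \in _); rewrite ?normr1 ?normr0 ?mulr1//.
    by rewrite mulr0.
  - move=> x _; apply: cvg_near_cst; exists (Num.bound `|p x|) => //= k /= hk.
    rewrite indicE memNset ?mulr0//=; apply/negP; rewrite -leNgt (le_trans (ler_norm _))//.
    by rewrite ltW// (lt_le_trans (archi_boundP (normr_ge0 _)))// ler_nat (leq_trans hk).
have [] := (cvgr_lt _ h e); first by rewrite Rintegral_cst// mul0r.
by move=> k _ /(_ k (leqnn k)) hk; exists k.+1%:R.
Qed.

End rint.

Section einv_first.
Context {R : realType}.

Lemma MVT_line (f f' : R -> R) (a b : R) : (forall x, is_derive x (1 : R) f (f' x)) ->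
  exists c, f b - f a = f' c * (b - a).
Proof.
move=> df.
have cf a' b' : {within `[a', b'], continuous f}.
  by apply: derivable_within_continuous => t _; have [] := df t.
have [ab|ba] := leP a b.
  by have [c _ ->] := MVT_segment ab (fun t _ => df t) (cf _ _); exists c.
have [c _ e] := MVT_segment (ltW ba) (fun t _ => df t) (cf _ _); exists c.
by rewrite -opprB e -mulrN opprB.
Qed.

Definition einv1 : R -> R := expinv 'X^2.

Lemma is_derive_einv (t : R) : is_derive t (1 : R) einv (einv1 t).
Proof.
have := @expinv_is_derive R 1 t; rewrite -einvE /einv1.
by rewrite -[1 : {poly R}]/(1%:P) derivC subr0 mulr1.
Qed.

Lemma einv1_ge0 t : 0 <= einv1 t.
Proof.
rewrite /einv1 /expinv; case: ifP => // t0; rewrite mulr_ge0 ?expR_ge0//.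
by rewrite hornerXn sqr_ge0.
Qed.

Lemma einv1_le0 t : t <= 0 -> einv1 t = 0.
Proof. by move=> t0; rewrite /einv1 /expinv ltNge t0. Qed.

Lemma smooth1_einv1 : smooth1 einv1.
Proof. exact: smooth1_expinv. Qed.

(** The derivatives of [einv] and of [einv1] belong to the globally bounded family [expinv]; one
    common constant shortens the later estimates. *)
Lemma einv_lipschitz : exists2 C : R, 0 < C & forall a b,
  [/\ `|einv a - einv b| <= C * `|a - b|, `|einv1 a - einv1 b| <= C * `|a - b| & einv1 a <= C].
Proof.
have [C1 C10 h1] := @expinv_global_bound R 'X^2.
have [C2 C20 h2] := @expinv_global_bound R ('X^2 * ('X^2 - ('X^2)^`())).
exists (C1 + C2 + 1); first by rewrite ltr_wpDl// addr_ge0.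
move=> a b; split.
- have [c ->] := @MVT_line einv _ b a is_derive_einv.
  by rewrite normrM ler_wpM2r//; apply: le_trans (h1 c) _; lra.
- have [c ->] := @MVT_line einv1 _ b a (@expinv_is_derive R 'X^2).
  by rewrite normrM ler_wpM2r//; apply: le_trans (h2 c) _; lra.
- by apply: le_trans (ler_norm _) _; apply: le_trans (h1 a) _; lra.
Qed.

End einv_first.

Section energy_form.
Context {R : realType} {n : nat}.
Local Notation V := 'rV[R]_n.
Local Notation mu2 := (leb2 R n).
Variable s : R.
Implicit Types (a b : V -> R).

Lemma euclidean_norm_continuous : continuous (@euclidean_norm R n).
Proof.
move=> x; apply: (@continuous_comp _ _ _ (fun x : V => \sum_(i < n) x ord0 i ^+ 2) Num.sqrt).
  by apply: smooth_continuous; apply: smooth_sum => i; apply: smoothM; exact: smooth_coord.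
exact: sqrt_continuous.
Qed.

Lemma measurable_levy : measurable_fun setT (@levy R n s).
Proof.
rewrite (_ : levy s = (fun x => x `^ (- (n%:R + 2 * s))) \o @euclidean_norm R n); last first.
  by apply/funext => h; rewrite /levy /= powRN.
apply: (measurableT_comp (measurable_powR _)).
by apply: continuous_measurable_rV; exact: euclidean_norm_continuous.
Qed.

Lemma measurable_sub_rV2 : measurable_fun setT (fun p : V * V => p.1 - p.2).
Proof.
apply: measurable_fun_rVP => i.
rewrite (_ : _ \o _ = (fun p : V * V => rV_coord i p.1 - rV_coord i p.2)); last first.
  by apply/funext => x; rewrite /rV_coord /= !mxE.
by apply: measurable_funB; apply: measurableT_comp (measurable_rV_coord i) _;
  [exact: measurable_fst|exact: measurable_snd].
Qed.

(** With half of the kernel in each factor, the energy density is a product of two functions that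
    are square integrable exactly when the seminorms are finite. *)
Definition gquot a (p : V * V) : R := (a p.1 - a p.2) * Num.sqrt (levy s (p.1 - p.2)).

Lemma measurable_gquot a : measurable_fun setT a -> measurable_fun setT (gquot a).
Proof.
move=> ma; apply: measurable_funM.
  by apply: measurable_funB; apply: measurableT_comp ma _; [exact: measurable_fst|exact: measurable_snd].
apply: (measurableT_comp (continuous_measurable_fun (@sqrt_continuous R))).
exact: (measurableT_comp measurable_levy measurable_sub_rV2).
Qed.

Lemma energy_densityE a b p : energy s a b p = gquot a p * gquot b p.
Proof.
rewrite /energy /gquot.
by rewrite [RHS](_ : _ = (a p.1 - a p.2) * (b p.1 - b p.2) * Num.sqrt (levy s (p.1 - p.2)) ^+ 2);
  [rewrite sqr_sqrtr ?levy_ge0|ring].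
Qed.

Lemma gagfinP a : measurable_fun setT a -> gagfin s a <-> sqint mu2 (gquot a).
Proof.
move=> ma; rewrite /gagfin /sqint (_ : (fun p => (energy s a a p)%:E) = fun p => (gquot a p ^+ 2)%:E).
  by split=> [h|[]//]; split=> //; exact: measurable_gquot.
by apply/funext => p; rewrite energy_densityE expr2.
Qed.

Lemma rint_energy a b : measurable_fun setT a -> measurable_fun setT b -> gagfin s a -> gagfin s b ->
  rint mu2 (energy s a b).
Proof.
move=> ma mb /(gagfinP ma) ha /(gagfinP mb) hb; rewrite /rint.
rewrite (_ : energy s a b = fun p => gquot a p * gquot b p); first exact: sqint_mul.
by apply/funext => p; rewrite energy_densityE.
Qed.

Lemma gagfin_einv (eps : R) a w : measurable_fun setT a -> measurable_fun setT w ->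
  gagfin s a -> gagfin s w -> gagfin s (fun x => einv (eps * a x - w x)).
Proof.
move=> ma mw /(gagfinP ma) ha /(gagfinP mw) hw.
have me : measurable_fun setT (fun x => einv (eps * a x - w x)).
  apply: (measurableT_comp (continuous_measurable_fun (smooth1_continuous smooth1_einv))).
  by apply: measurable_funB => //; apply: measurable_funM.
apply/(gagfinP me); have [C C0 hC] := @einv_lipschitz R.
apply: (sqint_le (measurable_gquot me) (sqintZ C (sqintB (sqintZ eps ha) hw))) => p.
rewrite (_ : eps * _ - _ = ((eps * a p.1 - w p.1) - (eps * a p.2 - w p.2)) * Num.sqrt (levy s (p.1 - p.2))).
  rewrite /gquot !normrM mulrA ler_wpM2r// (gtr0_norm C0).
  by have [] := hC (eps * a p.1 - w p.1) (eps * a p.2 - w p.2).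
by rewrite /gquot; ring.
Qed.

End energy_form.

(** * Test functions *)
Section test_functions.
Context {R : realType} {n : nat}.
Local Notation V := 'rV[R]_n.
Local Notation mu := (leb R n).
Variables (U : set V) (oU : open U) (bU : norm_bounded U).
Implicit Types (u w : V -> R) (d : 'I_n -> V -> R).

Lemma is_derive_partial_einv (eps : R) u w i : smooth u -> smooth w ->
  partial i (fun x => einv (eps * u x - w x)) =
  fun x => einv1 (eps * u x - w x) * (eps * partial i u x - partial i w x).
Proof.
move=> su sw; apply: partialE => x.
have h : is_derive x (delta_mx ord0 i : V) (fun x => eps * u x - w x) (eps * partial i u x - partial i w x).
  apply: is_deriveB; last exact: smooth_derive.
  exact: (@is_deriveZ _ _ _ u eps _ _ _ (smooth_derive i x su)).
apply/is_derive_line0; move/is_derive_line0 in h.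
have := @is_derive1_comp _ einv (fun t : R => eps * u (t *: delta_mx ord0 i + x) - w (t *: delta_mx ord0 i + x)) 0 _ _ _ h.
by rewrite scale0r add0r; apply; exact: is_derive_einv.
Qed.

(** The approximants are einv(eps phi - w) for approximants [phi] of [u]: since [w] is nonnegative
    they vanish wherever [phi] does, so they are admissible. The difficulty is the gradient, where a
    difference of values of [einv1] multiplies a function that is only square integrable. *)
Lemma h10_einv (eps : R) u d w : h10 U u d -> smooth w -> (forall x, 0 <= w x) ->
  (exists M : R, forall i x, `|partial i w x| <= M) ->
  h10 U (fun x => einv (eps * u x - w x))
    (fun i x => einv1 (eps * u x - w x) * (eps * d i x - partial i w x)).
Proof.
move=> [hu hd zu zd app] sw w0 [M hM].
have [C C0 hC] := @einv_lipschitz R.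
have mU := open_measurable oU.
have mw := smooth_measurable sw.
have mb : measurable_fun setT (fun x => eps * u x - w x).
  by apply: measurable_funB => //; apply: measurable_funM => //; exact: sqint_measurable hu.
have cE1 := smooth1_continuous (@smooth1_einv1 R).
have me1 : measurable_fun setT (fun x => einv1 (eps * u x - w x)).
  exact: (measurableT_comp (continuous_measurable_fun cE1)).
have me : measurable_fun setT (fun x => einv (eps * u x - w x)).
  exact: (measurableT_comp (continuous_measurable_fun (smooth1_continuous (@smooth1_einv R)))).
have out x : ~ U x -> einv (eps * u x - w x) = 0 /\ einv1 (eps * u x - w x) = 0.
  by move=> nU; rewrite zu// mulr0 sub0r einv_le0 ?einv1_le0 ?oppr_le0.
(* The derivatives of [w] are bounded but not necessarily square integrable on the whole space, so
   they are cut off to [U]; off [U] the factor [einv1] vanishes anyway. *)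
pose p i x := eps * d i x - partial i w x * \1_U x.
have hp i : sqint mu (p i).
  apply: sqintB; first exact: sqintZ.
  have h1 : sqint mu (fun x => M * \1_U x).
    apply: sqintZ; split; first exact: measurable_indic.
    rewrite (_ : (fun x => _) = (fun x => (\1_U x)%:E)).
      by rewrite integral_indic// setIT; exact: measure_U_lty oU bU.
    by apply/funext => x; rewrite indicE; case: (_ \in _); rewrite ?expr1n ?expr0n.
  apply: sqint_le h1 _.
    by apply: measurable_funM; [exact: smooth_measurable (smooth_partial i sw)|exact: measurable_indic].
  move=> x; rewrite !normrM ler_wpM2r// (le_trans (hM i x))//; exact: ler_norm.
have eE i x : einv1 (eps * u x - w x) * (eps * d i x - partial i w x) = einv1 (eps * u x - w x) * p i x.
  have [Ux|nU] := pselect (U x); last by have [_ ->] := out x nU; rewrite !mul0r.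
  by rewrite /p indicE mem_set// mulr1.
have E1b t : `|einv1 t| <= C by rewrite ger0_norm ?einv1_ge0//; have [] := hC t 0.
have he i : sqint mu (fun x => einv1 (eps * u x - w x) * (eps * d i x - partial i w x)).
  under eq_fun do rewrite eE.
  apply: (sqint_le _ (sqintZ C (hp i))); first by apply: measurable_funM => //; case: (hp i).
  by move=> x; rewrite !normrM (gtr0_norm C0) ler_wpM2r.
split => //.
- apply: (sqint_le me (sqintZ (C * eps) hu)) => x.
  have [h _ _] := hC (eps * u x - w x) (- w x).
  move: h; rewrite (@einv_le0 _ (- w x)) ?oppr_le0// subr0 opprK subrK.
  by rewrite -mulrA [X in _ -> _ <= X]normrM (gtr0_norm C0).
- by move=> x nU; have [] := out x nU.
- by move=> i x nU; have [_ ->] := out x nU; rewrite mul0r.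
move=> e e0.
pose P x := \sum_i p i x ^+ 2.
have hP : rint mu P by apply: rint_sum => i; exact: sqint_sqr.
have P0 x : 0 <= P x by apply: sumr_ge0 => i _; exact: sqr_ge0.
have e1 : 0 < e / (2 * C ^+ 2 + 1) / 2.
  by psv.
(* The level [L] depends on [u] and [w] only and is fixed before [phi] is chosen. Where P > L the
   bound on [einv1] and the small tail are used; where P <= L the Lipschitz bound on [einv1] and the
   closeness of [phi] to [u]. *)
have [L L0 hL] := tail_integral hP (rint_measurable hP) P0 e1.
pose A := 2 * C ^+ 2 * eps ^+ 2.
have A0 : 0 <= A := mulr_ge0 (mulr_ge0 (ler0n R 2) (sqr_ge0 C)) (sqr_ge0 eps).
(* The denominator collects the coefficients of the errors of [phi] and of its gradient, so that
   together they contribute at most e/2; the tail contributes less than e/2. *)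
have D0 := ltr_wpDl (addr_ge0 (addr_ge0 (mulr_ge0 A0 (ltW L0)) A0) (mulr_ge0 (sqr_ge0 C) (sqr_ge0 eps)))
  (ltr01 : 0 < 1 :> R).
have e2 := divr_gt0 (divr_gt0 e0 D0) (ltr0Sn R 1).
have [phi [cphi hu' hd']] := app _ e2.
have sphi := Cc_smoothW cphi.
exists (fun x => einv (eps * phi x - w x)).
have sqphi := Cc_sqint cphi.
have split2 : sqint mu (fun x => u x - phi x) by exact: sqintB.
have [_ [K [cK KU zK]]] := Cc_elim cphi.
have sb : smooth (fun x => eps * phi x - w x) by apply: smoothB => //; exact: smoothZ.
have eA : e / (A * L + A + C ^+ 2 * eps ^+ 2 + 1) / 2 * (A * L + A + C ^+ 2 * eps ^+ 2) <= e / 2.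
  set B := _ + C ^+ 2 * _; have B0 : 0 <= B.
    by rewrite /B; nng.
  rewrite mulrAC ler_pM2r// mulrAC ler_pdivrMr ?ltr_wpDl//.
  by rewrite ler_pM2l// lerDl.
have Iu0 : 0 <= \int[mu]_x ((u x - phi x) ^+ 2) by exact: Rintegral_sqr_ge0.
split.
- by apply: (Cc_intro (K := K)) => // [|x /zK ->]; [exact: smooth_comp smooth1_einv sb|
    rewrite mulr0 sub0r einv_le0// oppr_le0].
- have h1 : \int[mu]_x ((einv (eps * u x - w x) - einv (eps * phi x - w x)) ^+ 2) <=
      C ^+ 2 * eps ^+ 2 * \int[mu]_x ((u x - phi x) ^+ 2).
    rewrite -RintegralZl//; last exact: sqint_sqr.
    apply: le_rint_ge0 => [||x].
    + apply: measurable_funX; apply: measurable_funB => //.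
      by apply: smooth_measurable; exact: smooth_comp smooth1_einv sb.
    + by apply: rintZ; exact: sqint_sqr.
    + rewrite sqr_ge0/= -exprMn -exprMn -real_normK ?num_real// -[leRHS]real_normK ?num_real//.
      rewrite lerXn2r ?nnegrE// !normrM (gtr0_norm C0) -mulrA -normrM.
      have [h _ _] := hC (eps * u x - w x) (eps * phi x - w x); apply: le_trans h _.
      by apply: le_of_eq; congr (_ * `|_|); ring.
  apply: le_lt_trans h1 _; rewrite mulrC; apply: le_lt_trans (_ : e / 2 < e); last by lra.
  apply: le_trans eA; apply: ler_pM => //; [nng|exact: ltW|rewrite lerDr; nng].
move=> i; rewrite is_derive_partial_einv//.
have sqdi : sqint mu (fun x => d i x - partial i phi x).
  by apply: sqintB => //; apply: Cc_sqint (Cc_partial i cphi).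
pose G x := P x * \1_[set y | L < P y] x.
have hG : rint mu G by apply: rint_indic => //; apply: measurable_gt_set; exact: (rint_measurable hP).
have hR : rint mu (fun x => A * L * (u x - phi x) ^+ 2 + (2 * C ^+ 2 * G x + A * (d i x - partial i phi x) ^+ 2)).
  by apply: rintD; [apply: rintZ; exact: sqint_sqr|apply: rintD; apply: rintZ => //; exact: sqint_sqr].
have h1 : \int[mu]_x ((einv1 (eps * u x - w x) * (eps * d i x - partial i w x) -
   einv1 (eps * phi x - w x) * (eps * partial i phi x - partial i w x)) ^+ 2) <=
   \int[mu]_x (A * L * (u x - phi x) ^+ 2 + (2 * C ^+ 2 * G x + A * (d i x - partial i phi x) ^+ 2)).
  apply: le_rint_ge0 => // [|x].
    apply: measurable_funX; apply: measurable_funB; first by case: (he i).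
    apply: measurable_funM.
      by apply: smooth_measurable; exact: smooth_comp smooth1_einv1 sb.
    apply: smooth_measurable; apply: smoothB; last exact: smooth_partial.
    by apply: smoothZ; exact: smooth_partial.
  rewrite sqr_ge0/=.
  have r0 : 0 <= A * L * (u x - phi x) ^+ 2 + (2 * C ^+ 2 * G x + A * (d i x - partial i phi x) ^+ 2).
    by nng.
  have [Ux|nU] := pselect (U x); last first.
    have [_ ->] := out x nU; have -> : einv1 (eps * phi x - w x) = 0.
      by rewrite zK; [rewrite mulr0 sub0r einv1_le0 ?oppr_le0|move=> /KU].
    by rewrite !mul0r subr0 expr0n.
  rewrite eE; set a1 := einv1 _; set a2 := einv1 _.
  have -> : eps * partial i phi x - partial i w x = p i x - eps * (d i x - partial i phi x).
    by rewrite /p indicE mem_set// mulr1; ring.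
  set D := d i x - _; set q := p i x.
  have a2b : a2 ^+ 2 <= C ^+ 2 by rewrite lerXn2r ?nnegrE ?einv1_ge0 ?(ltW C0)//; have [] := hC (eps * phi x - w x) 0.
  have key : (a1 - a2) ^+ 2 * q ^+ 2 <= C ^+ 2 * eps ^+ 2 * L * (u x - phi x) ^+ 2 + C ^+ 2 * G x.
    have qP : q ^+ 2 <= P x.
      by rewrite /P (bigD1 i)//= lerDl sumr_ge0// => k _; exact: sqr_ge0.
    rewrite /G indicE; have [LP|PL] := ltP L (P x).
      rewrite mem_set//= mulr1 ler_wpDl//; first by nng.
      apply: ler_pM => //; rewrite ?sqr_ge0//.
      rewrite -[leLHS]real_normK ?num_real// lerXn2r ?nnegrE ?(ltW C0)//.
      have [_ _ b1] := hC (eps * u x - w x) 0; have [_ _ b2] := hC (eps * phi x - w x) 0.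
      have := einv1_ge0 (eps * u x - w x); have := einv1_ge0 (eps * phi x - w x).
      by rewrite -/a1 -/a2 in b1 b2 *; rewrite ler_norml; move: b1 b2; clear; lra.
    rewrite memNset/=; last by apply/negP; rewrite -leNgt.
    rewrite !mulr0 addr0 [leRHS](_ : _ = (C ^+ 2 * eps ^+ 2 * (u x - phi x) ^+ 2) * L); last by ring.
    apply: ler_pM (sqr_ge0 _) (sqr_ge0 _) _ (le_trans qP PL).
    rewrite -!exprMn -real_normK ?num_real// -[leRHS]real_normK ?num_real//.
    rewrite lerXn2r ?nnegrE// !normrM (gtr0_norm C0) -mulrA -normrM.
    have [_ h _] := hC (eps * u x - w x) (eps * phi x - w x); apply: le_trans h _.
    by apply: le_of_eq; congr (_ * `|_|); ring.
  have k2 : a2 ^+ 2 * (eps ^+ 2 * D ^+ 2) <= C ^+ 2 * (eps ^+ 2 * D ^+ 2).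
    by rewrite ler_wpM2r// mulr_ge0// sqr_ge0.
  rewrite (_ : a1 * q - a2 * (q - eps * D) = (a1 - a2) * q + a2 * (eps * D)); last by ring.
  have := sqr_ge0 ((a1 - a2) * q - a2 * (eps * D)).
  by move: key k2; rewrite /A; move: (G x) => g; clear; nra.
apply: le_lt_trans h1 _.
rewrite RintegralD//; [|by apply: rintZ; exact: sqint_sqr|
  by apply: rintD; apply: rintZ => //; exact: sqint_sqr].
rewrite RintegralD//; [|exact: rintZ|by apply: rintZ; exact: sqint_sqr].
rewrite !RintegralZl//; [|exact: sqint_sqr|exact: sqint_sqr].
have := hd' i; move: hu' hL.
set I1 := \int[_]_x _; set I2 := \int[_]_x _; set I3 := \int[_]_x _ => h1 h2 h3.
have k1 : 2 * C ^+ 2 * I2 < e / 2.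
  have c2 : 0 < 2 * C ^+ 2 by rewrite mulr_gt0// exprn_gt0.
  apply: lt_le_trans (_ : 2 * C ^+ 2 * (e / (2 * C ^+ 2 + 1) / 2) <= _); first by rewrite ltr_pM2l.
  rewrite mulrA ler_pM2r// mulrA ler_pdivrMr; last by rewrite ltr_wpDl// ltW.
  by rewrite mulrC ler_pM2l// lerDl.
have k2 : A * L * I1 + A * I3 <= e / 2.
  apply: le_trans eA; rewrite [leRHS]mulrC; set e' := e / _ / 2 in e2 h1 h3 *.
  apply: le_trans (_ : A * L * e' + A * e' <= _).
    by apply: lerD; apply: ler_wpM2l; [nng|exact: ltW|nng|exact: ltW].
  rewrite -mulrDl ler_wpM2r ?(ltW e2)// lerDl; nng.
by move: k1 k2; clear; lra.
Qed.

End test_functions.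

(** * Double integrals in the variables x and x - y *)

Section product_change.
Context {R : realType} {n : nat}.
Local Notation V := 'rV[R]_n.
Local Notation mu := (leb R n).
Local Notation mu2 := (leb2 R n).

Lemma integral_sub_any (g : V -> \bar R) (h : V) : measurable_fun setT g ->
  (\int[mu]_x g (h - x)%R = \int[mu]_x g x)%E.
Proof.
move=> mg; rewrite integralE [RHS]integralE; congr (_ - _)%E.
  by rewrite -[RHS](ge0_integral_sub h (measurable_funepos mg) (funepos_ge0 g)); apply: eq_integral => x _; rewrite !funeposE.
by rewrite -[RHS](ge0_integral_sub h (measurable_funeneg mg) (funeneg_ge0 g)); apply: eq_integral => x _; rewrite !funenegE.
Qed.

Definition shear (p : V * V) : V * V := (p.1, p.1 - p.2).

Lemma measurable_shear : measurable_fun setT shear.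
Proof. by apply/measurable_fun_pairP; split; [exact: measurable_fst|exact: measurable_sub_rV2]. Qed.

Lemma measurable_section1 (F : V * V -> \bar R) x : measurable_fun setT F ->
  measurable_fun setT (fun y => F (x, y)).
Proof. by move=> mF; apply: measurableT_comp mF _; exact: measurable_pair1. Qed.

Lemma integrable_shear (F : V * V -> \bar R) : mu2.-integrable setT F ->
  mu2.-integrable setT (F \o shear).
Proof.
move=> iF; have mF := measurable_int _ iF.
have mS : measurable_fun setT (F \o shear) by exact: measurableT_comp mF measurable_shear.
have mA : measurable_fun setT (abse \o F) by exact: measurableT_comp.
apply/(integrable12ltyP _ _ mS); move: iF => /(integrable12ltyP _ _ mF).
suff -> : (\int[mu]_x \int[mu]_y `|(F \o shear) (x, y)| = \int[mu]_x \int[mu]_y `|F (x, y)|)%E by [].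
apply: eq_integral => x _.
exact: (ge0_integral_sub x (measurable_section1 x mA) (fun y => abse_ge0 (F (x, y)))).
Qed.

(** The change of variables is made for each fixed [x] by a reflection and a translation, then
    Fubini's theorem exchanges the integrals. For almost every [h] the inner extended integral is
    finite and equals the real-valued one. *)
Lemma rint_shear (F : V * V -> R) : rint mu2 F ->
  rint mu (fun h : V => \int[mu]_x F (x, x - h)) /\
  \int[mu2]_p F p = \int[mu]_h \int[mu]_x F (x, x - h).
Proof.
move=> iF; have mF := rint_measurable iF.
have iS := integrable_shear iF.
have mFS := measurable_int _ iS.
have h1 : mu.-integrable setT (fubini_G mu (EFin \o F \o shear)).
  apply/integrableP; split; first exact: measurable_fubini_G iS.
  move: (iS) => /(integrable21ltyP _ _ mFS); apply: le_lt_trans; apply: ge0_le_integral => //.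
  - by apply: measurableT_comp => //; exact: measurable_fubini_G iS.
  - have mAS : measurable_fun setT (abse \o ((EFin \o F) \o shear)) by exact: measurableT_comp.
    exact: (@measurable_fun_fubini_tonelli_G _ _ _ _ _ (lebesgue_rV n) _ mAS (fun p => abse_ge0 _)).
  - move=> y _; apply: le_abse_integral => //.
    by apply: measurableT_comp mFS _; exact: measurable_pair2.
have ae : {ae mu, forall h, fubini_G mu (EFin \o F \o shear) h = (\int[mu]_x F (x, x - h))%:E}.
  have := ae_integrable2 iS; apply: filterS => h hh; rewrite /fubini_G /Rintegral /= fineK//.
  by have := integrable_fin_num measurableT hh.
have mG : measurable_fun setT (fun h : V => \int[mu]_x F (x, x - h)).
  have := measurableT_comp (fine_measurable measurableT) (measurable_int _ h1); exact.
split.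
  apply/integrableP; split; first exact/measurable_EFinP.
  rewrite (ae_eq_integral (abse \o fubini_G mu (EFin \o F \o shear)))//.
  - by case/integrableP: h1.
  - by apply: measurableT_comp => //; exact/measurable_EFinP.
  - by apply: measurableT_comp => //; exact: measurable_int h1.
  - by move: ae; apply: filterS => h /= -> _.
rewrite /Rintegral; congr fine.
rewrite -[LHS](integral12_prod_meas1 iF).
transitivity (\int[mu]_x fubini_F mu (EFin \o F \o shear) x)%E.
  apply: eq_integral => x _; rewrite /fubini_F /=.
  by rewrite (@integral_sub_any (fun y => (F (x, y))%:E) x)//; exact: (measurable_section1 x (F := EFin \o F)) ((measurable_EFinP _ _).2 mF).
rewrite (Fubini iS); apply: ae_eq_integral => //.
- exact: measurable_int h1.
- exact/measurable_EFinP.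
- by move: ae; apply: filterS => h hh _; exact: hh.
Qed.

End product_change.

(** * The fractional kernel *)
Section levy_kernel.
Context {R : realType} {n : nat}.
Local Notation V := 'rV[R]_n.
Local Notation mu := (leb R n).
Local Notation mu2 := (leb2 R n).
Variable s : R.
Hypothesis s01 : 0 < s < 1.
Implicit Types (a b : V -> R) (h : V).
Local Notation en := (@euclidean_norm R n).
Local Notation k := (levy s).

Lemma euclidean_normZ (c : R) h : en (c *: h) = `|c| * en h.
Proof.
rewrite /euclidean_norm -sqrtr_sqr -sqrtrM ?sqr_ge0//; congr Num.sqrt.
by rewrite mulr_sumr; apply: eq_bigr => i _; rewrite mxE exprMn.
Qed.

Lemma le_euclidean_norm h : `|h| <= en h.
Proof.
apply: rV_norm_le => [|i]; first exact: sqrtr_ge0.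
rewrite -sqrtr_sqr ler_sqrt; last by apply: sumr_ge0 => j _; exact: sqr_ge0.
by rewrite (bigD1 i)//= lerDl sumr_ge0// => j _; exact: sqr_ge0.
Qed.

Lemma levyZ (c : R) h : 0 < c -> k (c *: h) = c `^ (- (n%:R + 2 * s)) * k h.
Proof.
by move=> c0; rewrite /levy euclidean_normZ powRM ?sqrtr_ge0// (gtr0_norm c0) invfM powRN.
Qed.

Lemma levy_gt0 h : h != 0 -> 0 < k h.
Proof.
move=> h0; rewrite invr_gt0 powR_gt0// (lt_le_trans _ (le_euclidean_norm h))//.
by rewrite normr_gt0.
Qed.

Lemma levy_le (r : R) h : 0 < r -> r <= `|h| -> k h <= r `^ (- (n%:R + 2 * s)).
Proof.
move=> r0 rh; have e0 : 0 < en h by apply: lt_le_trans (le_euclidean_norm h); exact: lt_le_trans rh.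
rewrite powRN lef_pV2 ?posrE ?powR_gt0//; apply: ge0_ler_powR; rewrite ?nnegrE ?(ltW r0) ?(ltW e0)//.
  by have /andP[s0 _] := s01; rewrite addr_ge0// ?mulr_ge0// ltW.
by apply: le_trans rh _; exact: le_euclidean_norm.
Qed.

(* Summing the geometric series of the integrals over the dilates of [A]. *)
Lemma homogeneous_integral (G : V -> R) (A : set V) (B : nat -> set V) (c lam : R) :
  measurable_fun setT G -> (forall h, 0 <= G h) -> 0 < c -> 0 <= lam < 1 ->
  (forall h, c ^+ n * G (c *: h) = lam * G h) ->
  measurable A -> (forall m, measurable (B m)) -> B 0%N = set0 ->
  (forall m, B m `<=` B m.+1) ->
  (forall m h, B m.+1 h -> A h \/ B m (c^-1 *: h)) ->
  rint mu (fun h => G h * \1_A h) -> rint mu (fun h => G h * \1_(\bigcup_m B m) h).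
Proof.
move=> mG G0 c0 /andP[lam0 lam1] hG mA mB B0 Bm BA iA.
have mU : measurable (\bigcup_m B m) by exact: bigcupT_measurable.
pose F m h := G h * \1_(B m) h.
have mF m : measurable_fun setT (F m) by apply: measurable_funM => //; exact: measurable_indic.
have F0 m h : 0 <= F m h by rewrite mulr_ge0.
set a := (\int[mu]_h (G h * \1_A h)%:E)%E.
have afin : a \is a fin_num by have := integrable_fin_num measurableT iA.
have a0 : (0 <= a)%E by apply: integral_ge0 => h _; rewrite lee_fin mulr_ge0.
(* The sum of the geometric series, that is, the solution of L = a + lam L, which makes the bound
   inductive. *)
pose L := (1 - lam)^-1 * fine a.
have L0 : 0 <= L by rewrite mulr_ge0 ?fine_ge0// invr_ge0 subr_ge0 ltW.
have bound m : (\int[mu]_h (F m h)%:E <= L%:E)%E.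
  elim: m => [|m IH].
    rewrite (_ : (fun h => _) = cst 0%E) ?integral0 ?lee_fin//.
    by apply/funext => h; rewrite /F B0 indic0 mulr0.
  apply: le_trans (_ : (a + \int[mu]_h (G h * \1_(B m) (c^-1 *: h))%:E <= _))%E.
    rewrite -ge0_integralD//; last 4 first.
    - by move=> h _; rewrite lee_fin mulr_ge0.
    - by apply/measurable_EFinP; apply: measurable_funM => //; exact: measurable_indic.
    - by move=> h _; rewrite lee_fin mulr_ge0.
    - apply/measurable_EFinP; apply: measurable_funM => //.
      exact: (measurableT_comp (measurable_indic (mB m)) (measurable_scale_rV _)).
    apply: ge0_le_integral => //.
    + by move=> h _; rewrite lee_fin.
    + exact/measurable_EFinP.
    + apply: emeasurable_funD; apply/measurable_EFinP; apply: measurable_funM => //.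
      exact: (measurableT_comp (measurable_indic (mB m)) (measurable_scale_rV _)).
    move=> h _; rewrite lee_fin -mulrDr ler_wpM2l// /F !indicE.
    case: (boolP (h \in B m.+1)) => [|_]; last by rewrite addr_ge0.
    by rewrite inE => /BA[] h1; [rewrite (mem_set h1) lerDl|rewrite (mem_set h1) lerDr].
  rewrite -(ge0_integral_scale c0); last 2 first.
  - apply/measurable_EFinP; apply: measurable_funM => //.
    exact: (measurableT_comp (measurable_indic (mB m)) (measurable_scale_rV _)).
  - by move=> h; rewrite lee_fin mulr_ge0.
  have -> : ((c ^+ n)%:E * \int[mu]_x (G (c *: x) * \1_(B m) (c^-1 *: (c *: x)))%:E =
      lam%:E * \int[mu]_x (F m x)%:E)%E.
    rewrite -[LHS]ge0_integralZl_EFin; [|by []|by move=> h _; rewrite lee_fin mulr_ge0| |by rewrite exprn_ge0// ltW].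
      rewrite -[RHS]ge0_integralZl_EFin; [|by []|by move=> h _; rewrite lee_fin|exact/measurable_EFinP|by []].
      by apply: eq_integral => h _; rewrite -!EFinM mulrA hG scalerA mulVf ?gt_eqF// scale1r mulrA.
    apply/measurable_EFinP; apply: measurable_funM.
      exact: measurableT_comp mG (measurable_scale_rV _).
    apply: measurableT_comp (measurable_indic (mB m)) _.
    exact: measurableT_comp (measurable_scale_rV _) (measurable_scale_rV _).
  apply: le_trans (leeD2l a (lee_wpmul2l _ IH)) _; first by rewrite lee_fin.
  rewrite -(fineK afin) -EFinM -EFinD lee_fin /L.
  have l1 : 1 - lam != 0 by rewrite subr_eq0 eq_sym lt_eqF.
  by apply: le_of_eq; field.
apply: integrable_abs_lty => //.
  by apply: measurable_funM => //; exact: measurable_indic.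
under eq_integral do rewrite ger0_norm ?mulr_ge0//.
have cvF h : (F m h)%:E @[m --> \oo] --> (G h * \1_(\bigcup_m B m) h)%:E.
  apply: cvg_near_cst; rewrite indicE; case: (boolP (h \in \bigcup_m B m)).
    rewrite inE => -[m0 _ hm0]; exists m0 => // m /= m0m; rewrite /F indicE mem_set//.
    by rewrite -(subnKC m0m); elim: (m - m0)%N => [|j IH]; rewrite ?addn0// addnS; exact: Bm.
  move=> hn; exists 0%N => // m _; rewrite /F indicE memNset// => hm.
  by move/negP: hn; apply; rewrite inE; exists m.
rewrite (_ : (fun h => _) = (fun h => limn (fun m => (F m h)%:E))); last first.
  by apply/funext => h; apply/esym/cvg_lim => //; exact: cvF.
rewrite (monotone_convergence mu measurableT (g' := fun m h => (F m h)%:E))//; last 3 first.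
- by move=> m; apply/measurable_EFinP.
- by move=> m h _; rewrite lee_fin.
- move=> h _; apply/nondecreasing_seqP => m; rewrite lee_fin /F ler_wpM2l// !indicE ler_nat.
  by case: (boolP (h \in B m)) => //; rewrite inE => /Bm /mem_set ->.
apply: le_lt_trans (_ : (L%:E < +oo)%E); last exact: ltry.
apply: lime_le; last by exists 0%N => // m _; exact: bound.
apply: ereal_nondecreasing_is_cvgn; apply/nondecreasing_seqP => m.
apply: ge0_le_integral => //.
- by move=> h _; rewrite lee_fin.
- by apply/measurable_EFinP.
- by apply/measurable_EFinP.
- move=> h _; rewrite lee_fin /F ler_wpM2l// !indicE ler_nat.
  by case: (boolP (h \in B m)) => //; rewrite inE => /Bm /mem_set ->.
Qed.


Lemma powR_add (c p q : R) : 0 < c -> c `^ (p + q) = c `^ p * c `^ q.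
Proof. by move=> c0; rewrite powRD// (gt_eqF c0) implybT. Qed.

Lemma powR_nat (c : R) (m : nat) : 0 < c -> c `^ m%:R = c ^+ m.
Proof. by move=> c0; rewrite powR_mulrn// ltW. Qed.

Lemma powR_Xn (c : R) (p : R) : 0 < c -> c ^+ n * c `^ (- (n%:R + p)) = c `^ (- p).
Proof.
by move=> c0; rewrite -powR_nat// -powR_add// (_ : n%:R + - (n%:R + p) = - p)//; ring.
Qed.

Lemma half_powR_lt1 (p : R) : 0 < p -> (2^-1 : R) `^ p < 1.
Proof.
move=> p0; rewrite -[ltRHS](_ : 1 `^ p = 1 :> R); last by rewrite powR1.
apply: gt0_ltr_powR => //; rewrite ?nnegrE//; lra.
Qed.

Lemma measurable_norm_rV : measurable_fun setT (fun h : V => `|h|).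
Proof. by apply: continuous_measurable_rV => h; exact: norm_continuous. Qed.

Lemma measurable_norm_le (r : R) : measurable [set h : V | `|h| <= r].
Proof. by apply: closed_measurable; have := @closed_norm_le R n r; exact. Qed.

Lemma measurable_norm_gt (r : R) : measurable [set h : V | r < `|h|].
Proof. exact: measurable_gt_set measurable_norm_rV. Qed.

(** The scaling factor for halving is 2^(-(2-2s)), below 1 because s < 1. The annulus 1/4 < |h| <= 1
    covers the part whose double leaves the unit ball. *)
Lemma levy_near1 : rint mu (fun h => `|h| ^+ 2 * k h * \1_[set h : V | `|h| <= 1] h).
Proof.
have /andP[s0 s1] := s01.
pose B m := [set h : V | `|h| <= 1] `&` [set h : V | 2^-1 ^+ m < `|h|].
pose A := [set h : V | `|h| <= 1] `&` [set h : V | 4^-1 < `|h|].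
have mG : measurable_fun setT (fun h : V => `|h| ^+ 2 * k h).
  by apply: measurable_funM; [exact: measurable_funX measurable_norm_rV|exact: measurable_levy].
have mA : measurable A by apply: measurableI; [exact: measurable_norm_le|exact: measurable_norm_gt].
have := @homogeneous_integral (fun h => `|h| ^+ 2 * k h) A B 2^-1 (2^-1 `^ (2 - 2 * s)).
have -> : (fun h => `|h| ^+ 2 * k h * \1_(\bigcup_m B m) h) =
    (fun h => `|h| ^+ 2 * k h * \1_[set h : V | `|h| <= 1] h).
  apply/funext => h; have [->|h0] := eqVneq h 0; first by rewrite normr0 expr0n !mul0r.
  congr (_ * _); rewrite !indicE; congr (_%:R); congr nat_of_bool.
  apply/idP/idP; rewrite !inE; first by move=> [m _ []].
  move=> h1.
  have [m hm] : exists m, 2^-1 ^+ m < `|h|.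
    exists (Num.Def.archi_bound `|h|^-1).
    have h1' := @upper_nthrootP R `|h|^-1 _ (leqnn _).
    by rewrite exprVn -[ltRHS]invrK ltf_pV2 ?posrE ?invr_gt0 ?normr_gt0 ?exprn_gt0//.
  by exists m.
apply.
- exact: mG.
- by move=> h; rewrite mulr_ge0 ?sqr_ge0 ?levy_ge0.
- by rewrite invr_gt0.
- by rewrite powR_ge0 half_powR_lt1//; lra.
- move=> h; rewrite levyZ// normrZ exprMn ger0_norm//.
  have -> : (2^-1 : R) `^ (2 - 2 * s) = 2^-1 ^+ n * 2^-1 `^ (- (n%:R + (2 * s - 2))).
    by rewrite powR_Xn// opprB.
  have -> : - (n%:R + 2 * s) = - (n%:R + (2 * s - 2)) + - 2%:R :> R by ring.
  have e2 : (2^-1 : R) `^ (- 2%:R) = (2^-1 ^+ 2)^-1 by rewrite powRN powR_nat.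
  rewrite powR_add// e2.
  by move: (2^-1 `^ (- _)) (2^-1 ^+ n : R) => b c; field.
- exact: mA.
- by move=> m; apply: measurableI; [exact: measurable_norm_le|exact: measurable_norm_gt].
- by apply/seteqP; split => h //= -[/= h1]; rewrite expr0 ltNge h1.
- move=> m h [/= h1 h2]; split => //=; apply: le_lt_trans h2.
  by rewrite exprS ler_piMl ?exprn_ge0//; lra.
- move=> m h [/= h1 h2]; have [h3|h3] := ltP 4^-1 `|h|; first by left.
  right; split => /=; rewrite normrZ invrK ger0_norm//; first by lra.
  by move: h2; rewrite exprS; lra.
- apply: bbs_integrable; split; first by apply: measurable_funM => //; exact: measurable_indic.
  pose M := (4^-1 : R) `^ (- (n%:R + 2 * s)) + 1.
  have M1 : 1 <= M by rewrite lerDr powR_ge0.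
  exists M; first by lra.
  move=> h; rewrite indicE; split; last first.
    move=> Mh; rewrite memNset ?mulr0//= => -[/= h1 _]; lra.
  case: (boolP (h \in A)) => [|_]; last by rewrite mulr0 normr0; lra.
  rewrite inE => -[/= h1 h2]; rewrite mulr1 ger0_norm ?mulr_ge0 ?sqr_ge0 ?levy_ge0//.
  have h3 := @levy_le 4^-1 h _ (ltW h2).
  apply: (@le_trans _ _ (1 * k h)).
    by apply: ler_wpM2r; rewrite ?levy_ge0// exprn_ile1.
  by rewrite mul1r; apply: le_trans (h3 _) _ => //; rewrite lerDl.
Qed.

(** The scaling factor for doubling is 2^(-2s), below 1 because s > 0. *)
Lemma levy_far1 : rint mu (fun h => k h * \1_[set h : V | 1 < `|h|] h).
Proof.
have /andP[s0 s1] := s01.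
pose B m := [set h : V | `|h| <= 2 ^+ m] `&` [set h : V | 1 < `|h|].
pose A := [set h : V | `|h| <= 2] `&` [set h : V | 1 < `|h|].
have mG := @measurable_levy R n s.
have mA : measurable A by apply: measurableI; [exact: measurable_norm_le|exact: measurable_norm_gt].
have := @homogeneous_integral k A B 2 (2^-1 `^ (2 * s)).
have -> : \bigcup_m B m = [set h : V | 1 < `|h|].
  apply/seteqP; split => [h [m _ []]//|h /= h1].
  exists (Num.Def.archi_bound `|h|) => //; split => //=; apply: ltW.
  exact: (@upper_nthrootP R `|h| _ (leqnn _)).
apply.
- exact: mG.
- by move=> h; rewrite levy_ge0.
- by [].
- by rewrite powR_ge0 half_powR_lt1//; lra.
- move=> h; rewrite levyZ// mulrA powR_Xn//.
  by congr (_ * _); rewrite -powR_inv1// -powRrM mulN1r.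
- exact: mA.
- by move=> m; apply: measurableI; [exact: measurable_norm_le|exact: measurable_norm_gt].
- by apply/seteqP; split => h //= [] h1 /=; rewrite ltNge; rewrite expr0 in h1; rewrite h1.
- move=> m h [/= h1 h2]; split => //=; apply: le_trans h1 _.
  by rewrite exprS ler_peMl ?exprn_ge0//; lra.
- move=> m h [/= h1 h2]; have [h3|h3] := leP `|h| 2; first by left.
  by right; split => /=; rewrite normrZ ger0_norm//; move: h1; rewrite exprS; lra.
- apply: bbs_integrable; split; first by apply: measurable_funM => //; exact: measurable_indic.
  pose M := (1 : R) `^ (- (n%:R + 2 * s)) + 2.
  have M1 : 2 <= M by rewrite lerDr powR_ge0.
  exists M; first by lra.
  move=> h; rewrite indicE; split; last first.
    move=> Mh; rewrite memNset ?mulr0//= => -[/= h1 _]; lra.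
  case: (boolP (h \in A)) => [|_]; last by rewrite mulr0 normr0; lra.
  rewrite inE => -[/= h1 h2]; rewrite mulr1 ger0_norm ?levy_ge0//.
  by apply: le_trans (@levy_le 1 h _ (ltW h2)) _ => //; rewrite lerDl.
Qed.

Definition near_const : R := \int[mu]_h (`|h| ^+ 2 * k h * \1_[set h : V | `|h| <= 1] h).
Definition far_const : R := \int[mu]_h (k h * \1_[set h : V | 1 < `|h|] h).

(** For homogeneous integrands the dependence on the radius is an exact power, so only the two
    integrals at radius 1 remain as constants. *)
Lemma homogeneous_scale (G : V -> R) (p : R) (S : set V) (r : R) : 0 < r ->
  (forall c h, 0 < c -> G (c *: h) = c `^ p * G h) -> rint mu (fun h => G h * \1_S h) ->
  rint mu (fun h => G h * \1_S (r^-1 *: h)) /\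
  \int[mu]_h (G h * \1_S (r^-1 *: h)) = r `^ (n%:R + p) * \int[mu]_h (G h * \1_S h).
Proof.
move=> r0 hG iG; have ri0 : 0 < r^-1 by rewrite invr_gt0.
have e : (fun h => G h * \1_S (r^-1 *: h)) = (fun h => r `^ p * (G (r^-1 *: h) * \1_S (r^-1 *: h))).
  apply/funext => h; rewrite mulrA -hG// scalerA divff ?gt_eqF// scale1r//.
have i1 := integrable_scale ri0 iG.
rewrite e; split; first exact: rintZ.
have h0 := Rintegral_scale ri0 iG; rewrite /= in h0.
rewrite RintegralZl// powR_add// -h0 powR_nat// exprVn.
have rn : r ^+ n != 0 by rewrite expf_neq0// gt_eqF.
by move: (r ^+ n) rn => a a0; field.
Qed.

Lemma levy_near (r : R) : 0 < r ->
  rint mu (fun h => `|h| ^+ 2 * k h * \1_[set h : V | `|h| <= r] h) /\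
  \int[mu]_h (`|h| ^+ 2 * k h * \1_[set h : V | `|h| <= r] h) = r `^ (2 - 2 * s) * near_const.
Proof.
move=> r0; have := @homogeneous_scale (fun h => `|h| ^+ 2 * k h) (2 - (n%:R + 2 * s)) _ r r0 _ levy_near1.
have -> : (fun h => `|h| ^+ 2 * k h * \1_[set h : V | `|h| <= 1] (r^-1 *: h)) =
   (fun h => `|h| ^+ 2 * k h * \1_[set h : V | `|h| <= r] h).
  apply/funext => h; congr (_ * _); rewrite !indicE; congr (_%:R); congr nat_of_bool.
  apply/idP/idP; rewrite !inE /= normrZ gtr0_norm ?invr_gt0// mulrC ler_pdivrMr// mul1r//.
rewrite (_ : n%:R + (2 - (n%:R + 2 * s)) = 2 - 2 * s); last by ring.
apply => c h c0; rewrite levyZ// normrZ exprMn ger0_norm ?ltW//.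
rewrite powR_add// powR_nat//.
by ring.
Qed.

Lemma levy_far (r : R) : 0 < r ->
  rint mu (fun h => k h * \1_[set h : V | r < `|h|] h) /\
  \int[mu]_h (k h * \1_[set h : V | r < `|h|] h) = r `^ (- (2 * s)) * far_const.
Proof.
move=> r0; have := @homogeneous_scale k (- (n%:R + 2 * s)) _ r r0 _ levy_far1.
have -> : (fun h => k h * \1_[set h : V | 1 < `|h|] (r^-1 *: h)) =
   (fun h => k h * \1_[set h : V | r < `|h|] h).
  apply/funext => h; congr (_ * _); rewrite !indicE; congr (_%:R); congr nat_of_bool.
  apply/idP/idP; rewrite !inE /= normrZ gtr0_norm ?invr_gt0// mulrC ltr_pdivlMr// mul1r//.
rewrite (_ : n%:R - (n%:R + 2 * s) = - (2 * s)); last by ring.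
by apply => c h c0; rewrite levyZ.
Qed.

Lemma near_const_ge0 : 0 <= near_const.
Proof. by apply: Rintegral_ge0 => h _; rewrite !mulr_ge0 ?sqr_ge0 ?levy_ge0. Qed.

Lemma far_const_ge0 : 0 <= far_const.
Proof. by apply: Rintegral_ge0 => h _; rewrite !mulr_ge0 ?levy_ge0. Qed.

Lemma Cc_lipschitz b : Cc_smooth setT b -> exists2 C : R, 0 < C & forall x h, `|b (h + x) - b x| <= C * `|h|.
Proof.
move=> cb; have sb := Cc_smoothW cb.
have hb i : exists M : R, 0 < M /\ forall x, `|partial i b x| <= M.
  by have [_ [M M0 hM]] := Cc_bbs (Cc_partial i cb); exists M; split=> // x; have [] := hM x.
have [M hM] := choice hb.
have S0 : 0 <= \sum_i M i by apply: sumr_ge0 => i _; have [/ltW] := hM i.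
exists (n%:R * (\sum_i M i) + 1); first by rewrite ltr_wpDl// mulr_ge0.
move=> x h; apply: le_trans (smooth_lip_local sb S0 _) _.
  move=> i y _; have [_ /(_ y) /le_trans] := hM i; apply.
  by rewrite (bigD1 i)//= lerDl sumr_ge0// => j _; have [/ltW] := hM j.
by rewrite ler_wpM2r// lerDl.
Qed.

(** The density is at most m(x - y), where [m] uses the Lipschitz bound for |x - y| <= 1 and the sup
    bound beyond, and it vanishes unless [x] or [y] lies in the bounded set [B]. Each of these two
    cases gives a product of integrals. *)
Lemma gagfin_Cc b : Cc_smooth setT b -> gagfin s b.
Proof.
move=> cb; have mb := smooth_measurable (Cc_smoothW cb).
have [C C0 hC] := Cc_lipschitz cb.
have [_ [M M0 hM]] := Cc_bbs cb.
pose B := [set x : V | `|x| <= M].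
have mB : measurable B := measurable_norm_le M.
pose m h := C ^+ 2 * (`|h| ^+ 2 * k h * \1_[set h : V | `|h| <= 1] h) +
  (2 * M) ^+ 2 * (k h * \1_[set h : V | 1 < `|h|] h).
have im : rint mu m by apply: rintD; apply: rintZ; [exact: levy_near1|exact: levy_far1].
have m0 h : 0 <= m h by have := levy_ge0 s h; rewrite /m !indicE => ?; nng.
have mm := rint_measurable im.
have iB : rint mu (\1_B : V -> R).
  apply: bbs_integrable; split; first exact: measurable_indic.
  exists (M + 1); first by lra.
  move=> x; rewrite indicE; split; first by case: (_ \in _); rewrite ?normr1 ?normr0; lra.
  by move=> Mx; rewrite memNset//= /B /= => h; lra.
have mm2 : measurable_fun setT (fun p : V * V => m (p.1 - p.2)).
  exact: measurableT_comp mm measurable_sub_rV2.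
have mB1 : measurable_fun setT (fun p : V * V => \1_B p.1 : R).
  exact: measurableT_comp (measurable_indic mB) measurable_fst.
have mB2 : measurable_fun setT (fun p : V * V => \1_B p.2 : R).
  exact: measurableT_comp (measurable_indic mB) measurable_snd.
have fold_int : (\int[mu]_x ((\1_B x)%:E * \int[mu]_h (m h)%:E) < +oo)%E.
  have imE : (\int[mu]_h (m h)%:E)%E \is a fin_num by exact: (integrable_fin_num measurableT im).
  rewrite -(fineK imE); have := integral_fune_lt_pinfty measurableT (rintZ (fine (\int[mu]_h (m h)%:E)) iB).
  by congr (_ < _)%E; apply: eq_integral => x _ /=; rewrite EFinM muleC.
have i1 : rint mu2 (fun p => \1_B p.1 * m (p.1 - p.2)).
  have mF : measurable_fun setT (EFin \o (fun p : V * V => \1_B p.1 * m (p.1 - p.2))).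
    by apply/measurable_EFinP; exact: measurable_funM.
  apply/(integrable12ltyP _ _ mF); apply: le_lt_trans fold_int.
  apply: le_of_eq; apply: eq_integral => x _.
  rewrite -(ge0_integral_sub x (g := fun y => (m y)%:E)); last 2 first.
  - exact/measurable_EFinP.
  - by move=> y; rewrite lee_fin.
  rewrite -ge0_integralZl_EFin//; last 2 first.
  - by move=> y _; rewrite lee_fin.
  - by apply/measurable_EFinP; exact: measurableT_comp mm (measurable_opp_rV x).
  by apply: eq_integral => y _ /=; rewrite normrM !ger0_norm// EFinM.
have i2 : rint mu2 (fun p => \1_B p.2 * m (p.1 - p.2)).
  have mF : measurable_fun setT (EFin \o (fun p : V * V => \1_B p.2 * m (p.1 - p.2))).
    by apply/measurable_EFinP; exact: measurable_funM.
  apply/(integrable21ltyP _ _ mF); apply: le_lt_trans fold_int.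
  apply: le_of_eq; apply: eq_integral => x _.
  rewrite -(ge0_integral_add (- x) (g := fun y => (m y)%:E)); last 2 first.
  - exact/measurable_EFinP.
  - by move=> y; rewrite lee_fin.
  rewrite -ge0_integralZl_EFin//; last 2 first.
  - by move=> y _; rewrite lee_fin.
  - by apply/measurable_EFinP; exact: measurableT_comp mm (measurable_add_rV (- x)).
  by apply: eq_integral => y _ /=; rewrite normrM !ger0_norm// EFinM.
have key x y : energy s b b (x, y) <= m (x - y).
  rewrite /energy /= -expr2 /m !indicE.
  have [h1|h1] := leP `|x - y| 1.
    rewrite mem_set//= memNset/=; last by apply/negP; rewrite -leNgt.
    rewrite !mulr0 addr0 mulr1 mulrA ler_wpM2r ?levy_ge0//.
    rewrite -exprMn -real_normK ?num_real// lerXn2r ?nnegrE//; first by nng.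
    by have := hC y (x - y); rewrite subrK.
  rewrite memNset/=; last by apply/negP; rewrite -ltNge.
  rewrite mem_set//= !mulr0 add0r mulr1 ler_wpM2r ?levy_ge0//.
  rewrite -real_normK ?num_real// lerXn2r ?nnegrE//; first by rewrite mulr_ge0// ltW.
  apply: le_trans (ler_normB _ _) _.
  by have [hx _] := hM x; have [hy _] := hM y; lra.
have iE : rint mu2 (energy s b b).
  apply: (rint_le _ _ (rintD i1 i2)).
    rewrite (_ : energy s b b = fun p => gquot s b p * gquot s b p).
      by apply: measurable_funM; exact: measurable_gquot.
    by apply/funext => p; rewrite energy_densityE.
  move=> [x y]; rewrite ger0_norm; last first.
    by rewrite /energy /= -expr2 mulr_ge0 ?sqr_ge0 ?levy_ge0.
  have [xB|xB] := pselect (B x); last have [yB|yB] := pselect (B y).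
  - rewrite !indicE (mem_set xB) mul1r; apply: ler_wpDr; last exact: key.
    by rewrite mulr_ge0.
  - rewrite !indicE (mem_set yB) mul1r; apply: ler_wpDl; last exact: key.
    by rewrite mulr_ge0.
  - rewrite !indicE memNset// memNset// !mul0r addr0 /energy /=.
    have [_ ->] := hM x; last by rewrite ltNge; apply/negP.
    have [_ ->] := hM y; last by rewrite ltNge; apply/negP.
    by rewrite subrr !mul0r.
by have := integral_fune_lt_pinfty measurableT iE; exact.
Qed.

Definition diff2 b h x : R := 2 * b x - b (x + h) - b (x - h).

(** With y = x - h, the part of the product that contains a(x - h) is translated by [h] in [x]; all
    differences then fall on [b]. Thus [a] enters only through its values, which is what
    mollification needs. *)
Lemma nonlocal_formula a b : rint mu a -> gagfin s a -> Cc_smooth setT b ->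
  rint mu (fun h => k h * \int[mu]_x (a x * diff2 b h x)) /\
  \int[mu2]_p energy s a b p = \int[mu]_h (k h * \int[mu]_x (a x * diff2 b h x)).
Proof.
move=> ia ga cb; have ma := rint_measurable ia.
have mb := smooth_measurable (Cc_smoothW cb).
have [_ [M M0 hM]] := Cc_bbs cb.
have iE := rint_energy ma mb ga (gagfin_Cc cb).
have [i1 ->] := rint_shear iE.
have iM (c : V -> R) : measurable_fun setT c -> (forall x, `|c x| <= M) -> rint mu (fun x => a x * c x).
  move=> mc hc; apply: (@rint_le _ _ _ _ _ (fun x => M * `|a x|)).
  - exact: measurable_funM.
  - by move=> x; rewrite normrM mulrC ler_wpM2r.
  - by apply: rintZ; exact: rint_abs.
have mS h : measurable_fun setT (fun x : V => b (x + h)) by exact: measurableT_comp mb (measurable_add_rV h).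
have iS h : rint mu (fun x => a x * b (x + h)) by apply: iM => // x; have [] := hM (x + h).
have i0 : rint mu (fun x => a x * b x) by apply: iM => // x; have [] := hM x.
have e h : \int[mu]_x energy s a b (x, x - h) = k h * \int[mu]_x (a x * diff2 b h x).
  pose G y := a y * b (y + h) - a y * b y.
  have iG : rint mu G := rintB (iS h) i0.
  have iGh := integrable_add (- h) iG.
  have i2 : rint mu (fun x => a x * b x - a x * b (x - h)) := rintB i0 (iS (- h)).
  rewrite (_ : (fun x => _) = (fun x => k h * ((a x * b x - a x * b (x - h)) - G (x - h)))); last first.
    apply/funext => x; rewrite /energy /= /G subrK.
    by rewrite (_ : x - (x - h) = h); [ring|rewrite opprB addrC subrK].
  rewrite RintegralZl//; last exact: rintB.
  congr (_ * _); rewrite RintegralB// (Rintegral_add (- h) iG) -RintegralB//.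
  by apply: eq_Rintegral => x _; rewrite /G /diff2; ring.
by rewrite (_ : (fun h => _) = fun h : V => \int[mu]_x energy s a b (x, x - h));
  [|by apply/funext => h; rewrite e].
Qed.

End levy_kernel.

Section integral_limits.
Context d (T : measurableType d) (R : realType) (m : {measure set T -> \bar R}).

Lemma rint_monotone (F : nat -> T -> R) (G : T -> R) (L : R) :
  (forall k, measurable_fun setT (F k)) -> (forall k x, 0 <= F k x <= F k.+1 x) ->
  (forall x, \forall k \near \oo, F k x = G x) ->
  (forall k, (\int[m]_x (F k x)%:E <= L%:E)%E) -> rint m G /\ \int[m]_x G x <= L.
Proof.
move=> mF F0 FG FL.
have nd x : {homo (fun k => (F k x)%:E) : k l / (k <= l)%N >-> (k <= l)%E}.
  by apply/nondecreasing_seqP => k; rewrite lee_fin; have /andP[] := F0 k x.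
have F00 k x : 0 <= F k x by have /andP[] := F0 k x.
have cvF x : (fun k => (F k x)%:E) @ \oo --> (G x)%:E.
  by apply: cvg_near_cst; apply: filterS (FG x) => k ->.
have GE : (fun x => (G x)%:E) = (fun x => limn (fun k => (F k x)%:E)).
  by apply/funext => x; apply/esym/cvg_lim => //; exact: cvF.
have mFE k : measurable_fun setT (fun x => (F k x)%:E) by apply/measurable_EFinP.
have IG : (\int[m]_x (G x)%:E <= L%:E)%E.
  rewrite GE (monotone_convergence m measurableT (g' := fun k x => (F k x)%:E))//; last first.
    by move=> k x _; rewrite lee_fin.
  apply: lime_le; last by exists 0%N => // k _; exact: FL.
  apply: ereal_nondecreasing_is_cvgn; apply/nondecreasing_seqP => k.
  apply: ge0_le_integral => //.
  - by move=> x _; rewrite lee_fin.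
  - by move=> x _; rewrite lee_fin; have /andP[] := F0 k x.
have G0 x : 0 <= G x.
  by have [k _ /(_ k (leqnn k)) <-] := FG x.
have mG : measurable_fun setT G.
  apply: (measurable_fun_cvg mF) => x _.
  by apply: cvg_near_cst; exact: FG.
have iG : rint m G.
  apply: integrable_abs_lty => //; under eq_integral do rewrite ger0_norm//.
  by apply: le_lt_trans IG _; exact: ltry.
by split=> //; rewrite -lee_fin Rintegral_EFin.
Qed.

End integral_limits.

Section square_estimates.
Context {R : realType}.
Implicit Types a b c : R.

Lemma sqr_sub_le a b : b ^+ 2 <= 2 * a ^+ 2 + 2 * (a - b) ^+ 2.
Proof. by have := sqr_ge0 (2 * a - b); nra. Qed.

Lemma sqr_sub3_le (a b c d : R) :
  (a - b) ^+ 2 <= 3 * (a - c) ^+ 2 + 3 * (c - d) ^+ 2 + 3 * (b - d) ^+ 2.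
Proof.
by have := sqr_ge0 (a - c - (c - d)); have := sqr_ge0 (a - c + (b - d));
  have := sqr_ge0 (b - d + (c - d)); nra.
Qed.

Lemma translation_arith (E I1 I2 I3 S1 S2 N H : R) : 
  I1 <= 3 * I2 + 3 * I3 + 3 * I2 -> I3 <= 2 * N * H * S1 ->
  2 * N * H * S1 <= 2 * N * H * (2 * S2 + 2 * (N * E)) ->
  I2 < E -> I1 <= 12 * N * H * S2 + (6 + 12 * N * H * N) * E.
Proof. nra. Qed.

End square_estimates.

(** * Faber-Krahn inequality *)
Section faber_krahn.
Context {R : realType} {n : nat}.
Local Notation V := 'rV[R]_n.
Local Notation mu := (leb R n).
Local Notation mu2 := (leb2 R n).
Local Notation e_ i := (delta_mx ord0 i : V).
Implicit Types (phi u : V -> R) (h : V).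

Lemma sqr_sum_le (N : nat) (a : 'I_N -> R) : (\sum_i a i) ^+ 2 <= N%:R * \sum_i a i ^+ 2.
Proof.
elim: N a => [|N IH] a; first by rewrite !big_ord0 expr0n mul0r.
rewrite !big_ord_recl; case: N IH a => [|N] IH a.
  by rewrite !big_ord0 !addr0 mul1r.
set b := \sum_i a (lift ord0 i); set B := \sum_i a (lift ord0 i) ^+ 2.
have h1 : b ^+ 2 <= N.+1%:R * B by exact: IH.
have N0 : (0 : R) < N.+1%:R by rewrite ltr0n.
have h2 : 2 * a ord0 * b <= N.+1%:R * a ord0 ^+ 2 + B.
  rewrite -(ler_pM2l N0); have := sqr_ge0 (N.+1%:R * a ord0 - b).
  by move: h1; move: (N.+1%:R : R) => t; clear; nra.
by rewrite sqrrD -natr1; move: h1 h2; move: (N.+1%:R : R) => t; clear; nra.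
Qed.

Lemma sqint_shift u h : sqint mu u -> sqint mu (fun x => u (x + h)).
Proof.
move=> /sqintP[mu_ iu]; apply/sqintP; split.
  exact: measurableT_comp mu_ (measurable_add_rV h).
exact: (@integrable_add _ _ (fun x => u x ^+ 2) h iu).
Qed.

Lemma sqint_shift_norm u h : sqint mu u -> \int[mu]_x (u (x + h) ^+ 2) = \int[mu]_x (u x ^+ 2).
Proof. by move=> /sqint_sqr iu; exact: (@Rintegral_add _ _ (fun x => u x ^+ 2) h iu). Qed.

Lemma le_of_nat_inverse (x y C : R) : (forall N : nat, x <= y + C / N.+1%:R) -> x <= y.
Proof.
move=> h; apply/ler_addgt0Pr => e e0.
have [C0|C0] := leP C 0.
  by apply: le_trans (h 0%N) _; rewrite divr1; lra.
have := archi_boundP (ltW (divr_gt0 C0 e0)); set N := Num.Def.archi_bound _ => hN.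
apply: le_trans (h N) _; rewrite lerD2l ler_pdivrMr ?ltr0n//.
rewrite -ler_pdivrMl// mulrC; apply: ltW; apply: lt_le_trans hN _.
by rewrite ler_nat.
Qed.

(** On a bounded set the increment is t times the derivative up to O(t^2), since the derivative is
    Lipschitz, and outside it both sides of the increment vanish. The factor 2 comes from splitting
    the square. *)
Lemma increment_sqr_le phi i : Cc_smooth setT phi -> exists2 C : R, 0 <= C & forall t : R, `|t| <= 1 ->
  \int[mu]_x ((phi (x + t *: e_ i) - phi x) ^+ 2) <= 2 * t ^+ 2 * (\int[mu]_x (partial i phi x ^+ 2)) + C * t ^+ 4.
Proof.
move=> cphi; have sphi := Cc_smoothW cphi; have mphi := smooth_measurable sphi.
have [_ [M M0 hM]] := Cc_bbs cphi.
have [L L0 hL] := Cc_lipschitz (Cc_partial i cphi).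
pose B := [set x : V | `|x| <= M + 1].
have mB : measurable B := measurable_norm_le (M + 1).
have iB : rint mu (\1_B : V -> R).
  apply: bbs_integrable; split; first exact: measurable_indic.
  exists (M + 1); first by lra.
  move=> x; rewrite indicE; split; first by case: (_ \in _); rewrite ?normr1 ?normr0; lra.
  by move=> Mx; rewrite memNset//= /B /= => h; lra.
have I0 : 0 <= \int[mu]_x (\1_B x : R) by apply: Rintegral_ge0.
exists (2 * L ^+ 2 * \int[mu]_x (\1_B x : R)); first by nng.
move=> t t1.
have ip : rint mu (fun x => partial i phi x ^+ 2) by apply: sqint_sqr; exact: Cc_sqint (Cc_partial i cphi).
rewrite -RintegralZl// mulrAC -[X in _ + X]RintegralZl// -RintegralD//; [|exact: rintZ|exact: rintZ].
apply: le_rint_ge0 => [||x].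
- apply: measurable_funX; apply: measurable_funB => //.
  exact: measurableT_comp mphi (measurable_add_rV _).
- by apply: rintD; exact: rintZ.
rewrite sqr_ge0/=.
have [tau /andP[tau0 tau1] e] := line_MVT x t (fun y => smooth_derive i y sphi).
rewrite [x + _]addrC.
have [xB|xB] := pselect (B x).
  rewrite indicE mem_set// mulr1 e exprMn.
  have h1 := hL x ((tau * t) *: e_ i).
  have h2 : `|(tau * t) *: e_ i| <= `|t|.
    rewrite normrZ normrM (ger0_norm tau0) -[leRHS]mulr1 ler_pM ?normr_ge0 ?mulr_ge0 ?norm_delta_le1//.
    by rewrite ler_piMl.
  have h3 : `|partial i phi ((tau * t) *: e_ i + x) - partial i phi x| ^+ 2 <= L ^+ 2 * t ^+ 2.
    rewrite -exprMn -[leRHS]real_normK ?num_real// lerXn2r ?nnegrE//.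
    by rewrite normrM (gtr0_norm L0); apply: le_trans h1 _; rewrite ler_pM2l.
  rewrite real_normK ?num_real// in h3.
  have t2 := sqr_ge0 t; move: h3 t2; rewrite [t ^+ 4](_ : _ = t ^+ 2 * t ^+ 2); last by ring.
  move: (partial i phi _) (partial i phi _) (t ^+ 2) => b a T h3 T0.
  have h4 := sqr_sub_le b a.
  have h5 : T * (a - b) ^+ 2 <= T * (L ^+ 2 * T) by rewrite ler_wpM2l.
  by have := ler_wpM2l T0 h4; move: h5; nra.
have [_ ->] := hM x; last by move: xB; rewrite /B /= => /negP; rewrite -ltNge; lra.
have [_ ->] := hM (t *: e_ i + x).
  rewrite subrr expr0n /= indicE [t ^+ 4](_ : _ = (t ^+ 2) ^+ 2); last by ring.
  by apply: addr_ge0 => //; nng.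
have h1 : `|x| <= `|t *: e_ i + x| + `|t *: e_ i|.
  by rewrite -[in leLHS](addKr (t *: e_ i) x) addrC (le_trans (ler_normD _ _))// normrN.
have h2 : `|t *: e_ i| <= 1.
  by rewrite normrZ -[leRHS]mulr1 ler_pM ?norm_delta_le1.
by move: xB h1 h2; rewrite /B /= => /negP; rewrite -ltNge; lra.
Qed.

(* The segment is split into many equal steps, so that only the behaviour of
   the increment for small steps matters. *)
Lemma translation_coord phi i (t : R) : Cc_smooth setT phi ->
  \int[mu]_x ((phi (x + t *: e_ i) - phi x) ^+ 2) <= 2 * t ^+ 2 * (\int[mu]_x (partial i phi x ^+ 2)).
Proof.
move=> cphi.
have sq := Cc_sqint cphi.
have [C C0 hC] := increment_sqr_le i cphi.
have sqd h : sqint mu (fun x => phi (x + h) - phi x) by apply: sqintB => //; exact: sqint_shift.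
have tel N : \int[mu]_x ((phi (x + t *: e_ i) - phi x) ^+ 2) <=
    N.+1%:R ^+ 2 * \int[mu]_x ((phi (x + (t / N.+1%:R) *: e_ i) - phi x) ^+ 2).
  pose a (j : 'I_N.+1) x := phi (x + ((j.+1%:R * (t / N.+1%:R)) *: e_ i)) - phi (x + ((j%:R * (t / N.+1%:R)) *: e_ i)).
  have aE j : a j = fun x => (fun y => phi (y + (t / N.+1%:R) *: e_ i) - phi y) (x + ((j%:R * (t / N.+1%:R)) *: e_ i)).
    by apply/funext => x; rewrite /a /= -addrA -scalerDl -[j.+1%:R]natr1 mulrDl mul1r.
  have sa j : sqint mu (a j) by rewrite aE; exact: (sqint_shift _ (sqd _)).
  have sumE x : phi (x + t *: e_ i) - phi x = \sum_j a j x.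
    have -> : \sum_j a j x = \sum_(0 <= j < N.+1) ((fun k : nat => phi (x + ((k%:R * (t / N.+1%:R)) *: e_ i))) j.+1 -
       (fun k : nat => phi (x + ((k%:R * (t / N.+1%:R)) *: e_ i))) j) by rewrite big_mkord.
    by rewrite telescope_sumr//= mul0r scale0r addr0 mulrC divfK.
  apply: (@le_trans _ _ (\int[mu]_x (N.+1%:R * \sum_j a j x ^+ 2))).
    apply: le_rint => [||x]; first exact: sqint_sqr (sqd _).
      by apply: rintZ; apply: rint_sum => j; exact: sqint_sqr.
    by rewrite sumE sqr_sum_le.
  rewrite RintegralZl//; last by apply: rint_sum => j; exact: sqint_sqr.
  rewrite Rintegral_sum//; last by move=> j _; exact: sqint_sqr.
  rewrite (eq_bigr (fun=> \int[mu]_x ((phi (x + (t / N.+1%:R) *: e_ i) - phi x) ^+ 2))); last first.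
    by move=> j _; rewrite aE; exact: (sqint_shift_norm _ (sqd _)).
  by set I := \int[_]_x _; rewrite sumr_const card_ord -(mulr_natl I) mulrA expr2.
(* Adding [K] to the number of steps makes each step at most 1 in absolute value, the range of
   [increment_sqr_le]. *)
pose K := Num.Def.archi_bound `|t|.
apply: (@le_of_nat_inverse _ _ (C * t ^+ 4)) => N.
have e : \int[mu]_x ((phi (x + t *: e_ i) - phi x) ^+ 2) <= 2 * t ^+ 2 * (\int[mu]_x (partial i phi x ^+ 2)) + C * t ^+ 4 / (N + K).+1%:R.
  apply: le_trans (tel (N + K)%N) _; move: (hC (t / (N + K).+1%:R)).
  have m0 : (0 : R) < (N + K).+1%:R by rewrite ltr0n.
  have m1 : (1 : R) <= (N + K).+1%:R by rewrite ler1n.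
  have mt : `|t| <= (N + K).+1%:R.
    apply: le_trans (ltW (archi_boundP (normr_ge0 _))) _.
    by rewrite ler_nat -/K (leq_trans (leq_addl N K)).
  move: m0 m1 mt; move: ((N + K).+1%:R : R) => m m0 m1 mt.
  rewrite normrM normfV (gtr0_norm m0) ler_pdivrMr// mul1r => /(_ mt) h.
  rewrite -(ler_pM2l (exprn_gt0 2 m0)) in h; apply: le_trans h _.
  rewrite mulrDr; have -> : m ^+ 2 * (2 * (t / m) ^+ 2 * \int[mu]_x (partial i phi x ^+ 2)) =
    2 * t ^+ 2 * \int[mu]_x (partial i phi x ^+ 2) by field; rewrite gt_eqF.
  rewrite lerD2l [leLHS](_ : _ = C * t ^+ 4 / m * m^-1); last by field; rewrite gt_eqF.
  rewrite ler_piMr ?invf_le1//; apply: divr_ge0; last exact: ltW.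
  by apply: mulr_ge0 => //; rewrite (_ : t ^+ 4 = (t ^+ 2) ^+ 2) ?sqr_ge0//; ring.
apply: le_trans e _; rewrite lerD2l ler_wpM2l//.
  by apply: mulr_ge0 => //; rewrite (_ : t ^+ 4 = (t ^+ 2) ^+ 2) ?sqr_ge0//; ring.
by rewrite lef_pV2 ?posrE ?ltr0n// ler_nat ltnS leq_addr.
Qed.

(** The translation is performed one coordinate at a time; the Cauchy-Schwarz inequality for the [n]
    increments gives the factor [n]. *)
Lemma translation_Cc phi h : Cc_smooth setT phi ->
  \int[mu]_x ((phi (x + h) - phi x) ^+ 2) <= 2 * n%:R * `|h| ^+ 2 * (\sum_i \int[mu]_x (partial i phi x ^+ 2)).
Proof.
move=> cphi; have sq := Cc_sqint cphi.
pose P (k : nat) : V := \row_i (if (i < k)%N then h ord0 i else 0).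
pose a (i : 'I_n) x := phi (x + P i.+1) - phi (x + P i).
have PS (i : 'I_n) : P i.+1 = h ord0 i *: e_ i + P i.
  apply/rowP => j; rewrite !mxE eqxx /= eq_sym ltnS leq_eqVlt.
  have [->|ij] := eqVneq i j; first by rewrite eqxx ltnn mulr1 addr0.
  by rewrite (_ : (val j == val i) = false) ?mulr0 ?add0r//; apply/negbTE; rewrite eq_sym; exact: ij.
have aE i : a i = fun x => (fun y => phi (y + h ord0 i *: e_ i) - phi y) (x + P i).
  by apply/funext => x; rewrite /a PS addrA addrAC -addrA addrA addrAC.
have sqd v : sqint mu (fun x => phi (x + v) - phi x) by apply: sqintB => //; exact: sqint_shift.
have sa i : sqint mu (a i) by rewrite aE; exact: (sqint_shift _ (sqd _)).
have sumE x : phi (x + h) - phi x = \sum_i a i x.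
  have -> : \sum_j a j x = \sum_(0 <= j < n) ((fun k => phi (x + P k)) j.+1 - (fun k => phi (x + P k)) j) by rewrite big_mkord.
  rewrite telescope_sumr//=; congr (phi _ - phi _).
    by congr (_ + _); apply/rowP => j; rewrite mxE ltn_ord.
  by rewrite (_ : P 0%N = 0) ?addr0//; apply/rowP => j; rewrite !mxE.
apply: (@le_trans _ _ (\int[mu]_x (n%:R * \sum_i a i x ^+ 2))).
  apply: le_rint => [||x]; first exact: sqint_sqr (sqd _).
    by apply: rintZ; apply: rint_sum => j; exact: sqint_sqr.
  by rewrite sumE sqr_sum_le.
rewrite RintegralZl//; last by apply: rint_sum => j; exact: sqint_sqr.
rewrite Rintegral_sum//; last by move=> j _; exact: sqint_sqr.
rewrite (_ : 2 * n%:R * _ = n%:R * (2 * `|h| ^+ 2)); last by ring.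
rewrite -mulrA ler_wpM2l// mulr_sumr ler_sum// => i _.
rewrite aE (sqint_shift_norm (P i) (sqd _)); apply: le_trans (translation_coord _ _ cphi) _.
rewrite ler_wpM2r//; first exact: Rintegral_sqr_ge0.
rewrite ler_pM2l// -real_normK ?num_real// lerXn2r ?nnegrE//; exact: coord_le_norm.
Qed.

Variable U : set V.
Hypotheses (n0 : (0 < n)%N) (oU : open U) (bU : norm_bounded U).

Lemma Cc_setT phi : Cc_smooth U phi -> Cc_smooth setT phi.
Proof. by case=> h1 h2 _; split. Qed.

(** The constant is 12 = 3 * 2 * 2: three squares from inserting an approximant, the factor 2 of
    [translation_Cc], and the factor 2 of comparing the gradients. *)
Lemma h10_translation u (d : 'I_n -> V -> R) h : h10 U u d ->
  \int[mu]_x ((u (x + h) - u x) ^+ 2) <= 12 * n%:R * `|h| ^+ 2 * (\sum_i \int[mu]_x (d i x ^+ 2)).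
Proof.
move=> [hu hd _ _ app]; apply/ler_addgt0Pr => e e0.
set A := 12 * n%:R * `|h| ^+ 2.
have A0 : 0 <= A by rewrite /A !mulr_ge0 ?sqr_ge0.
have A6 : 0 < 6 + A * n%:R by rewrite ltr_wpDr// mulr_ge0.
have e1 : 0 < e / (6 + A * n%:R) := divr_gt0 e0 A6.
have [phi [cphi hu' hd']] := app _ e1.
have cT := Cc_setT cphi.
have sphi := Cc_sqint cT.
have su : sqint mu (fun x => u x - phi x) by exact: sqintB.
have suh := sqint_shift h su.
have sph : sqint mu (fun x => phi (x + h) - phi x) by apply: sqintB => //; exact: sqint_shift.
have sdu : sqint mu (fun x => u (x + h) - u x) by apply: sqintB => //; exact: sqint_shift.
have i1 := rintZ 3 (sqint_sqr suh); have i2 := rintZ 3 (sqint_sqr sph); have i3 := rintZ 3 (sqint_sqr su).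
have k1 : \int[mu]_x ((u (x + h) - u x) ^+ 2) <= 3 * \int[mu]_x ((u x - phi x) ^+ 2) +
     3 * (\int[mu]_x ((phi (x + h) - phi x) ^+ 2)) + 3 * \int[mu]_x ((u x - phi x) ^+ 2).
  rewrite -[X in 3 * X + _ + _](sqint_shift_norm h su).
  rewrite -!RintegralZl//; try exact: sqint_sqr.
  rewrite -RintegralD// -RintegralD//; last exact: rintD.
  apply: le_rint => [||x]; first exact: sqint_sqr.
    by apply: rintD => //; exact: rintD.
  move: (u (x + h)) (u x) (phi (x + h)) (phi x) => a b c d0.
  exact: sqr_sub3_le.
have k2 i : \int[mu]_x (partial i phi x ^+ 2) <= 2 * (\int[mu]_x (d i x ^+ 2)) + 2 * \int[mu]_x ((d i x - partial i phi x) ^+ 2).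
  have sp := Cc_sqint (Cc_partial i cT).
  have sd : sqint mu (fun x => d i x - partial i phi x) by exact: sqintB.
  rewrite -!RintegralZl//; try exact: sqint_sqr.
  rewrite -RintegralD//; try by apply: rintZ; exact: sqint_sqr.
  apply: le_rint => [||x]; first exact: sqint_sqr.
    by apply: rintD; apply: rintZ; exact: sqint_sqr.
  move: (d i x) (partial i phi x) => a b.
  exact: sqr_sub_le.
have k3 := translation_Cc h cT.
have k4 : \sum_i \int[mu]_x (partial i phi x ^+ 2) <= 2 * (\sum_i \int[mu]_x (d i x ^+ 2)) + 2 * (n%:R * (e / (6 + A * n%:R))).
  apply: (@le_trans _ _ (\sum_i (2 * (\int[mu]_x (d i x ^+ 2)) + 2 * (e / (6 + A * n%:R))))).
    apply: ler_sum => i _; apply: le_trans (k2 i) _; rewrite lerD2l ler_pM2l//; exact: ltW.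
  by rewrite big_split/= -mulr_sumr sumr_const card_ord -[X in _ + X <= _]mulr_natl mulrCA.
have k5 : 2 * n%:R * `|h| ^+ 2 * (\sum_i \int[mu]_x (partial i phi x ^+ 2)) <=
  2 * n%:R * `|h| ^+ 2 * (2 * (\sum_i \int[mu]_x (d i x ^+ 2)) + 2 * (n%:R * (e / (6 + A * n%:R)))).
  by rewrite ler_wpM2l//; nng.
have k6 : (6 + A * n%:R) * (e / (6 + A * n%:R)) = e.
  by rewrite mulrC divfK// gt_eqF.
rewrite -[X in _ <= _ + X]k6; exact: translation_arith k1 k3 k5 hu'.
Qed.


Lemma rint_prod (f g : V -> R) : rint mu f -> rint mu g ->
  rint mu2 (fun p => f p.1 * g p.2) /\
  \int[mu2]_p (f p.1 * g p.2) = (\int[mu]_x f x) * \int[mu]_x g x.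
Proof.
move=> ifx ig; have mf := rint_measurable ifx; have mg := rint_measurable ig.
have mF : measurable_fun setT (EFin \o (fun p : V * V => f p.1 * g p.2)).
  apply/measurable_EFinP; apply: measurable_funM.
    exact: measurableT_comp mf measurable_fst.
  exact: measurableT_comp mg measurable_snd.
have i2 : mu2.-integrable setT (EFin \o (fun p : V * V => f p.1 * g p.2)).
  apply/(integrable12ltyP _ _ mF).
  have := integral_fune_lt_pinfty measurableT (rintZ (\int[mu]_y `|g y|) (rint_abs ifx)).
  congr (_ < _)%E; apply: eq_integral => x _ /=.
  rewrite mulrC EFinM (Rintegral_EFin measurableT (rint_abs ig)) -ge0_integralZl_EFin//.
    by apply: eq_integral => y _; rewrite -EFinM normrM.
  by apply/measurable_EFinP; exact: measurableT_comp.
split=> //; rewrite /Rintegral -(integral12_prod_meas1 i2).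
have ifn := integrable_fin_num measurableT ifx; have ign := integrable_fin_num measurableT ig.
rewrite -fineM//; congr fine.
transitivity (\int[mu]_x ((\int[mu]_y g y) * f x)%:E)%E.
  apply: eq_integral => x _; rewrite /fubini_F /=.
  by rewrite mulrC -RintegralZl// (Rintegral_EFin measurableT (rintZ (f x) ig)).
rewrite -(Rintegral_EFin measurableT (rintZ _ ifx)) RintegralZl// EFinM !Rintegral_EFin// muleC//.
Qed.

Lemma lebesgue_rV_cube (r : R) : 0 < r -> mu [set h : V | `|h| <= r] = ((2 * r) ^+ n)%:E.
Proof.
move=> r0; rewrite (_ : [set h : V | _] = boxc (fun=> - r) (fun=> r)).
  rewrite lebesgue_rV_boxc; last by move=> i; lra.
  by rewrite prodr_const card_ord; congr (_ ^+ _)%:E; ring.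
apply/seteqP; split => h /= hr.
  by move=> i; rewrite in_itv /= -ler_norml (le_trans (coord_le_norm _ _)).
apply: rV_norm_le => [|i]; first exact: ltW.
by have := hr i; rewrite in_itv /= -ler_norml.
Qed.

Lemma rint_bounded_indic (A : set V) (M : R) : measurable A -> (forall x, A x -> `|x| <= M) ->
  rint mu (\1_A : V -> R).
Proof.
move=> mA AM; apply: bbs_integrable; split; first exact: measurable_indic.
exists (`|M| + 1); first by have := normr_ge0 M; lra.
move=> x; rewrite indicE; have := normr_ge0 M; have := ler_norm M; split.
  by case: (_ \in _); rewrite ?normr1 ?normr0; lra.
by move=> Mx; rewrite memNset//= => /AM; lra.
Qed.

Lemma Rintegral_indic (A : set V) : measurable A -> \int[mu]_x (\1_A x : R) = fine (mu A).
Proof. by move=> mA; rewrite /Rintegral integral_indic// setIT. Qed.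

Lemma rint_indic_U (A : set V) : measurable A -> A `<=` U -> rint mu (\1_A : V -> R).
Proof.
by move=> mA AU; have [M hM] := bU; apply: (@rint_bounded_indic A M) => // x /AU; exact: hM.
Qed.

Lemma h10_rint u (d : 'I_n -> V -> R) : h10 U u d -> rint mu u.
Proof.
move=> [hu _ zu _ _]; have mU := open_measurable oU.
apply: (rint_le (sqint_measurable hu) _ (rintD (sqint_sqr hu) (rint_indic_U mU (@subset_refl _ U)))) => x.
have [Ux|nU] := pselect (U x); last first.
  by rewrite zu// normr0 expr0n add0r indicE.
rewrite indicE mem_set//= -[u x ^+ 2]real_normK ?num_real//.
by have := sqr_ge0 (`|u x| - 2^-1); have : (0 : R) <= 4^-1 by []; nra.
Qed.

(** For |h| <= r the integral of u(x) u(x-h) equals the integral of u^2 minus half that of (u(x-h) -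
    u(x))^2, and translations bound the latter by 12 n r^2 S. Integrating over the cube of such [h]
    and forgetting the restriction on [h] bounds the result by the squared L^1 norm. *)
Lemma poincare_cube u (d : 'I_n -> V -> R) (r : R) : h10 U u d -> 0 < r ->
  (2 * r) ^+ n * (\int[mu]_x (u x ^+ 2) - 6 * n%:R * r ^+ 2 * (\sum_i \int[mu]_x (d i x ^+ 2))) <=
  (\int[mu]_x `|u x|) ^+ 2.
Proof.
move=> hud r0; have iu := h10_rint hud; have [hu _ _ _ _] := hud.
set S := \sum_i _; set I := \int[mu]_x (u x ^+ 2); set Q := [set h : V | `|h| <= r].
have S0 : 0 <= S by apply: sumr_ge0 => i _; exact: Rintegral_sqr_ge0.
have mQ : measurable Q := measurable_norm_le r.
have iQ : rint mu (\1_Q : V -> R) by exact: (@rint_bounded_indic Q r).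
have [ip pE] := rint_prod (rint_abs iu) (rint_abs iu).
pose F (p : V * V) := `|u p.1| * `|u p.2| * \1_Q (p.1 - p.2).
have mF : measurable_fun setT F.
  apply: measurable_funM; first exact: rint_measurable ip.
  exact: measurableT_comp (measurable_indic mQ) measurable_sub_rV2.
have Fle p : 0 <= F p <= `|u p.1| * `|u p.2|.
  rewrite /F indicE; case: (_ \in _); rewrite ?mulr1 ?mulr0 ?lexx ?mulr_ge0//.
have iF : rint mu2 F.
  by apply: (rint_le mF _ ip) => p; have /andP[F0 ?] := Fle p; rewrite ger0_norm.
have [ih hE] := rint_shear iF.
have F2 : \int[mu2]_p F p <= (\int[mu]_x `|u x|) ^+ 2.
  by rewrite expr2 -pE; apply: le_rint_ge0.
apply: le_trans F2; rewrite hE.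
have -> : (2 * r) ^+ n = \int[mu]_x (\1_Q x : R) by rewrite Rintegral_indic// lebesgue_rV_cube.
rewrite mulrC -RintegralZl//; apply: le_rint => // [|h]; first exact: rintZ.
have e : \int[mu]_x F (x, x - h) = \1_Q h * \int[mu]_x (`|u x| * `|u (x - h)|).
  have sh := sqint_shift (- h) hu.
  rewrite -RintegralZl//; last first.
    have := rint_abs (sqint_mul hu sh); rewrite /rint; congr (integrable _ _ _).
    by apply/funext => x; rewrite /= normrM.
  apply: eq_Rintegral => x _; rewrite /F /= mulrC.
  by rewrite (_ : x - (x - h) = h)// opprB addrC subrK.
rewrite e mulrC indicE; case: (boolP (h \in Q)) => [|_]; last by rewrite !mul0r.
rewrite inE /Q /= !mul1r => hr.
have sh := sqint_shift (- h) hu.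
have tr := h10_translation (- h) hud; rewrite -/S normrN in tr.
have i1 := sqint_mul hu sh.
have k1 : \int[mu]_x (u x * u (x - h)) <= \int[mu]_x (`|u x| * `|u (x - h)|).
  apply: le_rint => // [|x]; last by rewrite -normrM ler_norm.
  have := rint_abs i1; rewrite /rint; congr (integrable _ _ _).
  by apply/funext => x; rewrite /= normrM.
apply: le_trans k1.
have k2 : \int[mu]_x ((u (x - h) - u x) ^+ 2) = 2 * I - 2 * \int[mu]_x (u x * u (x - h)).
  rewrite (_ : (fun x => (u (x - h) - u x) ^+ 2) = (fun x => (u (x - h) ^+ 2 + u x ^+ 2) - 2 * (u x * u (x - h)))); last first.
    by apply/funext => x; ring.
  rewrite RintegralB//; [|by apply: rintD; exact: sqint_sqr|exact: rintZ].
  rewrite RintegralZl// RintegralD//; try exact: sqint_sqr.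
  by rewrite (sqint_shift_norm (- h) hu) -/I; ring.
rewrite k2 in tr.
have k3 : n%:R * `|h| ^+ 2 * S <= n%:R * r ^+ 2 * S.
  rewrite ler_wpM2r// ler_wpM2l// lerXn2r ?nnegrE//; exact: ltW.
by move: tr k3; move: (\int[mu]_x _) => J; rewrite -!mulrA; move: (n%:R * _) (n%:R * _) => a b; lra.
Qed.

(** The squared L^1 norm is at most 4 |A| times the squared L^2 norm I, so a cube of measure 8 |A|
    in [poincare_cube] yields I - 6 n r^2 S <= I/2, that is I <= 12 n r^2 S. *)
Lemma faber_krahn : exists2 K : R, 0 < K & forall u (d : 'I_n -> V -> R) (A : set V),
  h10 U u d -> measurable A -> (forall x, u x != 0 -> A x) -> A `<=` U ->
  \int[mu]_x (u x ^+ 2) <= K * (fine (mu A)) `^ (2 / n%:R) * (\sum_i \int[mu]_x (d i x ^+ 2)).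
Proof.
have nn : (0 : R) < n%:R by rewrite ltr0n.
exists (3 * n%:R * 8 `^ (2 / n%:R)); first by psv.
move=> u d A hud mA uA AU; have [hu _ _ _ _] := hud.
have iu := h10_rint hud; have iA := rint_indic_U mA AU.
set S := \sum_i _; set I := \int[mu]_x (u x ^+ 2); set a := fine (mu A).
have S0 : 0 <= S by apply: sumr_ge0 => i _; exact: Rintegral_sqr_ge0.
have I0 : 0 <= I by exact: Rintegral_sqr_ge0.
have a0 : 0 <= a by rewrite fine_ge0.
set X := \int[mu]_x `|u x|; have X0 : 0 <= X by apply: Rintegral_ge0.
have aE : \int[mu]_x (\1_A x : R) = a by rewrite Rintegral_indic.
have Xc (c : R) : 0 < c -> X <= c * I + c^-1 * a.
  move=> c0; rewrite -aE -!RintegralZl//; last exact: sqint_sqr.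
  rewrite -RintegralD//; [|by apply: rintZ; exact: sqint_sqr|exact: rintZ].
  apply: le_rint => [||x]; first exact: rint_abs.
    by apply: rintD; apply: rintZ => //; exact: sqint_sqr.
  have [->|ux] := eqVneq (u x) 0; first by rewrite normr0; nng.
  rewrite indicE (mem_set (uA _ ux)) mulr1 -[u x ^+ 2]real_normK ?num_real//.
  rewrite -(ler_pM2l c0) mulrDr divff ?gt_eqF// mulrA -expr2 -exprMn.
  by have := sqr_ge0 (c * `|u x| - 1); move: (c * `|u x|) (normr_ge0 (u x)) => y; nra.
have [I00|In0] := eqVneq I 0; first by rewrite I00; nng.
have Ip : 0 < I by rewrite lt_neqAle eq_sym In0.
have ap : 0 < a.
  rewrite lt_neqAle a0 andbT eq_sym; apply/eqP => a00.
  have A00 : mu A = 0%E.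
    rewrite -[LHS]fineK -/a ?a00//; rewrite -(setIT A) -integral_indic//.
    exact: (integrable_fin_num measurableT iA).
  move: In0; rewrite /I (eq_Rintegral_null (g := fun=> 0) mA A00); last first.
    move=> x nA _; have [->|/uA//] := eqVneq (u x) 0; by rewrite expr0n.
  by rewrite Rintegral_cst// mul0r eqxx.
have X2 : X ^+ 2 <= 4 * a * I.
  have [->|Xn0] := eqVneq X 0; first by rewrite expr0n; nng.
  have Xp : 0 < X by rewrite lt_neqAle eq_sym Xn0.
  (* This weight makes the first term of Young's inequality equal to X/2, so that it can be
     absorbed. *)
  have c0 : 0 < X / (2 * I) by psv.
  have := Xc _ c0; rewrite -(ler_pM2l Xp) invf_div.
  have -> : X * (X / (2 * I) * I + 2 * I / X * a) = X ^+ 2 / 2 + 2 * a * I.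
    by field; rewrite !gt_eqF.
  by rewrite -expr2; lra.
(* The side 2r of the cube satisfies (2r)^n = 8a. *)
pose r := 2^-1 * (8 * a) `^ (n%:R)^-1.
have r0 : 0 < r by rewrite /r; psv.
have a8 : 0 < 8 * a by psv.
have rn : (2 * r) ^+ n = 8 * a.
  rewrite /r mulrA divff// mul1r -powR_nat ?powR_gt0// -powRrM mulVf ?gt_eqF//.
  by rewrite powRr1// ltW.
have r2 : 4 * r ^+ 2 = 8 `^ (2 / n%:R) * a `^ (2 / n%:R).
  rewrite -powRM// /r exprMn mulrA (_ : 4 * _ = 1) ?mul1r; last by field.
  by rewrite -powR_nat ?powR_gt0// -powRrM; congr (_ `^ _); exact: mulrC.
have := poincare_cube hud r0; rewrite rn -/S -/I -/X => h.
have h2 := le_trans h X2.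
have h3 : 2 * (I - 6 * n%:R * r ^+ 2 * S) <= I.
  by rewrite -(ler_pM2l (_ : 0 < 4 * a)) ?mulr_gt0//; move: h2; lra.
rewrite (_ : 3 * n%:R * _ * _ = 3 * n%:R * (4 * r ^+ 2)); last by rewrite r2; ring.
by move: h3; rewrite -!mulrA; lra.
Qed.

(** With [A] the whole of [U], the Faber-Krahn inequality is a Poincare inequality. *)
Lemma h10_gradient0 u (d : 'I_n -> V -> R) : h10 U u d -> (forall i, \int[mu]_x (d i x ^+ 2) = 0) ->
  [ae mu, x | u x = 0].
Proof.
move=> hud d0; have [K K0 hK] := faber_krahn; have [hu _ zu _ _] := hud.
have := hK _ _ U hud (open_measurable oU) _ (@subset_refl _ U).
rewrite big1; last by move=> i _; exact: d0.
rewrite mulr0 => h.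
have h0 : \int[mu]_x (u x ^+ 2) = 0.
  apply/eqP; rewrite eq_le h ?Rintegral_ge0// => [x _|x]; first exact: sqr_ge0.
  by move=> ux; apply: contrapT => /zu /eqP; rewrite (negbTE ux).
have [N [mN N0 hN]] := Rintegral0_null measurableT (sqint_sqr hu) (fun x _ => sqr_ge0 (u x)) h0.
by exists N; split=> // x /hN /(_ I) /eqP; rewrite sqrf_eq0 => /eqP.
Qed.

End faber_krahn.

(** * Two iteration lemmas *)

Section decay.
Context {R : realType}.

Lemma einv_homo : {homo (@einv R) : x y / x <= y}.
Proof.
move=> x y xy; rewrite /einv; case: ifP => x0; last by case: ifP => // _; exact: expR_ge0.
rewrite (lt_le_trans x0 xy) ler_expR lerN2 lef_pV2 ?posrE//; exact: lt_le_trans xy.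
Qed.

Lemma powR_le1_ex (K th lam : R) : 0 <= K -> 0 < th -> 0 < lam ->
  exists2 eta : R, 0 < eta <= 1 & K * eta `^ th <= lam.
Proof.
move=> K0 th0 lam0; pose c := lam / (K + 1 + lam).
have c0 : 0 < c by rewrite /c; psv.
have c1 : c <= 1 by rewrite /c ler_pdivrMr ?mul1r; [lra|psv].
exists (c `^ th^-1).
  rewrite powR_gt0// -[leRHS](_ : 1 `^ th^-1 = 1 :> R); last by rewrite powR1.
  by apply: ge0_ler_powR; rewrite ?nnegrE ?invr_ge0 ?(ltW c0) ?(ltW th0).
rewrite -powRrM mulVf ?gt_eqF// powRr1; last exact: ltW.
rewrite /c mulrA ler_pdivrMr; last by psv.
by rewrite mulrC ler_pM2l//; lra.
Qed.

(** The first recursion, with small factors [eps], brings the sequence below a threshold [eta] with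
    K eta^th <= lam. From there the second recursion applies: a bound B for a tail of the sequence
    becomes lam B for the next tail. *)
Lemma fast_decay (b eps : nat -> R) (K th lam : R) : (forall j, 0 <= b j) -> 0 <= K -> 0 < th < 1 ->
  (forall j, 0 <= eps j) -> eps @ \oo --> (0 : R) -> 
  (forall j, b j.+1 <= K * b j `^ th * eps j) ->
  (forall (B : R) j, (forall i, (j <= i)%N -> b i <= B) -> b j.+1 <= K * b j `^ th * B) ->
  0 < lam < 1 -> exists2 C : R, 0 < C & forall j, b j <= C * lam ^+ j.
Proof.
move=> b0 K0 /andP[th0 th1] e0 ecv hII hI /andP[lam0 lam1].
have [E hE] : exists E : R, forall j, eps j <= E.
  have [E [_ hE]] := cvg_seq_bounded (cvgP _ ecv).
  exists (E + 1) => j; have := hE (E + 1) _ j I; rewrite ltrDl ltr01 => /(_ isT).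
  by apply: le_trans; exact: ler_norm.
have E0 : 0 <= E by exact: le_trans (e0 0%N) (hE 0%N).
(* The fixed point of x -> K E x^th; any B0 >= X is preserved by the recursion because th < 1. *)
pose X := (K * E) `^ (1 - th)^-1.
pose B0 := b 0%N + 1 + X.
have X0 : 0 <= X by exact: powR_ge0.
have B01 : 1 <= B0 by rewrite /B0; have := b0 0%N; lra.
have B00 : 0 < B0 by lra.
have KEB : K * B0 `^ th * E <= B0.
  have h1 : K * E <= B0 `^ (1 - th).
    have -> : K * E = X `^ (1 - th).
      by rewrite /X -powRrM mulVf ?powRr1 ?mulr_ge0// subr_eq0 gt_eqF.
    by rewrite ge0_ler_powR ?nnegrE ?(ltW B00)//; [lra|rewrite /B0; have := b0 0%N; lra].
  rewrite mulrAC; apply: le_trans (ler_wpM2r (powR_ge0 B0 th) h1) _.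
  by rewrite -powR_add// subrK powRr1// ltW.
have bB0 j : b j <= B0.
  elim: j => [|j IH]; first by rewrite /B0; lra.
  apply: le_trans (hII j) _; apply: le_trans KEB.
  apply: ler_pM => //; first by rewrite mulr_ge0// powR_ge0.
  by rewrite ler_wpM2l// ge0_ler_powR ?nnegrE// ltW.
have [eta /andP[eta0 eta1] etaK] := powR_le1_ex K0 th0 lam0.
have [J hJ] : exists J : nat, forall j, (J <= j)%N -> b j <= eta.
  have d0 : 0 < eta / (K * B0 `^ th + 1).
    by rewrite divr_gt0// ltr_wpDl// mulr_ge0// powR_ge0.
  have [J _ hJ] := cvgr_lt _ ecv _ d0.
  exists J.+1 => -[//|j] Jj; apply: le_trans (hII j) _.
  have := hJ j Jj; rewrite /= ltr_pdivlMr; last by rewrite ltr_wpDl// mulr_ge0// powR_ge0.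
  move=> h; apply: le_trans (ltW h); rewrite mulrC ler_wpM2l//.
  apply: le_trans (_ : K * B0 `^ th <= _); last by rewrite lerDl.
  by rewrite ler_wpM2l// ge0_ler_powR ?nnegrE// ltW.
(* The bound is for all later terms at once, since the second recursion requires a bound for a whole
   tail. *)
have key m : forall i, (J + m <= i)%N -> b i <= eta * lam ^+ m.
  elim: m => [|m IH] i; first by rewrite addn0 mulr1; exact: hJ.
  case: i => [|i]; first by rewrite addnS.
  rewrite addnS ltnS => Ji.
  apply: le_trans (hI (eta * lam ^+ m) i _) _.
    by move=> l il; apply: IH; exact: leq_trans il.
  rewrite exprS [leRHS]mulrCA; apply: ler_wpM2r; first by nng.
  apply: le_trans etaK; apply: ler_wpM2l => //; apply: ge0_ler_powR; rewrite ?nnegrE ?(ltW th0) ?(ltW eta0)//.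
  by apply: hJ; exact: leq_trans (leq_addr _ _) Ji.
exists (B0 * lam ^- J); first by rewrite divr_gt0// exprn_gt0.
move=> j; have [Jj|jJ] := leqP J j.
  apply: le_trans (key (j - J)%N j _) _; first by rewrite subnKC.
  rewrite -{2}(subnKC Jj) exprD -mulrA mulKf ?expf_neq0 ?gt_eqF//.
  by apply: ler_wpM2r; [nng|exact: le_trans eta1 B01].
apply: le_trans (bB0 j) _; rewrite -mulrA ler_peMr//; first exact: ltW.
rewrite mulrC ler_pdivlMr ?exprn_gt0// mul1r ler_wiXn2l ?ltW//; exact: ltnW.
Qed.

(** The levels t_m = 1 + L (1 - 2^-m) stay below 1 + L. The gaps cost a factor 2^m at step m, which
    the power 1 + kap compensates once [a] decays like eta^m with eta^kap = 1/2. *)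
Lemma degiorgi (a : R -> R) (K kap : R) : (forall t, 0 <= a t) -> (forall s t, 1 <= s -> s <= t -> a t <= a s) ->
  0 < K -> 0 < kap ->
  (forall t del, 1 <= t -> 0 < del -> a (t + del) <= K * del^-1 * a t `^ (1 + kap)) ->
  exists2 M : R, 0 < M & a M = 0.
Proof.
move=> a0 nda K0 kap0 ha.
pose eta : R := 2^-1 `^ kap^-1.
have eta0 : 0 < eta by exact: powR_gt0.
have etak : eta `^ kap = 2^-1 by rewrite -powRrM mulVf ?gt_eqF// powRr1.
have eta1 : eta < 1 by rewrite /eta half_powR_lt1// invr_gt0.
(* The induction step needs 2 K a(1)^kap / L <= eta. *)
pose L := 2 * K * (a 1) `^ kap / eta + 1.
have L0 : 0 < L by rewrite ltr_wpDl// divr_ge0 ?(ltW eta0)// !mulr_ge0 ?powR_ge0// ltW.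
pose t m := 1 + L * (1 - 2^-1 ^+ m).
have t1 m : 1 <= t m by rewrite lerDl mulr_ge0 ?(ltW L0)// subr_ge0 exprn_ile1//; lra.
have tS m : t m.+1 = t m + L * 2^-1 ^+ m.+1.
  by rewrite /t exprS; move: (2^-1 ^+ m : R) => y; lra.
have key m : a (t m) <= a 1 * eta ^+ m.
  elim: m => [|m IH]; first by rewrite /t expr0 subrr mulr0 addr0 mulr1.
  have d0 : 0 < L * 2^-1 ^+ m.+1 by psv.
  rewrite tS; apply: le_trans (ha _ _ (t1 m) d0) _.
  apply: le_trans (_ : K * (L * 2^-1 ^+ m.+1)^-1 * (a 1 * eta ^+ m) `^ (1 + kap) <= _).
    apply: ler_wpM2l; first by nng.
    by apply: ge0_ler_powR; rewrite ?nnegrE //; [nng|have a10 := a0 1; nng].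
  have [->|a1n] := eqVneq (a 1) 0.
    by rewrite !mul0r powR0 ?mulr0// gt_eqF// addr_gt0.
  have a1 : 0 < a 1 by rewrite lt_neqAle eq_sym a1n a0.
  have em : 0 < eta ^+ m by psv.
  have ae0 : 0 < a 1 * eta ^+ m by psv.
  rewrite powR_add// (powRr1 (ltW ae0)) (powRM _ (ltW a1) (ltW em)).
  have -> : (eta ^+ m) `^ kap = 2^-1 ^+ m.
    by rewrite -(powR_nat m eta0) -powRrM mulrC powRrM etak powR_nat.
  rewrite exprS; have h2 : (0 : R) < 2^-1 ^+ m by psv.
  rewrite exprS [leLHS](_ : _ = a 1 * eta ^+ m * (2 * K * (a 1) `^ kap / L)); last first.
    by move: (2^-1 ^+ m : R) h2 => y y0; field; rewrite !gt_eqF.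
  rewrite [leRHS](_ : _ = a 1 * eta ^+ m * eta); last by ring.
  apply: ler_wpM2l; first by nng.
  rewrite ler_pdivrMr// /L mulrDr mulrCA divff ?gt_eqF// !mulr1.
  by rewrite lerDl ltW.
exists (1 + L); first by lra.
apply/eqP; rewrite eq_le a0 andbT.
have tL m : t m <= 1 + L.
  by rewrite /t lerD2l ler_piMr ?(ltW L0)// gerBl exprn_ge0.
have cv : (fun m => a 1 * eta ^+ m) @ \oo --> (a 1 * 0 : R).
  by apply: cvgMr; apply: cvg_expr; rewrite ger0_norm// ltW.
rewrite mulr0 in cv; apply: cvgr_to_ge cv _; exists 0%N => // m _ /=.
by apply: le_trans (key m); apply: nda.
Qed.

End decay.

(** * Boundedness *)
Section weak_sol.
Context {R : realType} {n : nat}.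
Local Notation V := 'rV[R]_n.
Local Notation mu := (leb R n).
Local Notation mu2 := (leb2 R n).
Variables (U : set V) (s : R).
Hypotheses (n0 : (0 < n)%N) (oU : open U) (bU : norm_bounded U).
Implicit Types (f u phi : V -> R) (d e : 'I_n -> V -> R).
Let mU : measurable U := open_measurable oU.

(** The linear equation with a right-hand side given as a function on the whole space; the
    nonlinearity is recovered only through the choice of [f]. *)
Definition weak_sol f u d := [/\ h10 U u d, gagfin s u & forall phi e, h10 U phi e -> gagfin s phi ->
  \int[mu]_x (\sum_i d i x * e i x) + \int[mu2]_p energy s u phi p = \int[mu]_x (f x * phi x)].

Lemma h10_null u u' d (N : set V) : measurable N -> mu N = 0%E -> measurable_fun setT u' ->
  zoff U u' -> (forall x, ~ N x -> u x = u' x) -> h10 U u d -> h10 U u' d.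
Proof.
move=> mN N0 mu' zu' uu' [hu hd zu zd app]; split=> //.
  split=> //; rewrite -(eq_integral_null mN N0 (f := fun x => (u x ^+ 2)%:E)); first by case: hu.
  by move=> x /uu' ->.
move=> e e0; have [phi [h1 h2 h3]] := app _ e0; exists phi; split=> //.
by rewrite -(eq_Rintegral_null mN N0 (f := fun x => (u x - phi x) ^+ 2))// => x /uu' ->.
Qed.

Lemma weak_sol_null f u u' d (N : set V) : measurable N -> mu N = 0%E -> measurable_fun setT u' ->
  zoff U u' -> (forall x, ~ N x -> u x = u' x) -> weak_sol f u d -> weak_sol f u' d.
Proof.
move=> mN N0 mu' zu' uu' [hud gu eqn]; have [M2 [mM2 M20 hM2]] := null_cross mN N0.
split; first exact: (h10_null mN N0 mu' zu' uu' hud).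
  move: gu; rewrite /gagfin (eq_integral_null mM2 M20 (g := fun p => (energy s u' u' p)%:E))// => p /hM2[p1 p2].
  by rewrite /energy !uu'.
move=> phi e hp gp; rewrite -(eqn _ _ hp gp); congr (_ + _).
by apply: (eq_Rintegral_null mM2 M20) => p /hM2[p1 p2] _; rewrite /energy !uu'.
Qed.

Lemma partial_cst i (c : R) x : partial i (fun _ : V => c) x = 0.
Proof. by rewrite (@partialE _ _ _ (fun=> 0))// => y; exact: is_derive_cst. Qed.

Lemma gagfin_cst (c : R) : gagfin s (fun _ : V => c).
Proof.
rewrite /gagfin (_ : (fun p => _) = cst 0%E) ?integral0 ?ltry//.
by apply/funext => p; rewrite /energy subrr !mul0r.
Qed.

Lemma rint_dot d e : (forall i, sqint mu (d i)) -> (forall i, sqint mu (e i)) ->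
  rint mu (fun x => \sum_i d i x * e i x).
Proof. by move=> hd he; apply: rint_sum => i; exact: sqint_mul. Qed.

Lemma test_cst f u d (eps k : R) : weak_sol f u d -> 0 <= k ->
  [/\ h10 U (fun x => einv (eps * u x - k)) (fun i x => einv1 (eps * u x - k) * (eps * d i x)),
    rint mu (fun x => eps * einv1 (eps * u x - k) * \sum_i d i x ^+ 2),
    rint mu2 (energy s u (fun x => einv (eps * u x - k))) &
    \int[mu]_x (eps * einv1 (eps * u x - k) * \sum_i d i x ^+ 2) +
     \int[mu2]_p energy s u (fun x => einv (eps * u x - k)) p =
     \int[mu]_x (f x * einv (eps * u x - k))].
Proof.
move=> [hud gu eqn] k0; have [hu hd _ _ _] := hud.
have := h10_einv oU bU eps hud (smooth_cst k) (fun=> k0).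
have -> : (fun i x => einv1 (eps * u x - k) * (eps * d i x - partial i (fun _ : V => k) x)) =
  (fun i x => einv1 (eps * u x - k) * (eps * d i x)).
  by apply/funext => i; apply/funext => x; rewrite partial_cst subr0.
move=> hphi; have {}hphi := hphi _; have {}hphi : h10 U (fun x => einv (eps * u x - k)) (fun i x => einv1 (eps * u x - k) * (eps * d i x)).
  by apply: hphi; exists 0 => i x; rewrite partial_cst normr0.
have gphi : gagfin s (fun x => einv (eps * u x - k)).
  by apply: gagfin_einv => //; [exact: sqint_measurable hu|exact: gagfin_cst].
have [hp he _ _ _] := hphi.
have e : (fun x => \sum_i d i x * (einv1 (eps * u x - k) * (eps * d i x))) =
    (fun x => eps * einv1 (eps * u x - k) * \sum_i d i x ^+ 2).
  by apply/funext => x; rewrite mulr_sumr; apply: eq_bigr => i _; ring.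
split=> //.
- by rewrite -e; exact: rint_dot.
- by apply: rint_energy => //; [exact: sqint_measurable hu|exact: sqint_measurable hp].
- by rewrite -(eqn _ _ hphi gphi) e.
Qed.

(** In the equation tested with einv(-u) both terms on the left are at most 0 while the right side
    is at least 0, so the gradient of the test function vanishes and the Faber-Krahn inequality
    makes it zero almost everywhere. *)
Lemma weak_sol_ge0 f u d : (forall x, 0 <= f x) -> weak_sol f u d ->
  [ae mu, x | 0 <= u x].
Proof.
move=> f0 hs; have [hphi i1 i2 eqn] := test_cst (-1) hs (lexx 0).
have [hp he _ _ _] := hphi.
have p2 p : energy s u (fun x => einv (-1 * u x - 0)) p <= 0.
  rewrite /energy mulr_le0_ge0 ?levy_ge0//.
  have [uu|uu] := leP (u p.1) (u p.2).
    rewrite mulr_le0_ge0 ?subr_le0// subr_ge0 einv_homo//; lra.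
  by rewrite mulr_ge0_le0 ?subr_ge0 ?(ltW uu)// subr_le0 einv_homo//; lra.
have r0 : 0 <= \int[mu]_x (f x * einv (-1 * u x - 0)).
  by apply: Rintegral_ge0 => x _; rewrite mulr_ge0 ?einv_ge0.
have q2 : \int[mu2]_p energy s u (fun x => einv (-1 * u x - 0)) p <= 0.
  apply: le_trans (le_rint i2 (rint0 mu2) p2) _.
  by rewrite (_ : \int[mu2]_p 0 = 0)// /Rintegral integral0.
have q1 : \int[mu]_x (einv1 (-1 * u x - 0) * \sum_i d i x ^+ 2) <= 0.
  have -> : (fun x => einv1 (-1 * u x - 0) * \sum_i d i x ^+ 2) =
    (fun x => - 1 * (-1 * einv1 (-1 * u x - 0) * \sum_i d i x ^+ 2)).
    by apply/funext => x; ring.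
  by rewrite RintegralZl//; lra.
have [C C0 hC] := @einv_lipschitz R.
(* The square of [einv1] is at most [C] times [einv1], so the squared gradient is controlled by the
   integral just shown to be at most 0. *)
have q3 i : \int[mu]_x ((einv1 (-1 * u x - 0) * (-1 * d i x)) ^+ 2) = 0.
  apply/eqP; rewrite eq_le Rintegral_ge0 ?andbT => [|x _]; last exact: sqr_ge0.
  have i1' : rint mu (fun x => einv1 (-1 * u x - 0) * \sum_i d i x ^+ 2).
    have := rintZ (-1) i1; rewrite /rint; congr (integrable _ _ _).
    by apply/funext => x /=; congr EFin; ring.
  apply: (@le_trans _ _ (\int[mu]_x (C * (einv1 (-1 * u x - 0) * \sum_i d i x ^+ 2)))).
    apply: le_rint => [||x]; [exact: sqint_sqr (he i)|exact: rintZ|].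
    rewrite exprMn expr2 -!mulrA; have [_ _ h1] := hC (-1 * u x - 0) 0.
    apply: ler_pM => //; [exact: einv1_ge0|by rewrite mulr_ge0 ?einv1_ge0 ?sqr_ge0|].
    apply: ler_wpM2l; first exact: einv1_ge0.
    rewrite mulN1r sqrrN (bigD1 i)//= lerDl sumr_ge0// => j _; exact: sqr_ge0.
  by rewrite RintegralZl// pmulr_rle0.
have [N [mN N0 hN]] := h10_gradient0 n0 oU bU hphi q3.
exists N; split=> // x /hN; case: ltP => // ux h; move: h; move/eqP; rewrite gt_eqF// einv_gt0; lra.
Qed.


Section linfty.
Variables (f u : V -> R) (d : 'I_n -> V -> R) (c q p : R).
Hypotheses (mf : measurable_fun setT f) (f0 : forall x, 0 <= f x) (u0 : forall x, 0 <= u x).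
Hypotheses (c0 : 0 < c) (q1 : 1 <= q) (fu : forall x, f x <= c * (1 + u x `^ (q - 1))).
Hypotheses (hs : weak_sol f u d) (p2 : 2 < p) (qp : q <= p) (pn : 1 - 2 / p <= 2 / n%:R).

Let th := 1 - 2 / p.
Let hud : h10 U u d. Proof. by case: hs. Qed.
Let mu_ : measurable_fun setT u. Proof. by case: hud => hu _ _ _ _; exact: sqint_measurable hu. Qed.

Definition level t : set V := [set x | t < u x].
Definition levelm t : R := fine (mu (level t)).

Lemma measurable_level t : measurable (level t).
Proof. exact: measurable_gt_set. Qed.

Lemma level_sub t : 0 <= t -> level t `<=` U.
Proof.
move=> t0 x; rewrite /level /= => tu; apply: contrapT => nU.
by case: hud => _ _ zu _ _; move: tu; rewrite zu// ltNge t0.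
Qed.

Lemma rint_level (A : set V) t : measurable A -> 0 <= t -> rint mu (\1_(A `&` level t) : V -> R).
Proof.
move=> mA t0; apply: (rint_indic_U bU); first exact: measurableI (measurable_level t).
by move=> x [_]; exact: level_sub.
Qed.

Lemma levelm_ge0 t : 0 <= levelm t.
Proof. by rewrite fine_ge0. Qed.

Lemma levelmE t : 0 <= t -> \int[mu]_x (\1_(level t) x : R) = levelm t.
Proof. by move=> t0; rewrite Rintegral_indic//; exact: measurable_level. Qed.

Lemma levelm_le (A B : set V) : measurable A -> measurable B -> A `<=` B -> B `<=` U ->
  fine (mu A) <= fine (mu B).
Proof.
move=> mA mB AB BU; rewrite -!Rintegral_indic//; apply: le_rint.
- by apply: (rint_indic_U bU) => // x /AB; exact: BU.
- exact: (rint_indic_U bU).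
- move=> x; rewrite !indicE ler_nat; case: (boolP (x \in A)) => //.
  by rewrite inE => /AB /mem_set ->.
Qed.

(** Both bounds apply the Faber-Krahn inequality to einv((u - t)/del), supported in the level set of
    [t]. They differ in how the gradient is treated: the first uses the equation, where the
    fractional term is nonnegative; the second keeps the gradient of [u] over the level set. *)
Lemma level_estimates : exists2 K : R, 0 < K & forall t del : R, 0 <= t -> 0 < del ->
  (rint mu (fun x => f x * \1_(level t) x) ->
    levelm (t + del) <= K * levelm t `^ th * del^-1 * \int[mu]_x (f x * \1_(level t) x)) /\
  levelm (t + del) <= K * levelm t `^ th * del ^- 2 * \int[mu]_x ((\sum_i d i x ^+ 2) * \1_(level t) x).
Proof.
have [K K0 hK] := faber_krahn n0 oU bU.
have [C C0 hC] := @einv_lipschitz R.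
have [_ hd _ _ _] := hud.
pose m0 := fine (mu U).
have m00 : 0 <= m0 by rewrite fine_ge0.
pose K1 := expR 2 * (K * (m0 + 1) `^ (2 / n%:R - th) * (C + C ^+ 2)).
exists K1; first by rewrite /K1; psv.
move=> t del t0 del0; set A := level t; set phi := fun x => einv (del^-1 * u x - t / del).
have k0 : 0 <= t / del by nng.
have [hphi i1 i2 eqn] := test_cst del^-1 hs k0; have [hp he zp _ _] := hphi.
have uA x : phi x != 0 -> A x.
  move=> h; rewrite /A /level /= ltNge; apply: contra h => ut; apply/eqP; rewrite /phi einv_le0//.
  by rewrite mulrC -mulrBl pmulr_lle0 ?invr_gt0// subr_le0.
have E1A x : einv1 (del^-1 * u x - t / del) * \1_A x = einv1 (del^-1 * u x - t / del).
  rewrite indicE; case: (boolP (x \in A)); first by rewrite mulr1.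
  rewrite notin_setE => /negP; rewrite -leNgt => ut; rewrite einv1_le0 ?mul0r//.
  by rewrite mulrC -mulrBl pmulr_lle0 ?invr_gt0// subr_le0.
have fk := hK _ _ A hphi (measurable_level t) uA (@level_sub t t0).
(* Above t + del the argument of [einv] is at least 1, so the squared test function is at least
   exp(-2). *)
have low : expR (- 2) * levelm (t + del) <= \int[mu]_x (phi x ^+ 2).
  have td : 0 <= t + del by nng.
  have il : rint mu (\1_(level (t + del)) : V -> R).
    by apply: (rint_indic_U bU); [exact: measurable_level|exact: level_sub].
  rewrite -levelmE// -RintegralZl//; apply: le_rint => [||x]; [exact: rintZ|exact: sqint_sqr|].
  rewrite indicE; case: (boolP (x \in _)); last by rewrite mulr0 sqr_ge0.
  rewrite inE /level /= => h; rewrite mulr1.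
  rewrite (_ : - 2 = - 1 + - 1 :> R); last by ring.
  rewrite expRD -expr2 lerXn2r ?nnegrE ?expR_ge0 ?einv_ge0//; apply: einv_ge.
  by rewrite mulrC -mulrBl ler_pdivlMr// mul1r; lra.
have a0 := levelm_ge0 t.
have am : levelm t <= m0 + 1.
  have am0 : levelm t <= m0 := levelm_le (measurable_level t) mU (@level_sub t t0) (@subset_refl _ U).
  by apply: le_trans am0 _; rewrite lerDl.
(* The exponent 2/n of the Faber-Krahn inequality is lowered to [th]; the excess power is bounded
   because the level set lies in [U]. *)
have ath : levelm t `^ (2 / n%:R) <= levelm t `^ th * (m0 + 1) `^ (2 / n%:R - th).
  have [->|an] := eqVneq (levelm t) 0.
    by rewrite powR0 ?mulr_ge0 ?powR_ge0// gt_eqF// divr_gt0// ltr0n.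
  have ap : 0 < levelm t by rewrite lt_neqAle eq_sym an.
  rewrite [X in _ `^ X <= _](_ : _ = th + (2 / n%:R - th)); last by ring.
  rewrite powR_add// ler_wpM2l ?powR_ge0// ge0_ler_powR ?nnegrE ?subr_ge0//; lra.
have iE i : rint mu (fun x => (einv1 (del^-1 * u x - t / del) * (del^-1 * d i x)) ^+ 2) by exact: sqint_sqr.
set S := \sum_i _ in fk.
have SE : S = \int[mu]_x (\sum_i (einv1 (del^-1 * u x - t / del) * (del^-1 * d i x)) ^+ 2).
  by apply/esym; apply: Rintegral_sum => // i _; exact: iE.
have S0 : 0 <= S by apply: sumr_ge0 => i _; exact: Rintegral_sqr_ge0.
have up : levelm (t + del) <= expR 2 * (K * (m0 + 1) `^ (2 / n%:R - th)) * levelm t `^ th * S.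
  rewrite -(ler_pM2l (expR_gt0 (- 2))); apply: le_trans low _; apply: le_trans fk _.
  have eE : expR (- 2) * expR 2 = 1 :> R by rewrite -expRD addNr expR0.
  rewrite [leRHS](_ : _ = (expR (- 2) * expR 2) * (K * (levelm t `^ th * (m0 + 1) `^ (2 / n%:R - th)) * S)); last by ring.
  by rewrite eE mul1r ler_wpM2r// ler_pM2l.
have e1 x : \sum_i (einv1 (del^-1 * u x - t / del) * (del^-1 * d i x)) ^+ 2 =
    einv1 (del^-1 * u x - t / del) ^+ 2 * del ^- 2 * \sum_i d i x ^+ 2.
  by rewrite mulr_sumr; apply: eq_bigr => i _; rewrite !exprMn exprVn mulrA.
have b1 x : 0 <= einv1 (del^-1 * u x - t / del) <= C.
  by rewrite einv1_ge0 /=; have [_ _] := hC (del^-1 * u x - t / del) 0.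
have s0 x : 0 <= \sum_i d i x ^+ 2 by apply: sumr_ge0 => i _; exact: sqr_ge0.
have d2 : 0 <= del ^- 2 by rewrite invr_ge0 sqr_ge0.
have fin B : S <= (C + C ^+ 2) * B -> levelm (t + del) <= K1 * levelm t `^ th * B.
  move=> SB; apply: le_trans up _; rewrite /K1.
  rewrite (_ : _ * _ * B = expR 2 * (K * (m0 + 1) `^ (2 / n%:R - th)) * levelm t `^ th * ((C + C ^+ 2) * B)); last by ring.
  by apply: ler_wpM2l SB; nng.
split=> [iA|].
  rewrite -mulrA; apply: fin; rewrite SE.
  have h2 : \int[mu]_x (del^-1 * einv1 (del^-1 * u x - t / del) * \sum_i d i x ^+ 2) <= \int[mu]_x (f x * \1_A x).
    apply: (@le_trans _ _ (\int[mu]_x (f x * phi x))).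
      rewrite /phi -eqn lerDl; apply: Rintegral_ge0 => y _.
      rewrite /energy mulr_ge0 ?levy_ge0//.
      have [uu|uu] := leP (u y.1) (u y.2).
        rewrite mulr_le0 ?subr_le0//; apply: einv_homo; rewrite lerD2r ler_wpM2l// invr_ge0 ltW//.
      rewrite mulr_ge0 ?subr_ge0 ?(ltW uu)//; apply: einv_homo; rewrite lerD2r ler_wpM2l// ?invr_ge0 ltW//.
    apply: le_rint_ge0 => // [|x].
      by apply: measurable_funM => //; exact: sqint_measurable hp.
    rewrite mulr_ge0 ?einv_ge0//= ler_wpM2l// indicE; case: (boolP (x \in A)) => [_|]; first exact: einv_le1.
    by rewrite notin_setE => nA; rewrite [phi x](_ : _ = 0)//; apply: contrapT => /eqP /uA.
  apply: (@le_trans _ _ (\int[mu]_x (C * del^-1 * (del^-1 * einv1 (del^-1 * u x - t / del) * \sum_i d i x ^+ 2)))).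
    apply: le_rint => [||x]; [exact: rint_sum|exact: rintZ|].
    rewrite e1 (_ : C * _ * _ = C * einv1 (del^-1 * u x - t / del) * (del ^- 2 * \sum_i d i x ^+ 2)); last first.
      by rewrite -exprVn; ring.
    rewrite -mulrA ler_wpM2r ?mulr_ge0// expr2 ler_wpM2r//; by have /andP[] := b1 x.
  rewrite RintegralZl// -mulrA; apply: ler_pM => //.
  - exact: ltW.
  - rewrite mulr_ge0// ?invr_ge0 ?(ltW del0)//; apply: Rintegral_ge0 => x _.
    by rewrite !mulr_ge0 ?invr_ge0 ?(ltW del0)//; have /andP[] := b1 x.
  - by rewrite lerDl sqr_ge0.
  - by rewrite ler_wpM2l// invr_ge0 ltW.
rewrite -mulrA; apply: fin; rewrite SE.
have iD : rint mu (fun x => (\sum_i d i x ^+ 2) * \1_A x).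
  by apply: rint_indic; [exact: measurable_level|apply: rint_sum => i; exact: sqint_sqr].
rewrite -!RintegralZl//; last exact: rintZ.
apply: le_rint => [||x]; [exact: rint_sum|by do 2!apply: rintZ|].
rewrite e1 -(E1A x) (_ : (_ * \1_A x) ^+ 2 = einv1 (del^-1 * u x - t / del) ^+ 2 * \1_A x); last first.
  by rewrite exprMn indicE; case: (_ \in _); rewrite ?expr1n ?expr0n.
rewrite [leLHS](_ : _ = einv1 (del^-1 * u x - t / del) ^+ 2 * (del ^- 2 * ((\sum_i d i x ^+ 2) * \1_A x))); last by ring.
have /andP[b10 b11] := b1 x.
apply: ler_wpM2r; first by rewrite !mulr_ge0.
by apply: (@le_trans _ _ (C ^+ 2)); [rewrite lerXn2r ?nnegrE ?(ltW C0)|rewrite lerDr ltW].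
Qed.

(* Dyadic decomposition of the range of [u]. *)
Lemma level_growth : exists2 C : R, 0 < C & forall (A : set V) (j : nat) (B : R), measurable A ->
  (forall i, (j <= i)%N -> fine (mu (A `&` level (2 ^+ i))) * (2 ^+ i) `^ (q - 1) <= B * 2^-1 ^+ i) ->
  rint mu (fun x => f x * \1_(A `&` level (2 ^+ j)) x) /\
  \int[mu]_x (f x * \1_(A `&` level (2 ^+ j)) x) <= C * B * 2^-1 ^+ j.
Proof.
(* On the layer 2^i < u <= 2^(i+1) the growth condition gives f <= 2 c (2^(i+1))^(q-1); the factor 2
   of the final constant sums the geometric series. *)
pose C1 := 2 * c * 2 `^ (q - 1).
have C10 : 0 < C1 by rewrite /C1; psv.
exists (2 * C1); first by psv.
move=> A j B mA hA.
have e2 i : (0 : R) < 2 ^+ i by psv.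
have mL t : measurable (A `&` level t) by exact: measurableI (measurable_level t).
(* Truncating from above makes the partial integrals finite before anything is known about the
   integral over the whole level set; each increment of [m] adds one dyadic layer. *)
pose S m := A `&` level (2 ^+ j) `\` level (2 ^+ (j + m)).
have mS m : measurable (S m) by apply: measurableD => //; exact: measurable_level.
pose F m x := f x * \1_(S m) x.
have mF m : measurable_fun setT (F m) by apply: measurable_funM => //; exact: measurable_indic.
have F0 m x : 0 <= F m x by rewrite mulr_ge0.
have SS m x : S m x -> S m.+1 x.
  move=> [h1 h2]; split=> // h3; apply: h2; rewrite /level /= in h3 *; apply: le_lt_trans h3.
  by rewrite ler_eXn2l ?ltr1n// leq_add2l.
have step m x : F m.+1 x <= F m x + C1 * (2 ^+ (j + m)) `^ (q - 1) * \1_(A `&` level (2 ^+ (j + m))) x.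
  rewrite /F !indicE.
  have r0 : 0 <= C1 * (2 ^+ (j + m)) `^ (q - 1) by nng.
  case: (boolP (x \in S m.+1)) => [|_]; last by rewrite mulr0; nng.
  rewrite inE => -[[Ax ux] ux2].
  have [um|um] := pselect (level (2 ^+ (j + m)) x); last first.
    by rewrite (mem_set (_ : S m x))// lerDl mulr_ge0.
  rewrite (mem_set (_ : (A `&` level (2 ^+ (j + m))) x))// !mulr1 ler_wpDl ?mulr_ge0//.
  apply: le_trans (fu x) _; rewrite /C1 -!mulrA.
  rewrite (_ : 2 * (c * _) = c * (2 * (2 `^ (q - 1) * (2 ^+ (j + m)) `^ (q - 1)))); last by ring.
  rewrite ler_pM2l// -powRM// -exprS -addnS.
  have ub : u x <= 2 ^+ (j + m.+1) by rewrite leNgt; apply/negP.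
  have h1 : u x `^ (q - 1) <= (2 ^+ (j + m.+1)) `^ (q - 1).
    by rewrite ge0_ler_powR ?nnegrE ?subr_ge0// ltW.
  have h2 : 1 <= (2 ^+ (j + m.+1) : R) `^ (q - 1).
    rewrite -[leLHS](_ : 1 `^ (q - 1) = 1 :> R); last by rewrite powR1.
    rewrite ge0_ler_powR ?nnegrE ?subr_ge0 ?(ltW (e2 _))//; apply: exprn_ege1; lra.
  by lra.
have iI m : rint mu (\1_(A `&` level (2 ^+ m)) : V -> R) by apply: rint_level => //; exact: ltW.
have bnd m : rint mu (F m) /\ \int[mu]_x F m x <= C1 * B * (2 * 2^-1 ^+ j - 2 * 2^-1 ^+ (j + m)).
  elim: m => [|m [iF IH]].
    rewrite addn0 subrr mulr0 (_ : F 0%N = fun=> 0); first by rewrite Rintegral_cst// mul0r; split=> //; exact: rint0.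
    apply/funext => x; rewrite /F indicE memNset ?mulr0//= => -[[_ h]]; by rewrite addn0.
  have i2 := rintZ (C1 * (2 ^+ (j + m)) `^ (q - 1)) (iI (j + m)%N).
  have iFS : rint mu (F m.+1).
    by apply: (rint_le (mF _) _ (rintD iF i2)) => x; rewrite ger0_norm.
  split=> //; apply: le_trans (le_rint iFS (rintD iF i2) (step m)) _.
  have eI : \int[mu]_x (C1 * (2 ^+ (j + m)) `^ (q - 1) * \1_(A `&` level (2 ^+ (j + m))) x) =
    C1 * (2 ^+ (j + m)) `^ (q - 1) * fine (mu (A `&` level (2 ^+ (j + m)))).
    by rewrite RintegralZl; [congr (_ * _); exact: (Rintegral_indic (mL _))|by []|exact: iI].
  rewrite RintegralD; [|by []|exact: iF|exact: i2]; rewrite eI.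
  have := hA (j + m)%N (leq_addr _ _); move=> /(ler_wpM2l (ltW C10)).
  rewrite addnS exprS; move: IH; move: (fine _) ((2 ^+ (j + m)) `^ (q - 1)) (2^-1 ^+ (j + m)) => a b y.
  by move: (\int[mu]_x _) (2^-1 ^+ j) => I1 z IH h; lra.
apply: (rint_monotone mF).
- move=> m x; rewrite F0 /F ler_wpM2l// !indicE ler_nat.
  by case: (boolP (x \in S m)) => //; rewrite inE => /SS /mem_set ->.
- move=> x; exists (Num.Def.archi_bound (u x)) => // m /= hm; rewrite /F !indicE; congr (_ * _%:R).
  congr nat_of_bool; apply/idP/idP; rewrite !inE; first by case.
  move=> h; split=> //; rewrite /level /= => h2.
  have := @upper_nthrootP R (u x) (j + m)%N (leq_trans hm (leq_addl _ _)).
  by rewrite ltNge (ltW h2).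
- move=> m; have [iF h] := bnd m; rewrite -(Rintegral_EFin measurableT iF) lee_fin.
  apply: le_trans h _.
  have B0 : 0 <= B.
    have := hA j (leqnn j); rewrite -ler_pdivrMr ?exprn_gt0//; apply: le_trans.
    by rewrite divr_ge0 ?exprn_ge0// mulr_ge0 ?powR_ge0// fine_ge0.
  have y0 : (0 : R) <= 2^-1 ^+ (j + m) by exact: exprn_ge0.
  have cb : 0 <= C1 * B by nng.
  by have := mulr_ge0 cb y0; rewrite mulrBr; lra.
Qed.


(** The quantity T^j |{u > 2^j}| is of weak L^p type. Since p th = p - 2, raising it to the power
    [th] leaves T^j (2^j)^-2, which matches the scaling of [level_estimates] for t = del = 2^j. *)
Let T : R := 2 `^ p.
Let p0 : 0 < p. Proof. by move: p2; lra. Qed.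
Let thE : p * th = p - 2. Proof. by rewrite /th mulrBr mulr1 mulrCA divff ?gt_eqF// mulr1. Qed.
Let th01 : 0 < th < 1.
Proof. by rewrite /th subr_gt0 ltr_pdivrMr// mul1r p2 gtrBl divr_gt0. Qed.

Let pow2 (x : R) j : (2 ^+ j : R) `^ x = (2 `^ x) ^+ j.
Proof. by rewrite -powR_nat// -powRrM mulrC powRrM powR_nat// powR_gt0. Qed.

Let Tpow j (a : R) : 0 <= a -> (T ^+ j * a) `^ th = T ^+ j * (2 ^+ j) ^- 2 * a `^ th.
Proof.
move=> a0; rewrite powRM ?exprn_ge0 ?powR_ge0//; congr (_ * _).
rewrite -[in LHS]pow2 -powRrM thE powR_add ?exprn_gt0// pow2; congr (_ * _).
by rewrite powRN powR_nat// exprn_gt0.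
Qed.

(** An application of [fast_decay] to the weak L^p quantities: its small factors are the gradient
    integrals over the level sets, and its tail recursion comes from the equation with [f] estimated
    by dyadic layers. *)
Lemma levelm_decay (lam : R) : 0 < lam < 1 -> exists2 C : R, 0 < C & forall j, levelm (2 ^+ j) <= C * lam ^+ j.
Proof.
move=> lam01; have [K K0 hK] := level_estimates; have [Cg Cg0 hg] := level_growth.
have [_ hd _ _ _] := hud.
have e2 i : (0 : R) < 2 ^+ i by psv.
have T0 : 0 < T by exact: powR_gt0.
have T1 : 1 <= T.
  by rewrite -[leLHS](powRr0 (2 : R)) /T; apply: ler_powR; [lra|exact: ltW].
pose b j := T ^+ j * levelm (2 ^+ j).
have b0 j : 0 <= b j by have := levelm_ge0 (2 ^+ j); rewrite /b => ?; nng.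
pose eps j := \int[mu]_x ((\sum_i d i x ^+ 2) * \1_(level (2 ^+ j)) x).
have iD : rint mu (fun x => \sum_i d i x ^+ 2) by apply: rint_sum => i; exact: sqint_sqr.
have s0 x : 0 <= \sum_i d i x ^+ 2 by apply: sumr_ge0 => i _; exact: sqr_ge0.
have eps0 j : 0 <= eps j by apply: Rintegral_ge0 => x _; rewrite mulr_ge0.
have epscv : eps @ \oo --> (0 : R).
  have -> : 0 = \int[mu]_x (0 : R) by rewrite Rintegral_cst// mul0r.
  apply: (@Rintegral_cvg _ _ _ mu setT _ _ (fun x => \sum_i d i x ^+ 2)) => //.
  - move=> j; apply: measurable_funM; [exact: rint_measurable iD|apply: measurable_indic; exact: measurable_level].
  - move=> j x _; rewrite ger0_norm ?mulr_ge0// indicE; case: (_ \in _); rewrite ?mulr1 ?mulr0//.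
  - move=> x _; apply: cvg_near_cst; exists (Num.Def.archi_bound (u x)) => // m /= hm.
    rewrite indicE memNset ?mulr0// /level /= => h2.
    by have := @upper_nthrootP R (u x) m hm; rewrite ltNge (ltW h2).
have st j (B : R) : levelm (2 ^+ j + 2 ^+ j) <= K * levelm (2 ^+ j) `^ th * B * (2 ^+ j) ^- 2 ->
    b j.+1 <= T * K * b j `^ th * B.
  rewrite (_ : 2 ^+ j + 2 ^+ j = 2 ^+ j.+1 :> R); last by rewrite exprS; ring.
  move=> h.
  rewrite /b (Tpow _ (levelm_ge0 _)) exprS -!mulrA ler_pM2l//.
  rewrite [leRHS](_ : _ = T ^+ j * (K * levelm (2 ^+ j) `^ th * B * (2 ^+ j) ^- 2)); last by ring.
  by rewrite ler_pM2l ?exprn_gt0.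
have h2 j : b j.+1 <= T * K * (Cg + 1) * b j `^ th * eps j.
  have [_ h] := hK (2 ^+ j) (2 ^+ j) (ltW (e2 _)) (e2 _).
  apply: le_trans (st j (eps j) _) _; first by rewrite [leRHS]mulrAC.
  apply: ler_wpM2r => //; apply: ler_wpM2r; first exact: powR_ge0.
  rewrite ler_peMr ?mulr_ge0 ?(ltW T0) ?(ltW K0)//; lra.
(* Since q <= p, a bound for the weak L^p quantities controls the growth of [f]. The factor 2^-j
   from the layers and del^-1 = 2^-j together give the required (2^j)^-2. *)
have h1 (B : R) j : (forall i, (j <= i)%N -> b i <= B) -> b j.+1 <= T * K * (Cg + 1) * b j `^ th * B.
  move=> hB.
  have B0 : 0 <= B by apply: le_trans (b0 j) (hB j _).
  have [] := hg setT j B measurableT.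
    move=> i ji; rewrite setTI; apply: (@le_trans _ _ (levelm (2 ^+ i) * (2 ^+ i) `^ (p - 1))).
      apply: ler_wpM2l; first exact: levelm_ge0.
      apply: ler_powR; last by rewrite lerD2r.
      by apply: exprn_ege1; lra.
    rewrite (_ : (2 ^+ i) `^ (p - 1) = T ^+ i * 2^-1 ^+ i); last first.
      by rewrite pow2 powR_add// exprMn powRN powRr1.
    rewrite mulrA [_ * T ^+ i]mulrC; apply: ler_wpM2r; first exact: exprn_ge0.
    exact: hB.
  rewrite setTI => iF hF.
  have [h _] := hK (2 ^+ j) (2 ^+ j) (ltW (e2 _)) (e2 _).
  rewrite -!mulrA mulrA; apply: le_trans (st j ((Cg + 1) * B) _) _; last first.
    by rewrite -!mulrA ler_pM2l// ler_pM2l// mulrCA.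
  apply: le_trans (h iF) _.
  rewrite -!mulrA; apply: ler_wpM2l; first exact: ltW.
  apply: ler_wpM2l; first exact: powR_ge0.
  rewrite [leRHS](_ : _ = (2 ^+ j)^-1 * ((Cg + 1) * B * 2^-1 ^+ j)); last first.
    by rewrite exprVn; field; rewrite gt_eqF.
  apply: ler_wpM2l; first by rewrite invr_ge0 ltW.
  apply: le_trans hF _; apply: ler_wpM2r; first exact: exprn_ge0.
  by apply: ler_wpM2r => //; rewrite lerDl.
have [C C0 hC] := @fast_decay R b eps (T * K * (Cg + 1)) th lam b0
  (ltW (mulr_gt0 (mulr_gt0 T0 K0) (addr_gt0 Cg0 ltr01))) th01 eps0 epscv h2 h1 lam01.
exists C => // j; apply: le_trans (hC j); rewrite /b ler_peMl ?levelm_ge0//.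
  exact: exprn_ege1.
Qed.

(** The fast decay is interpolated with the trivial bound: the measure [m] of a dyadic level set
    inside {u > t} is written m^(1-kap) m^kap. The first factor produces a power of |{u > t}|, the
    second absorbs the growth of [f]. *)
Lemma levelm_vanish : exists2 M : R, 0 < M & levelm M = 0.
Proof.
have [K K0 hK] := level_estimates; have [Cg Cg0 hg] := level_growth.
have /andP[th0 th1] := th01.
(* The exponents add up to th + (1 - kap) = 1 + kap, the superlinear power that De Giorgi's
   iteration requires. *)
pose kap := th / 2; have kap0 : 0 < kap by rewrite /kap; psv.
have kap1 : kap < 1 by rewrite /kap; lra.
have q0 : 0 < q := lt_le_trans ltr01 q1.
(* Chosen so that lam^kap = 2^-q: multiplied by (2^i)^(q-1) it leaves exactly 2^-i. *)
pose lam : R := 2^-1 `^ (q / kap).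
have lam0 : 0 < lam by exact: powR_gt0.
have lam01 : 0 < lam < 1 by rewrite lam0 half_powR_lt1// divr_gt0.
have [C C0 hC] := levelm_decay lam01.
have nd r t : 1 <= r -> r <= t -> levelm t <= levelm r.
  move=> r1 rt; apply: levelm_le; try exact: measurable_level.
    by move=> x; rewrite /level /=; exact: le_lt_trans.
  by apply: level_sub; exact: le_trans r1.
apply: (@degiorgi R levelm (K * Cg * C `^ kap) kap levelm_ge0 nd) => //; first by psv.
move=> t del t1 del0; set A := level t.
have t0 : 0 <= t by lra.
have mA : measurable A := measurable_level t.
have a0 := levelm_ge0 t.
have AU : A `<=` U := level_sub t0.
have [] := hg A 0%N (C `^ kap * levelm t `^ (1 - kap)) mA.
  move=> i _; set m := fine _.
  have mL : measurable (A `&` level (2 ^+ i)) by exact: measurableI (measurable_level _).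
  have m0 : 0 <= m by rewrite fine_ge0.
  have m1 : m <= levelm t by apply: levelm_le => // x [].
  have m2 : m <= C * lam ^+ i.
    apply: le_trans (hC i); apply: levelm_le => //; first exact: measurable_level.
    by apply: level_sub; exact: exprn_ge0.
  have -> : m = m `^ (1 - kap) * m `^ kap.
    have [->|mn] := eqVneq m 0; first by rewrite powR0 ?mul0r// gt_eqF// subr_gt0.
    by rewrite -powR_add ?subrK ?powRr1// lt_neqAle eq_sym mn.
  have h1 : m `^ (1 - kap) <= levelm t `^ (1 - kap).
    by apply: ge0_ler_powR; rewrite ?nnegrE ?subr_ge0// ltW.
  have h2 : m `^ kap <= C `^ kap * (2^-1 `^ q) ^+ i.
    have -> : C `^ kap * (2^-1 `^ q) ^+ i = (C * lam ^+ i) `^ kap.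
      rewrite powRM ?(ltW C0) ?exprn_ge0 ?(ltW lam0)//; congr (_ * _).
      have lamk : lam `^ kap = 2^-1 `^ q by rewrite /lam -powRrM divfK ?gt_eqF.
      by rewrite -lamk -powR_nat ?powR_gt0// -powRrM [kap * _]mulrC powRrM powR_nat.
    by apply: ge0_ler_powR; rewrite ?nnegrE ?(ltW kap0)// mulr_ge0 ?exprn_ge0 ?(ltW lam0) ?(ltW C0).
  have h3 : (2^-1 `^ q) ^+ i * (2 ^+ i) `^ (q - 1) = 2^-1 ^+ i :> R.
    rewrite pow2 -exprMn; congr (_ ^+ i); rewrite powR_add// powRN (powRr1 (ler0n _ 2)) mulrA -powRM//.
    by rewrite mulVf// powR1 mul1r.
  rewrite -h3 mulrA [C `^ kap * _]mulrC -[leRHS]mulrA mulrA; apply: ler_wpM2r; first exact: powR_ge0.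
  by rewrite -mulrA; apply: ler_pM; rewrite ?powR_ge0.
have AE : A `&` level (2 ^+ 0) = A.
  by apply/seteqP; split => [x []//|x Ax]; split => //; rewrite /level /= expr0; exact: le_lt_trans Ax.
rewrite AE expr0 mulr1 => iF hF.
have [h _] := hK t del t0 del0; apply: le_trans (h iF) _.
have [->|an] := eqVneq (levelm t) 0.
  by rewrite !powR0 ?mulr0 ?mul0r// gt_eqF// addr_gt0.
have ap : 0 < levelm t by rewrite lt_neqAle eq_sym an.
apply: le_trans (ler_wpM2l _ hF) _; first by nng.
have -> : 1 + kap = th + (1 - kap) by rewrite /kap; field.
by rewrite (powR_add th (1 - kap) ap); apply: le_of_eq; ring.
Qed.

End linfty.

End weak_sol.

(** * The nonlinearity and bounded representatives *)

Section nonlinearity.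
Context {R : realType} {n : nat}.
Local Notation V := 'rV[R]_n.
Local Notation mu := (leb R n).
Variables (U : set V) (g : V -> R -> R) (alpha : R).
Hypotheses (n0 : (0 < n)%N) (oU : open U) (alpha0 : 0 < alpha).
Hypothesis g_holder : holder_loc alpha (U `*` [set: R]) (fun p => g p.1 p.2).

Lemma holder_compact (K : set V) (M : R) : compact K -> K `<=` U -> exists2 C : R, 0 <= C &
  forall x y t r, K x -> K y -> `|t| <= M -> `|r| <= M ->
    `|g x t - g y r| <= C * (Num.max `|x - y| `|t - r|) `^ alpha.
Proof.
move=> cK0 KU.
have cK : compact (K `*` `[- M, M]%classic : set (V * R)).
  by apply: compact_setX => //; exact: segment_compact.
have [C hC] := g_holder cK (fun p (h : (K `*` `[- M, M]%classic) p) => conj (KU _ h.1) Logic.I).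
exists `|C| => // x y t r ax ay tM rM.
have := hC (x, t) (y, r); rewrite /= !in_itv /= -!ler_norml => /(_ (conj ax tM) (conj ay rM)).
move/le_trans; apply; apply: (@le_trans _ _ (`|C| * `|(x, t) - (y, r)| `^ alpha)).
  by apply: ler_wpM2r; [exact: powR_ge0|exact: ler_norm].
by apply: le_of_eq.
Qed.

Lemma open_box_nbhs x : U x -> exists2 r : R, 0 < r & boxc (fun i => x ord0 i - r) (fun i => x ord0 i + r) `<=` U.
Proof.
move=> Ux; have /nbhs_ballP[r /= r0 hr] := open_nbhs_nbhs (conj oU Ux).
exists (r / 2); first by psv.
move=> y hy; apply: hr; rewrite rV_ballE /=; apply: rV_norm_lt => // i.
have := hy i; rewrite in_itv /= !mxE ltr_norml => /andP[h1 h2]; apply/andP; split; lra.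
Qed.

Lemma nonlinearity_continuous x t (e : R) : U x -> 0 < e -> exists2 del : R, 0 < del &
  forall y r, `|y - x| < del -> `|r - t| < del -> U y /\ `|g y r - g x t| < e.
Proof.
move=> Ux e0; have [rho rho0 hrho] := open_box_nbhs Ux.
have [C C0 hC] := holder_compact (`|t| + 1) (@compact_boxc _ _ _ _) hrho.
pose d1 := (e / (C + 1)) `^ alpha^-1.
have d10 : 0 < d1 by apply: powR_gt0; psv.
exists (Num.min rho (Num.min 1 d1)); first by rewrite !lt_min rho0 ltr01 d10.
move=> y r; rewrite !lt_min => /andP[y1 /andP[_ y3]] /andP[r1 /andP[r2 r3]].
have box z : `|z - x| < rho -> boxc (fun i => x ord0 i - rho) (fun i => x ord0 i + rho) z.
  move=> zx i; rewrite in_itv /=; have := coord_le_norm (z - x) i; rewrite !mxE => h.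
  by have := le_lt_trans h zx; rewrite ltr_norml => /andP[h1 h2]; apply/andP; split; lra.
split; first by apply: hrho; exact: box.
apply: le_lt_trans (hC y x r t (box _ y1) _ _ _) _.
- by apply: box; rewrite subrr normr0.
- by have := ler_normD t (r - t); rewrite addrC subrK; lra.
- lra.
set m := Num.max _ _; have m0 : 0 <= m by rewrite le_max normr_ge0.
have md : m < d1 by rewrite gt_max y3.
have h1 : m `^ alpha < e / (C + 1).
  rewrite [ltRHS](_ : _ = d1 `^ alpha); last first.
    by rewrite /d1 -powRrM mulVf ?gt_eqF// powRr1//; nng.
  by apply: gt0_ltr_powR; rewrite ?nnegrE ?(ltW d10).
apply: (@le_lt_trans _ _ (C * (e / (C + 1)))); first by rewrite ler_wpM2l// ltW.
by rewrite mulrA ltr_pdivrMr; [rewrite mulrC ltr_pM2l//; lra|psv].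
Qed.

(** The pair (u x, x) is read as a row vector with n + 1 entries, on which [g] extended by 0 is
    Borel: it is continuous on the open set [W] of vectors whose tail lies in [U] and constant on
    the complement. *)
Lemma nonlinearity_measurable (u : V -> R) : measurable_fun setT u ->
  measurable_fun setT (fun x => g x (u x) * \1_U x).
Proof.
move=> mu_.
pose tl (y : 'rV[R]_n.+1) : V := \row_j y ord0 (lift ord0 j).
pose W := [set y | U (tl y)].
pose F y := g (tl y) (y ord0 ord0) * \1_U (tl y).
have tlN y z : `|tl y - tl z| <= `|y - z|.
  apply: rV_norm_le => // i; rewrite !mxE; have := coord_le_norm (y - z) (lift ord0 i).
  by rewrite !mxE.
have FW (O : set R) : open O -> open (W `&` F @^-1` O).
  move=> oO; rewrite openE => y [Wy Oy].
  have /nbhs_ballP[e /= e0 he] := open_nbhs_nbhs (conj oO Oy).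
  have [del del0 hd] := nonlinearity_continuous (y ord0 ord0) Wy e0.
  apply/nbhs_ballP; exists del => // z; rewrite rV_ballE /= => yz.
  have h1 : `|tl z - tl y| < del by apply: le_lt_trans (tlN _ _) _; rewrite distrC.
  have h2 : `|z ord0 ord0 - y ord0 ord0| < del.
    by have := coord_le_norm (z - y) ord0; rewrite !mxE distrC => /le_lt_trans; apply; rewrite distrC.
  have [Wz hz] := hd _ _ h1 h2; split=> //; apply: he; rewrite /F.
  by rewrite !indicE (mem_set (Wz : U _)) (mem_set (Wy : U _)) !mulr1 /ball /= distrC.
have oW : open W.
  by have := FW setT openT; rewrite preimage_setT setIT.
have mF : measurable_fun setT F.
  apply: (measurability _ (RGenOpens.measurableE R)) => _ [_ [a [b ->] <-]].
  have oO : open (`]a, b[%classic : set R) by exact: interval_open.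
  rewrite setTI (_ : F @^-1` _ = (W `&` F @^-1` `]a, b[%classic) `|` (~` W `&` F @^-1` `]a, b[%classic)); last first.
    by rewrite -setIUl setUv setTI.
  apply: measurableU; first by apply: open_measurable; exact: FW.
  have [Ob|Ob] := pselect (`]a, b[%classic (0 : R)).
    rewrite (_ : _ `&` _ = ~` W); first by apply: measurableC; exact: open_measurable.
    apply/seteqP; split => [y []//|y nW]; split=> //.
    by rewrite /preimage /= /F indicE memNset// mulr0.
  rewrite (_ : _ `&` _ = set0)//; apply/seteqP; split => // y [nW].
  by rewrite /preimage /= /F indicE memNset// mulr0 => /Ob.
have -> : (fun x => g x (u x) * \1_U x) = F \o (fun x => rV_cons (u x, x)).
  apply/funext => x; rewrite /F /= rV_cons0 /= (_ : tl _ = x)//.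
  by apply/rowP => j; rewrite mxE rV_consS.
apply: measurableT_comp mF _; apply: (measurableT_comp (@measurable_rV_cons R n)).
by apply/measurable_fun_pairP; split; [exact: mu_|exact: measurable_id].
Qed.

(** For n > 2 the critical exponent itself satisfies 1 - 2/p = 2/n; for n <= 2 any p > 2 works
    because 2/n >= 1. *)
Lemma subcritical_exponent (q : R) : 1 <= q -> (q%:E <= critical_exponent n)%E ->
  exists p : R, [/\ 2 < p, q <= p & 1 - 2 / p <= 2 / n%:R].
Proof.
move=> q1; rewrite /critical_exponent; have nn : (0 : R) < n%:R by rewrite ltr0n.
case: ltnP => n2 hq.
  have n2' : (0 : R) < n%:R - 2 by rewrite subr_gt0 (ltr_nat _ 2).
  exists (2 * n%:R / (n%:R - 2)); split=> //.
    by rewrite ltr_pdivlMr//; lra.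
  by apply: le_of_eq; field; rewrite !gt_eqF.
exists (2 * (q + 1)); split; [lra|lra|].
have h1 : (1 : R) <= 2 / n%:R by rewrite ler_pdivlMr// mul1r ler_nat.
by apply: le_trans h1; rewrite gerBl; apply: divr_ge0 => //; lra.
Qed.

Lemma weak_sol_rhs (s : R) f f' u d (N : set V) : measurable N -> mu N = 0%E ->
  (forall x, ~ N x -> f x = f' x) -> weak_sol U s f u d -> weak_sol U s f' u d.
Proof.
move=> mN N0 ff [h1 h2 h3]; split=> // phi e hp gp; rewrite h3//.
by apply: (eq_Rintegral_null mN N0) => x /ff ->.
Qed.

Hypotheses (bU : norm_bounded U) (g_ge0 : forall x t, U x -> 0 <= g x t).

(** Sign, growth bound and boundedness are first known almost everywhere; [u] and [f] are modified
    on null sets after each of them so that they hold at every point, as the level set estimates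
    require. *)
Lemma bounded_solution (s c q : R) (u0 : V -> R) : 0 < c -> 1 <= q ->
  (q%:E <= critical_exponent n)%E ->
  {ae mu, forall x, U x -> forall t, `|g x t| <= c * (1 + `|t| `^ (q - 1))} ->
  weak_solution s U g u0 -> exists f u d M,
  [/\ weak_sol U s f u d, measurable_fun setT f, 0 < M,
    forall x, (0 <= u x <= M) /\ (0 <= f x <= M) &
    [ae mu, x | u0 x = u x /\ (U x -> f x = g x (u x))]].
Proof.
move=> c0 q1 qc gr hsol; have mU := open_measurable oU.
have [u1 [d [hud ae1 gu eqn]]] := weak_solution_borel n0 oU bU hsol.
have [hu1 _ zu1 _ _] := hud; have mu1 := sqint_measurable hu1.
pose f1 x := g x (u1 x) * \1_U x.
have mf1 : measurable_fun setT f1 := nonlinearity_measurable mu1.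
have f10 x : 0 <= f1 x.
  by rewrite /f1 indicE; case: (boolP (x \in U)) => [|_]; rewrite ?mulr0// inE mulr1; exact: g_ge0.
have ws1 : weak_sol U s f1 u1 d.
  split=> // phi e hp gp; rewrite eqn//.
  rewrite -[RHS](@Rintegral_zoff _ _ U); last by move=> x nU; rewrite /f1 indicE memNset// mulr0 mul0r.
  by apply: eq_Rintegral => x; rewrite /f1 indicE => ->; rewrite mulr1.
have [N0 [mN0 N00 hN0]] := ae_null_set ae1.
have [N1 [mN1 N10 hN1]] := weak_sol_ge0 n0 oU bU f10 ws1.
have [N2 [mN2 N20 hN2]] := ae_null_set gr.
(* The positive part of [u1]. *)
pose u2 x := 2^-1 * (u1 x + `|u1 x|).
have u2E x : 0 <= u1 x -> u2 x = u1 x by move=> h; rewrite /u2 ger0_norm//; lra.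
have u20 x : 0 <= u2 x.
  by have := ler_norm (- u1 x); rewrite normrN /u2; lra.
have mu2 : measurable_fun setT u2.
  by apply: measurable_funM => //; apply: measurable_funD => //; exact: measurableT_comp.
have zu2 : zoff U u2 by move=> x /zu1; rewrite /u2 => ->; rewrite normr0 addr0 mulr0.
pose G x := g x (u2 x) * \1_U x; have mG : measurable_fun setT G := nonlinearity_measurable mu2.
pose H x := c * (1 + u2 x `^ (q - 1)).
have mH : measurable_fun setT H.
  apply: measurable_funM => //; apply: measurable_funD => //.
  exact: (measurableT_comp (measurable_powR _) mu2).
have G0 x : 0 <= G x.
  by rewrite /G indicE; case: (boolP (x \in U)) => [|_]; rewrite ?mulr0// inE mulr1; exact: g_ge0.
have H0 x : 0 <= H x by rewrite /H; nng.
(* The minimum with the growth bound [H] turns an almost everywhere inequality into one valid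
   everywhere. *)
pose f2 x := Num.min (G x) (H x).
have mf2 : measurable_fun setT f2 by exact: measurable_minr.
have f20 x : 0 <= f2 x by rewrite le_min G0 H0.
have mN12 : measurable (N1 `|` N2) by exact: measurableU.
have N120 : mu (N1 `|` N2) = 0%E by exact: null_set_setU.
have f12 x : ~ (N1 `|` N2) x -> f1 x = f2 x.
  move=> /not_orP[/hN1 h1 /hN2 h2]; rewrite /f2 /G u2E// -/(f1 x).
  apply/esym/min_idPl; rewrite /f1 /H u2E// indicE; case: (boolP (x \in U)) => [|_].
    by rewrite inE mulr1 => Ux; apply: le_trans (ler_norm _) _; have := h2 Ux (u1 x); rewrite (ger0_norm h1).
  by rewrite mulr0; nng.
have ws2 : weak_sol U s f2 u2 d.
  apply: (weak_sol_rhs mN12 N120 f12).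
  by apply: (weak_sol_null mN1 N10 mu2 zu2 _ ws1) => x /hN1 h; rewrite u2E.
have [p [p2 qp pn]] := subcritical_exponent q1 qc.
have f2H x : f2 x <= c * (1 + u2 x `^ (q - 1)) by rewrite /f2 ge_min lexx orbT.
have [M M0 hM] := levelm_vanish n0 oU bU mf2 f20 u20 c0 q1 f2H ws2 p2 qp pn.
pose N3 := level u2 M.
have mN3 : measurable N3 by exact: measurable_gt_set.
have N3U : N3 `<=` U.
  move=> x; rewrite /N3 /level /= => Mx; apply: contrapT => nU.
  by move: Mx; rewrite zu2// ltNge (ltW M0).
have N30 : mu N3 = 0%E.
  rewrite -[LHS]fineK; first by rewrite [fine _]hM.
  rewrite ge0_fin_numE//; apply: le_lt_trans (measure_U_lty oU bU).
  by apply: le_measure; rewrite ?inE.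
pose B := c * (1 + M `^ (q - 1)).
have B0 : 0 <= B by rewrite /B; nng.
(* The level set above [M] is null, so these truncations change nothing almost everywhere. *)
pose u3 x := Num.min (u2 x) M; pose f3 x := Num.min (f2 x) B.
have mu3 : measurable_fun setT u3 by exact: measurable_minr.
have mf3 : measurable_fun setT f3 by exact: measurable_minr.
have u23 x : ~ N3 x -> u2 x = u3 x.
  by move=> /negP; rewrite -leNgt => h; apply/esym/min_idPl.
have f23 x : ~ N3 x -> f2 x = f3 x.
  move=> /negP; rewrite -leNgt => h; apply/esym/min_idPl; apply: le_trans (f2H x) _.
  rewrite ler_pM2l// lerD2l; apply: ge0_ler_powR; rewrite ?nnegrE ?subr_ge0 ?(ltW M0)//.
have zu3 : zoff U u3 by move=> x /zu2; rewrite /u3 => ->; apply/min_idPl; exact: ltW.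
have ws3 : weak_sol U s f3 u3 d.
  by apply: (weak_sol_rhs mN3 N30 f23); exact: (weak_sol_null mN3 N30 mu3 zu3 u23 ws2).
exists f3, u3, d, (M + B); split=> //.
- by rewrite ltr_wpDr.
- move=> x; split; apply/andP; split.
  + by rewrite /u3 le_min u20 (ltW M0).
  + by rewrite /u3 ge_min; apply/orP; right; rewrite lerDl.
  + by rewrite /f3 le_min f20 B0.
  + by rewrite /f3 ge_min; apply/orP; right; rewrite lerDr ltW.
exists (N0 `|` ((N1 `|` N2) `|` N3)); split.
- by apply: measurableU => //; exact: measurableU.
- by apply: null_set_setU => //; [exact: measurableU|exact: null_set_setU].
move=> x /not_orP[/hN0 -> /not_orP[x12 x3]].
have x1 : ~ N1 x by move=> h; apply: x12; left.
rewrite -u23// u2E; last exact: hN1.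
by split=> // Ux; rewrite -f23// -f12// /f1 indicE mem_set// mulr1.
Qed.

End nonlinearity.

(** * Radial mollifiers *)
Section calculus1.
Context {R : realType}.
Implicit Types (f F P : R -> R).

Lemma MVT_gt f f' (a x y : R) : (forall t, a < t -> is_derive t (1 : R) f (f' t)) -> a < x -> a < y ->
  exists c, [/\ a < c, `|c - x| <= `|y - x| & f y - f x = f' c * (y - x)].
Proof.
move=> df ax ay.
have cf x' y' : a < x' -> {within `[x', y'], continuous f}.
  move=> ax'; apply: derivable_within_continuous => t; rewrite in_itv /= => /andP[xt _].
  by have [] := df t (lt_le_trans ax' xt).
have dI x' y' : a < x' -> forall t, t \in `]x', y'[ -> is_derive t (1 : R) f (f' t).
  by move=> ax' t; rewrite in_itv /= => /andP[xt _]; apply: df; exact: lt_trans xt.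
have [xy|yx] := leP x y.
  have [c] := MVT_segment xy (dI x y ax) (cf x y ax); rewrite in_itv /= => /andP[xc cy] e.
  exists c; split=> //; first exact: lt_le_trans xc.
  by rewrite !ger0_norm ?subr_ge0// lerD2r.
have [c] := MVT_segment (ltW yx) (dI y x ay) (cf y x ay); rewrite in_itv /= => /andP[yc cx] e.
exists c; split; first exact: lt_le_trans yc.
  by rewrite !ler0_norm ?subr_le0 ?(ltW yx)// lerN2 lerD2r.
by rewrite -opprB e -mulrN opprB.
Qed.

Lemma is_derive_bound f (x a C b rho : R) : 0 < b -> 0 < rho ->
  (forall h, `|h| <= rho -> `|f (h + x) - f x - h * a| <= C * `|h| `^ (1 + b)) ->
  is_derive x (1 : R) f a.
Proof.
move=> b0 rho0 hf.
have H : (fun h : R => h^-1 *: ((f \o shift x) (h *: (1 : R)) - f x)) @ 0^' --> a.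
  apply/cvgrPdist_lt => e e0; near=> h.
  have h0 : h != 0 by near: h; exact: nbhs_dnbhs_neq.
  have hp : 0 < `|h| by rewrite normr_gt0.
  have h1 : `|h| < Num.min rho ((e / (`|C| + 1)) `^ b^-1).
    by near: h; apply: dnbhs0_lt; rewrite lt_min rho0 powR_gt0// divr_gt0.
  move: h1; rewrite lt_min => /andP[h1 he].
  rewrite /= [h *: 1]mulr1.
  have -> : a - h^-1 *: (f (h + x) - f x) = - (h^-1 * (f (h + x) - f x - h * a)).
    by rewrite /GRing.scale /=; field.
  rewrite normrN normrM normfV ltr_pdivrMl//.
  apply: le_lt_trans (hf h (ltW h1)) _.
  rewrite powR_add// powRr1 ?ltW// mulrCA ltr_pM2l//.
  apply: (@le_lt_trans _ _ (`|C| * `|h| `^ b)); first by rewrite ler_wpM2r ?powR_ge0// ler_norm.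
  have hb : `|h| `^ b < e / (`|C| + 1).
    rewrite [ltRHS](_ : _ = ((e / (`|C| + 1)) `^ b^-1) `^ b); last first.
      by rewrite -powRrM mulVf ?gt_eqF// powRr1// divr_ge0 ?ltW.
    by apply: gt0_ltr_powR; rewrite ?nnegrE ?powR_ge0.
  apply: (@le_lt_trans _ _ (`|C| * (e / (`|C| + 1)))); first by rewrite ler_wpM2l// ltW.
  by rewrite mulrA ltr_pdivrMr// mulrC ltr_pM2l// ltrDl.
have D : derivable f x 1 by apply/cvg_ex; exists a.
by apply: DeriveDef => //; exact/cvg_lim.
Unshelve. all: by end_near. Qed.

Lemma local_primitive f (a : R) : continuous f ->
  exists F, forall x, a < x -> is_derive x (1 : R) F (f x).
Proof.
move=> cf; exists (fun x => \int[lebesgue_measure]_(t in `[a, x]) f t) => x ax.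
have [] := @continuous_FTC1_closed R f a x (x + 1) _ _ ax (cf x).
- by rewrite ltrDl.
- apply: continuous_compact_integrable; first exact: segment_compact.
  exact: continuous_subspaceT.
by move=> D E; apply: DeriveDef; [exact: D|rewrite derive1E in E; exact: E].
Qed.

(** Primitives starting at the points -(m+1), normalised to vanish at 0, agree on common domains and
    are glued. *)
Lemma primitive f : continuous f -> exists F, forall x, is_derive x (1 : R) F (f x).
Proof.
move=> cf; have [F0 hF0] := choice (fun m : nat => local_primitive (- m.+1%:R) cf).
pose F m x := F0 m x - F0 m 0.
have dF m (x : R) : - m.+1%:R < x -> is_derive x (1 : R) (F m) (f x).
  move=> mx; rewrite -[f x]subr0; apply: is_deriveB; exact: hF0.
have m0 m : - m.+1%:R < 0 :> R by rewrite oppr_lt0 ltr0n.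
have FE m m' (x : R) : (m <= m')%N -> - m.+1%:R < x -> F m x = F m' x.
  move=> mm mx.
  have mm' : - m'.+1%:R <= - m.+1%:R :> R by rewrite lerN2 ler_nat.
  have d (t : R) : - m.+1%:R < t -> is_derive t (1 : R) (F m \- F m') ((fun=> 0) t).
    by move=> mt; rewrite -(subrr (f t)); apply: is_deriveB; apply: dF => //; exact: le_lt_trans mt.
  have [c [_ _]] := MVT_gt d (m0 m) mx.
  rewrite mul0r /F /= !subrr subr0 => /eqP.
  by rewrite subr_eq0 => /eqP.
pose N (x : R) := Num.Def.archi_bound `|x|.
have Nx x : - (N x).+1%:R < x.
  rewrite ltrNl; apply: le_lt_trans (ler_norm _) _; rewrite normrN.
  by apply: lt_trans (archi_boundP (normr_ge0 x)) _; rewrite ltr_nat.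
exists (fun x => F (N x) x) => x.
apply: (@near_eq_is_derive _ _ _ (F (N x))); last exact: dF.
near=> y.
have xy : - (N x).+1%:R < y.
  by near: y; apply: open_nbhs_nbhs; split; [exact: open_gt|exact: Nx].
have [h|h] := leqP (N x) (N y); first exact: FE.
by rewrite (FE (N y) (N x))//; exact: ltnW.
Unshelve. all: by end_near. Qed.

(** The variable of a profile is the squared Euclidean norm, which makes the radial function smooth
    at the origin without a parity condition. *)
Definition profile P := smooth1 P /\ forall x, 1 <= x -> P x = 0.

(** Produces the second mollifier: with Q' = -P/2 the gradient of Q(|x|^2) is -x P(|x|^2). Vanishing
    at 1 makes [Q] a profile again. *)
Lemma profile_primitive P : profile P -> exists2 Q, profile Q & forall x, is_derive x (1 : R) Q (- 2^-1 * P x).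
Proof.
move=> [sP P0]; have [F dF] := primitive (smooth1_continuous sP).
have dQ x : is_derive x (1 : R) (fun x => - 2^-1 * (F x - F 1)) (- 2^-1 * P x).
  have h : is_derive x (1 : R) (fun x => F x - F 1) (P x).
    by rewrite -[P x]subr0; apply: is_deriveB.
  exact: (@is_deriveZ _ _ _ (fun x => F x - F 1) (- 2^-1) _ _ _ h).
exists (fun x => - 2^-1 * (F x - F 1)) => //; split.
  have [D [D0 dD]] := sP.
  exists (fun k => if k is k'.+1 then fun x => - 2^-1 * D k' x else fun x => - 2^-1 * (F x - F 1)).
  split=> // -[|k] x; first by rewrite D0.
  exact: (@is_deriveZ _ _ _ (D k) (- 2^-1) _ _ _ (dD k x)).
move=> x x1; have [->|xn] := eqVneq x 1; first by rewrite subrr mulr0.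
have x1' : 1 < x by rewrite lt_neqAle eq_sym xn.
have cF : {within `[1, x], continuous F}.
  by apply: derivable_within_continuous => t _; have [] := dF t.
have [c] := MVT_segment x1 (fun t _ => dF t) cF.
by rewrite in_itv /= => /andP[c1 _] ->; rewrite P0// mul0r mulr0.
Qed.

End calculus1.

Section calculus.
Context {R : realType} {n : nat}.
Local Notation V := 'rV[R]_n.
Local Notation e_ i := (delta_mx ord0 i : V).
Implicit Types (f g phi : V -> R) (x h v : V).

Lemma is_derive_partialE f i x (a : R) : is_derive x (e_ i) f a -> partial i f x = a.
Proof. by move=> h; rewrite /partial; exact: derive_val. Qed.

Lemma partial_sum (I : Type) (r : seq I) (f : I -> V -> R) i x : (forall k, smooth (f k)) ->
  partial i (fun x => \sum_(k <- r) f k x) x = \sum_(k <- r) partial i (f k) x.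
Proof.
move=> sf; apply: is_derive_partialE; elim: r => [|k r IH].
  by under eq_fun do rewrite big_nil; rewrite big_nil; exact: is_derive_cst.
under eq_fun do rewrite big_cons; rewrite big_cons.
by apply: is_deriveD => //; exact: smooth_derive.
Qed.

Lemma partialB f g i x : smooth f -> smooth g -> partial i (fun x => f x - g x) x = partial i f x - partial i g x.
Proof.
by move=> sf sg; apply: is_derive_partialE; apply: is_deriveB; exact: smooth_derive.
Qed.

Lemma partialD f g i x : smooth f -> smooth g -> partial i (fun x => f x + g x) x = partial i f x + partial i g x.
Proof.
by move=> sf sg; apply: is_derive_partialE; apply: is_deriveD; exact: smooth_derive.
Qed.

Lemma partialZ (c : R) f i x : smooth f -> partial i (fun x => c * f x) x = c * partial i f x.
Proof.
move=> sf; apply: is_derive_partialE.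
exact: (@is_deriveZ _ _ _ f c _ _ _ (smooth_derive i x sf)).
Qed.

Lemma partial_coord i j x : partial j (fun x : V => x ord0 i) x = (i == j)%:R.
Proof. by apply: is_derive_partialE; exact: is_derive_coord. Qed.

Lemma smooth_taylor1 f x h (M : R) : smooth f -> 0 <= M ->
  (forall i j y, `|y - x| <= `|h| -> `|partial i (partial j f) y| <= M) ->
  `|f (h + x) - f x - \sum_i h ord0 i * partial i f x| <= n%:R ^+ 2 * M * `|h| ^+ 2.
Proof.
move=> sf M0 hM; pose l (y : V) := \sum_(i < n) partial i f x * y ord0 i.
have sl : smooth l by apply: smooth_sum => i; apply: smoothZ; exact: smooth_coord.
pose g y := f y - l y; have sg : smooth g by exact: smoothB.
have -> : f (h + x) - f x - \sum_i h ord0 i * partial i f x = g (h + x) - g x.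
  have lE : l (h + x) - l x = \sum_i h ord0 i * partial i f x.
    by rewrite /l -sumrB; apply: eq_bigr => i _; rewrite mxE; ring.
  by rewrite /g -lE; ring.
apply: le_trans (@smooth_lip_local _ _ g x h (n%:R * M * `|h|) sg _ _) _; first by nng.
  move=> j y yx; have -> : partial j g y = partial j f y - partial j f x.
    rewrite partialB//; congr (_ - _); rewrite partial_sum; last first.
      by move=> k; apply: smoothZ; exact: smooth_coord.
    rewrite (bigD1 j)//= big1 => [|i ij]; last first.
      by rewrite partialZ; [rewrite partial_coord (negbTE ij) mulr0|exact: smooth_coord].
    by rewrite partialZ; [rewrite partial_coord eqxx mulr1 addr0|exact: smooth_coord].
  rewrite -[y](subrK x); apply: le_trans (smooth_lip_local (x := x) (smooth_partial j sf) M0 _) _.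
    by move=> i z zx; apply: hM; exact: le_trans yx.
  by rewrite ler_wpM2l// mulr_ge0.
by apply: le_of_eq; ring.
Qed.

Lemma smooth_second_bound f (M : R) : smooth f -> exists2 C : R, 0 <= C &
  forall i j x, `|x| <= M -> `|partial i (partial j f) x| <= C.
Proof.
move=> sf; have h (p : 'I_n * 'I_n) : exists C : R, forall x, `|x| <= M -> `|partial p.1 (partial p.2 f) x| <= C.
  by apply: smooth_bounded_on_ball; apply: smooth_partial; exact: smooth_partial.
have [C hC] := choice h; exists (\sum_p `|C p|); first exact: sumr_ge0.
move=> i j x xM; apply: le_trans (hC (i, j) x xM) _; apply: le_trans (ler_norm _) _.
by rewrite (bigD1 (i, j))//= lerDl sumr_ge0.
Qed.

Lemma smooth_is_derive_dir f x v : smooth f -> is_derive x v f (\sum_i v ord0 i * partial i f x).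
Proof.
move=> sf; have [C C0 hC] := smooth_second_bound (`|x| + `|v|) sf.
apply/is_derive_line0; apply: (@is_derive_bound _ _ _ _ (n%:R ^+ 2 * C * `|v| ^+ 2) 1 1) => // h h1.
rewrite addr0 scale0r add0r.
have -> : h * \sum_i v ord0 i * partial i f x = \sum_i (h *: v) ord0 i * partial i f x.
  by rewrite mulr_sumr; apply: eq_bigr => i _; rewrite mxE mulrA.
apply: le_trans (smooth_taylor1 sf C0 _) _ => [i j y|].
  move=> yx; apply: hC; rewrite -[y](subrK x) (le_trans (ler_normD _ _))// addrC lerD2l.
  by apply: le_trans yx _; rewrite normrZ ler_piMl.
rewrite (_ : 1 + 1 = 2%:R)//; have [->|h0] := eqVneq h 0.
  by rewrite scale0r normr0 expr0n mulr0 mulr_ge0 ?powR_ge0//; nng.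
by rewrite powR_nat ?normr_gt0// normrZ exprMn; apply: le_of_eq; ring.
Qed.

End calculus.

(** * Convolutions, dilations and the Euler operator *)

Section convolution.
Context {R : realType} {n : nat}.
Local Notation V := 'rV[R]_n.
Local Notation mu := (leb R n).
Local Notation e_ i := (delta_mx ord0 i : V).
Implicit Types (u phi zeta : V -> R) (x y z : V) (t : R) (l : seq 'I_n).

Definition conv u phi z := \int[mu]_x (u x * phi (z - x)).

Lemma Cc_sup phi : Cc_smooth setT phi -> exists2 M : R, 0 < M & forall x, `|phi x| <= M.
Proof. by move=> /Cc_bbs[_ [M M0 hM]]; exists M => // x; have [] := hM x. Qed.

Lemma rint_conv u phi z : rint mu u -> Cc_smooth setT phi -> rint mu (fun x => u x * phi (z - x)).
Proof.
move=> iu cphi; have [M M0 hM] := Cc_sup cphi.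
apply: (@rint_le _ _ _ _ _ (fun x => M * `|u x|)); last by apply: rintZ; exact: rint_abs.
  apply: measurable_funM; first exact: rint_measurable iu.
  exact: measurableT_comp (smooth_measurable (Cc_smoothW cphi)) (measurable_opp_rV z).
by move=> x; rewrite normrM mulrC ler_wpM2r.
Qed.

Lemma conv_sup_bound u phi z (M : R) : rint mu u -> (forall x, `|u x| <= M) -> Cc_smooth setT phi ->
  `|conv u phi z| <= M * \int[mu]_x `|phi x|.
Proof.
move=> iu uM cphi; have ic := rint_conv z iu cphi; have ip := bbs_integrable (Cc_bbs cphi).
have ia := rint_abs ip; have is_ := integrable_sub z ia.
apply: le_trans (le_normr_Rintegral measurableT ic) _.
rewrite -(Rintegral_sub z ia) -RintegralZl//.
apply: le_rint => [||x]; [exact: rint_abs|exact: rintZ|].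
by rewrite normrM ler_wpM2r.
Qed.

Lemma convZ u phi (c : R) z : rint mu u -> Cc_smooth setT phi ->
  conv u (fun x => c * phi x) z = c * conv u phi z.
Proof.
move=> iu cphi; rewrite /conv -RintegralZl//; last exact: rint_conv.
by apply: eq_Rintegral => x _; ring.
Qed.

Lemma conv_lin u phi psi chi (c : R) z : rint mu u -> Cc_smooth setT phi -> Cc_smooth setT psi -> Cc_smooth setT chi ->
  conv u phi z - conv u psi z - c * conv u chi z = \int[mu]_x (u x * (phi (z - x) - psi (z - x) - c * chi (z - x))).
Proof.
move=> iu c1 c2 c3.
have i1 := rint_conv z iu c1; have i2 := rint_conv z iu c2; have i3 := rint_conv z iu c3.
rewrite /conv -RintegralZl// -RintegralB// -RintegralB//; [|exact: rintB|exact: rintZ].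
by apply: eq_Rintegral => x _; ring.
Qed.

Lemma Rintegral_remainder u (g : V -> R) (C : R) : rint mu u -> measurable_fun setT g -> (forall x, `|g x| <= C) ->
  `|\int[mu]_x (u x * g x)| <= C * \int[mu]_x `|u x|.
Proof.
move=> iu mg hg; have ia := rint_abs iu.
have iug : rint mu (fun x => u x * g x).
  apply: (@rint_le _ _ _ _ _ (fun x => C * `|u x|)); last exact: rintZ.
    by apply: measurable_funM => //; exact: rint_measurable iu.
  by move=> x; rewrite normrM mulrC ler_wpM2r.
apply: le_trans (le_normr_Rintegral measurableT iug) _; rewrite -RintegralZl//.
apply: le_rint => [||x]; [exact: rint_abs|exact: rintZ|].
by rewrite normrM mulrC ler_wpM2r.
Qed.

Lemma Cc_second_bound phi : Cc_smooth setT phi -> exists2 C : R, 0 <= C &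
  forall i j x, `|partial i (partial j phi) x| <= C.
Proof.
move=> cphi; have h (p : 'I_n * 'I_n) : exists C : R, forall x, `|partial p.1 (partial p.2 phi) x| <= C.
  by have [C _ hC] := Cc_sup (Cc_partial p.1 (Cc_partial p.2 cphi)); exists C.
have [C hC] := choice h; exists (\sum_p `|C p|); first exact: sumr_ge0.
move=> i j x; apply: le_trans (hC (i, j) x) _; apply: le_trans (ler_norm _) _.
by rewrite (bigD1 (i, j))//= lerDl sumr_ge0.
Qed.

Lemma Cc_translate phi h : Cc_smooth setT phi -> Cc_smooth setT (fun x => phi (h + x)).
Proof.
move=> cphi; have sphi := Cc_smoothW cphi; have [_ [M M0 hM]] := Cc_bbs cphi.
apply: (Cc_intro (K := boxc (fun=> - (M + `|h|)) (fun=> M + `|h|))) => //.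
- by have := @smooth_affine _ _ phi 1 h sphi; congr smooth; apply/funext => x; rewrite scale1r addrC.
- exact: compact_boxc.
- move=> x nx; have [_ ->//] := hM (h + x); rewrite ltNge; apply/negP => hx; apply: nx => i.
  rewrite in_itv /= -ler_norml; apply: le_trans (coord_le_norm x i) _.
  rewrite -[x](addKr h) (le_trans (ler_normD _ _))// normrN addrC lerD2r//.
Qed.

(** The derivative is taken under the integral by a uniform quadratic Taylor remainder for [phi],
    which gives the difference quotient an explicit error of order h. *)
Lemma conv_is_derive u phi z i : rint mu u -> Cc_smooth setT phi ->
  is_derive z (e_ i) (conv u phi) (conv u (partial i phi) z).
Proof.
move=> iu cphi; have sphi := Cc_smoothW cphi; have [C C0 hC] := Cc_second_bound cphi.
apply/is_derive_line0; apply: (@is_derive_bound _ _ _ _ (n%:R ^+ 2 * C * \int[mu]_x `|u x|) 1 1) => // h h1.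
rewrite addr0 scale0r add0r.
have -> : conv u phi (h *: e_ i + z) = conv u (fun x => phi (h *: e_ i + x)) z.
  by apply: eq_Rintegral => x _; rewrite addrA.
rewrite conv_lin//; [|exact: Cc_translate|exact: Cc_partial].
rewrite (_ : 1 + 1 = 2%:R)//.
have h2 : `|h| ^+ 2 <= `|h| `^ 2%:R.
  by have [->|h0] := eqVneq h 0; [rewrite normr0 expr0n /= powR_ge0|rewrite powR_nat ?normr_gt0].
apply: (@le_trans _ _ (n%:R ^+ 2 * C * `|h| ^+ 2 * \int[mu]_x `|u x|)); last first.
  rewrite mulrAC; apply: ler_wpM2l => //; rewrite !mulr_ge0//; apply: Rintegral_ge0 => x _; exact: normr_ge0.
have mphi := smooth_measurable sphi.
apply: (@Rintegral_remainder u (fun x => phi (h *: e_ i + (z - x)) - phi (z - x) - h * partial i phi (z - x))) => //.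
  have mo := measurable_opp_rV z.
  apply: measurable_funB; first apply: measurable_funB.
  - exact: measurableT_comp (smooth_measurable (Cc_smoothW (Cc_translate (h *: e_ i) cphi))) mo.
  - exact: measurableT_comp mphi mo.
  - apply: measurable_funM => //; exact: measurableT_comp (smooth_measurable (smooth_partial i sphi)) mo.
move=> x; have := smooth_taylor1 (x := z - x) (h := h *: e_ i) sphi C0 (fun i j y _ => hC i j y).
rewrite (bigD1 i)//= big1 => [|j ji]; last by rewrite !mxE eqxx /= (negbTE ji) mulr0 mul0r.
rewrite !mxE !eqxx mulr1 addr0 => /le_trans; apply.
rewrite ler_wpM2l//; first by nng.
rewrite lerXn2r ?nnegrE// normrZ ler_piMr//; exact: norm_delta_le1.
Qed.

Lemma smooth_conv u phi : rint mu u -> Cc_smooth setT phi -> smooth (conv u phi).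
Proof.
move=> iu cphi; apply: (@smooth_coind _ _ (fun f => exists2 psi, Cc_smooth setT psi & f = conv u psi)); last by exists phi.
move=> _ [psi cpsi ->]; split; last first.
  move=> i; exists (conv u (partial i psi)); first by exists (partial i psi) => //; exact: Cc_partial.
  by move=> x; exact: conv_is_derive.
have [L L0 hL] := Cc_lipschitz cpsi.
pose I := \int[mu]_x `|u x|; have I0 : 0 <= I by apply: Rintegral_ge0.
have lip z h : `|conv u psi (h + z) - conv u psi z| <= L * `|h| * I.
  have -> : conv u psi (h + z) = conv u (fun x => psi (h + x)) z.
    by apply: eq_Rintegral => x _; rewrite addrA.
  have ct := Cc_translate h cpsi.
  have i1 := rint_conv z iu ct; have i2 := rint_conv z iu cpsi.
  rewrite /conv -RintegralB//.
  rewrite (_ : (fun x => _) = (fun x => u x * (psi (h + (z - x)) - psi (z - x)))); last by apply/funext => x; ring.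
  apply: (@Rintegral_remainder u (fun x => psi (h + (z - x)) - psi (z - x)) (L * `|h|)) => //.
  have mo := measurable_opp_rV z; apply: measurable_funB.
    exact: measurableT_comp (smooth_measurable (Cc_smoothW ct)) mo.
  exact: measurableT_comp (smooth_measurable (Cc_smoothW cpsi)) mo.
move=> z A /nbhs_ballP[e /= e0 hA].
have K0 : 0 < L * I + 1 by rewrite ltr_wpDl// mulr_ge0// ltW.
apply/(@nbhs_ballP _ _ z); exists (e / (L * I + 1)); first by rewrite /= divr_gt0.
move=> y; rewrite rV_ballE /= => yz; apply: hA; rewrite /ball /=.
have := lip y (z - y); rewrite subrK => /le_lt_trans; apply.
rewrite mulrAC; apply: (@le_lt_trans _ _ ((L * I) * (e / (L * I + 1)))).
  by rewrite ler_wpM2l ?mulr_ge0 ?(ltW L0)// ltW.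
by rewrite mulrA ltr_pdivrMr// mulrC ltr_pM2l// ltrDl.
Qed.

Lemma partial_conv u phi i : rint mu u -> Cc_smooth setT phi -> partial i (conv u phi) = conv u (partial i phi).
Proof. by move=> iu cphi; apply/funext => z; apply: is_derive_partialE; exact: conv_is_derive. Qed.

(** The exponent [N] is independent of the dimension because each spatial derivative raises it by
    one, as does the derivative in [t]. *)
Definition dilate (N : nat) t zeta y := t^-1 ^+ N * zeta (t^-1 *: y).

(** The generator of the dilations of weight [N]: up to sign and one more power of 1/t, the
    derivative in [t] of [dilate N t zeta] is the dilate of this function. *)
Definition euler (N : nat) zeta y := N%:R * zeta y + \sum_i y ord0 i * partial i zeta y.

Lemma smooth_dilate N t zeta : smooth zeta -> smooth (dilate N t zeta).
Proof.
move=> sz; apply: smoothZ; have := @smooth_affine _ _ zeta t^-1 0 sz.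
by congr smooth; apply/funext => y; rewrite addr0.
Qed.

Lemma dilate_out N t zeta (r : R) : 0 < t -> (forall x, r < `|x| -> zeta x = 0) ->
  forall x, t * r < `|x| -> dilate N t zeta x = 0.
Proof.
move=> t0 hz x tx; rewrite /dilate hz ?mulr0// normrZ gtr0_norm ?invr_gt0//.
by rewrite mulrC ltr_pdivlMr// mulrC.
Qed.

Lemma Cc_out phi (r : R) : smooth phi -> (forall x, r < `|x| -> phi x = 0) -> Cc_smooth setT phi.
Proof.
move=> sp hp; apply: (Cc_intro (K := boxc (fun=> - r) (fun=> r))) => //; first exact: compact_boxc.
move=> x nx; apply: hp; rewrite ltNge; apply/negP => xr; apply: nx => i.
by rewrite in_itv /= -ler_norml (le_trans (coord_le_norm x i)).
Qed.

Lemma Cc_dilate N t zeta : 0 < t -> Cc_smooth setT zeta -> Cc_smooth setT (dilate N t zeta).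
Proof.
move=> t0 cz; have [_ [M M0 hM]] := Cc_bbs cz.
apply: (@Cc_out _ (t * M)); first exact: smooth_dilate (Cc_smoothW cz).
by apply: dilate_out => // x xM; have [_ ->] := hM x.
Qed.

Lemma partial_dilate N t zeta i : smooth zeta -> partial i (dilate N t zeta) = dilate N.+1 t (partial i zeta).
Proof.
move=> sz; apply/funext => y; apply: is_derive_partialE.
have h : is_derive y (e_ i) (fun x => zeta (t^-1 *: x)) (t^-1 * partial i zeta (t^-1 *: y)).
  have := @is_derive_affine _ _ zeta i t^-1 0 y (partial i zeta (t^-1 *: y + 0)) (smooth_derive i _ sz).
  by rewrite addr0; under eq_fun do rewrite addr0.
have := @is_deriveZ _ _ _ (fun x => zeta (t^-1 *: x)) (t^-1 ^+ N) _ _ _ h.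
by rewrite /dilate exprSr -mulrA; apply.
Qed.

Lemma smooth_euler N zeta : smooth zeta -> smooth (euler N zeta).
Proof.
move=> sz; apply: smoothD; first exact: smoothZ.
by apply: smooth_sum => i; apply: smoothM; [exact: smooth_coord|exact: smooth_partial].
Qed.

Lemma Cc_euler N zeta : Cc_smooth setT zeta -> Cc_smooth setT (euler N zeta).
Proof.
move=> cz; have [sz [K [cK KT hK]]] := Cc_elim cz.
apply: (Cc_intro (K := K)) => //; first exact: smooth_euler.
move=> x nK; rewrite /euler hK// mulr0 add0r big1// => i _.
by rewrite (compactly_supported_partial i (compact_closed_rV cK) sz hK)// mulr0.
Qed.

Lemma is_derive_dilate N t zeta y : smooth zeta -> 0 < t ->
  is_derive t (1 : R) (fun t => dilate N t zeta y) (- dilate N.+1 t (euler N zeta) y).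
Proof.
move=> sz t0; set sig := t^-1.
have h1 : is_derive sig (1 : R) (fun r : R => zeta (r *: y)) (\sum_i y ord0 i * partial i zeta (sig *: y)).
  have /is_derive_line := @smooth_is_derive_dir _ _ zeta (sig *: y + 0) y sz.
  by rewrite addr0; under [X in is_derive _ _ X _ -> _]eq_fun do rewrite addr0.
have h2 : is_derive sig (1 : R) (fun r : R => r ^+ N) (N%:R * sig ^+ N.-1).
  have -> : (fun r : R => r ^+ N) = id ^+ N by apply/funext => r; rewrite exprfctE.
  have := @is_deriveX _ _ id N sig 1 1 (is_derive_id _ _).
  by rewrite /GRing.scale /= mulr1.
have h3 : is_derive sig (1 : R) (fun r : R => r ^+ N * zeta (r *: y))
   (sig ^+ N * (\sum_i y ord0 i * partial i zeta (sig *: y)) + zeta (sig *: y) * (N%:R * sig ^+ N.-1)).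
  exact: is_deriveM h2 h1.
have h4 : is_derive t (1 : R) (fun r : R => r^-1) (- t ^- 2).
  have := @is_deriveV _ id t 1 1 (lt0r_neq0 t0) (is_derive_id _ _).
  by rewrite /GRing.scale /= mulr1.
have e : \sum_i (sig *: y) ord0 i * partial i zeta (sig *: y) = sig * \sum_i y ord0 i * partial i zeta (sig *: y).
  by rewrite mulr_sumr; apply: eq_bigr => i _; rewrite mxE mulrA.
have := is_derive1_comp h3 h4; congr (is_derive _ _ _ _).
rewrite /dilate /euler -/sig e (_ : t ^- 2 = sig ^+ 2); last by rewrite exprVn.
move: (\sum_i _) (zeta _) => S z0.
by case: N {h2 h3} => [|N] /=; rewrite ?exprS; ring.
Qed.


(** The same scheme as for spatial derivatives: a second order Taylor bound in [t], uniform in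
    space, is integrated against [u]. *)
Lemma conv_dilate_is_derive u N t zeta z : rint mu u -> Cc_smooth setT zeta -> 0 < t ->
  is_derive t (1 : R) (fun t => conv u (dilate N t zeta) z) (- conv u (dilate N.+1 t (euler N zeta)) z).
Proof.
move=> iu cz t0; have sz := Cc_smoothW cz.
have ce1 := Cc_euler N cz; have se1 := Cc_smoothW ce1.
have ce2 := Cc_euler N.+1 ce1.
have [M M0 hM] := Cc_sup ce2.
pose C := (4 / t) ^+ N.+2 * M.
have C0 : 0 <= C by rewrite /C; nng.
(* All intermediate scales exceed t/4, which keeps the powers of 1/t in the remainder bounded. *)
have q0 : 0 < t / 4 by psv.
have qt : t / 4 < t by rewrite ltr_pdivrMr//; lra.
apply: (@is_derive_bound _ _ _ _ (C * \int[mu]_x `|u x|) 1 (t / 2)) => // [|h ht]; first by psv.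
have qh : t / 4 < h + t.
  have := ler_norm (- h); rewrite normrN; move: ht; have : t / 4 < t / 2 by rewrite ltr_pM2l//; lra.
  lra.
have th0 : 0 < h + t by exact: lt_trans qh.
have cd := Cc_dilate N t0 cz; have cdh := Cc_dilate N th0 cz; have cd1 := Cc_dilate N.+1 t0 ce1.
have -> : conv u (dilate N (h + t) zeta) z - conv u (dilate N t zeta) z - h * (- conv u (dilate N.+1 t (euler N zeta)) z) =
   conv u (dilate N (h + t) zeta) z - conv u (dilate N t zeta) z - (- h) * conv u (dilate N.+1 t (euler N zeta)) z by ring.
rewrite conv_lin//.
have h2 : `|h| ^+ 2 <= `|h| `^ (1 + 1).
  rewrite (_ : 1 + 1 = 2%:R)//.
  by have [->|h0] := eqVneq h 0; [rewrite normr0 expr0n /= powR_ge0|rewrite powR_nat ?normr_gt0].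
apply: (@le_trans _ _ (C * `|h| ^+ 2 * \int[mu]_x `|u x|)); last first.
  rewrite mulrAC; apply: ler_wpM2l => //; rewrite mulr_ge0//; apply: Rintegral_ge0 => x _; exact: normr_ge0.
apply: (@Rintegral_remainder u (fun x => dilate N (h + t) zeta (z - x) - dilate N t zeta (z - x) -
   (- h) * dilate N.+1 t (euler N zeta) (z - x)) (C * `|h| ^+ 2)) => //.
  have mo := measurable_opp_rV z.
  have mc phi : Cc_smooth setT phi -> measurable_fun setT (fun x => phi (z - x)).
    by move=> cp; exact: measurableT_comp (smooth_measurable (Cc_smoothW cp)) mo.
  by apply: measurable_funB; [apply: measurable_funB; exact: mc|apply: measurable_funM => //; exact: mc].
move=> x; set y := z - x.
have d1 (r : R) : t / 4 < r -> is_derive r (1 : R) (fun r => dilate N r zeta y) (- dilate N.+1 r (euler N zeta) y).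
  by move=> qr; apply: is_derive_dilate => //; exact: lt_trans qr.
have d2 (r : R) : t / 4 < r -> is_derive r (1 : R) (fun r => - dilate N.+1 r (euler N zeta) y)
   (dilate N.+2 r (euler N.+1 (euler N zeta)) y).
  move=> qr; rewrite -[dilate N.+2 _ _ _]opprK; apply: is_deriveN; apply: is_derive_dilate => //.
  exact: lt_trans qr.
have [c [qc ct e1]] := MVT_gt d1 qt qh.
have [c' [qc' _ e2]] := MVT_gt d2 qt qc.
rewrite e1 (_ : _ - _ = (- dilate N.+1 c (euler N zeta) y - - dilate N.+1 t (euler N zeta) y) * h); last by ring.
rewrite e2 addrK in ct *.
rewrite normrM normrM expr2 mulrA; apply: ler_wpM2r => //.
apply: ler_pM => //.
rewrite /dilate normrM /C; apply: ler_pM => //.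
have c'0 : 0 < c' by exact: lt_trans qc'.
rewrite normrX normfV (gtr0_norm c'0) lerXn2r ?nnegrE ?invr_ge0 ?(ltW c'0) ?divr_ge0 ?(ltW t0)//.
by rewrite -invf_div lef_pV2 ?posrE// ltW.
Qed.

Definition rad (P : R -> R) x := P (\sum_i x ord0 i ^+ 2).

Lemma smooth_sqnorm : smooth (fun x : V => \sum_i x ord0 i ^+ 2).
Proof. by apply: smooth_sum => i; apply: smoothM; exact: smooth_coord. Qed.

Lemma partial_sqnorm i x : partial i (fun x : V => \sum_i x ord0 i ^+ 2) x = 2 * x ord0 i.
Proof.
rewrite partial_sum => [|k]; last by apply: smoothM; exact: smooth_coord.
have sc k := @smooth_coord R n k.
rewrite (bigD1 i)//= big1 => [|j ji].
  by rewrite addr0 (partialM (f := fun x : V => x ord0 i) (g := fun x : V => x ord0 i))// partial_coord eqxx /=; ring.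
by rewrite (partialM (f := fun x : V => x ord0 j) (g := fun x : V => x ord0 j))// partial_coord (negbTE ji) /=; ring.
Qed.

Lemma partial_comp1 (F F' : R -> R) (f : V -> R) i x : (forall r, is_derive r (1 : R) F (F' r)) -> smooth f ->
  partial i (fun x => F (f x)) x = F' (f x) * partial i f x.
Proof.
move=> dF sf; apply: is_derive_partialE; apply/is_derive_line0.
have /is_derive_line0 h := smooth_derive i x sf.
have := @is_derive1_comp _ F (fun r : R => f (r *: e_ i + x)) 0 _ _ (dF _) h.
by rewrite scale0r add0r.
Qed.

Lemma smooth_rad P : smooth1 P -> smooth (rad P).
Proof. by move=> sP; apply: smooth_comp => //; exact: smooth_sqnorm. Qed.

Lemma rad_out P x : profile P -> 1 < `|x| -> rad P x = 0.
Proof.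
move=> [_ P0] x1; apply: P0; have h := lt_le_trans x1 (le_euclidean_norm x).
have s0 : 0 <= \sum_i x ord0 i ^+ 2 by apply: sumr_ge0 => i _; exact: sqr_ge0.
rewrite -[leRHS]sqr_sqrtr// -[leLHS](expr1n _ 2) lerXn2r ?nnegrE ?sqrtr_ge0//; exact: ltW.
Qed.

Lemma Cc_rad P : profile P -> Cc_smooth setT (rad P).
Proof. by move=> pP; apply: (@Cc_out _ 1); [apply: smooth_rad; case: pP|move=> x; exact: rad_out]. Qed.

Definition lapl f x : R := \sum_(i < n) partial i (partial i f) x.

Lemma Cc_lapl phi : Cc_smooth setT phi -> Cc_smooth setT (lapl phi).
Proof.
move=> cp; have [sp [K [cK KT hK]]] := Cc_elim cp.
apply: (Cc_intro (K := K)) => //; first by apply: smooth_sum => i; apply: smooth_partial; exact: smooth_partial.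
have hp i x := compactly_supported_partial i (compact_closed_rV cK) sp hK (x := x).
move=> x nK; apply: big1 => i _.
exact: (compactly_supported_partial i (compact_closed_rV cK) (smooth_partial i sp) (hp i)).
Qed.

(** The left side is the divergence of x P(|x|^2), and x P(|x|^2) is minus the gradient of
    Q(|x|^2). *)
Lemma euler_rad P Q : profile P -> profile Q -> (forall r : R, is_derive r (1 : R) Q (- 2^-1 * P r)) ->
  euler n (rad P) = fun x => - lapl (rad Q) x.
Proof.
move=> [sP _] [sQ _] dQ; have sr := smooth_rad sP; apply/funext => x.
have h i : partial i (rad Q) = fun x => - (x ord0 i * rad P x).
  apply/funext => y; rewrite /rad (partial_comp1 i y dQ smooth_sqnorm) partial_sqnorm.
  by move: (P _) => a; field.
rewrite /lapl /euler -sumrN.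
have h2 i : - partial i (partial i (rad Q)) x = rad P x + x ord0 i * partial i (rad P) x.
  have sc := @smooth_coord R n i.
  rewrite h; have -> : partial i (fun x => - (x ord0 i * rad P x)) x = - 1 * partial i (fun x => x ord0 i * rad P x) x.
    rewrite -partialZ; last exact: smoothM.
    by congr (partial i _ x); apply/funext => y; ring.
  by rewrite partialM// partial_coord eqxx /=; ring.
rewrite (eq_bigr _ (fun i _ => h2 i)) big_split /=; congr (_ + _).
by rewrite sumr_const card_ord mulr_natl.
Qed.

Lemma euler_partial N zeta j : smooth zeta -> euler N.+1 (partial j zeta) = partial j (euler N zeta).
Proof.
move=> sz; apply/funext => x; rewrite {2}/euler.
have sp i := smooth_partial i sz; have sc i := @smooth_coord R n i.
rewrite partialD; [|exact: smoothZ|by apply: smooth_sum => i; exact: smoothM].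
rewrite partialZ// partial_sum => [|i]; last exact: smoothM.
have h i : partial j (fun x => x ord0 i * partial i zeta x) x = x ord0 i * partial i (partial j zeta) x + (i == j)%:R * partial i zeta x.
  by rewrite partialM// partial_coord (partial_comm i j sz) [partial i zeta x * _]mulrC.
rewrite (eq_bigr _ (fun i _ => h i)) big_split /= /euler.
have -> : \sum_(i < n) (i == j)%:R * partial i zeta x = partial j zeta x.
  by rewrite (bigD1 j)//= eqxx mul1r big1 ?addr0// => i /negbTE ->; rewrite mul0r.
by rewrite -natr1; ring.
Qed.

Lemma lapl_partial f j : smooth f -> partial j (lapl f) = lapl (partial j f).
Proof.
move=> sf; apply/funext => x; rewrite /lapl partial_sum => [|i]; last by do 2!apply: smooth_partial.
apply: eq_bigr => i _; rewrite (partial_comm j i (smooth_partial i sf)).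
by rewrite (partial_comm j i sf).
Qed.

(** Each derivative raises the weight of the Euler operator by one and commutes with the Laplacian,
    so the radial identity persists at weight n + |l|. *)
Lemma euler_dpart P Q l : profile P -> profile Q -> (forall r : R, is_derive r (1 : R) Q (- 2^-1 * P r)) ->
  euler (n + size l) (dpart l (rad P)) = fun x => - lapl (dpart l (rad Q)) x.
Proof.
move=> pP pQ dQ; have [sP _] := pP; have [sQ _] := pQ.
elim: l => [|j l IH]; first by rewrite addn0; exact: euler_rad.
rewrite /= addnS euler_partial; last by apply: smooth_dpart; exact: smooth_rad.
rewrite IH; have sd := smooth_dpart l (smooth_rad sQ).
have sl : smooth (lapl (dpart l (rad Q))).
  by apply: smooth_sum => i; do 2!apply: smooth_partial.
apply/funext => x; rewrite -lapl_partial//.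
have -> : (fun x => - lapl (dpart l (rad Q)) x) = (fun x => - 1 * lapl (dpart l (rad Q)) x).
  by apply/funext => y; ring.
by rewrite partialZ//; ring.
Qed.

End convolution.

(** * Mollified equation and truncation of the fractional kernel *)

Section truncated.
Context {R : realType} {n : nat}.
Local Notation V := 'rV[R]_n.
Local Notation mu := (leb R n).
Local Notation mu2 := (leb2 R n).
Local Notation en := (@euclidean_norm R n).

Lemma rint_fubini (F : V * V -> R) : rint mu2 F ->
  \int[mu]_x \int[mu]_y F (x, y) = \int[mu]_y \int[mu]_x F (x, y).
Proof.
move=> iF.
have ae1 : {ae mu, forall x, fubini_F mu (EFin \o F) x = (\int[mu]_y F (x, y))%:E}.
  have := ae_integrable1 iF; apply: filterS => x hx; rewrite /fubini_F /Rintegral /= fineK//.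
  by have := integrable_fin_num measurableT hx.
have ae2 : {ae mu, forall y, fubini_G mu (EFin \o F) y = (\int[mu]_x F (x, y))%:E}.
  have := ae_integrable2 iF; apply: filterS => x hx; rewrite /fubini_G /Rintegral /= fineK//.
  by have := integrable_fin_num measurableT hx.
have m1 : measurable_fun setT (fun x : V => \int[mu]_y F (x, y)).
  have := measurableT_comp (fine_measurable measurableT) (measurable_fubini_F iF); exact.
have m2 : measurable_fun setT (fun y : V => \int[mu]_x F (x, y)).
  have := measurableT_comp (fine_measurable measurableT) (measurable_fubini_G iF); exact.
rewrite /Rintegral; congr fine.
transitivity (\int[mu]_x fubini_F mu (EFin \o F) x)%E.
  apply: ae_eq_integral => //.
  - exact/measurable_EFinP.
  - exact: measurable_fubini_F iF.
  - by move: ae1; apply: filterS => x hx _; rewrite [RHS]hx.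
transitivity (\int[mu]_y fubini_G mu (EFin \o F) y)%E; first exact: (Fubini iF).
apply: ae_eq_integral => //.
- exact: measurable_fubini_G iF.
- exact/measurable_EFinP.
- by move: ae2; apply: filterS => x hx _; rewrite [LHS]hx.
Qed.

Lemma euclidean_norm_lip x y : `|en x - en y| <= n%:R * `|x - y|.
Proof.
have [->|xy] := eqVneq x y; first by rewrite !subrr !normr0 mulr0.
have e0 (z : V) : 0 <= en z by exact: sqrtr_ge0.
have s0 (z : V) : 0 <= \sum_(i < n) z ord0 i ^+ 2 by apply: sumr_ge0 => i _; exact: sqr_ge0.
have es (z : V) : en z ^+ 2 = \sum_(i < n) z ord0 i ^+ 2 by rewrite sqr_sqrtr.
have p0 : 0 < en x + en y.
  rewrite lt_neqAle addr_ge0// andbT eq_sym; apply: contra xy => h.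
  have := paddr_eq0 (e0 x) (e0 y); rewrite h => /esym /andP[/eqP x0 /eqP y0].
  have zz (z : V) : en z = 0 -> z = 0.
    by move=> z0; apply/eqP; rewrite -normr_eq0 eq_le normr_ge0 andbT -z0 le_euclidean_norm.
  by rewrite (zz x)// (zz y).
rewrite -(ler_pM2r p0) -{1}(gtr0_norm p0) -normrM.
have -> : (en x - en y) * (en x + en y) = en x ^+ 2 - en y ^+ 2 by ring.
rewrite !es -sumrB; apply: le_trans (ler_norm_sum _ _ _) _.
apply: (@le_trans _ _ (\sum_(i < n) `|x - y| * (en x + en y))); last first.
  by rewrite sumr_const card_ord -[leLHS]mulr_natl mulrA.
apply: ler_sum => i _.
rewrite (_ : _ - _ = (x - y) ord0 i * (x + y) ord0 i); last by rewrite !mxE; ring.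
rewrite normrM; apply: ler_pM => //; first exact: coord_le_norm.
apply: le_trans (coord_le_norm _ _) _; apply: le_trans (ler_normD _ _) _.
by apply: lerD; exact: le_euclidean_norm.
Qed.

(** For v >= 1 the inequality 1 - v^(-p) <= p (v - 1) follows from exp w >= 1 + w used twice, once
    for the power and once for the logarithm. *)
Lemma powR_neg_lip (p r a b : R) : 0 <= p -> 0 < r -> r <= a -> r <= b ->
  `|a `^ (- p) - b `^ (- p)| <= p * r `^ (- p) / r * `|a - b|.
Proof.
move=> p0 r0.
suff H x y : r <= x -> x <= y -> `|x `^ (- p) - y `^ (- p)| <= p * r `^ (- p) / r * `|x - y|.
  move=> ra rb; have [ab|/ltW ba] := leP a b; first exact: H.
  by rewrite distrC [`|a - b|]distrC; exact: H.
move=> rx xy; have x0 : 0 < x by exact: lt_le_trans rx.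
have y0 : 0 < y by exact: lt_le_trans xy.
have xr : x `^ (- p) <= r `^ (- p).
  by rewrite !powRN lef_pV2 ?posrE ?powR_gt0//; apply: ge0_ler_powR; rewrite ?nnegrE ?(ltW r0) ?(ltW x0).
have e : y `^ (- p) = x `^ (- p) * (y / x) `^ (- p).
  by rewrite -powRM ?ltW ?divr_gt0// mulrCA divff ?mulr1 ?gt_eqF.
have yx1 : 1 <= y / x by rewrite ler_pdivlMr// mul1r.
have b1 : (y / x) `^ (- p) <= 1.
  rewrite powRN invf_le1; last by rewrite powR_gt0// divr_gt0.
  rewrite -[leLHS](_ : 1 `^ p = 1 :> R); last by rewrite powR1.
  by apply: ge0_ler_powR; rewrite ?nnegrE//; exact: le_trans yx1.
have b2 : 1 - p * (y / x - 1) <= (y / x) `^ (- p).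
  rewrite /powR gt_eqF ?divr_gt0//; apply: le_trans (expR_ge1Dx _).
  rewrite lerD2l mulNr lerN2 ler_wpM2l//.
  have := expR_ge1Dx (ln (y / x)); rewrite lnK ?posrE ?divr_gt0//; lra.
rewrite e -[X in `|X - _|]mulr1 -mulrBr normrM ger0_norm ?powR_ge0// ger0_norm ?subr_ge0//.
rewrite ler0_norm ?subr_le0// opprB.
apply: (@le_trans _ _ (r `^ (- p) * (p * (y / x - 1)))).
  by apply: ler_pM; rewrite ?powR_ge0 ?subr_ge0//; lra.
rewrite [leRHS](_ : _ = r `^ (- p) * (p * ((y - x) / r))); last by ring.
rewrite ler_wpM2l ?powR_ge0// ler_wpM2l//.
have -> : y / x - 1 = (y - x) / x by field; rewrite gt_eqF.
by rewrite ler_wpM2l ?subr_ge0// lef_pV2.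
Qed.

Variables (s : R) (s01 : 0 < s < 1) (n0 : (0 < n)%N).
Local Notation k := (levy s).
Let pp : R := n%:R + 2 * s.
Let pp0 : 0 < pp. Proof. by have /andP[s0 _] := s01; rewrite ltr_wpDl// mulr_gt0. Qed.

Implicit Types (rho r : R) (x y z h : V).
(** The kernel with its singularity capped at radius [rho]: bounded, integrable, Lipschitz, and
    equal to [levy] wherever |h| >= rho. *)
Definition ktail (rho : R) (h : V) : R := (Num.max rho (en h)) `^ (- pp).

Lemma ktail_ge0 rho h : 0 <= ktail rho h. Proof. exact: powR_ge0. Qed.

Lemma ktailN rho h : ktail rho (- h) = ktail rho h.
Proof. by rewrite /ktail -scaleN1r euclidean_normZ normrN normr1 mul1r. Qed.

Lemma ktail_le rho h : 0 < rho -> h != 0 -> ktail rho h <= k h.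
Proof.
move=> r0 h0; have e0 : 0 < en h by rewrite (lt_le_trans _ (le_euclidean_norm h))// normr_gt0.
rewrite /levy /ktail powRN lef_pV2 ?posrE ?powR_gt0 ?lt_max ?r0//.
by apply: ge0_ler_powR; rewrite ?nnegrE ?(ltW pp0) ?(ltW e0) ?le_max ?(ltW r0) ?lexx ?orbT.
Qed.

Lemma ktail_far rho h : 0 < rho -> rho <= `|h| -> ktail rho h = k h.
Proof.
move=> r0 rh; rewrite /ktail /levy (max_idPr _) ?powRN//.
by apply: le_trans rh _; exact: le_euclidean_norm.
Qed.

Lemma ktail_bound rho h : 0 < rho -> ktail rho h <= rho `^ (- pp).
Proof.
move=> r0; rewrite /ktail !powRN lef_pV2 ?posrE ?powR_gt0 ?lt_max ?r0//.
by apply: ge0_ler_powR; rewrite ?nnegrE ?(ltW pp0) ?le_max ?(ltW r0) ?lexx.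
Qed.


Lemma ktail_lip rho x y : 0 < rho ->
  `|ktail rho x - ktail rho y| <= pp * rho `^ (- pp) / rho * n%:R * `|x - y|.
Proof.
move=> r0; apply: le_trans (powR_neg_lip (ltW pp0) r0 _ _) _; rewrite ?le_max ?lexx//.
rewrite -[leRHS]mulrA ler_wpM2l//; first by rewrite !mulr_ge0 ?powR_ge0 ?invr_ge0 ?(ltW r0) ?(ltW pp0).
apply: le_trans (euclidean_norm_lip x y).
have := ler_norm (en x - en y); have := ler_norm (en y - en x); rewrite (distrC (en y)) ler_norml.
move: (normr_ge0 (en x - en y)); case: (leP rho (en x)); case: (leP rho (en y)); lra.
Qed.

Lemma measurable_ktail rho : measurable_fun setT (ktail rho).
Proof.
have men : measurable_fun setT (fun h : V => en h).
  by apply: continuous_measurable_rV; exact: euclidean_norm_continuous.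
exact: (measurableT_comp (measurable_powR (- pp)) (measurable_maxr (measurable_cst rho) men)).
Qed.

Lemma rint_ktail rho : 0 < rho -> rint mu (ktail rho).
Proof.
move=> r0.
have [i1 _] := levy_far (n := n) s01 r0.
have i2 : rint mu (\1_[set h : V | `|h| <= rho] : V -> R).
  by apply: (rint_bounded_indic (M := rho)) => //; exact: measurable_norm_le.
apply: (rint_le _ _ (rintD (rintZ (rho `^ (- pp)) i2) i1)); first exact: measurable_ktail.
move=> h; rewrite ger0_norm ?ktail_ge0// !indicE.
have [hr|hr] := leP `|h| rho.
  by rewrite mem_set// mulr1 -[leLHS]addr0 lerD ?ktail_bound// mulr_ge0// levy_ge0.
rewrite memNset; last by move=> /= /(lt_le_trans hr); rewrite ltxx.
by rewrite mem_set// mulr0 add0r mulr1 ktail_far// ltW.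
Qed.

Variables (U : set V) (oU : open U) (bU : norm_bounded U).
Variables (f u : V -> R) (d : 'I_n -> V -> R) (M : R).
Hypotheses (hs : weak_sol U s f u d) (mf : measurable_fun setT f) (fU : zoff U f).
Hypotheses (bf : forall x, `|f x| <= M) (bu : forall x, `|u x| <= M).
Let hud : h10 U u d. Proof. by case: hs. Qed.
Let iu : rint mu u. Proof. exact: (h10_rint oU bU hud). Qed.
Let mU : measurable U. Proof. exact: open_measurable. Qed.
Let iU : rint mu (\1_U : V -> R).
Proof. by case: bU => M' hM'; exact: rint_bounded_indic hM'. Qed.

Lemma rint_bounded_zoff (a : V -> R) (C : R) : measurable_fun setT a -> zoff U a ->
  (forall x, U x -> `|a x| <= C) -> rint mu a.
Proof.
move=> ma aU aC; apply: (rint_le ma _ (rintZ C iU)) => x.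
have [Ux|Ux] := pselect (U x); first by rewrite indicE mem_set// mulr1 aC.
by rewrite aU// normr0 indicE memNset// mulr0.
Qed.

Let if_ : rint mu f. Proof. exact: (rint_bounded_zoff (C := M)). Qed.

Lemma weak_test kap : Cc_smooth U kap ->
  rint mu (fun h => k h * \int[mu]_x (u x * diff2 kap h x)) /\
  - (\int[mu]_x (u x * lapl kap x)) + \int[mu]_h (k h * \int[mu]_x (u x * diff2 kap h x)) =
  \int[mu]_x (f x * kap x).
Proof.
move=> hk; have [_ gu eqn] := hs.
have [i1 e1] := nonlocal_formula s01 iu gu (Cc_setT hk).
split=> //; rewrite -(eqn kap (fun i => partial i kap)); last 2 first.
- exact: Cc_h10.
- exact: (gagfin_Cc s01 (Cc_setT hk)).
rewrite -e1; congr (_ + _).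
have i2 i : rint mu (fun x => d i x * partial i kap x).
  by case: hud => _ hd _ _ _; apply: sqint_mul => //; apply: (Cc_sqint (U := U)); exact: Cc_partial.
have i3 i : rint mu (fun x => u x * partial i (partial i kap) x).
  case: hud => hu _ _ _ _; apply: sqint_mul => //; apply: (Cc_sqint (U := U)).
  by apply: Cc_partial; exact: Cc_partial.
have e2 i : \int[mu]_x (u x * partial i (partial i kap) x) = - \int[mu]_x (d i x * partial i kap x).
  have := h10_weak_partial i hud (Cc_partial i hk).
  have [_ _ zu zd _] := hud.
  have z1 : zoff U (fun x => u x * partial i (partial i kap) x) by move=> x Ux; rewrite zu// mul0r.
  have z2 : zoff U (fun x => d i x * partial i kap x) by move=> x Ux; rewrite zd// mul0r.
  by rewrite (Rintegral_zoff z1) (Rintegral_zoff z2).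
rewrite (_ : (fun x => u x * lapl kap x) = fun x => \sum_i u x * partial i (partial i kap) x); last first.
  by apply/funext => x; rewrite /lapl mulr_sumr.
rewrite (Rintegral_sum _ measurableT (fun i _ => i3 i)) (Rintegral_sum _ measurableT (fun i _ => i2 i)).
by rewrite -sumrN; apply: eq_bigr => i _; rewrite e2 opprK.
Qed.

Implicit Types (psi : V -> R).

Lemma lipschitz_continuous_rV (a : V -> R) (L : R) : (forall x y, `|a x - a y| <= L * `|x - y|) -> continuous a.
Proof.
move=> hL x A /nbhs_ballP[e /= e0 hA]; apply/(@nbhs_ballP _ _ x).
exists (e / (`|L| + 1)) => /=; first by rewrite divr_gt0.
move=> y; rewrite rV_ballE /= ltr_pdivlMr// => xy; apply: hA; rewrite /ball /=.
apply: le_lt_trans (hL _ _) _; apply: le_lt_trans xy; rewrite mulrC ler_wpM2l//.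
by rewrite ler_wpDr// ler_norm.
Qed.

(** Points whose closed [r]-ball lies in [U]; mollifiers of radius at most [r] centred there are
    admissible test functions. *)
Definition inner (r : R) : set V := [set z | forall y, `|y - z| <= r -> U y].

Lemma Cc_reflect psi r z : Cc_smooth setT psi -> (forall x, r < `|x| -> psi x = 0) -> inner r z ->
  Cc_smooth U (fun x => psi (z - x)).
Proof.
move=> hpsi out zr.
rewrite (_ : (fun x => _) = fun x => psi (-1 *: x + z)); last first.
  by apply/funext => x; rewrite scaleN1r addrC.
apply: (@Cc_intro _ _ _ [set x : V | `|x - z| <= r]).
- by apply: smooth_affine; exact: Cc_smoothW hpsi.
- have cB := @compact_boxc R n (fun i => z ord0 i - r) (fun i => z ord0 i + r).
  apply: subclosed_compact cB _.
    rewrite (_ : [set _ | _] = (fun x : V => `|x - z|) @^-1` [set t | t <= r]); last by [].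
    apply: closed_comp => [x _|]; last exact: closed_le.
    apply: (@lipschitz_continuous_rV (fun y : V => `|y - z|) 1) => y1 y2; rewrite mul1r.
    by apply: le_trans (ler_dist_dist _ _) _; rewrite opprB addrA subrK.
  move=> x /= xz i; rewrite in_itv /=; have := le_trans (coord_le_norm (x - z) i) xz.
  by rewrite !mxE ler_norml; lra.
- by move=> x /= xz; exact: zr.
- move=> x h; apply: out; rewrite scaleN1r addrC distrC ltNge; apply/negP => xz; exact: h.
Qed.

(** Testing with the reflected function x -> psi(z - x) turns the weak equation into a pointwise one
    for the convolutions at [z]. *)
Lemma conv_equation psi r z : Cc_smooth setT psi -> (forall x, r < `|x| -> psi x = 0) -> inner r z ->
  rint mu (fun h => k h * (2 * conv u psi z - conv u psi (z + h) - conv u psi (z - h))) /\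
  - conv u (lapl psi) z +
    \int[mu]_h (k h * (2 * conv u psi z - conv u psi (z + h) - conv u psi (z - h))) = conv f psi z.
Proof.
move=> hpsi out zr; have hk := Cc_reflect hpsi out zr.
have [i1 e1] := weak_test hk.
have e2 h : \int[mu]_x (u x * diff2 (fun x => psi (z - x)) h x) =
    2 * conv u psi z - conv u psi (z + h) - conv u psi (z - h).
  rewrite /conv -RintegralZl//; last exact: rint_conv.
  rewrite -RintegralB; [|by []|by apply: rintZ; exact: rint_conv|exact: rint_conv].
  rewrite -RintegralB; [|by []|by apply: rintB; [apply: rintZ|]; exact: rint_conv|exact: rint_conv].
  apply: eq_Rintegral => x _; rewrite /diff2.
  rewrite (_ : z - (x + h) = z - h - x); last by rewrite opprD addrAC addrA.
  rewrite (_ : z - (x - h) = z + h - x); last by rewrite opprB addrA addrAC.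
  by ring.
have e3 x : lapl (fun x => psi (z - x)) x = lapl psi (z - x).
  rewrite {1}/lapl {1}[lapl psi]/lapl; apply: eq_bigr => i _.
  rewrite (_ : (fun x => psi (z - x)) = fun x => psi (-1 *: x + z)); last first.
    by apply/funext => y; rewrite scaleN1r addrC.
  have := dpart_affine [:: i; i] (-1) z (Cc_smoothW hpsi) => /(congr1 (@^~ x)) /= ->.
  by rewrite expr2 mulrNN mulr1 mul1r scaleN1r addrC.
split.
  by move: i1; congr rint; apply/funext => h; rewrite e2.
rewrite -[RHS]e1 /conv.
under [in RHS]eq_Rintegral => x _ do rewrite e3.
by congr (_ + _); apply: eq_Rintegral => h _; rewrite e2.
Qed.

Lemma inner_sub r z : 0 <= r -> inner r z -> U z.
Proof. by move=> r0; apply; rewrite subrr normr0. Qed.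

Definition far_average rho (x : V) : R := 2 * \int[mu]_h (ktail rho h * u (x + h)).

Lemma rint_far_average rho x : 0 < rho -> rint mu (fun h => ktail rho h * u (x + h)).
Proof.
move=> r0; apply: (rint_le _ _ (rintZ M (rint_ktail r0))).
  apply: measurable_funM; first exact: measurable_ktail.
  rewrite (_ : (fun h => _) = fun h => u (h + x)); last by apply/funext => h; rewrite addrC.
  exact: rint_measurable (integrable_add x iu).
move=> h; rewrite normrM (ger0_norm (ktail_ge0 _ _)) mulrC.
by rewrite ler_wpM2r// ktail_ge0.
Qed.

Lemma far_averageE rho x : 0 < rho -> far_average rho x = 2 * \int[mu]_y (ktail rho (y - x) * u y).
Proof.
move=> r0; congr (2 * _).
pose F (h : V) := ktail rho h * u (x + h).
have iF : rint mu F by exact: rint_far_average.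
rewrite -/F -(Rintegral_add (- x) iF); apply: eq_Rintegral => y _.
by rewrite /F [x + _]addrC subrK.
Qed.

Lemma far_average_bound rho : 0 < rho -> exists2 L : R, 0 <= L & forall x y,
  `|far_average rho x| <= L /\ `|far_average rho x - far_average rho y| <= L * `|x - y|.
Proof.
move=> r0.
pose I := \int[mu]_x `|u x|.
have I0 : 0 <= I by apply: Rintegral_ge0.
pose c1 := rho `^ (- pp); pose c2 := pp * rho `^ (- pp) / rho * n%:R.
have c10 : 0 <= c1 by exact: powR_ge0.
have c20 : 0 <= c2 by rewrite !mulr_ge0 ?powR_ge0 ?invr_ge0 ?(ltW r0) ?(ltW pp0).
have mk x : measurable_fun setT (fun y : V => ktail rho (y - x)).
  by apply: measurableT_comp; [exact: measurable_ktail|exact: measurable_add_rV].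
have ik x : rint mu (fun y => u y * ktail rho (y - x)).
  apply: (rint_le _ _ (rintZ c1 (rint_abs iu))).
    by apply: measurable_funM => //; exact: rint_measurable iu.
  move=> y; rewrite normrM mulrC ler_wpM2r// ger0_norm ?ktail_ge0//.
  exact: ktail_bound.
have E x : far_average rho x = 2 * \int[mu]_y (u y * ktail rho (y - x)).
  by rewrite far_averageE//; congr (2 * _); apply: eq_Rintegral => y _; rewrite mulrC.
exists (2 * (c1 + c2) * I); first by rewrite !mulr_ge0 ?addr_ge0.
move=> x y; split.
  rewrite E normrM ger0_norm// -mulrA ler_wpM2l//.
  apply: le_trans (Rintegral_remainder (C := c1) iu (mk x) _) _.
    by move=> t; rewrite ger0_norm ?ktail_ge0//; exact: ktail_bound.
  by rewrite ler_wpM2r// lerDl.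
rewrite !E -mulrBr -RintegralB//; [|exact: ik|exact: ik].
rewrite normrM ger0_norm//.
rewrite [leRHS](_ : _ = 2 * ((c1 + c2) * `|x - y| * I)); last by ring.
rewrite ler_wpM2l//.
under eq_Rintegral => t _ do rewrite -mulrBr.
apply: le_trans (Rintegral_remainder (C := c2 * `|x - y|) iu _ _) _.
- by apply: measurable_funB; exact: mk.
- move=> t; apply: le_trans (ktail_lip _ _ r0) _.
  by rewrite (_ : t - x - (t - y) = y - x) 1?(distrC y)//; rewrite opprB addrC addrA subrK.
- by rewrite ler_wpM2r// ler_wpM2r// lerDr.
Qed.


(** What the right-hand side becomes when the [ktail] part of the fractional operator is moved to
    it: the integral of ktail(h) (2 u(x) - u(x+h) - u(x-h)) is twice the mass of [ktail] times u(x),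
    minus [far_average]. *)
Definition truncated_rhs rho (x : V) : R :=
  (f x - 2 * (\int[mu]_h ktail rho h) * u x + far_average rho x) * \1_U x.

Lemma measurable_far_average rho : 0 < rho -> measurable_fun setT (far_average rho).
Proof.
move=> r0; have [L L0 hL] := far_average_bound r0.
by apply: continuous_measurable_rV; apply: (lipschitz_continuous_rV (L := L)) => x y; case: (hL x y).
Qed.

Lemma measurable_truncated_rhs rho : 0 < rho -> measurable_fun setT (truncated_rhs rho).
Proof.
move=> r0; apply: measurable_funM; last exact: measurable_indic.
apply: measurable_funD; last exact: measurable_far_average.
by apply: measurable_funB => //; apply: measurable_funM => //; exact: rint_measurable iu.
Qed.

Lemma truncated_rhs_bound rho : 0 < rho -> exists2 L : R, 0 <= L & forall x, `|truncated_rhs rho x| <= L.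
Proof.
move=> r0; have [L L0 hL] := far_average_bound r0.
set K := \int[mu]_h ktail rho h.
have M0 : 0 <= M by exact: le_trans (bu 0).
exists (M + `|2 * K| * M + L); first by rewrite !addr_ge0// mulr_ge0.
move=> x; rewrite /truncated_rhs -/K indicE; case: (x \in U); last first.
  by rewrite mulr0 normr0 !addr_ge0// mulr_ge0.
rewrite mulr1; apply: le_trans (ler_normD _ _) _; apply: lerD; last by case: (hL x x).
apply: le_trans (ler_normB _ _) _; apply: lerD => //.
by rewrite normrM ler_wpM2l.
Qed.

Lemma rint_truncated_rhs rho : 0 < rho -> rint mu (truncated_rhs rho).
Proof.
move=> r0; have [L L0 hL] := truncated_rhs_bound r0.
apply: (rint_bounded_zoff (C := L)); first exact: measurable_truncated_rhs.
  by move=> x Ux; rewrite /truncated_rhs indicE memNset// mulr0.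
by move=> x _.
Qed.

(** By Fubini's theorem, averaging the mollified function is mollifying the average. *)
Lemma conv_average psi rho z : Cc_smooth setT psi -> 0 < rho ->
  rint mu (fun h => ktail rho h * conv u psi (z + h)) /\
  2 * \int[mu]_h (ktail rho h * conv u psi (z + h)) = \int[mu]_x (far_average rho x * psi (z - x)) /\
  rint mu (fun x => far_average rho x * psi (z - x)).
Proof.
move=> hpsi r0.
pose F (p : V * V) : R := ktail rho p.1 * (u (p.2 + p.1) * psi (z - p.2)).
have ir : rint mu (fun x => psi (z - x)).
  by apply: integrable_sub; exact: bbs_integrable (Cc_bbs hpsi).
have mF : measurable_fun setT F.
  apply: measurable_funM; first by apply: measurableT_comp => //; exact: measurable_ktail.
  apply: measurable_funM.
    apply: (measurableT_comp (rint_measurable iu)).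
    apply: measurable_fun_rVP => i.
    rewrite (_ : _ \o _ = fun p : V * V => rV_coord i p.2 + rV_coord i p.1); last first.
      by apply/funext => p; rewrite /rV_coord /= !mxE.
    by apply: measurable_funD; apply: measurableT_comp => //; exact: measurable_rV_coord.
  exact: (measurableT_comp (rint_measurable ir) measurable_snd).
have [ip _] := rint_prod (rint_ktail r0) (rint_abs ir).
have iF : rint mu2 F.
  apply: (rint_le mF _ (rintZ M ip)) => p; rewrite /F !normrM (ger0_norm (ktail_ge0 _ _)).
  by rewrite [leRHS]mulrCA ler_wpM2l ?ktail_ge0// ler_wpM2r.
have iE : rint mu (fun x => far_average rho x * psi (z - x)).
  have [L L0 hL] := far_average_bound r0.
  apply: (rint_le _ _ (rintZ L (rint_abs ir))).
    by apply: measurable_funM; [exact: measurable_far_average|exact: rint_measurable ir].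
  by move=> x; rewrite normrM ler_wpM2r//; case: (hL x x).
have e1 h : \int[mu]_x F (h, x) = ktail rho h * conv u psi (z + h).
  have ic := rint_conv (z + h) iu hpsi.
  rewrite /F /= RintegralZl//.
    congr (_ * _); rewrite /conv -(Rintegral_add h ic); apply: eq_Rintegral => x _.
    by rewrite opprD addrACA subrr addr0.
  have := integrable_add h ic; congr (_.-integrable _ _); apply/funext => x /=.
  by rewrite opprD addrACA subrr addr0.
have e2 x : \int[mu]_h F (h, x) = 2^-1 * far_average rho x * psi (z - x).
  rewrite /far_average mulKf// -RintegralZr//; last exact: rint_far_average.
  by apply: eq_Rintegral => h _; rewrite /F mulrA.
split; last (split; [|exact: iE]).
  have C0 : forall x, `|conv u psi x| <= M * \int[mu]_x `|psi x| by move=> x; exact: conv_sup_bound.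
  apply: (rint_le _ _ (rintZ (M * \int[mu]_x `|psi x|) (rint_ktail r0))).
    apply: measurable_funM; first exact: measurable_ktail.
    rewrite (_ : (fun h => _) = fun h => conv u psi (1 *: h + z)); last by apply/funext => h; rewrite scale1r addrC.
    by apply: smooth_measurable; apply: smooth_affine; exact: smooth_conv.
  by move=> h; rewrite normrM ger0_norm ?ktail_ge0// mulrC ler_wpM2r// ktail_ge0.
have := rint_fubini iF.
under eq_Rintegral => h _ do rewrite e1.
move=> ->.
under eq_Rintegral => h _ do rewrite e2 -mulrA.
by rewrite RintegralZl// mulrA mulfV// mul1r.
Qed.

(** Only the kernel [levy] minus [ktail] is left, and it vanishes for |h| >= rho, so values within
    [rho] of [z] suffice. Below the scale [tau] second differences are bounded by A |h|^2, above it
    by B. *)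
Lemma truncated_equation rho psi r z (A B tau : R) : 0 < rho -> Cc_smooth setT psi ->
  (forall x, r < `|x| -> psi x = 0) -> inner r z -> 0 < tau -> 0 <= A -> 0 <= B ->
  (forall h, `|h| <= tau -> `|h| <= rho -> 
    `|2 * conv u psi z - conv u psi (z + h) - conv u psi (z - h)| <= A * `|h| ^+ 2) ->
  (forall h, `|h| <= rho -> `|2 * conv u psi z - conv u psi (z + h) - conv u psi (z - h)| <= B) ->
  `|conv u (lapl psi) z + conv (truncated_rhs rho) psi z| <=
    A * (tau `^ (2 - 2 * s) * near_const (n := n) s) + B * (tau `^ (- (2 * s)) * far_const (n := n) s).
Proof.
move=> r0 hpsi out zr t0 A0 B0 hA hB.
have [i1 e1] := conv_equation hpsi out zr.
have [i2 [e2 i2']] := conv_average z hpsi r0.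
have ik := rint_ktail r0.
pose D h := 2 * conv u psi z - conv u psi (z + h) - conv u psi (z - h).
rewrite -/(D _) in e1 i1.
set K := \int[mu]_h ktail rho h.
have i3 : rint mu (fun h => ktail rho h * conv u psi (z - h)).
  move: (integrable_sub 0 i2); congr rint; apply/funext => h /=.
  by rewrite sub0r ktailN.
have i4 : rint mu (fun h => ktail rho h * D h).
  rewrite (_ : (fun h => _) = fun h => 2 * conv u psi z * ktail rho h
     - ktail rho h * conv u psi (z + h) - ktail rho h * conv u psi (z - h)).
    by apply: rintB => //; apply: rintB => //; exact: rintZ.
  by apply/funext => h; rewrite /D; ring.
have e4 : \int[mu]_h (ktail rho h * D h) =
    2 * K * conv u psi z - \int[mu]_x (far_average rho x * psi (z - x)).
  rewrite (_ : (fun h => _) = fun h => 2 * conv u psi z * ktail rho h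
     - ktail rho h * conv u psi (z + h) - ktail rho h * conv u psi (z - h)); last first.
    by apply/funext => h; rewrite /D; ring.
  rewrite RintegralB; [|by []|by apply: rintB => //; exact: rintZ|exact: i3].
  rewrite RintegralB; [|by []|exact: rintZ|exact: i2].
  rewrite RintegralZl//.
  have -> : \int[mu]_h (ktail rho h * conv u psi (z - h)) = \int[mu]_h (ktail rho h * conv u psi (z + h)).
    rewrite -(Rintegral_sub 0 i2); apply: eq_Rintegral => h _.
    by rewrite sub0r ktailN.
  by rewrite -e2 -/K; ring.
have e5 : conv (truncated_rhs rho) psi z = conv f psi z - 2 * K * conv u psi z + \int[mu]_x (far_average rho x * psi (z - x)).
  have if1 := rint_conv z if_ hpsi; have iu1 := rint_conv z iu hpsi.
  rewrite /conv -RintegralZl//.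
  rewrite -RintegralB; [|by []|exact: if1|exact: rintZ].
  rewrite -RintegralD; [|by []|by apply: rintB => //; exact: rintZ|exact: i2'].
  apply: eq_Rintegral => x _; rewrite /truncated_rhs -/K.
  have [Ux|Ux] := pselect (U x); first by rewrite indicE mem_set//= mulr1; ring.
  rewrite (out (z - x)); first by rewrite !mulr0 subr0 addr0.
  by rewrite ltNge; apply/negP => h; apply: Ux; apply: zr; rewrite distrC.
have -> : conv u (lapl psi) z + conv (truncated_rhs rho) psi z = \int[mu]_h ((k h - ktail rho h) * D h).
  rewrite e5; under [RHS]eq_Rintegral => h _ do rewrite mulrBl.
  by rewrite RintegralB// e4; move: e1; rewrite -/D; lra.
have [in1 en1] := levy_near (n := n) s01 t0; have [if1 ef1] := levy_far (n := n) s01 t0.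
rewrite -en1 -ef1.
rewrite -RintegralZl// -RintegralZl// -RintegralD//; [|exact: rintZ|exact: rintZ].
have i5 : rint mu (fun h => (k h - ktail rho h) * D h).
  rewrite (_ : (fun h => _) = fun h => k h * D h - ktail rho h * D h); last first.
    by apply/funext => h; rewrite mulrBl.
  exact: rintB.
apply: le_trans (le_normr_Rintegral measurableT i5) _.
apply: le_rint; first exact: rint_abs.
  by apply: rintD; exact: rintZ.
move=> h.
have rhs0 : 0 <= A * (`|h| ^+ 2 * k h * \1_[set h : V | `|h| <= tau] h) + B * (k h * \1_[set h : V | tau < `|h|] h).
  by rewrite addr_ge0// !mulr_ge0 ?levy_ge0.
have [rh|hr] := leP rho `|h|; first by rewrite ktail_far// subrr mul0r normr0.
have [->|h0] := eqVneq h 0.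
  rewrite (_ : D 0 = 0); last by rewrite /D addr0 subr0; ring.
  by rewrite mulr0 !normr0 expr0n /= !mul0r mulr0 add0r !mulr_ge0// levy_ge0.
have k1 : 0 <= k h - ktail rho h by rewrite subr_ge0 ktail_le.
have k2 : k h - ktail rho h <= k h by rewrite gerBl ktail_ge0.
rewrite normrM (ger0_norm k1) !indicE.
have [ht|ht] := leP `|h| tau.
  rewrite mem_set// memNset; last by rewrite /= ltNge ht.
  rewrite !mulr0 addr0 mulr1 mulrA mulrC.
  by apply: ler_pM => //; apply: hA => //; exact: ltW.
rewrite memNset; last by rewrite /= leNgt ht.
rewrite mem_set// !mulr0 add0r mulr1 mulrC.
by apply: ler_pM => //; apply: hB; exact: ltW.
Qed.

End truncated.

Section power_growth.
Context {R : realType}.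

Lemma derive_compare (G G' H H' : R -> R) (t0 a b : R) :
  (forall t : R, 0 < t -> is_derive t (1 : R) G (G' t)) -> (forall t : R, 0 < t -> is_derive t (1 : R) H (H' t)) ->
  (forall t, 0 < t <= t0 -> `|G' t| <= H' t) -> 0 < a -> a <= b -> b <= t0 -> `|G b - G a| <= H b - H a.
Proof.
move=> dG dH GH a0 ab bt.
have key (K K' : R -> R) : (forall t : R, 0 < t -> is_derive t (1 : R) K (K' t)) ->
    (forall t, 0 < t <= t0 -> 0 <= K' t) -> 0 <= K b - K a.
  move=> dK K0.
  have [x|//|c] := @MVT_segment R K K' a b ab.
  - by rewrite in_itv /= => /andP[ax _]; apply: dK; exact: lt_trans ax.
  - apply: derivable_within_continuous => x; rewrite in_itv /= => /andP[ax _].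
    by have [] := dK x (lt_le_trans a0 ax).
  rewrite in_itv /= => /andP[ac cb] ->; rewrite mulr_ge0 ?subr_ge0//; apply: K0.
  by rewrite (lt_le_trans a0 ac) (le_trans cb bt).
have h1 := key (fun t => H t - G t) (fun t => H' t - G' t).
have h2 := key (fun t => H t + G t) (fun t => H' t + G' t).
have {}h1 : 0 <= H b - G b - (H a - G a).
  apply: h1 => t t0'; first by apply: is_deriveB; [exact: dH|exact: dG].
  by rewrite subr_ge0; apply: le_trans (GH _ t0'); exact: ler_norm.
have {}h2 : 0 <= H b + G b - (H a + G a).
  apply: h2 => t t0'; first by apply: is_deriveD; [exact: dH|exact: dG].
  by rewrite -lerBlDr sub0r; apply: le_trans (GH _ t0'); rewrite -normrN ler_norm.
by rewrite ler_norml; move: h1 h2; lra.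
Qed.

(** Used with p < 0, where the bound at a small scale comes from the value at a fixed scale, and
    with p > 0, where it makes a mollified function converge as the scale tends to 0. *)
Lemma powR_growth (G G' : R -> R) (C p t0 a b : R) : p != 0 ->
  (forall t : R, 0 < t -> is_derive t (1 : R) G (G' t)) ->
  (forall t, 0 < t <= t0 -> `|G' t| <= C * t `^ (p - 1)) -> 0 < a -> a <= b -> b <= t0 ->
  `|G b - G a| <= C / p * (b `^ p - a `^ p).
Proof.
move=> p0 dG hG a0 ab bt; rewrite mulrBr.
apply: (@derive_compare G G' (fun t => C / p * t `^ p) _ t0 a b dG _ hG a0 ab bt) => t t1.
have h := is_derive1_powR p t1.
have := is_deriveZ (C / p) h; congr is_derive.
by rewrite /GRing.scale /= mulrA divfK.
Qed.

Lemma powR_le_exp (t a b : R) : 0 < t <= 1 -> a <= b -> t `^ b <= t `^ a.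
Proof.
move=> /andP[t0 t1] ab; rewrite /powR gt_eqF// ler_expR ler_wnM2r//.
by rewrite ln_le0.
Qed.

Lemma powR_le_base (t r b : R) : 0 < t -> t <= r -> 0 <= b -> t `^ b <= r `^ b.
Proof. by move=> t0 tr b0; apply: ge0_ler_powR => //; rewrite nnegrE; lra. Qed.

End power_growth.

Section diff2.
Context {R : realType}.
Implicit Types a b c m : R.

Lemma diff2_opp a b c : 2 * a - b - c = - (b + c - 2 * a).
Proof. by ring. Qed.

Lemma diff2_le4 a b c m : `|a| <= m -> `|b| <= m -> `|c| <= m -> `|2 * a - b - c| <= 4 * m.
Proof. by rewrite !ler_norml; lra. Qed.

End diff2.

(** * Interior regularity *)
Section decays.
Context {R : realType} {n : nat}.
Local Notation V := 'rV[R]_n.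
Local Notation mu := (leb R n).
Implicit Types (a u phi zeta : V -> R) (x y z : V) (t r : R) (l : seq 'I_n) (P Q : R -> R).

Lemma dpart_rad_out P l x : profile P -> 1 < `|x| -> dpart l (rad P) x = 0.
Proof.
move=> hP; pose K : set V := [set x | `|x| <= 1].
have : forall x, ~ K x -> dpart l (rad P) x = 0.
  elim: l => [|i l IH] /= y yK; first by apply: rad_out => //; rewrite ltNge; apply/negP.
  have sm : smooth (dpart l (rad P)) by apply: smooth_dpart; apply: smooth_rad; case: hP.
  exact: (compactly_supported_partial i (@closed_norm_le R n 1) sm IH).
by move=> h x1; apply: h; rewrite /K /= leNgt x1.
Qed.

Lemma Cc_dpart_rad P l : profile P -> Cc_smooth setT (dpart l (rad P) : V -> R).
Proof. by move=> hP; apply: Cc_dpart; exact: Cc_rad. Qed.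

Lemma dilate_add (N k : nat) t zeta : dilate (N + k) t zeta = fun y => t^-1 ^+ k * dilate N t zeta y.
Proof. by apply/funext => y; rewrite /dilate exprD mulrCA mulrA. Qed.

Lemma dpart_dilate (N : nat) t zeta l : smooth zeta ->
  dpart l (dilate N t zeta) = dilate (N + size l) t (dpart l zeta).
Proof.
move=> sz; elim: l => [|i l IH] /=; first by rewrite addn0.
by rewrite IH partial_dilate ?addnS//; exact: smooth_dpart.
Qed.

Lemma dpart_conv u phi l : rint mu u -> Cc_smooth setT phi -> dpart l (conv u phi) = conv u (dpart l phi).
Proof.
move=> iu hphi; elim: l => [|i l IH] //=; rewrite IH partial_conv//.
by apply: Cc_dpart.
Qed.

Lemma conv_dilate_add u (N k : nat) t zeta z : rint mu u -> Cc_smooth setT zeta -> 0 < t ->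
  conv u (dilate (N + k) t zeta) z = t^-1 ^+ k * conv u (dilate N t zeta) z.
Proof. by move=> iu hz t0; rewrite dilate_add convZ//; exact: Cc_dilate. Qed.

Lemma Rintegral_dilate t zeta : 0 < t -> rint mu zeta -> \int[mu]_x dilate n t zeta x = \int[mu]_x zeta x.
Proof.
move=> t0 iz; rewrite /dilate RintegralZl//; last by apply: integrable_scale => //; rewrite invr_gt0.
by rewrite Rintegral_scale// invr_gt0.
Qed.

Lemma norm_dilate N t zeta x : 0 < t -> `|dilate N t zeta x| = dilate N t (fun y => `|zeta y|) x.
Proof. by move=> t0; rewrite /dilate normrM ger0_norm// exprn_ge0// invr_ge0 ltW. Qed.

Lemma Cc_rint phi : Cc_smooth setT phi -> rint mu phi.
Proof. by move=> h; exact: bbs_integrable (Cc_bbs h). Qed.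

Lemma Rintegral_norm_dilate t zeta : 0 < t -> Cc_smooth setT zeta ->
  \int[mu]_x `|dilate n t zeta x| = \int[mu]_x `|zeta x|.
Proof.
move=> t0 hz; rewrite -(Rintegral_dilate t0 (rint_abs (Cc_rint hz))).
by apply: eq_Rintegral => x _; exact: norm_dilate.
Qed.

Variables (U : set V) (oU : open U) (bU : norm_bounded U).

(* Decay of the mollifications of derivatives: for [a] of class [C^beta] it holds as soon as the
   number of derivatives exceeds [beta]. *)
Definition decays a (beta : R) (m : nat) := forall P l r, profile P -> (m <= size l)%N -> 0 < r ->
  exists2 C : R, 0 <= C & forall z t, inner U r z -> 0 < t <= 1 ->
    `|conv a (dilate n t (dpart l (rad P))) z| <= C * t `^ beta.

Definition bounded_rint a := rint mu a /\ exists M : R, forall x, `|a x| <= M.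

Lemma conv_dilate_bound a zeta : bounded_rint a -> Cc_smooth setT zeta ->
  exists2 C : R, 0 <= C & forall z t, 0 < t -> `|conv a (dilate n t zeta) z| <= C.
Proof.
move=> [ia [M aM]] hz; exists (M * \int[mu]_x `|zeta x|).
  by apply: mulr_ge0; [exact: le_trans (aM 0)|apply: Rintegral_ge0].
move=> z t t0; rewrite -(Rintegral_norm_dilate t0 hz); apply: conv_sup_bound => //.
exact: Cc_dilate.
Qed.

Lemma decays0 a m : bounded_rint a -> decays a 0 m.
Proof.
move=> ha P l r hP _ _; have [C C0 hC] := conv_dilate_bound ha (Cc_dpart_rad l hP).
by exists C => // z t _ /andP[t0 _]; rewrite powRr0 mulr1; exact: hC.
Qed.

(** Above the threshold [t0] the convolutions are merely bounded, which is enough there. *)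
Lemma decays_small a P l r (beta C t0 : R) : bounded_rint a -> profile P -> 0 < t0 <= 1 -> 0 <= C -> 0 <= beta ->
  (forall z t, inner U r z -> 0 < t <= t0 -> `|conv a (dilate n t (dpart l (rad P))) z| <= C * t `^ beta) ->
  exists2 C' : R, 0 <= C' & forall z t, inner U r z -> 0 < t <= 1 ->
    `|conv a (dilate n t (dpart l (rad P))) z| <= C' * t `^ beta.
Proof.
move=> ha hP /andP[t00 t01] C0 b0 hC; have [D D0 hD] := conv_dilate_bound ha (Cc_dpart_rad l hP).
exists (C + D * t0 `^ (- beta)); first by rewrite addr_ge0// mulr_ge0// powR_ge0.
move=> z t zr /andP[tp t1]; rewrite mulrDl.
have [tt0|/ltW t0t] := leP t t0.
  apply: le_trans (hC _ _ zr _) _; first by rewrite tp.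
  by rewrite lerDl !mulr_ge0 ?powR_ge0.
apply: le_trans (hD z t tp) _; apply: ler_wpDl; first by rewrite mulr_ge0// powR_ge0.
rewrite -mulrA ler_peMr// powRN mulrC ler_pdivlMr ?powR_gt0// mul1r.
exact: powR_le_base.
Qed.

Definition holder_inner (a : V -> R) (beta : R) := forall r, 0 < r -> exists2 C : R, 0 <= C &
  forall x y, inner U r x -> inner U r y -> `|x - y| <= 1 -> `|a x - a y| <= C * `|x - y| `^ beta.

Lemma inner_near r z y (q : R) : inner U r z -> `|y - z| <= q -> inner U (r - q) y.
Proof.
move=> zr yz x xy; apply: zr.
have -> : x - z = (x - y) + (y - z) by rewrite addrA subrK.
by apply: le_trans (ler_normD _ _) _; move: xy yz; lra.
Qed.

Lemma inner_le r r' z : r' <= r -> inner U r z -> inner U r' z.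
Proof. by move=> rr zr y yz; apply: zr; exact: le_trans rr. Qed.

(** A derivative of the mollifier has integral 0, so a(x) may be replaced by a(x) - a(z), and only
    points within [t] of [z] contribute. *)
Lemma decays_holder a (beta : R) : bounded_rint a -> 0 <= beta -> holder_inner a beta -> decays a beta 1.
Proof.
move=> ha b0 hh P l r hP l1 r0.
have hz := Cc_dpart_rad l hP; set zeta := dpart l (rad P) in hz *.
have r20 : 0 < r / 2 by rewrite divr_gt0.
have [C C0 hC] := hh _ r20.
have t0P : 0 < Num.min 1 (r / 2) by rewrite lt_min ltr01.
apply: (@decays_small a P l r beta (C * \int[mu]_x `|zeta x|) (Num.min 1 (r / 2))) => //.
- by rewrite t0P ge_min lexx.
- by apply: mulr_ge0 => //; apply: Rintegral_ge0.
move=> z t zr /andP[t0]; rewrite le_min => /andP[t1 tr].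
have hd := Cc_dilate n t0 hz.
have ia := ha.1.
have i1 : rint mu (fun x => dilate n t zeta (z - x)) by apply: integrable_sub; exact: Cc_rint.
have z0 : \int[mu]_x dilate n t zeta (z - x) = 0.
  rewrite (Rintegral_sub z (Cc_rint hd)) Rintegral_dilate//; last exact: Cc_rint.
  rewrite /zeta; case: (l) l1 => [//|i l'] _ /=.
  by apply: (Rintegral_partial0 (U := setT)); exact: Cc_dpart_rad.
have ic := rint_conv z ia hd.
have -> : conv a (dilate n t zeta) z = \int[mu]_x ((a x - a z) * dilate n t zeta (z - x)).
  under [RHS]eq_Rintegral => x _ do rewrite mulrBl.
  rewrite RintegralB; [|by []|exact: ic|exact: rintZ].
  by rewrite RintegralZl// z0 mulr0 subr0.
have i2 : rint mu (fun x => (a x - a z) * dilate n t zeta (z - x)).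
  rewrite (_ : (fun x => _) = fun x => a x * dilate n t zeta (z - x) - a z * dilate n t zeta (z - x)).
    by apply: rintB => //; exact: rintZ.
  by apply/funext => x; rewrite mulrBl.
apply: le_trans (le_normr_Rintegral measurableT i2) _.
rewrite -(Rintegral_norm_dilate t0 hz) -(Rintegral_sub z (rint_abs (Cc_rint hd))).
rewrite mulrAC -RintegralZl//; last exact: rint_abs.
apply: le_rint; [exact: rint_abs|by apply: rintZ; exact: rint_abs|].
move=> x; rewrite normrM.
have [zx|zx] := leP `|z - x| t; last first.
  rewrite (_ : dilate n t zeta (z - x) = 0) ?normr0 ?mulr0//.
  apply: (@dilate_out _ _ n t zeta 1) => //; last by rewrite mulr1.
  by move=> y; exact: dpart_rad_out.
rewrite ler_wpM2r//.
have xr : inner U (r / 2) x.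
  by apply: inner_le (inner_near zr (_ : `|x - z| <= r / 2)); [lra|rewrite distrC (le_trans zx)].
have zr' : inner U (r / 2) z by apply: inner_le zr; lra.
have xz1 : `|x - z| <= 1 by rewrite distrC (le_trans zx).
apply: le_trans (hC _ _ xr zr' xz1) _; rewrite ler_wpM2l// distrC.
have [->|xz] := eqVneq z x; last by apply: powR_le_base => //; rewrite normr_gt0 subr_eq0.
rewrite subrr normr0; have [->|b1] := eqVneq beta 0; first by rewrite !powRr0.
by rewrite powR0// powR_ge0.
Qed.

End decays.

Section regularity.
Context {R : realType} {n : nat}.
Local Notation V := 'rV[R]_n.
Local Notation mu := (leb R n).
Implicit Types (a phi zeta : V -> R) (x y z : V) (t r : R) (l : seq 'I_n) (P Q : R -> R).

Lemma finite_bound (I : finType) (Phi : I -> R -> Prop) :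
  (forall i C C', C <= C' -> Phi i C -> Phi i C') -> (forall i, exists2 C, 0 <= C & Phi i C) ->
  exists2 C, 0 <= C & forall i, Phi i C.
Proof.
move=> mono ex.
have /choice[c hc] : forall i, exists C, 0 <= C /\ Phi i C by move=> i; have [C ? ?] := ex i; exists C.
exists (\sum_i c i); first by apply: sumr_ge0 => i _; case: (hc i).
move=> i; apply: mono (hc i).2; rewrite (bigD1 i)//= lerDl.
by apply: sumr_ge0 => j _; case: (hc j).
Qed.

Lemma exprV_powR t (N : nat) : 0 < t -> t^-1 ^+ N = t `^ (- N%:R).
Proof. by move=> t0; rewrite powRN powR_nat// exprVn. Qed.

Lemma lapl_dilate (N : nat) t zeta : smooth zeta -> lapl (dilate N t zeta) = dilate N.+2 t (lapl zeta).
Proof.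
move=> sz; apply/funext => y.
transitivity (\sum_(i < n) dilate N.+2 t (partial i (partial i zeta)) y); last first.
  by rewrite /dilate /lapl mulr_sumr.
rewrite /lapl; apply: eq_bigr => i _; by rewrite partial_dilate// partial_dilate//; exact: smooth_partial.
Qed.


(** Because -euler is a Laplacian and the Laplacian of a dilate gains two powers of 1/t where the
    derivative in [t] gains one, the factor [t] remains. *)
Lemma conv_rad_derive u P Q l z t : rint mu u -> profile P -> profile Q ->
  (forall r : R, is_derive r (1 : R) Q (- 2^-1 * P r)) -> 0 < t ->
  is_derive t (1 : R) (fun t => conv u (dilate (n + size l) t (dpart l (rad P))) z)
    (t * conv u (lapl (dilate (n + size l) t (dpart l (rad Q)))) z).
Proof.
move=> iu hP hQ dQ t0.
have hzP := Cc_dpart_rad l hP : Cc_smooth setT (dpart l (rad P) : V -> R).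
have hzQ := Cc_dpart_rad l hQ : Cc_smooth setT (dpart l (rad Q) : V -> R).
have hL := Cc_lapl hzQ.
have := conv_dilate_is_derive (n + size l) z iu hzP t0.
rewrite (euler_dpart l hP hQ dQ) lapl_dilate; last exact: Cc_smoothW hzQ.
rewrite -[X in dilate X t (lapl _)]addn1 conv_dilate_add// expr1 mulrA divff ?gt_eqF// mul1r.
rewrite (_ : (fun x => - lapl _ x) = fun x => (-1) * lapl (dpart l (rad Q)) x); last first.
  by apply/funext => x; rewrite mulN1r.
rewrite (_ : dilate _ _ (fun x => -1 * _) = fun x => -1 * dilate (n + size l).+1 t (lapl (dpart l (rad Q))) x); last first.
  by apply/funext => x; rewrite /dilate mulrCA.
by rewrite convZ ?mulN1r ?opprK//; exact: Cc_dilate.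
Qed.

Variables (s : R) (s01 : 0 < s < 1) (n0 : (0 < n)%N).
Variables (U : set V) (oU : open U) (bU : norm_bounded U).
Variables (f u : V -> R) (d : 'I_n -> V -> R) (M : R).
Hypotheses (hs : weak_sol U s f u d) (mf : measurable_fun setT f) (fU : zoff U f).
Hypotheses (bf : forall x, `|f x| <= M) (bu : forall x, `|u x| <= M).
Let hud : h10 U u d. Proof. by case: hs. Qed.
Let iu : rint mu u. Proof. exact: (h10_rint oU bU hud). Qed.
Let bru : bounded_rint u. Proof. by split=> //; exists M. Qed.
Local Notation F := (truncated_rhs s U f u).

Lemma decays_second a l P r (beta : R) m : decays U a beta m -> rint mu a -> profile P -> (m <= size l)%N -> 0 < r ->
  exists2 C : R, 0 <= C & forall i j z t, inner U r z -> 0 < t <= 1 ->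
    `|conv a (dilate n t (dpart [:: i, j & l] (rad P))) z| <= C * t `^ beta.
Proof.
move=> ha ia hP lm r0.
have [|[i j]|C C0 hC] := @finite_bound ('I_n * 'I_n)%type (fun ij C => forall z t, inner U r z -> 0 < t <= 1 ->
    `|conv a (dilate n t (dpart [:: ij.1, ij.2 & l] (rad P))) z| <= C * t `^ beta).
- move=> ij C C' CC h z t zr t1; apply: le_trans (h _ _ zr t1) _.
  by rewrite ler_wpM2r// powR_ge0.
- exact: (ha P [:: i, j & l] r hP (leqW (leqW lm)) r0).
- by exists C => // i j; exact: (hC (i, j)).
Qed.

(** Let G(t) be the mollified derivative of order L = |l|. Its derivative is [t] times a Laplacian,
    which the truncated equation bounds by the fractional part, of order t^(-L+beta-2s), and the
    right-hand side, of order t^(-L+sigma). Hence G' is O(t^(beta'-L-1)); since beta' < L,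
    integration down from a fixed scale gives G = O(t^(beta'-L)). *)
Lemma decays_step (beta sigma beta' : R) m : 0 <= beta' ->
  decays U u beta m -> (forall rho, 0 < rho -> decays U (F rho) sigma m) ->
  beta' <= beta + (2 - 2 * s) -> beta' <= 2 + sigma -> beta' < m%:R -> decays U u beta' m.
Proof.
move=> b'0 hu hF b1 b2 bm P l r hP lm r0.
set L := size l in lm *.
have bL : beta' < L%:R by apply: lt_le_trans bm _; rewrite ler_nat.
(* Second differences with |h| <= rho involve points within 2 rho = r/2 of [z], where the assumed
   decay is available. *)
pose rho := r / 4; have rho0 : 0 < rho by rewrite divr_gt0.
have r20 : 0 < r / 2 by rewrite divr_gt0.
have [Q hQ dQ] := profile_primitive hP.
have dG z t := @conv_rad_derive u P Q l z t iu hP hQ dQ.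
have [C2 C20 hC2] := decays_second hu iu hQ lm r20.
have [C0 C00 hC0] := hu Q l _ hQ lm r20.
have [CF CF0 hCF] := hF rho rho0 Q l _ hQ lm r0.
set near := near_const (n := n) s; set far := far_const (n := n) s.
have near0 : 0 <= near by exact: near_const_ge0.
have far0 : 0 <= far by exact: far_const_ge0.
pose K := n%:R ^+ 2 * C2 * near + 4 * C0 * far + CF.
have K0 : 0 <= K by rewrite !addr_ge0// !mulr_ge0.
have hz := Cc_dpart_rad l hQ : Cc_smooth setT (dpart l (rad Q) : V -> R).
have sz := Cc_smoothW hz.
have t0P : 0 < Num.min 1 r by rewrite lt_min ltr01.
have key z t : inner U r z -> 0 < t <= Num.min 1 r ->
    `|conv u (lapl (dilate (n + L) t (dpart l (rad Q)))) z| <= K * (t `^ (- L%:R) * t `^ (- 2) * t `^ beta').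
  move=> zr /andP[t0]; rewrite le_min => /andP[t1 tr].
  have t01 : 0 < t <= 1 by rewrite t0.
  set psi := dilate (n + L) t _.
  have hpsi : Cc_smooth setT psi by exact: Cc_dilate.
  have out x : r < `|x| -> psi x = 0.
    move=> rx; apply: (@dilate_out _ _ _ t _ 1) => //; last by rewrite mulr1; exact: le_lt_trans rx.
    by move=> y; exact: dpart_rad_out.
  have scale (k : nat) (zeta : V -> R) z' : Cc_smooth setT zeta ->
      conv u (dilate (n + k) t zeta) z' = t `^ (- k%:R) * conv u (dilate n t zeta) z'.
    by move=> h; rewrite conv_dilate_add// exprV_powR.
  have tL0 : 0 <= t `^ (- L%:R) by exact: powR_ge0.
  pose A := n%:R ^+ 2 * (t `^ (- (L.+2)%:R) * (C2 * t `^ beta)).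
  pose B := 4 * (t `^ (- L%:R) * (C0 * t `^ beta)).
  have inz q y : `|y - z| <= q -> q <= r / 2 -> inner U (r / 2) y.
    move=> yz qr; apply: inner_le (inner_near zr yz); lra.
  have hA h : `|h| <= rho -> `|2 * conv u psi z - conv u psi (z + h) - conv u psi (z - h)| <= A * `|h| ^+ 2.
    move=> hr.
    have M0 : 0 <= t `^ (- (L.+2)%:R) * (C2 * t `^ beta) by rewrite !mulr_ge0 ?powR_ge0.
    have := @smooth_diff2_local _ _ (conv u psi) z h _ (smooth_conv iu hpsi) M0.
    rewrite diff2_opp normrN.
    rewrite /A [n%:R ^+ 2 * _ * _]mulrA.
    apply=> i j y hy.
    rewrite partial_conv// partial_conv//; last exact: Cc_partial.
    have := dpart_dilate (n + L) t [:: i; j] sz; rewrite /= => ->.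
    rewrite -addnA addn2 scale; last exact: (Cc_dpart_rad [:: i, j & l] hQ).
    rewrite normrM (ger0_norm (powR_ge0 _ _)) ler_wpM2l ?powR_ge0//.
    apply: (hC2 i j y t _ t01); apply: inz hy _; rewrite /rho in hr; move: hr; lra.
  have hB h : `|h| <= rho -> `|2 * conv u psi z - conv u psi (z + h) - conv u psi (z - h)| <= B.
    move=> hr.
    have c y : `|y - z| <= rho -> `|conv u psi y| <= t `^ (- L%:R) * (C0 * t `^ beta).
      move=> yz; rewrite /psi scale// normrM (ger0_norm (powR_ge0 _ _)) ler_wpM2l//.
      by apply: hC0 => //; apply: inz yz _; rewrite /rho; lra.
    have c1 := c z; have c2 := c (z + h); have c3 := c (z - h).
    rewrite subrr normr0 in c1; rewrite [z + h]addrC addrK in c2; rewrite addrAC subrr sub0r normrN in c3.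
    rewrite [h + z]addrC in c2.
    have {}c1 := c1 (ltW rho0); have {}c2 := c2 hr; have {}c3 := c3 hr.
    exact: (diff2_le4 c1 c2 c3).
  have A0 : 0 <= A by rewrite !mulr_ge0 ?powR_ge0.
  have B0 : 0 <= B by rewrite !mulr_ge0 ?powR_ge0.
  (* The splitting scale [tau] is the mollification scale [t]: there the second difference bound and
     the sup bound contribute the same power. *)
  have := truncated_equation s01 oU bU hs mf fU bf bu rho0 hpsi out zr t0 A0 B0 (fun h _ => hA h) hB.
  have cF : `|conv (F rho) psi z| <= t `^ (- L%:R) * (CF * t `^ sigma).
    have iF := rint_truncated_rhs s01 oU bU hs mf bf bu rho0.
    rewrite /psi (conv_dilate_add n L z iF hz t0).
    by rewrite exprV_powR// normrM (ger0_norm (powR_ge0 _ _)) ler_wpM2l//; exact: hCF.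
  have p1 : t `^ beta * t `^ (2 - 2 * s) <= t `^ beta'.
    by rewrite -(powR_add _ _ t0); exact: powR_le_exp t01 b1.
  have p2 : t `^ beta * t `^ (- (2 * s)) <= t `^ (- 2) * t `^ beta'.
    by rewrite -!(powR_add _ _ t0); apply: (powR_le_exp t01); move: b1; lra.
  have p3 : t `^ sigma <= t `^ (- 2) * t `^ beta'.
    by rewrite -!(powR_add _ _ t0); apply: (powR_le_exp t01); move: b2; lra.
  have p4 : t `^ (- (L.+2)%:R) = t `^ (- L%:R) * t `^ (- 2).
    by rewrite -(powR_add _ _ t0); congr (_ `^ _); rewrite -natr1 -natr1; ring.
  set X := t `^ (- L%:R) in tL0 cF p4 *; set Y := t `^ (- 2) in p2 p3 p4 *; set Z := t `^ beta' in p1 p2 p3 *.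
  have Y0 : 0 <= Y by exact: powR_ge0.
  have q1 : A * (t `^ (2 - 2 * s) * near) <= n%:R ^+ 2 * C2 * near * (X * Y * Z).
    rewrite /A p4 [leLHS](_ : _ = n%:R ^+ 2 * C2 * near * (X * Y * (t `^ beta * t `^ (2 - 2 * s)))); last by ring.
    by rewrite ler_wpM2l ?mulr_ge0// ler_wpM2l ?mulr_ge0.
  have q2 : B * (t `^ (- (2 * s)) * far) <= 4 * C0 * far * (X * Y * Z).
    rewrite /B -/X [leLHS](_ : _ = 4 * C0 * far * (X * (t `^ beta * t `^ (- (2 * s))))); last by ring.
    by rewrite -[X * Y * Z]mulrA ler_wpM2l ?mulr_ge0// ler_wpM2l.
  have q3 : X * (CF * t `^ sigma) <= CF * (X * Y * Z).
    by rewrite mulrCA ler_wpM2l// -mulrA ler_wpM2l.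
  have := ler_normB (conv u (lapl psi) z + conv (F rho) psi z) (conv (F rho) psi z); rewrite addrK => g h.
  by rewrite /K 2!mulrDl; move: g h cF q1 q2 q3; rewrite -/near -/far; lra.
have ha := Cc_dpart_rad l hP : Cc_smooth setT (dpart l (rad P) : V -> R).
have [D D0 hD] := conv_dilate_bound bru ha.
set t0 := Num.min 1 r in t0P key *.
(* The exponent is negative, so the fixed scale contributes a bounded term, dominated by t^p. *)
pose p := beta' - L%:R; have p0 : p < 0 by rewrite subr_lt0.
apply: (@decays_small _ _ U u P l r beta' (D * t0 `^ (- L%:R) + K / (- p)) t0) => //.
- by rewrite t0P ge_min lexx.
- by rewrite addr_ge0// ?mulr_ge0 ?powR_ge0// invr_ge0 oppr_ge0 ltW.
move=> z t zr /andP[tp tt0].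
have t1 : t <= 1 by apply: le_trans tt0 _; rewrite ge_min lexx.
pose G t := conv u (dilate (n + L) t (dpart l (rad P))) z.
have eG t' : 0 < t' -> G t' = t' `^ (- L%:R) * conv u (dilate n t' (dpart l (rad P))) z.
  by move=> t'0; rewrite /G conv_dilate_add// exprV_powR.
have pn0 : p != 0 by rewrite lt_eqF.
have := fun h => @powR_growth _ G _ K p t0 t t0 pn0 (dG z) h tp tt0 (lexx _).
have e1 (x : R) : 0 < x -> x `^ (p - 1) = x * (x `^ (- L%:R) * x `^ (- 2) * x `^ beta').
  move=> x0; rewrite -!(powR_add _ _ x0) -{2}[x](powRr1 (ltW x0)) -(powR_add _ _ x0); congr (_ `^ _).
  by rewrite /p; ring.
move=> hG.
have {}hG : `|G t0 - G t| <= K / p * (t0 `^ p - t `^ p).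
  apply: hG => x /andP[x0 xt]; rewrite e1// normrM gtr0_norm//.
  rewrite [leRHS]mulrCA ler_wpM2l ?(ltW x0)//; apply: key => //.
  by rewrite x0.
have {}hG : `|G t| <= t0 `^ (- L%:R) * D + K / (- p) * t `^ p.
  have g0 : `|G t0| <= t0 `^ (- L%:R) * D.
    by rewrite eG// normrM (ger0_norm (powR_ge0 _ _)) ler_wpM2l ?powR_ge0//; exact: hD.
  have g1 : K / p * (t0 `^ p - t `^ p) <= K / (- p) * t `^ p.
    rewrite invrN mulrN mulNr mulrBr lerBlDr addNr.
    by rewrite mulr_le0_ge0 ?powR_ge0// mulr_ge0_le0// invr_le0 ltW.
  rewrite -[G t](subKr (G t0)); apply: le_trans (ler_normB _ _) _.
  by move: hG g0 g1; lra.
have -> : conv u (dilate n t (dpart l (rad P))) z = t `^ L%:R * G t.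
  by rewrite eG// mulrA -powR_add// addrN powRr0 mul1r.
rewrite normrM (ger0_norm (powR_ge0 _ _)).
apply: le_trans (_ : t `^ L%:R * (t0 `^ (- L%:R) * D + K / (- p) * t `^ p) <= _).
  by rewrite ler_wpM2l ?powR_ge0.
rewrite [leLHS]mulrDr [leRHS]mulrDl; apply: lerD.
  rewrite [leRHS]mulrC [D * _]mulrC ler_wpM2r//; first by rewrite mulr_ge0 ?powR_ge0.
  by apply: powR_le_exp; [rewrite tp|exact: ltW].
rewrite mulrCA -powR_add// (_ : L%:R + p = beta'); last by rewrite /p; ring.
by [].
Qed.

(** Each application of the step gains 2 - 2s > 0 until the cap [B] is reached, so finitely many
    suffice. *)
Lemma decays_iter (sigma B : R) m : 0 <= B -> B <= 2 + sigma -> B < m%:R ->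
  (forall rho, 0 < rho -> decays U (F rho) sigma m) -> decays U u B m.
Proof.
move=> B0 Bs Bm hF.
have s2 : 0 < 2 - 2 * s by have /andP[_ s1] := s01; lra.
have H (N : nat) : decays U u (Num.min B (N%:R * (2 - 2 * s))) m.
  elim: N => [|N IH]; first by rewrite mul0r min_r//; exact: decays0.
  apply: (decays_step _ IH hF).
  - by rewrite le_min B0 mulr_ge0// ltW.
  - rewrite -natr1 mulrDl mul1r ge_min; case: (leP B (N%:R * _)) => h; last by rewrite lexx orbT.
    by rewrite lerDl ltW.
  - by rewrite ge_min Bs.
  - by rewrite gt_min Bm.
pose N := (Num.truncn (B / (2 - 2 * s))).+1.
have BN : B <= N%:R * (2 - 2 * s) by rewrite -ler_pdivrMr//; exact/ltW/truncnS_gt.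
by have := H N; rewrite min_l.
Qed.

End regularity.

Section arith.
Context {R : realType}.
Lemma wlim_derive_arith (a a' c c' h p q q' K1 K2 K3 : R) : a' - c' = h * q' ->
  `|a' - a| <= K1 -> `|c' - c| <= K1 -> `|q' - q| <= K2 -> `|q - p| <= K3 ->
  `|a - c - h * p| <= 2 * K1 + `|h| * K2 + `|h| * K3.
Proof.
move=> e k1 k2 k3 k4.
have -> : a - c - h * p = - (a' - a) + (c' - c) + h * (q' - q) + h * (q - p).
  by rewrite !mulrBr -e; ring.
have h3 : `|h * (q' - q)| <= `|h| * K2 by rewrite normrM ler_wpM2l.
have h4 : `|h * (q - p)| <= `|h| * K3 by rewrite normrM ler_wpM2l.
move: k1 k2 h3 h4; rewrite !ler_norml.
set A := h * _; set B := h * _; set H2 := `|h| * K2; set H3 := `|h| * K3; lra.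
Qed.
End arith.

(** * Limits of mollifications and their derivatives *)

Section mollifier_limits.
Context {R : realType} {n : nat}.
Local Notation V := 'rV[R]_n.
Local Notation e_ i := (delta_mx ord0 i : V).
Implicit Types (x y z : V) (t r b : R) (l : seq 'I_n) (i : 'I_n).
Variable U : set V.
Variable w : R -> V -> R.
Hypothesis sw : forall t, 0 < t -> smooth (w t).

(** A Cauchy condition as the scale tends to 0, with power rate and locally uniform in [U]; [wlim]
    is the limit along the scales 1/(k+1). *)
Definition rate l b := forall r, 0 < r -> exists2 C : R, 0 <= C & forall z t t', inner U r z ->
  0 < t' -> t' <= t -> t <= 1 -> `|dpart l (w t) z - dpart l (w t') z| <= C * t `^ b.

Definition wlim l z : R := lim ((fun k : nat => dpart l (w k.+1%:R^-1) z) @ \oo).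

Lemma rate_weaken l b b' : b' <= b -> rate l b -> rate l b'.
Proof.
move=> bb h r r0; have [C C0 hC] := h r r0; exists C => // z t t' zr t'0 tt t1.
apply: le_trans (hC z t t' zr t'0 tt t1) _; rewrite ler_wpM2l//.
by apply: powR_le_exp => //; rewrite (lt_le_trans t'0 tt).
Qed.

Lemma inverse_nat_le t : 0 < t -> exists N : nat, forall k, (N <= k)%N -> k.+1%:R^-1 <= t.
Proof.
move=> t0; exists (Num.truncn t^-1) => k Nk.
rewrite -[t]invrK lef_pV2 ?posrE ?invr_gt0//.
by apply/ltW; apply: lt_le_trans (truncnS_gt _) _; rewrite ler_nat.
Qed.

Lemma wlim_rate l b : 0 < b -> rate l b -> forall r, 0 < r -> exists2 C : R, 0 <= C & forall z t,
  inner U r z -> 0 < t <= 1 -> `|dpart l (w t) z - wlim l z| <= C * t `^ b.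
Proof.
move=> b0 h r r0; have [C C0 hC] := h r r0; exists C => // z t zr /andP[t0 t1].
have inv1 (k : nat) : 0 < k.+1%:R^-1 :> R by [].
have cv : cvg ((fun k : nat => dpart l (w k.+1%:R^-1) z) @ \oo).
  apply: cauchy_cvg; apply: cauchy_exP => e /= e0.
  have e20 : 0 < e / 2 by rewrite divr_gt0.
  have [eta /andP[eta0 eta1] he] := powR_le1_ex C0 b0 e20.
  have [N hN] := inverse_nat_le eta0.
  exists (dpart l (w N.+1%:R^-1) z); exists N => // k /= Nk; rewrite /ball /=.
  apply: le_lt_trans (hC z _ _ zr (inv1 k) _ _) _.
  - by rewrite lef_pV2 ?posrE// ler_nat.
  - by apply: le_trans eta1; exact: hN.
  apply: le_lt_trans (_ : e / 2 < _); last by rewrite ltr_pdivrMr// mulr_natr mulr2n ltrDl.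
  by apply: le_trans he; rewrite ler_wpM2l// powR_le_base// ?hN// ltW.
apply/ler_addgt0Pr => e e0.
have [N hN] := inverse_nat_le t0.
have /cvgrPdist_le /(_ _ e0) [N' _ hN'] : (fun k : nat => dpart l (w k.+1%:R^-1) z) @ \oo --> wlim l z by exact: cv.
pose k := maxn N N'.
have h1 := hN' k (leq_maxr _ _); have h2 := hC z t _ zr (inv1 k) (hN k (leq_maxl _ _)) t1.
rewrite -(subrKA (dpart l (w k.+1%:R^-1) z)); apply: le_trans (ler_normD _ _) _.
by apply: lerD => //; rewrite distrC.
Qed.

Lemma rate_bound l b (D : R) : 0 <= b -> rate l b -> (forall z, `|dpart l (w 1) z| <= D) ->
  forall r, 0 < r -> exists2 C : R, 0 <= C & forall z t, inner U r z -> 0 < t <= 1 -> `|dpart l (w t) z| <= C.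
Proof.
move=> b0 h hD r r0; have [C C0 hC] := h r r0; exists (C + D).
  by rewrite addr_ge0// (le_trans _ (hD 0)).
move=> z t zr /andP[t0 t1]; have := hC z 1 t zr t0 t1 (lexx _); rewrite powR1 mulr1 => h1.
rewrite -[dpart l (w t) z](subKr (dpart l (w 1) z)).
by apply: le_trans (ler_normB _ _) _; rewrite addrC; apply: lerD.
Qed.

Definition holder_strong (a : V -> R) b := forall r, 0 < r -> exists2 C : R, 0 <= C &
  forall x y, inner U r x -> inner U r y -> `|a x - a y| <= C * `|x - y| `^ b.

Lemma holder_strong_inner a b : holder_strong a b -> holder_inner U a b.
Proof. by move=> h r r0; have [C C0 hC] := h r r0; exists C => // x y xr yr _; exact: hC. Qed.

(** Two points at distance [t] are compared through the mollification at scale [t]: the rate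
    controls the two errors, and the gradient bound t^(b-1) over the distance [t] the remaining
    difference. *)
Lemma wlim_holder l b (D : R) : 0 < b <= 1 -> rate l b -> (forall z, `|dpart l (w 1) z| <= D) ->
  (forall i r, 0 < r -> exists2 C : R, 0 <= C & forall z t, inner U r z -> 0 < t <= 1 ->
    `|dpart (i :: l) (w t) z| <= C * t `^ (b - 1)) -> holder_strong (wlim l) b.
Proof.
move=> /andP[b0 b1] hr hD hd r r0.
have [C1 C10 hC1] := wlim_rate b0 hr r0.
have r20 : 0 < r / 2 by rewrite divr_gt0.
have [i C C' CC h z t zr t1|i|C2 C20 hC2] := @finite_bound R 'I_n (fun i C => forall z t, inner U (r / 2) z ->
    0 < t <= 1 -> `|dpart (i :: l) (w t) z| <= C * t `^ (b - 1)).
- by apply: le_trans (h z t zr t1) _; rewrite ler_wpM2r// powR_ge0.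
- exact: hd.
have D0 : 0 <= D by exact: le_trans (hD 0).
(* Beyond this distance the segment may leave the region of the gradient bound; there boundedness of
   the limit is used, at the cost of the factor t0^(-b). *)
pose t0 := Num.min 1 (r / 2).
have t0P : 0 < t0 by rewrite lt_min ltr01.
exists (n%:R * C2 + 2 * C1 + 2 * (D + C1) * t0 `^ (- b)).
  by rewrite !addr_ge0 ?mulr_ge0 ?addr_ge0 ?powR_ge0.
move=> x y xr yr.
have [->|xy] := eqVneq x y; first by rewrite subrr normr0 mulr_ge0 ?addr_ge0 ?mulr_ge0 ?addr_ge0 ?powR_ge0.
have dp : 0 < `|x - y| by rewrite normr_gt0 subr_eq0.
have [dt|td] := leP `|x - y| t0; last first.
  have bd z : inner U r z -> `|wlim l z| <= D + C1.
    move=> zr; have := hC1 z 1 zr; rewrite ltr01 lexx powR1 mulr1 => /(_ isT) h1.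
    rewrite -[wlim l z](subKr (dpart l (w 1) z)); apply: le_trans (ler_normB _ _) _.
    by apply: lerD.
  apply: le_trans (ler_normB _ _) _; apply: le_trans (lerD (bd x xr) (bd y yr)) _.
  rewrite (_ : D + C1 + (D + C1) = 2 * (D + C1)); last by ring.
  rewrite [leRHS]mulrDl; apply: ler_wpDl.
    by rewrite mulr_ge0 ?addr_ge0 ?mulr_ge0 ?powR_ge0.
  rewrite -mulrA ler_peMr ?mulr_ge0 ?addr_ge0// powRN mulrC ler_pdivlMr ?powR_gt0// mul1r.
  by apply: powR_le_base => //; exact: ltW.
set t := `|x - y| in dp dt *.
have /andP[t1 tr] : (t <= 1) && (t <= r / 2) by move: dt; rewrite le_min.
have t01 : 0 < t <= 1 by rewrite dp.
have k1 := hC1 x t xr t01; have k2 := hC1 y t yr t01.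
have M0 : 0 <= C2 * t `^ (b - 1) by rewrite mulr_ge0 ?powR_ge0.
have := @smooth_lip_local _ _ (dpart l (w t)) y (x - y) _ (smooth_dpart _ (sw dp)) M0.
rewrite subrK => /(_ _) k3.
have {}k3 : `|dpart l (w t) x - dpart l (w t) y| <= n%:R * (C2 * t `^ (b - 1)) * t.
  apply: k3 => i z hz; apply: (hC2 i z t _ t01).
  by apply: inner_le (inner_near yr hz); move: tr; rewrite -/t; lra.
have e1 : t `^ (b - 1) * t = t `^ b by rewrite -{2}[t](powRr1 (ltW dp)) -powR_add// subrK.
have e2 : n%:R * (C2 * t `^ (b - 1)) * t = n%:R * C2 * t `^ b by rewrite -e1; ring.
have p0 : 0 <= 2 * (D + C1) * t0 `^ (- b) * t `^ b by rewrite !mulr_ge0 ?addr_ge0 ?powR_ge0.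
rewrite e2 in k3; rewrite distrC in k1.
have -> : wlim l x - wlim l y = (wlim l x - dpart l (w t) x) + (dpart l (w t) x - dpart l (w t) y) + (dpart l (w t) y - wlim l y).
  by ring.
apply: le_trans (ler_normD _ _) _; apply: le_trans (lerD (ler_normD _ _) (lexx _)) _.
by rewrite 2![_ * t `^ b]mulrDl; move: k1 k2 k3 p0; lra.
Qed.

(** The mean value theorem is applied to the mollification with [h] fixed, and the scale then tends
    to 0. Hoelder continuity of the limit of the derivatives compensates for the unknown
    intermediate point. *)
Lemma wlim_derive l i b b' e r x : 0 < b -> rate l b -> 0 < b' -> rate (i :: l) b' ->
  0 < e -> holder_strong (wlim (i :: l)) e -> 0 < r -> inner U r x ->
  is_derive x (e_ i) (wlim l) (wlim (i :: l) x).
Proof.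
move=> b0 hr b'0 hr' e0 hh r0 xr; apply/is_derive_line0.
have r20 : 0 < r / 2 by rewrite divr_gt0.
have [C1 C10 hC1] := wlim_rate b0 hr r20.
have [C2 C20 hC2] := wlim_rate b'0 hr' r20.
have [C3 C30 hC3] := hh _ r20.
apply: (@is_derive_bound R _ 0 _ C3 e (r / 2)) => // h hr2; rewrite addr0 scale0r add0r.
have in2 (c : R) : `|c| <= `|h| -> inner U (r / 2) (c *: e_ i + x).
  move=> ch; apply: (@inner_le _ _ _ (r - r / 2)); first lra.
  apply: inner_near xr _; rewrite addrK normrZ; apply: le_trans hr2.
  by apply: le_trans ch; rewrite ler_piMr// norm_delta_le1.
set X := `| _ - _ |; apply/ler_addgt0Pr => eps eps0.
have K0 : 0 <= 2 * C1 + `|h| * C2 by rewrite addr_ge0 ?mulr_ge0.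
have m0 : 0 < Num.min b b' by rewrite lt_min b0.
have [t /andP[t0 t1] ht] := powR_le1_ex K0 m0 eps0.
have t01 : 0 < t <= 1 by rewrite t0.
have sm : smooth (dpart l (w t)) by apply: smooth_dpart; exact: sw.
have [tau /andP[tau0 tau1] hm] := @line_MVT _ _ (dpart l (w t)) (partial i (dpart l (w t))) x (e_ i) h
   (fun y => smooth_derive i y sm).
have inh : inner U (r / 2) (h *: e_ i + x) by exact: in2.
have inx : inner U (r / 2) x by apply: inner_le xr; lra.
have inxi : inner U (r / 2) ((tau * h) *: e_ i + x).
  by apply: in2; rewrite normrM ler_piMl// ger0_norm.
set xi := (tau * h) *: e_ i + x in hm inxi.
have k1 := hC1 _ t inh t01; have k2 := hC1 _ t inx t01; have k3 := hC2 _ t inxi t01.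
have k4 := hC3 _ _ inxi inx.
have k5 : `|wlim (i :: l) xi - wlim (i :: l) x| <= C3 * `|h| `^ e.
  apply: le_trans k4 _; rewrite ler_wpM2l//; apply: ge0_ler_powR; rewrite ?nnegrE// ?(ltW e0)//.
  rewrite /xi addrK normrZ; apply: le_trans (_ : `|tau * h| <= _).
    by rewrite ler_piMr// norm_delta_le1.
  by rewrite normrM ler_piMl// ger0_norm.
have tb : t `^ b <= t `^ (Num.min b b') by apply: powR_le_exp => //; rewrite ge_min lexx.
have tb' : t `^ b' <= t `^ (Num.min b b') by apply: powR_le_exp => //; rewrite ge_min lexx orbT.
have e1 : `|h| `^ (1 + e) = `|h| * `|h| `^ e.
  have [->|h0] := eqVneq h 0; first by rewrite normr0 mul0r powR0// gt_eqF// addr_gt0.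
  by rewrite powR_add ?normr_gt0// powRr1.
have := @wlim_derive_arith R (wlim l (h *: e_ i + x)) (dpart l (w t) (h *: e_ i + x)) (wlim l x) (dpart l (w t) x) h
  (wlim (i :: l) x) (wlim (i :: l) xi) (dpart (i :: l) (w t) xi) _ _ _ hm k1 k2 k3 k5.
move=> hX; apply: le_trans hX _.
rewrite e1 [leRHS]addrC; apply: lerD; last by rewrite mulrCA.
by apply: le_trans ht; rewrite [leRHS]mulrDl; apply: lerD; rewrite -mulrA ler_wpM2l// ler_wpM2l.
Qed.

End mollifier_limits.

Section mollification.
Context {R : realType} {n : nat}.
Local Notation V := 'rV[R]_n.
Local Notation mu := (leb R n).
Local Notation mu2 := (leb2 R n).
Implicit Types (a phi zeta : V -> R) (x y z : V) (t r : R) (l : seq 'I_n) (P Q : R -> R).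

Definition bump_profile (t : R) : R := einv (1 - t).

Lemma bump_profileP : profile bump_profile.
Proof.
split=> [|x x1]; last by rewrite /bump_profile einv_le0// subr_le0.
rewrite (_ : bump_profile = fun t => einv (-1 * t + 1)); last first.
  by apply/funext => t; rewrite /bump_profile mulN1r addrC.
exact: smooth1_comp_affine smooth1_einv.
Qed.

Lemma Rintegral_bump_gt0 : 0 < \int[mu]_x (rad bump_profile x : R).
Proof.
have i0 : rint mu (rad bump_profile) := Cc_rint (Cc_rad bump_profileP).
rewrite lt_neqAle Rintegral_ge0 ?andbT//; last by move=> x _; exact: einv_ge0.
apply/negP => /eqP/esym e0.
have [N [mN N0 hN]] := Rintegral0_null measurableT i0 (fun x _ => einv_ge0 _) e0.
have nN : mu.-negligible N by exists N; split.
have q0 : 0 < n.+1%:R^-1 :> R by rewrite invr_gt0 ltr0n.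
have [y yb yN] := negligible_ball 0 nN q0.
have := hN y yN I; rewrite /rad /bump_profile => /eqP; apply/negP; rewrite gt_eqF// einv_gt0 subr_gt0.
move: yb; rewrite rV_ballE /= sub0r normrN => yb.
apply: le_lt_trans (_ : \sum_(i < n) n.+1%:R^-1 < 1).
  apply: ler_sum => i _; have yi : `|y ord0 i| <= n.+1%:R^-1.
    by apply: le_trans (coord_le_norm y i) _; exact: ltW.
  rewrite -real_normK ?num_real// expr2; apply: le_trans (_ : n.+1%:R^-1 * 1 <= _); last by rewrite mulr1.
  by apply: ler_pM => //; apply: le_trans yi _; rewrite invf_le1// ler1n.
by rewrite sumr_const card_ord -[ltLHS]mulr_natl ltr_pdivrMr// mul1r ltr_nat.
Qed.

Lemma unit_profile : exists P, [/\ profile P, forall t, 0 <= P t & \int[mu]_x (rad P x : R) = 1].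
Proof.
have hP0 := bump_profileP; have I0 := Rintegral_bump_gt0.
have i0 : rint mu (rad bump_profile) := Cc_rint (Cc_rad hP0).
set I1 := \int[mu]_x _ in I0.
exists (fun t => I1^-1 * bump_profile t); split.
- split; last by move=> x x1; rewrite (hP0.2 x x1) mulr0.
  have [D [D0 hD]] := hP0.1; exists (fun k t => I1^-1 * D k t); split; first by rewrite D0.
  by move=> k x; have := is_deriveZ I1^-1 (hD k x).
- by move=> t; rewrite mulr_ge0 ?invr_ge0 ?(ltW I0)// einv_ge0.
- by rewrite /rad RintegralZl// mulVf// gt_eqF.
Qed.

Lemma lapl_conv a phi z : rint mu a -> Cc_smooth setT phi -> conv a (lapl phi) z = lapl (conv a phi) z.
Proof.
move=> ia hphi; rewrite /lapl /conv.
under eq_Rintegral => x _ do rewrite mulr_sumr.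
have h i : rint mu (fun x => a x * partial i (partial i phi) (z - x)).
  by apply: rint_conv => //; apply: Cc_partial; exact: Cc_partial.
rewrite (Rintegral_sum _ measurableT (fun i _ => h i)); apply: eq_bigr => i _.
have e1 : partial i (conv a phi) = conv a (partial i phi) by exact: partial_conv.
have e2 : partial i (conv a (partial i phi)) = conv a (partial i (partial i phi)).
  by apply: partial_conv => //; exact: Cc_partial.
by have := congr1 (@^~ z) e2; rewrite -e1 => ->.
Qed.

Variable U : set V.
Variables (u : V -> R) (M : R).
Hypotheses (iu : rint mu u) (bu : forall x, `|u x| <= M).

Variable P : R -> R.
Hypothesis hP : profile P.

Definition mollify t := conv u (dilate n t (rad P)).

Lemma smooth_mollify t : 0 < t -> smooth (mollify t).
Proof. by move=> t0; apply: smooth_conv => //; apply: Cc_dilate => //; exact: Cc_rad. Qed.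

Lemma dpart_mollify l t z : 0 < t ->
  dpart l (mollify t) z = conv u (dilate (n + size l) t (dpart l (rad P))) z.
Proof.
move=> t0; rewrite /mollify dpart_conv//; last by apply: Cc_dilate => //; exact: Cc_rad.
by rewrite dpart_dilate//; apply: smooth_rad; case: hP.
Qed.

Lemma dpart_mollify_scale l t z : 0 < t ->
  dpart l (mollify t) z = t `^ (- (size l)%:R) * conv u (dilate n t (dpart l (rad P))) z.
Proof.
by move=> t0; rewrite dpart_mollify// conv_dilate_add ?exprV_powR//; exact: Cc_dpart_rad.
Qed.

Lemma mollify_bound l : exists D : R, forall z, `|dpart l (mollify 1) z| <= D.
Proof.
have bru : bounded_rint u by split=> //; exists M.
have [D D0 hD] := conv_dilate_bound bru (Cc_dpart_rad l hP); exists D => z.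
by rewrite dpart_mollify_scale// powR1 mul1r; exact: hD.
Qed.

Lemma decays_mollify_bound B m l r : decays U u B m -> (m <= size l)%N -> 0 < r ->
  exists2 C : R, 0 <= C & forall z t, inner U r z -> 0 < t <= 1 ->
    `|dpart l (mollify t) z| <= C * t `^ (B - (size l)%:R).
Proof.
move=> hB ml r0; have [C C0 hC] := hB P l r hP ml r0; exists C => // z t zr t1.
have t0 : 0 < t by case/andP: t1.
rewrite dpart_mollify_scale// normrM (ger0_norm (powR_ge0 _ _)) powR_add// mulrC mulrA.
by rewrite ler_wpM2r ?powR_ge0//; exact: hC.
Qed.

(** Integrates the formula for the derivative in the scale with the positive exponent B - |l|. The
    Laplacian adds two derivatives, hence the hypothesis on |l| + 2. *)
Lemma decays_rate B m l : decays U u B m -> (m <= (size l).+2)%N -> (size l)%:R < B ->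
  rate U mollify l (B - (size l)%:R).
Proof.
move=> hB ml lB r r0; set L := size l in ml lB *.
have [Q hQ dQ] := profile_primitive hP.
have dG z t := @conv_rad_derive R n u P Q l z t iu hP hQ dQ.
have [C2 C20 hC2] : exists2 C : R, 0 <= C & forall i z t, inner U r z -> 0 < t <= 1 ->
    `|conv u (dilate n t (dpart [:: i, i & l] (rad Q))) z| <= C * t `^ B.
  apply: finite_bound; last by move=> i; exact: (hB Q [:: i, i & l] r hQ ml r0).
  move=> i C C' CC h z t zr t1; by apply: le_trans (h z t zr t1) _; rewrite ler_wpM2r// powR_ge0.
have p0 : 0 < B - L%:R by rewrite subr_gt0.
exists (n%:R * C2 / (B - L%:R)); first by rewrite !mulr_ge0 ?invr_ge0 ?(ltW p0).
move=> z t t' zr t'0 tt t1.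
rewrite !dpart_mollify ?(lt_le_trans t'0 tt)//.
have pn0 : B - L%:R != 0 by rewrite gt_eqF.
have h := fun h => @powR_growth R (fun t => conv u (dilate (n + L) t (dpart l (rad P))) z) _ (n%:R * C2) (B - L%:R) 1 t' t
  pn0 (dG z) h t'0 tt t1.
apply: le_trans (h _) _; last first.
  by rewrite ler_wpM2l ?gerBl ?powR_ge0// !mulr_ge0 ?invr_ge0 ?(ltW p0).
move=> q q1; have q0 : 0 < q by case/andP: q1.
have hz := Cc_dpart_rad l hQ : Cc_smooth setT (dpart l (rad Q) : V -> R).
have sz := Cc_smoothW hz.
rewrite lapl_conv//; last exact: Cc_dilate.
rewrite normrM gtr0_norm// /lapl.
apply: le_trans (_ : q * \sum_(i < n) q `^ (- L.+2%:R) * (C2 * q `^ B) <= _).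
  rewrite ler_wpM2l ?(ltW q0)//; apply: le_trans (ler_norm_sum _ _ _) _; apply: ler_sum => i _.
  have := dpart_conv [:: i; i] iu (Cc_dilate (n + L) q0 hz); rewrite /= => ->.
  have := dpart_dilate (n + L) q [:: i; i] sz; rewrite /= => ->.
  rewrite -addnA addn2 conv_dilate_add//; last exact: (Cc_dpart_rad [:: i, i & l] hQ).
  rewrite exprV_powR// normrM (ger0_norm (powR_ge0 _ _)) ler_wpM2l ?powR_ge0//.
  exact: hC2.
rewrite sumr_const card_ord -[_ *+ n]mulr_natl.
have -> : B - L%:R - 1 = 1 + - L.+2%:R + B by rewrite -addn2 natrD; lra.
rewrite !powR_add// powRr1 ?(ltW q0)//.
by rewrite [leLHS](_ : _ = n%:R * C2 * (q * q `^ (- L.+2%:R) * q `^ B))//; ring.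
Qed.

(** By Fubini's theorem the mollifier is moved to [phi], which is Lipschitz, so the error is of
    order [t] whatever the regularity of [u]. *)
Lemma mollify_pairing phi : (forall q : R, 0 <= P q) -> \int[mu]_x (rad P x : R) = 1 -> Cc_smooth setT phi ->
  exists C : R, forall t, 0 < t -> `|\int[mu]_z (mollify t z * phi z) - \int[mu]_x (u x * phi x)| <= C * t.
Proof.
move=> P0 P1 hphi; have [L L0 hL] := Cc_lipschitz hphi.
exists (L * \int[mu]_x `|u x|) => t t0.
pose eta : V -> R := dilate n t (rad P).
have heta : Cc_smooth setT eta by apply: Cc_dilate => //; exact: Cc_rad.
have ieta : rint mu eta := Cc_rint heta.
have iphi : rint mu phi := Cc_rint hphi.
have eta1 : \int[mu]_x eta x = 1 by rewrite Rintegral_dilate//; exact: Cc_rint (Cc_rad hP).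
have eta0 x : 0 <= eta x by rewrite /eta /dilate mulr_ge0 ?exprn_ge0 ?invr_ge0 ?(ltW t0)//; exact: P0.
have [E E0 hE] := Cc_sup heta.
pose F (p : V * V) : R := phi p.1 * (u p.2 * eta (p.1 - p.2)).
have [ip _] := rint_prod (rint_abs iphi) (rint_abs iu).
have mF : measurable_fun setT F.
  apply: measurable_funM; first exact: (measurableT_comp (rint_measurable iphi) measurable_fst).
  apply: measurable_funM; first exact: (measurableT_comp (rint_measurable iu) measurable_snd).
  exact: (measurableT_comp (rint_measurable ieta) measurable_sub_rV2).
have iF : rint mu2 F.
  apply: (rint_le mF _ (rintZ E ip)) => p; rewrite /F 2!normrM mulrA [leRHS]mulrC.
  by rewrite ler_wpM2l ?mulr_ge0//; exact: hE.
have e1 : \int[mu]_z (mollify t z * phi z) = \int[mu]_x \int[mu]_z F (z, x).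
  rewrite -(rint_fubini iF); apply: eq_Rintegral => z _.
  transitivity (phi z * conv u eta z); first by rewrite mulrC.
  by rewrite /conv -(RintegralZl (phi z) measurableT (rint_conv z iu heta)).
have i1 x : rint mu (fun y => eta y * phi (y + x)).
  have [E' E'0 hE'] := Cc_sup hphi.
  apply: (rint_le _ _ (rintZ E' ieta)).
    apply: measurable_funM; first exact: rint_measurable ieta.
    exact: (rint_measurable (integrable_add x iphi)).
  by move=> y; rewrite normrM (ger0_norm (eta0 _)) mulrC ler_wpM2r.
have e2 x : \int[mu]_z F (z, x) = u x * \int[mu]_y (eta y * phi (y + x)).
  have i2 : rint mu (fun z => eta (z - x) * phi z).
    move: (integrable_add (- x) (i1 x)); congr (_.-integrable _ _); apply/funext => z /=.
    by rewrite subrK.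
  rewrite -(Rintegral_add (- x) (i1 x)) -RintegralZl//; last first.
    by move: i2; congr (_.-integrable _ _); apply/funext => z /=; rewrite subrK.
  by apply: eq_Rintegral => z _; rewrite /F /= subrK; ring.
have iuphi : rint mu (fun x => u x * phi x).
  have [E' E'0 hE'] := Cc_sup hphi.
  apply: (rint_le _ _ (rintZ E' (rint_abs iu))).
    by apply: measurable_funM; [exact: rint_measurable iu|exact: rint_measurable iphi].
  by move=> y; rewrite normrM mulrC ler_wpM2r.
have g0 x : \int[mu]_y (eta y * phi (y + x)) - phi x = \int[mu]_y (eta y * (phi (y + x) - phi x)).
  under [RHS]eq_Rintegral => y _ do rewrite mulrBr.
  rewrite RintegralB; [|by []|exact: i1|by rewrite (_ : (fun _ => _) = fun y => phi x * eta y); [exact: rintZ|apply/funext => y; rewrite mulrC]].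
  by rewrite RintegralZr// eta1 mul1r.
have g1 x : `|\int[mu]_y (eta y * phi (y + x)) - phi x| <= L * t.
  rewrite g0.
  have i3 : rint mu (fun y => eta y * (phi (y + x) - phi x)).
    rewrite (_ : (fun _ => _) = fun y => eta y * phi (y + x) - phi x * eta y).
      by apply: rintB => //; exact: rintZ.
    by apply/funext => y; rewrite mulrBr [phi x * _]mulrC.
  apply: le_trans (le_normr_Rintegral measurableT i3) _.
  rewrite -[L * t]mulr1 -eta1 -RintegralZl//.
  apply: le_rint; [exact: rint_abs|exact: rintZ|] => y.
  rewrite normrM (ger0_norm (eta0 _)) mulrC.
  have [yt|yt] := leP `|y| t.
    by rewrite ler_wpM2r//; apply: le_trans (hL _ _) _; rewrite ler_wpM2l// ltW.
  rewrite (_ : eta y = 0) ?mulr0//; apply: (@dilate_out _ _ n t (rad P) 1) => //; last by rewrite mulr1.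
  by move=> z; exact: rad_out.
have mG : measurable_fun setT (fun x => \int[mu]_z F (z, x)).
  have := measurableT_comp (fine_measurable measurableT) (measurable_fubini_G iF); exact.
have iG : rint mu (fun x => u x * \int[mu]_y (eta y * phi (y + x))).
  have [E' E'0 hE'] := Cc_sup hphi.
  apply: (rint_le _ _ (rintD (rint_abs iuphi) (rintZ (L * t) (rint_abs iu)))).
    by move: mG; congr measurable_fun; apply/funext => x; exact: e2.
  move=> x; rewrite -[X in u x * X](subrK (phi x)) mulrDr addrC; apply: le_trans (ler_normD _ _) _.
  by rewrite lerD2l normrM mulrC ler_wpM2r.
rewrite e1; under eq_Rintegral => x _ do rewrite e2.
rewrite -RintegralB//.
apply: le_trans (le_normr_Rintegral measurableT (rintB iG iuphi)) _.
rewrite mulrAC -RintegralZl//; last exact: rint_abs.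
apply: le_rint; [by apply: rint_abs; exact: rintB|by apply: rintZ; exact: rint_abs|] => x.
by rewrite -mulrBr normrM mulrC ler_wpM2r.
Qed.

Lemma open_inner x : open U -> U x -> exists2 r : R, 0 < r & inner U r x.
Proof.
move=> oU Ux; have /nbhs_ballP[e /= e0 he] := oU x Ux.
exists (e / 2); first by rewrite divr_gt0.
move=> y xy; apply: he; rewrite rV_ballE /= distrC; apply: le_lt_trans xy _.
by rewrite ltr_pdivrMr// mulr_natr mulr2n ltrDl.
Qed.

Lemma compact_inner (K : set V) : open U -> compact K -> K `<=` U ->
  exists2 r : R, 0 < r & forall x, K x -> inner U r x.
Proof.
move=> oU /compact_near_coveringP cK KU.
have [|N _ hN] := cK nat \oo (fun k x => inner U k.+1%:R^-1 x) _.
  move=> x Kx; have [r r0 hr] := open_inner oU (KU x Kx).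
  have r20 : 0 < r / 2 by rewrite divr_gt0.
  have [N hN] := inverse_nat_le r20.
  exists (ball x (r / 2), [set k | (N <= k)%N]).
    by split; [exact: nbhsx_ballx|exists N].
  move=> [y k] /= [xy Nk]; have k1 := hN k Nk.
  have k2 : k.+1%:R^-1 <= r - r / 2 by apply: le_trans k1 _; lra.
  apply: inner_le k2 _.
  by apply: inner_near hr _; move: xy; rewrite rV_ballE /= distrC => /ltW.
exists N.+1%:R^-1 => // x Kx; exact: (hN N (leqnn N) x Kx).
Qed.

Hypotheses (oU : open U) (bU : norm_bounded U).

(** The pointwise limit is identified with [u] by pairing with test functions and the fundamental
    lemma. Since the mollifier is nonnegative with integral 1, the bound [M] is inherited. *)
Lemma mollify_limit b : (0 < n)%N -> 0 < b -> rate U mollify [::] b -> (forall q : R, 0 <= P q) ->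
  \int[mu]_x (rad P x : R) = 1 ->
  [/\ measurable_fun setT (fun x => wlim mollify [::] x * \1_U x),
    forall x, `|wlim mollify [::] x * \1_U x| <= M &
  [ae mu, x | U x -> u x = wlim mollify [::] x]].
Proof.
move=> n0 b0 hr P0 P1.
set v := fun x => wlim mollify [::] x * \1_U x.
have mU := open_measurable oU.
have mv : measurable_fun setT v.
  apply: (measurable_fun_cvg (h := fun (k : nat) x => mollify k.+1%:R^-1 x * \1_U x)).
    move=> k; apply: measurable_funM; last exact: measurable_indic.
    by apply: smooth_measurable; exact: smooth_mollify.
  move=> x _.
  have [Ux|Ux] := pselect (U x); last first.
    rewrite [v x]/v indicE memNset// mulr0 (_ : (fun _ => _) = cst 0); first exact: cvg_cst.
    by apply/funext => k; rewrite /= mulr0.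
  have [r r0 xr] := open_inner oU Ux; have [C C0 hC] := wlim_rate b0 hr r0.
  rewrite [v x]/v indicE mem_set// mulr1.
  apply/cvgrPdist_le => e e0; have [eta /andP[eta0 eta1] he] := powR_le1_ex C0 b0 e0.
  have [N hN] := inverse_nat_le eta0.
  exists N => // k Nk /=; rewrite mulr1 distrC.
  have k1 : 0 < (k.+1%:R^-1 : R) <= 1 by rewrite invr_gt0 ltr0n invf_le1// ler1n.
  apply: le_trans (hC x _ xr k1) _; apply: le_trans he; rewrite ler_wpM2l//.
  by case/andP: k1 => k0 _; apply: powR_le_base => //; [exact: hN|exact: ltW].
have wM t x : 0 < t -> `|mollify t x| <= M.
  move=> t0; have h := conv_sup_bound x iu bu (Cc_dilate n t0 (Cc_rad hP)).
  apply: le_trans h _; rewrite Rintegral_norm_dilate//; last exact: Cc_rad.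
  under eq_Rintegral => y _ do rewrite (ger0_norm (P0 _)).
  by rewrite [X in _ * X]P1 mulr1.
have vM x : `|v x| <= M.
  have [Ux|Ux] := pselect (U x); last first.
    by rewrite /v indicE memNset// mulr0 normr0; exact: le_trans (bu x).
  have [r r0 xr] := open_inner oU Ux; have [C C0 hC] := wlim_rate b0 hr r0.
  rewrite /v indicE mem_set// mulr1; apply/ler_addgt0Pr => e e0.
  have [eta /andP[eta0 eta1] he] := powR_le1_ex C0 b0 e0.
  have eta01 : 0 < eta <= 1 by rewrite eta0.
  rewrite -[wlim _ _ _](subKr (mollify eta x)); apply: le_trans (ler_normB _ _) _.
  by apply: lerD; [exact: wM|apply: le_trans (hC x _ xr eta01) he].
have vU : zoff U v by move=> x Ux; rewrite /v indicE memNset// mulr0.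
have iv : rint mu v by apply: (rint_bounded_zoff oU bU (C := M)).
(* On the compact support of [phi] the convergence is uniform, so the pairings with [u] and with [v]
   are limits of the same quantities. *)
have wz phi : Cc_smooth U phi -> \int[mu]_(x in U) ((u x - v x) * phi x) = 0.
  move=> hphi; have hphiT := Cc_setT hphi.
  have [E E0 hE] := Cc_sup hphiT.
  have iphi := Cc_rint hphiT.
  have im (a : V -> R) (D : R) : measurable_fun setT a -> (forall x, `|a x| <= D) -> rint mu (fun x => a x * phi x).
    move=> ma aD; apply: (rint_le _ _ (rintZ D (rint_abs iphi))).
      by apply: measurable_funM => //; exact: rint_measurable iphi.
    by move=> x; rewrite normrM ler_wpM2r.
  have iup := im u M (rint_measurable iu) bu.
  have ivp := im v M mv vM.
  rewrite Rintegral_zoff; last by move=> x Ux; rewrite (Cc_zoff hphi Ux) mulr0.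
  under eq_Rintegral => x _ do rewrite mulrBl.
  rewrite RintegralB//; apply/eqP; rewrite -normr_le0; apply/ler_addgt0Pr => e e0; rewrite add0r.
  have [C hC] := mollify_pairing P0 P1 hphiT.
  have [_ [K [cK KU Kout]]] := Cc_elim hphi.
  have [r r0 Kr] := compact_inner oU cK KU.
  have [C' C'0 hC'] := wlim_rate b0 hr r0.
  have p0 : 0 <= \int[mu]_x `|phi x| by apply: Rintegral_ge0.
  have K0 : 0 <= `|C| + C' * \int[mu]_x `|phi x| by rewrite addr_ge0// mulr_ge0.
  have m0 : 0 < Num.min 1 b by rewrite lt_min ltr01.
  have [t /andP[t0 t1] ht] := powR_le1_ex K0 m0 e0.
  have t01 : 0 < t <= 1 by rewrite t0.
  have imp := im (mollify t) M (smooth_measurable (smooth_mollify t0)) (fun x => wM t x t0).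
  have k1 := hC t t0.
  have k2 : `|\int[mu]_z (mollify t z * phi z) - \int[mu]_x (v x * phi x)| <= C' * t `^ b * \int[mu]_x `|phi x|.
    rewrite -RintegralB//; apply: le_trans (le_normr_Rintegral measurableT (rintB imp ivp)) _.
    rewrite -RintegralZl//; last exact: rint_abs.
    apply: le_rint; [by apply: rint_abs; exact: rintB|by apply: rintZ; exact: rint_abs|] => x.
    rewrite -mulrBl normrM; have [xK|xK] := pselect (K x); last by rewrite (Kout x xK) normr0 !mulr0.
    rewrite ler_wpM2r// /v indicE mem_set; last exact: KU.
    by rewrite mulr1; exact: (hC' x t (Kr x xK) t01).
  have tb : t `^ b <= t `^ (Num.min 1 b) by apply: powR_le_exp => //; rewrite ge_min lexx orbT.
  have tb' : t <= t `^ (Num.min 1 b) by rewrite -{1}[t]powRr1 ?(ltW t0)//; apply: powR_le_exp => //; rewrite ge_min lexx.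
  rewrite -(subrKA (\int[mu]_z (mollify t z * phi z))); apply: le_trans (ler_normD _ _) _.
  rewrite distrC; apply: le_trans (lerD k1 k2) _; apply: le_trans ht; rewrite [leRHS]mulrDl; apply: lerD.
    apply: le_trans (_ : `|C| * t <= _); first by rewrite ler_wpM2r ?(ltW t0)// ler_norm.
    by rewrite ler_wpM2l.
  by rewrite mulrAC ler_wpM2l// mulr_ge0.
have mud : measurable_fun setT (fun x => u x - v x) by apply: measurable_funB => //; exact: rint_measurable iu.
have iud : mu.-integrable U (EFin \o (fun x => u x - v x)) by exact: integrable_zoff (rintB iu iv).
have [N [mN N0 hN]] := weak_zero n0 oU mud iud wz.
split=> //; exists N; split=> // x xN Ux; have := hN x xN Ux; rewrite /v indicE mem_set// mulr1 => /eqP.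
by rewrite subr_eq0 => /eqP.
Qed.

End mollification.

(** * The two passes of the interior regularity *)

Section interior.
Context {R : realType} {n : nat}.
Local Notation V := 'rV[R]_n.
Local Notation mu := (leb R n).
Local Notation e_ i := (delta_mx ord0 i : V).
Implicit Types (x y z : V) (t r : R) (l : seq 'I_n) (P : R -> R).
Variables (s : R) (s01 : 0 < s < 1) (n0 : (0 < n)%N).
Variables (U : set V) (oU : open U) (bU : norm_bounded U).

Lemma decays_mono a (b : R) (m m' : nat) : (m <= m')%N -> decays U a b m -> decays U a b m'.
Proof. by move=> mm h P l r hP ml r0; apply: h => //; exact: leq_trans ml. Qed.

Lemma conv_rhs_null f f' u d (N : set V) : measurable N -> mu N = 0%E ->
  (forall x, ~ N x -> U x -> f x = f' x) -> weak_sol U s f u d -> weak_sol U s f' u d.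
Proof.
move=> mN N0 ff [hu gu heq]; split=> // phi e hphi gphi; rewrite heq//.
apply: (eq_Rintegral_null mN N0) => x xN _.
have [Ux|Ux] := pselect (U x); first by rewrite ff.
by case: hphi => _ _ zphi _ _; rewrite (zphi x Ux) !mulr0.
Qed.

Section first_stage.
Variables (f u : V -> R) (d : 'I_n -> V -> R) (M : R) (P : R -> R).
Hypotheses (hs : weak_sol U s f u d) (mf : measurable_fun setT f) (fU : zoff U f).
Hypotheses (bf : forall x, `|f x| <= M) (bu : forall x, `|u x| <= M) (hP : profile P).
Let hud : h10 U u d. Proof. by case: hs. Qed.
Let iu : rint mu u. Proof. exact: (h10_rint oU bU hud). Qed.
Local Notation w := (mollify u P).

(** Any exponent strictly between 1 and 2 would do: above 1 so that first derivatives converge, and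
    below the number 2 of derivatives. *)
Lemma decays_first : decays U u (3 / 2) 2.
Proof.
apply: (decays_iter s01 oU bU hs mf fU bf bu (sigma := 0)); try lra.
move=> rho rho0; apply: decays0; have [L L0 hL] := truncated_rhs_bound s01 oU bU hs bf bu rho0.
by split; [exact: (rint_truncated_rhs s01 oU bU hs mf bf bu rho0)|exists L].
Qed.

Lemma rate_first0 : rate U w [::] (3 / 2).
Proof. by have := decays_rate iu hP (l := [::]) decays_first isT; rewrite /= subr0; apply; lra. Qed.

Lemma rate_first1 i : rate U w [:: i] (1 / 2).
Proof.
have := decays_rate iu hP (l := [:: i]) decays_first isT.
by rewrite /= (_ : 3 / 2 - 1 = 1 / 2 :> R); [apply; lra|lra].
Qed.

(** A positive rate for the next derivatives makes them bounded, which is the gradient hypothesis of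
    [wlim_holder] at exponent 1. *)
Lemma lipschitz_of_rates l (b : R) : 1 <= b -> rate U w l b -> (forall i, exists2 b', 0 < b' & rate U w (i :: l) b') ->
  holder_strong U (wlim w l) 1.
Proof.
move=> b1 h0 h1.
have [D hD] := mollify_bound iu bu hP l.
apply: (wlim_holder (smooth_mollify iu hP) _ (rate_weaken b1 h0) hD); first by rewrite ltr01 lexx.
move=> i r r0; have [b' b'0 hr] := h1 i; have [D' hD'] := mollify_bound iu bu hP (i :: l).
have [C C0 hC] := rate_bound (ltW b'0) hr hD' r0; exists C => // z t zr t1.
by rewrite subrr powRr0 mulr1; exact: hC.
Qed.

Lemma lipschitz_first : holder_strong U (wlim w [::]) 1.
Proof.
apply: lipschitz_of_rates rate_first0 _; first by lra.
by move=> i; exists (1 / 2); [lra|exact: rate_first1].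
Qed.

End first_stage.

Variables (g : V -> R -> R) (alpha : R).
Hypothesis alpha01 : 0 < alpha < 1.
Hypothesis g_holder : holder_loc alpha (U `*` [set: R]) (fun p => g p.1 p.2).
Hypothesis g_ge0 : forall x t, U x -> 0 <= g x t.

Lemma powR_small_exp (q a b : R) : 0 <= q <= 1 -> 0 < a -> a <= b -> q `^ b <= q `^ a.
Proof.
move=> /andP[q0 q1] a0 ab; have [->|qn] := eqVneq q 0.
  by rewrite !powR0// gt_eqF// (lt_le_trans a0).
by apply: powR_le_exp => //; rewrite lt_neqAle eq_sym qn q0.
Qed.

Lemma holder_inner_weaken a (b b' : R) : 0 < b' -> b' <= b -> holder_inner U a b -> holder_inner U a b'.
Proof.
move=> b0 bb h r r0; have [C C0 hC] := h r r0; exists C => // x y xr yr xy.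
apply: le_trans (hC x y xr yr xy) _; rewrite ler_wpM2l//; apply: powR_small_exp => //.
by rewrite normr_ge0.
Qed.

Lemma holder_innerD a b (p : R) : holder_inner U a p -> holder_inner U b p -> holder_inner U (fun x => a x + b x) p.
Proof.
move=> ha hb r r0; have [C C0 hC] := ha r r0; have [D D0 hD] := hb r r0.
exists (C + D) => [|x y xr yr xy]; first exact: addr_ge0.
rewrite (_ : _ - _ = (a x - a y) + (b x - b y)); last by ring.
by rewrite mulrDl; apply: le_trans (ler_normD _ _) _; apply: lerD; [exact: hC|exact: hD].
Qed.

Lemma holder_innerZ a (c p : R) : holder_inner U a p -> holder_inner U (fun x => c * a x) p.
Proof.
move=> ha r r0; have [C C0 hC] := ha r r0.
exists (`|c| * C) => [|x y xr yr xy]; first exact: mulr_ge0.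
by rewrite -mulrBr normrM -mulrA ler_wpM2l//; exact: hC.
Qed.

Lemma eq_holder_inner a b (p : R) : (forall x, U x -> a x = b x) -> holder_inner U a p -> holder_inner U b p.
Proof.
move=> e ha r r0; have [C C0 hC] := ha r r0; exists C => // x y xr yr xy.
have Ux := inner_sub (ltW r0) xr; have Uy := inner_sub (ltW r0) yr.
by rewrite -(e x Ux) -(e y Uy); exact: hC.
Qed.

Lemma compact_closure_inner r : 0 < r -> exists2 K, compact K & inner U r `<=` K /\ K `<=` U.
Proof.
move=> r0; have [M hM] := bU; exists (closure (inner U r)); last first.
  split; first exact: subset_closure.
  move=> z /(_ (ball z r)) []; first exact: nbhsx_ballx.
  by move=> y [yr]; rewrite rV_ballE /= => /ltW; exact: yr.
have cB := @compact_boxc R n (fun _ => - M) (fun _ => M).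
have cC := compact_closed_rV cB.
apply: subclosed_compact cB _; first exact: closed_closure.
rewrite [X in _ `<=` X]((closure_id _).1 cC).
apply: closure_subset => z zr i; rewrite in_itv /= -ler_norml.
by apply: le_trans (coord_le_norm _ _) (hM z _); exact: inner_sub (ltW r0) zr.
Qed.

(** A Lipschitz [v] preserves the exponent of [g]. The minimum with [M] keeps the right-hand side
    bounded and does not increase differences. *)
Lemma holder_nonlinearity v (M : R) : (forall x, `|v x| <= M) -> holder_strong U v 1 ->
  holder_inner U (fun x => Num.min M (g x (v x))) alpha.
Proof.
move=> vM hv r r0; have [C1 C10 hC1] := hv r r0.
have [K cK [rK KU]] := compact_closure_inner r0.
have [C C0 hC] := holder_compact g_holder M cK KU.
have /andP[a0 a1] := alpha01.
exists (C * (1 + C1) `^ alpha); first by rewrite mulr_ge0 ?powR_ge0.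
move=> x y xr yr xy.
apply: le_trans (_ : `|g x (v x) - g y (v y)| <= _).
  have := ler_norm (g x (v x) - g y (v y)); have := ler_norm (g y (v y) - g x (v x)).
  rewrite (distrC (g y _)) ler_norml; move: (normr_ge0 (g x (v x) - g y (v y))).
  by case: (leP M (g x (v x))); case: (leP M (g y (v y))); lra.
apply: le_trans (hC x y _ _ (rK x xr) (rK y yr) (vM x) (vM y)) _.
rewrite -mulrA ler_wpM2l// -powRM ?addr_ge0//.
apply: ge0_ler_powR; rewrite ?nnegrE ?(ltW a0) ?mulr_ge0 ?addr_ge0 ?le_max ?normr_ge0//.
rewrite ge_max mulrDl mul1r lerDl mulr_ge0//=; apply: le_trans (hC1 x y xr yr) _.
by rewrite powRr1// lerDr.
Qed.

(** The tail terms moved to the right-hand side are as regular as [u] or Lipschitz, so with [f] and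
    [u] Hoelder the cap rises to 2 + alpha, below the number 3 of derivatives. *)
Lemma decays_second_stage f u d (M : R) : weak_sol U s f u d -> measurable_fun setT f -> zoff U f ->
  (forall x, `|f x| <= M) -> (forall x, `|u x| <= M) -> holder_inner U f alpha -> holder_inner U u alpha ->
  decays U u (2 + alpha) 3.
Proof.
have /andP[a0 a1] := alpha01.
move=> hs mf fU bf bu hf hu; apply: (decays_iter s01 oU bU hs mf fU bf bu (sigma := alpha)); try lra.
move=> rho rho0; apply: (decays_mono (m := 1)) => //.
have [L L0 hL] := truncated_rhs_bound s01 oU bU hs bf bu rho0.
apply: decays_holder; [|exact: ltW|].
  by split; [exact: (rint_truncated_rhs s01 oU bU hs mf bf bu rho0)|exists L].
set K := 2 * \int[mu]_h ktail s rho h.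
apply: (@eq_holder_inner (fun x => f x + (- K * u x + far_average s u rho x))).
  by move=> x Ux; rewrite /truncated_rhs indicE mem_set// mulr1 -/K; ring.
apply: holder_innerD => //; apply: holder_innerD; first exact: holder_innerZ.
have [L' L'0 hL'] := far_average_bound s01 oU bU hs bu rho0.
apply: (@holder_inner_weaken _ 1) => //; first exact: ltW.
move=> r r0; exists L' => // x y _ _ _; rewrite powRr1//.
by have [] := hL' x y.
Qed.

Lemma is_derive_open (a b : V -> R) x i (c : R) : (forall y, U y -> a y = b y) -> U x ->
  is_derive x (e_ i) a c -> is_derive x (e_ i) b c.
Proof.
move=> ab Ux; apply: near_eq_is_derive; have := oU Ux.
by apply: filterS => y; exact: ab.
Qed.

Lemma continuous_open (a b : V -> R) x : (forall y, U y -> a y = b y) -> U x ->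
  {for x, continuous a} -> {for x, continuous b}.
Proof.
move=> ab Ux ca A; rewrite -(ab x Ux) => hA; have := ca A hA.
by apply: filterS2 (oU Ux) => y Uy /=; rewrite ab.
Qed.

Lemma holder_continuous a (b : R) x : 0 < b -> holder_strong U a b -> U x -> {for x, continuous a}.
Proof.
move=> b0 ha Ux; have [r r0 xr] := open_inner oU Ux.
have r20 : 0 < r / 2 by rewrite divr_gt0.
have [C C0 hC] := ha _ r20.
move=> A /nbhs_ballP[e /= e0 hA]; apply/(@nbhs_ballP _ _ x).
have e20 : 0 < e / 2 by rewrite divr_gt0.
have [del /andP[del0 _] hd] := powR_le1_ex C0 b0 e20.
exists (Num.min del (r / 2)) => /=; first by rewrite lt_min del0.
move=> y; rewrite rV_ballE /= lt_min => /andP[xy xy2]; apply: hA; rewrite /ball /=.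
have yr : inner U (r / 2) y.
  have h : `|y - x| <= r / 2 by rewrite distrC ltW.
  have h2 : r / 2 <= r - r / 2 by lra.
  exact: inner_le h2 (inner_near xr h).
have xr2 : inner U (r / 2) x by apply: inner_le xr; lra.
apply: le_lt_trans (hC x y xr2 yr) _; apply: le_lt_trans (_ : e / 2 < _); last by lra.
apply: le_trans hd; rewrite ler_wpM2l//; apply: ge0_ler_powR; rewrite ?nnegrE ?(ltW b0) ?(ltW del0)//.
exact: ltW.
Qed.

Lemma holder_strong_loc a (b : R) : 0 < b -> holder_strong U a b -> holder_loc b U a.
Proof.
move=> b0 ha K cK KU; have [r r0 Kr] := compact_inner oU cK KU; have [C C0 hC] := ha r r0.
by exists C => x y Kx Ky; apply: hC; exact: Kr.
Qed.

(** The first pass, with a bounded right-hand side, gives the Lipschitz representative [v]; the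
    second, with the right-hand side recomputed from [v], gives the derivatives of the limit [v2] of
    the mollifications of [v]. *)
Lemma interior_regularity f u d (M : R) (N : set V) : weak_sol U s f u d -> measurable_fun setT f ->
  (forall x, (0 <= u x <= M) /\ (0 <= f x <= M)) -> measurable N -> mu N = 0%E ->
  (forall x, ~ N x -> U x -> f x = g x (u x)) ->
  exists v, [/\ measurable_fun setT v, zoff U v, forall x, `|v x| <= M, C2_holder_loc alpha U v & holder_strong U v 1 /\
    [ae mu, x | u x = v x]].
Proof.
move=> hs0 mf0 ufM mN N0 fg; have mU := open_measurable oU.
have /andP[a0 a1] := alpha01.
have M0 : 0 <= M by have [/andP[h1 h2] _] := ufM 0; exact: le_trans h2.
have [P [hP P0 P1]] := @unit_profile R n.
have null (u' v' : V -> R) (N' : set V) : measurable N' -> mu N' = 0%E -> zoff U u' ->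
    (forall x, ~ N' x -> U x -> u' x = v' x) -> forall x, ~ N' x -> u' x = v' x * \1_U x.
  move=> mN' N'0 zu' h x xN; have [Ux|Ux] := pselect (U x).
    by rewrite indicE mem_set// mulr1 h.
  by rewrite zu'// indicE memNset// mulr0.
have z1 (v' : V -> R) : zoff U (fun x => v' x * \1_U x) by move=> x Ux; rewrite indicE memNset// mulr0.
pose f1 x := f x * \1_U x.
have mf1 : measurable_fun setT f1 by apply: measurable_funM => //; exact: measurable_indic.
have bf1 x : `|f1 x| <= M.
  rewrite /f1 indicE; case: (x \in U); rewrite ?mulr0 ?normr0// mulr1.
  by have [_ /andP[h1 h2]] := ufM x; rewrite ger0_norm.
have bu0 x : `|u x| <= M by have [/andP[h1 h2] _] := ufM x; rewrite ger0_norm.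
have hs1 : weak_sol U s f1 u d.
  apply: (@conv_rhs_null f f1 u d set0 measurable0 (measure0 _)) hs0 => x _ Ux.
  by rewrite /f1 indicE mem_set// mulr1.
have zu : zoff U u by case: hs0 => -[].
have iu : rint mu u by case: hs0 => hu _ _; exact: (h10_rint oU bU hu).
have b32 : 0 < 3 / 2 :> R by lra.
have [mv vM [N1 [mN1 N10 hN1]]] := mollify_limit iu bu0 hP oU bU n0 b32 (rate_first0 hs1 mf1 (z1 f) bf1 bu0 hP) P0 P1.
have lipv := lipschitz_first hs1 mf1 (z1 f) bf1 bu0 hP.
set v := fun x => _ * \1_U x in mv vM.
have {}vM : forall x, `|v x| <= M := vM.
have ev x : U x -> wlim (mollify u P) [::] x = v x by move=> Ux; rewrite /v indicE mem_set// mulr1.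
have uv : forall x, ~ N1 x -> u x = v x := null u _ N1 mN1 N10 zu hN1.
have hsv : weak_sol U s f1 v d := weak_sol_null mN1 N10 mv (z1 _) uv hs1.
(* The right-hand side computed from the continuous representative is Hoelder at every point, while
   the given [f] agrees with it only almost everywhere. *)
pose f2 x : R := Num.min M (g x (v x)) * \1_U x.
have mf2 : measurable_fun setT f2.
  have hm := nonlinearity_measurable oU a0 g_holder mv.
  rewrite (_ : f2 = fun x => Num.min M (g x (v x) * \1_U x) * \1_U x); last first.
    by apply/funext => x; rewrite /f2 indicE; case: (x \in U); rewrite ?mulr1// !mulr0.
  by apply: measurable_funM; [exact: (measurable_minr (measurable_cst M) hm)|exact: measurable_indic].
have bf2 x : `|f2 x| <= M.
  rewrite /f2; have [Ux|Ux] := pselect (U x); last by rewrite indicE memNset// mulr0 normr0.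
  by rewrite indicE mem_set// mulr1 ger0_norm ?ge_min ?lexx// le_min M0 g_ge0.
have mNN : measurable (N `|` N1) by exact: measurableU.
have NN0 : mu (N `|` N1) = 0%E by rewrite measureU0.
have hs2 : weak_sol U s f2 v d.
  apply: (conv_rhs_null mNN NN0 _ hsv) => x /not_orP[xN xN1] Ux.
  rewrite /f1 /f2 indicE mem_set// !mulr1 -(uv x xN1) -fg//.
  by rewrite min_r//; case: (ufM x) => _ /andP[].
have lipv' : holder_strong U v 1.
  move=> r r0; have [C C0 hC] := lipv r r0; exists C => // x y xr yr.
  by rewrite -(ev x (inner_sub (ltW r0) xr)) -(ev y (inner_sub (ltW r0) yr)); exact: hC.
have hf2 : holder_inner U f2 alpha.
  apply: eq_holder_inner (holder_nonlinearity vM lipv') => x Ux.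
  by rewrite /f2 indicE mem_set// mulr1.
have hv : holder_inner U v alpha.
  by apply: (@holder_inner_weaken _ 1) => //; [exact: ltW|exact: holder_strong_inner].
have D3 := decays_second_stage hs2 mf2 (z1 _) bf2 vM hf2 hv.
have iv : rint mu v by case: hs2 => hv' _ _; exact: (h10_rint oU bU hv').
set w := mollify v P.
have sw : forall t, 0 < t -> smooth (w t) by move=> t t0; exact: smooth_mollify.
have r0 : rate U w [::] (3 / 2) := rate_first0 hs2 mf2 (z1 _) bf2 vM hP.
have r1 i : rate U w [:: i] (1 + alpha).
  have := decays_rate iv hP (l := [:: i]) D3 isT.
  by rewrite /= (_ : 2 + alpha - 1 = 1 + alpha); [apply; lra|ring].
have r2 i j : rate U w [:: i; j] alpha.
  have := decays_rate iv hP (l := [:: i; j]) D3 isT.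
  by rewrite /= (_ : 2 + alpha - 2 = alpha); [apply; lra|ring].
(* The orders 0 and 1 are Lipschitz; at order 2 the third derivatives are only O(t^(alpha-1)), which
   gives exactly the exponent [alpha]. *)
have h0 : holder_strong U (wlim w [::]) 1 := lipschitz_first hs2 mf2 (z1 _) bf2 vM hP.
have h1 i : holder_strong U (wlim w [:: i]) 1.
  apply: (lipschitz_of_rates hs2 vM hP _ (r1 i)); first by lra.
  by move=> j; exists alpha => //; exact: r2.
have h2 i j : holder_strong U (wlim w [:: i; j]) alpha.
  have [D hD] := mollify_bound iv vM hP [:: i; j].
  apply: (wlim_holder sw _ (r2 i j) hD); first by rewrite a0 ltW.
  move=> k r r0'; have := decays_mollify_bound iv hP (l := [:: k; i; j]) D3 isT r0'.
  by rewrite /= (_ : 2 + alpha - 3 = alpha - 1)//; ring.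
have [mv2 v2M [N2 [mN2 N20 hN2]]] := mollify_limit iv vM hP oU bU n0 b32 r0 P0 P1.
set v2 := fun x => _ * \1_U x in mv2 v2M.
have {}v2M : forall x, `|v2 x| <= M := v2M.
have e2 x : U x -> wlim w [::] x = v2 x by move=> Ux; rewrite /v2 indicE mem_set// mulr1.
have vv2 : forall x, ~ N2 x -> v x = v2 x := null v _ N2 mN2 N20 (z1 _) hN2.
have p1a : 0 < 1 + alpha by lra.
have d0 i x : U x -> is_derive x (e_ i) v2 (wlim w [:: i] x).
  move=> Ux; apply: (is_derive_open e2 Ux); have [r r0' xr] := open_inner oU Ux.
  exact: (wlim_derive sw b32 r0 p1a (r1 i) ltr01 (h1 i) r0' xr).
have E1 i x : U x -> wlim w [:: i] x = partial i v2 x.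
  by move=> Ux; rewrite (is_derive_partialE (d0 i x Ux)).
have d1 i j x : U x -> is_derive x (e_ j) (partial i v2) (wlim w [:: j; i] x).
  move=> Ux; apply: (is_derive_open (E1 i) Ux); have [r r0' xr] := open_inner oU Ux.
  exact: (wlim_derive sw p1a (r1 i) a0 (r2 j i) a0 (h2 j i) r0' xr).
have E2 i j x : U x -> wlim w [:: j; i] x = partial j (partial i v2) x.
  by move=> Ux; rewrite (is_derive_partialE (d1 i j x Ux)).
exists v2; split; [exact: mv2|exact: z1|exact: v2M|..].
- split.
    split; first by move=> x Ux; apply: (continuous_open e2 Ux); exact: (holder_continuous ltr01 h0).
    move=> i; split; first by move=> x Ux; have [] := d0 i x Ux.
    split; first by move=> x Ux; apply: (continuous_open (E1 i) Ux); exact: (holder_continuous ltr01 (h1 i)).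
    move=> j; split; first by move=> x Ux; have [] := d1 i j x Ux.
    split=> // x Ux; apply: (continuous_open (E2 i j) Ux); exact: (holder_continuous a0 (h2 j i)).
  move=> i j; apply: holder_strong_loc => //.
  move=> r r0'; have [C C0 hC] := h2 i j r r0'; exists C => // x y xr yr.
  by rewrite -(E2 j i x (inner_sub (ltW r0') xr)) -(E2 j i y (inner_sub (ltW r0') yr)); exact: hC.
- split.
    move=> r r0'; have [C C0 hC] := h0 r r0'; exists C => // x y xr yr.
    by rewrite -(e2 x (inner_sub (ltW r0') xr)) -(e2 y (inner_sub (ltW r0') yr)); exact: hC.
  exists (N1 `|` N2); split; [exact: measurableU|by rewrite measureU0|].
  by move=> x /not_orP[xN1 xN2]; rewrite (uv x xN1); exact: vv2.
Qed.

End interior.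

Lemma quarters_le (R : realType) (a b c d eps : R) : 0 < eps -> c <= eps / 8 -> d <= eps / 8 ->
  a + b <= eps / 4 -> a + c + (b + d) <= eps.
Proof. by lra. Qed.

(** * Boundary continuity *)
Section comparison.
Context {R : realType} {n : nat}.
Local Notation V := 'rV[R]_n.
Local Notation mu := (leb R n).
Local Notation mu2 := (leb2 R n).
Implicit Types (a b phi : V -> R) (x y z h : V) (t r : R) (i : 'I_n).
Variables (s : R) (s01 : 0 < s < 1) (n0 : (0 < n)%N).
Variables (U : set V) (oU : open U) (bU : norm_bounded U).

(** Here [b] need not be supported in [U], so the definition of weak derivative does not apply;
    vanishing of [phi] at the boundary, in the sense of approximation by test functions, takes its
    place. *)
Lemma h10_by_parts phi e b i : h10 U phi e -> Cc_smooth setT b ->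
  \int[mu]_x (e i x * b x) = - \int[mu]_x (phi x * partial i b x).
Proof.
move=> hphi hb; have [sphi se _ _ approx] := hphi.
have sb : sqint mu b := Cc_sqint hb.
have sdb : sqint mu (partial i b) by apply: (Cc_sqint (U := setT)); exact: Cc_partial.
pose B := \int[mu]_x (b x ^+ 2) + \int[mu]_x (partial i b x ^+ 2).
have B1 : 0 <= \int[mu]_x (b x ^+ 2) by exact: Rintegral_sqr_ge0.
have B2 : 0 <= \int[mu]_x (partial i b x ^+ 2) by exact: Rintegral_sqr_ge0.
apply/eqP; rewrite -subr_eq0 opprK -normr_le0; apply/ler_addgt0Pr => eps eps0; rewrite add0r.
pose c := eps / (4 * (B + 1)).
have B0 : 0 < B + 1 by rewrite /B; lra.
have c0 : 0 < c by rewrite divr_gt0// mulr_gt0.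
have ce0 : 0 < c * eps / 8 by rewrite divr_gt0// mulr_gt0.
have [psi [hpsi h1 /(_ i) h2]] := approx _ ce0.
have sp := Cc_sqint hpsi.
have spp : sqint mu (partial i psi) by apply: (Cc_sqint (U := U)); exact: Cc_partial.
have := Rintegral_by_parts i hpsi (Cc_smoothW hb) => h3.
have k1 := sqint_young c0 sb (sqintB (se i) spp).
have k2 := sqint_young c0 sdb (sqintB sphi sp).
have e1 : \int[mu]_x (b x * (e i x - partial i psi x)) = \int[mu]_x (e i x * b x) - \int[mu]_x (b x * partial i psi x).
  rewrite -RintegralB; [|by []|exact: sqint_mul|exact: sqint_mul].
  by apply: eq_Rintegral => x _; ring.
have e2 : \int[mu]_x (partial i b x * (phi x - psi x)) = \int[mu]_x (phi x * partial i b x) - \int[mu]_x (partial i b x * psi x).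
  rewrite -RintegralB; [|by []|exact: sqint_mul|exact: sqint_mul].
  by apply: eq_Rintegral => x _; ring.
rewrite e1 in k1; rewrite e2 in k2.
have -> : \int[mu]_x (e i x * b x) + \int[mu]_x (phi x * partial i b x) =
   (\int[mu]_x (e i x * b x) - \int[mu]_x (b x * partial i psi x)) + (\int[mu]_x (phi x * partial i b x) - \int[mu]_x (partial i b x * psi x)).
  by rewrite h3 opprK addrACA subrr addr0.
apply: le_trans (ler_normD _ _) _; apply: le_trans (lerD k1 k2) _.
have q1 : c^-1 * \int[mu]_x ((e i x - partial i psi x) ^+ 2) <= eps / 8.
  by rewrite ler_pdivrMl// mulrA ltW.
have q2 : c^-1 * \int[mu]_x ((phi x - psi x) ^+ 2) <= eps / 8.
  by rewrite ler_pdivrMl// mulrA ltW.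
have q3 : c * (\int[mu]_x (b x ^+ 2) + \int[mu]_x (partial i b x ^+ 2)) <= eps / 4.
  rewrite -/B /c mulrAC ler_pdivrMr ?mulr_gt0//.
  by rewrite [leRHS](_ : _ = eps * (B + 1)); [rewrite ler_wpM2l ?(ltW eps0)// lerDl|field].
by rewrite mulrDr in q3; exact: (quarters_le eps0 q1 q2 q3).
Qed.

(** Second differences of [b] are bounded by its second derivatives for |h| <= tau and by its sup
    norm beyond; [phi] enters only through its integral. *)
Lemma nonlocal_bound phi b (C2 C0 tau : R) : rint mu phi -> (forall x, 0 <= phi x) -> gagfin s phi ->
  Cc_smooth setT b -> 0 <= C2 -> 0 <= C0 -> 0 < tau ->
  (forall i j x, `|partial i (partial j b) x| <= C2) -> (forall x, `|b x| <= C0) ->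
  `|\int[mu2]_p energy s phi b p| <=
    (n%:R ^+ 2 * C2 * (tau `^ (2 - 2 * s) * near_const (n := n) s) + 4 * C0 * (tau `^ (- (2 * s)) * far_const (n := n) s)) *
    \int[mu]_x phi x.
Proof.
move=> iphi phi0 gphi hb C20 C00 t0 hC2 hC0.
have [i1 ->] := nonlocal_formula s01 iphi gphi hb.
set I := \int[mu]_x phi x.
have [in1 en1] := levy_near (n := n) s01 t0; have [if1 ef1] := levy_far (n := n) s01 t0.
rewrite -en1 -ef1 -RintegralZl// -RintegralZl// -RintegralD//; [|exact: rintZ|exact: rintZ].
rewrite -RintegralZr//; last by apply: rintD; exact: rintZ.
apply: le_trans (le_normr_Rintegral measurableT i1) _.
apply: le_rint; first exact: rint_abs.
  rewrite (_ : (fun _ => _) = fun h => I * (n%:R ^+ 2 * C2 * (`|h| ^+ 2 * levy s h * \1_[set h : V | `|h| <= tau] h)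
     + 4 * C0 * (levy s h * \1_[set h : V | tau < `|h|] h))).
    by apply: rintZ; apply: rintD; exact: rintZ.
  by apply/funext => h; rewrite mulrC.
move=> h; rewrite normrM (ger0_norm (levy_ge0 _ _)).
have md : measurable_fun setT (fun x => diff2 b h x).
  have mb := rint_measurable (Cc_rint hb).
  apply: measurable_funB; last exact: (rint_measurable (integrable_add (- h) (Cc_rint hb))).
  apply: measurable_funB; last exact: (rint_measurable (integrable_add h (Cc_rint hb))).
  exact: measurable_funM.
have gen (D : R) : (forall x, `|diff2 b h x| <= D) -> `|\int[mu]_x (phi x * diff2 b h x)| <= D * I.
  move=> hD; apply: le_trans (Rintegral_remainder iphi md hD) _.
  by under eq_Rintegral => x _ do rewrite (ger0_norm (phi0 _)).
have [ht|ht] := leP `|h| tau.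
  rewrite !indicE mem_set// memNset; last by rewrite /= ltNge ht.
  rewrite !mulr0 addr0 mulr1.
  rewrite [leRHS](_ : _ = levy s h * (n%:R ^+ 2 * C2 * `|h| ^+ 2 * I)); last by ring.
  rewrite ler_wpM2l ?levy_ge0//; apply: gen => x.
  rewrite /diff2 diff2_opp normrN.
  by apply: smooth_diff2_local => //; exact: Cc_smoothW hb.
rewrite !indicE memNset; last by rewrite /= leNgt ht.
rewrite mem_set// !mulr0 add0r mulr1.
rewrite [leRHS](_ : _ = levy s h * (4 * C0 * I)); last by ring.
by rewrite ler_wpM2l ?levy_ge0//; apply: gen => x; exact: diff2_le4.
Qed.

(** The equation is tested with einv(u - w0), where w0 = A (1 - b). The inequality for [b] is needed
    only where w0 < M, since elsewhere u <= M <= w0 and the test function vanishes. *)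
Lemma comparison f u d (M A C2 C0 tau : R) b : weak_sol U s f u d -> measurable_fun setT f ->
  (forall x, `|f x| <= M) -> (forall x, u x <= M) -> Cc_smooth setT b -> 0 <= A -> (forall x, b x <= 1) ->
  0 <= C2 -> 0 <= C0 -> 0 < tau ->
  (forall i j x, `|partial i (partial j b) x| <= C2) -> (forall x, `|b x| <= C0) ->
  (forall x, U x -> A * (1 - b x) < M ->
    M + A * (n%:R ^+ 2 * C2 * (tau `^ (2 - 2 * s) * near_const (n := n) s) +
             4 * C0 * (tau `^ (- (2 * s)) * far_const (n := n) s)) <= A * lapl b x) ->
  [ae mu, x | u x <= A * (1 - b x)].
Proof.
move=> hs mf bf uM hb A0 b1 C20 C00 t0 hC2 hC0 hsup.
set KN := _ + 4 * C0 * _ in hsup.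
have sb := Cc_smoothW hb.
pose w0 x := A * (1 - b x).
have sw0 : smooth w0 by apply: smoothZ; apply: smoothB => //; exact: smooth_cst.
have w00 x : 0 <= w0 x by rewrite mulr_ge0// subr_ge0.
have dw0 i x : partial i w0 x = - A * partial i b x.
  rewrite /w0 partialZ; last by apply: smoothB => //; exact: smooth_cst.
  by rewrite partialB//; [rewrite partial_cst sub0r mulrN mulNr|exact: smooth_cst].
have [hu gu heq] := hs.
have mu_ := sqint_measurable (let: And5 h _ _ _ _ := hu in h).
have bd : exists D : R, forall i x, `|partial i w0 x| <= D.
  have [i C C' CC h x|i|C _ hC] := @finite_bound R 'I_n (fun i C => forall x, `|partial i b x| <= C).
  - exact: le_trans (h x) CC.
  - by have [C C0' hC] := Cc_sup (Cc_partial i hb); exists C => //; exact: ltW.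
  by exists (A * C) => i x; rewrite dw0 normrM normrN (ger0_norm A0); apply: ler_wpM2l => //; exact: hC.
have [phi [e [hphi phiE eE]]] : exists phi e, [/\ h10 U phi e, forall x, phi x = einv (u x - w0 x) &
    forall i x, e i x = einv1 (u x - w0 x) * (d i x - partial i w0 x)].
  have h := h10_einv oU bU 1 hu sw0 w00 bd.
  eexists; eexists; split; first exact: h.
    by move=> x /=; rewrite mul1r.
  by move=> i x /=; rewrite !mul1r.
have gw0 : gagfin s w0.
  have := gagfin_Cc s01 (b := fun x => b x * (fun=> A) x) (Cc_mul hb (smooth_cst A)).
  congr (_ < _)%E; apply: eq_integral => p _; congr EFin.
  by rewrite /energy /w0; ring.
have gphi : gagfin s phi.
  rewrite (_ : phi = fun x => einv (1 * u x - w0 x)); last by apply/funext => x; rewrite phiE mul1r.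
  by apply: gagfin_einv => //; exact: smooth_measurable.
have eqn := heq phi e hphi gphi.
have phi0 x : 0 <= phi x by rewrite phiE; exact: einv_ge0.
have iphi : rint mu phi := h10_rint oU bU hphi.
have [sphi se zphi _ _] := hphi.
have sd : forall i, sqint mu (d i) by case: hu.
have sdb i : sqint mu (partial i b) by apply: (Cc_sqint (U := setT)); exact: Cc_partial.
have sdw i : sqint mu (partial i w0).
  by rewrite (_ : partial i w0 = fun x => - A * partial i b x); [exact: sqintZ|apply/funext => x; exact: dw0].
pose P1 x := \sum_i (d i x - partial i w0 x) * e i x.
have iP1 : rint mu P1 by apply: rint_sum => i; apply: sqint_mul => //; exact: sqintB.
have iP2 i : rint mu (fun x => partial i w0 x * e i x) by exact: sqint_mul.
have eP2 : \int[mu]_x (\sum_i partial i w0 x * e i x) = A * \int[mu]_x (phi x * lapl b x).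
  rewrite (Rintegral_sum _ measurableT (fun i _ => iP2 i)).
  transitivity (\sum_i A * \int[mu]_x (phi x * partial i (partial i b) x)).
    apply: eq_bigr => i _.
    under eq_Rintegral => x _ do rewrite dw0 mulrC mulrCA.
    have ieb : rint mu (fun x => e i x * partial i b x) := sqint_mul (se i) (sdb i).
    by rewrite (RintegralZl (- A) measurableT ieb) (h10_by_parts i hphi (Cc_partial i hb)) mulrNN.
  rewrite -mulr_sumr; congr (_ * _).
  under [RHS]eq_Rintegral => x _ do rewrite mulr_sumr.
  rewrite (Rintegral_sum _ measurableT)// => i _; apply: sqint_mul => //.
  by apply: (Cc_sqint (U := setT)); apply: Cc_partial; exact: Cc_partial.
have e1 : \int[mu]_x (\sum_i d i x * e i x) = \int[mu]_x P1 x + A * \int[mu]_x (phi x * lapl b x).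
  rewrite -eP2 -RintegralD//; last exact: rint_sum.
  by apply: eq_Rintegral => x _; rewrite /P1 -big_split; apply: eq_bigr => i _ /=; ring.
have mphi := sqint_measurable sphi.
have gb := gagfin_Cc s01 hb.
have mb := smooth_measurable sb.
have ie1 := rint_energy mu_ mphi gu gphi.
have ie2 := rint_energy mphi mb gphi gb.
(* Monotonicity of [einv] makes the energy of u - w0 against the test function nonnegative, so [u]
   may be replaced by [w0], whose differences are -A times those of [b]. *)
have e2 : \int[mu2]_p energy s u phi p >= - A * \int[mu2]_p energy s phi b p.
  rewrite -RintegralZl//; apply: le_rint => //; first exact: rintZ.
  move=> p; rewrite /energy !mulrA ler_wpM2r ?levy_ge0//.
  have : 0 <= (u p.1 - w0 p.1 - (u p.2 - w0 p.2)) * (phi p.1 - phi p.2).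
    rewrite !phiE; have [h|/ltW h] := leP (u p.1 - w0 p.1) (u p.2 - w0 p.2).
      by rewrite mulr_le0// subr_le0//; exact: einv_homo.
    by rewrite mulr_ge0// subr_ge0//; exact: einv_homo.
  rewrite /w0; move: (u p.1) (u p.2) (b p.1) (b p.2) (phi p.1) (phi p.2) => u1 u2 b1' b2' p1 p2.
  move=> h; rewrite -subr_ge0 (_ : _ - _ = (u1 - A * (1 - b1') - (u2 - A * (1 - b2'))) * (p1 - p2))//.
  by ring.
have e3 := nonlocal_bound iphi phi0 gphi hb C20 C00 t0 hC2 hC0.
have if1 : rint mu (fun x => f x * phi x).
  apply: (rint_le _ _ (rintZ M iphi)); first exact: measurable_funM.
  by move=> x; rewrite normrM (ger0_norm (phi0 x)) ler_wpM2r.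
have e4 : \int[mu]_x (f x * phi x) <= M * \int[mu]_x phi x.
  rewrite -RintegralZl//; apply: le_rint => //; first exact: rintZ.
  by move=> x; rewrite ler_wpM2r//; exact: le_trans (ler_norm _) (bf x).
have il : rint mu (fun x => phi x * lapl b x).
  have [D D0 hD] := Cc_sup (Cc_lapl hb).
  apply: (rint_le _ _ (rintZ D iphi)).
    by apply: measurable_funM => //; exact: smooth_measurable (Cc_smoothW (Cc_lapl hb)).
  by move=> x; rewrite normrM mulrC (ger0_norm (phi0 x)) ler_wpM2r.
have e5 : M * \int[mu]_x phi x + A * KN * \int[mu]_x phi x <= A * \int[mu]_x (phi x * lapl b x).
  rewrite -mulrDl -!RintegralZl//; apply: le_rint; [exact: rintZ|exact: rintZ|] => x.
  rewrite mulrCA mulrC; have [Ux|Ux] := pselect (U x); last by rewrite zphi// !mul0r.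
  have [h|h] := leP (u x) (w0 x).
    by rewrite (_ : phi x = 0) ?mul0r//; rewrite phiE einv_le0// subr_le0.
  by rewrite ler_wpM2l//; apply: hsup => //; apply: lt_le_trans h (uM x).
have P1ge0 x : 0 <= P1 x.
  apply: sumr_ge0 => i _; rewrite eE mulrCA -expr2 mulr_ge0 ?sqr_ge0//; exact: einv1_ge0.
have P10 : \int[mu]_x P1 x = 0.
  apply/eqP; rewrite eq_le Rintegral_ge0 ?andbT//.
  move: eqn e2 e3 e4 e5; rewrite e1 -/KN ler_norml.
  set X1 := \int[mu]_x P1 x; set X2 := \int[mu]_x (phi x * _); set X3 := \int[mu2]_p _; set X4 := \int[mu2]_p _.
  set X5 := \int[mu]_x (f x * _); set X6 := \int[mu]_x phi x.
  move=> h1 h2 /andP[_ h3] h4 h5.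
  have := ler_wpM2l A0 h3; rewrite mulrA; move: h1 h2 h4 h5; rewrite mulNr; clear; lra.
have [E E0 hE] := @einv_lipschitz R.
have [N [mN N0 hN]] : [ae mu, x | phi x = 0].
  apply: (h10_gradient0 n0 oU bU hphi) => i.
  apply/eqP; rewrite eq_le; apply/andP; split; last exact: Rintegral_sqr_ge0.
  apply: le_trans (_ : E * \int[mu]_x P1 x <= 0); last by rewrite P10 mulr0.
  rewrite -RintegralZl//; apply: le_rint; [exact: sqint_sqr|exact: rintZ|] => x.
  apply: le_trans (_ : E * ((d i x - partial i w0 x) * e i x) <= _).
    rewrite eE; set q := einv1 _; set v := d i x - _.
    have q0 : 0 <= q by exact: einv1_ge0.
    have qE : q <= E by rewrite /q; have [] := hE (u x - w0 x) 0.
    rewrite [leLHS](_ : _ = q * (q * v ^+ 2)); last by ring.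
    rewrite [leRHS](_ : _ = E * (q * v ^+ 2)); last by ring.
    by rewrite ler_wpM2r// mulr_ge0// sqr_ge0.
  rewrite ler_wpM2l ?(ltW E0)// /P1 (bigD1 i)//= lerDl; apply: sumr_ge0 => j _.
  by rewrite eE mulrCA -expr2 mulr_ge0 ?sqr_ge0//; exact: einv1_ge0.
exists N; split=> // x xN; rewrite leNgt; apply/negP => h.
have := hN x xN; rewrite phiE => /eqP; apply/negP; rewrite gt_eqF// einv_gt0 subr_gt0.
exact: h.
Qed.

End comparison.

(** * Exterior balls and barriers *)

Section exterior.
Context {R : realType} {n : nat}.
Local Notation V := 'rV[R]_n.
Local Notation e_ i := (delta_mx ord0 i : V).
Implicit Types (x y z : V).

Definition dotv (x y : V) : R := \sum_i x ord0 i * y ord0 i.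

Lemma dotvE x y : dotv x y = (x *m y^T) ord0 ord0.
Proof. by rewrite mxE; apply: eq_bigr => i _; rewrite mxE. Qed.

Lemma dotv_orthogonal (Q : 'M[R]_n) x y : Q *m Q^T = 1%:M -> dotv (x *m Q) (y *m Q) = dotv x y.
Proof. by move=> hQ; rewrite !dotvE trmx_mul -mulmxA (mulmxA Q) hQ mul1mx. Qed.

Lemma dotv_ge0 x : 0 <= dotv x x.
Proof. by apply: sumr_ge0 => i _; rewrite -expr2 sqr_ge0. Qed.

Lemma dotvDZ x y (c : R) : dotv (x + c *: y) (x + c *: y) = dotv x x + 2 * c * dotv x y + c ^+ 2 * dotv y y.
Proof.
rewrite /dotv !mulr_sumr -!big_split /=; apply: eq_bigr => i _; rewrite !mxE; ring.
Qed.

Lemma dotv_young x y : 2 * `|dotv x y| <= dotv x x + dotv y y.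
Proof.
have h1 := dotv_ge0 (x + 1 *: y); have h2 := dotv_ge0 (x + (-1) *: y).
rewrite dotvDZ expr1n in h1; rewrite dotvDZ sqrrN expr1n in h2.
by case: (ger0P (dotv x y)) => _; lra.
Qed.

Lemma norm_sqr_le_dotv x : `|x| ^+ 2 <= dotv x x.
Proof.
have -> : dotv x x = euclidean_norm x ^+ 2.
  rewrite sqr_sqrtr; last by apply: sumr_ge0 => i _; exact: sqr_ge0.
  by apply: eq_bigr => i _; rewrite expr2.
by rewrite lerXn2r ?nnegrE ?sqrtr_ge0//; exact: le_euclidean_norm.
Qed.

(** Subtracting the linear part leaves a function whose partial derivatives are at most L times the
    distance to [x]; the Lipschitz bound then gives a quadratic error. *)
Lemma C11_taylor (h : V -> R) x : C11 h -> exists2 L : R, 0 <= L & forall w : V,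
  h x + \sum_i w ord0 i * partial i h x - L * `|w| ^+ 2 <= h (w + x).
Proof.
move=> [[_ dh] lh].
have hd i y : derivable h y (e_ i) by have [h1 _] := dh i; exact: h1.
have [||L L0 hL] := @finite_bound R 'I_n (fun i L => forall y, `|partial i h y - partial i h x| <= L * `|y - x|).
- by move=> i C C' CC hC y; apply: le_trans (hC y) _; rewrite ler_wpM2r.
- move=> i; have [k [_ hk]] := lh i; exists (`|k| + 1) => [|y]; first by rewrite addr_ge0.
  have k1 : k < `|k| + 1 by rewrite ltr_pwDr// ler_norm.
  exact: (hk _ k1 (y, x)).
exists (n%:R * L) => [|w]; first by rewrite mulr_ge0.
pose l (y : V) := \sum_(i < n) partial i h x * y ord0 i.
have sl : smooth l by apply: smooth_sum => i; apply: smoothZ; exact: smooth_coord.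
have dl j y : is_derive y (e_ j) l (partial j h x).
  have := smooth_derive j y sl; congr is_derive.
  rewrite partial_sum; last by move=> k; apply: smoothZ; exact: smooth_coord.
  rewrite (bigD1 j)//= big1 => [|i ij].
    by rewrite partialZ; [rewrite partial_coord eqxx mulr1 addr0|exact: smooth_coord].
  by rewrite partialZ; [rewrite partial_coord (negbTE ij) mulr0|exact: smooth_coord].
pose g y := h y - l y.
have dg j y : is_derive y (e_ j) g (partial j h y - partial j h x).
  by have h1 := is_derive_partial (hd j y); have h2 := dl j y; exact: is_deriveB.
have lE : l (w + x) - l x = \sum_i w ord0 i * partial i h x.
  by rewrite /l -sumrB; apply: eq_bigr => i _; rewrite mxE; ring.
have gE : g (w + x) - g x = h (w + x) - h x - \sum_i w ord0 i * partial i h x.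
  by rewrite /g -lE; ring.
have dg' i y : derivable g y (e_ i) by have [] := dg i y.
have := @lip_local _ _ g x w (L * `|w|) dg' (mulr_ge0 L0 (normr_ge0 _)); rewrite gE => hg.
have {}hg : `|h (w + x) - h x - \sum_i w ord0 i * partial i h x| <= n%:R * (L * `|w|) * `|w|.
  apply: hg => i y yw; rewrite (is_derive_partialE (dg i y)); apply: le_trans (hL i y) _.
  by rewrite ler_wpM2l.
move: hg; rewrite (_ : n%:R * (L * `|w|) * `|w| = n%:R * L * `|w| ^+ 2); last by ring.
by rewrite ler_norml => /andP[hg _]; move: hg; lra.
Qed.

End exterior.

Section exterior_ball.
Context {R : realType} {n : nat}.
Local Notation V := 'rV[R]_n.

(** The ball with centre x0 - r N and radius [r] misses [U] for every small [r], not just for one;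
    the barrier argument fixes the radius only after its constants are known. *)
Lemma exterior_ball (U : set V) (x0 : V) : C11_boundary_at U x0 -> ~ U x0 ->
  exists N (R0 : R), [/\ dotv N N = 1, 0 < R0 & forall (r : R) x, 0 < r -> r <= R0 -> U x ->
    r ^+ 2 < dotv (x - x0 + r *: N) (x - x0 + r *: N)].
Proof.
move=> [Q [k [h [r [hQ hh r0 hU]]]]] Ux0.
pose p := col' k (x0 *m Q).
have [L L0 hL] := C11_taylor p hh.
(* The normal (-grad h, 1) to the graph in the rotated coordinates, pointing into [U]. *)
pose N0 : V := \row_i (if unlift k i is Some j then - partial j h p else 1).
have dN0 (w : V) : dotv w N0 = w ord0 k - \sum_j (col' k w) ord0 j * partial j h p.
  rewrite /dotv (bigD1_ord k)//= /N0 mxE unlift_none mulr1; congr (_ + _).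
  by rewrite -sumrN; apply: eq_bigr => j _; rewrite !mxE liftK mulrN.
have hp : (x0 *m Q) ord0 k <= h p.
  rewrite leNgt; apply/negP => hlt; apply: Ux0; apply/(hU x0 (ballxx _ r0)); exact: hlt.
have near x : ball x0 r x -> U x -> - L * dotv (x - x0) (x - x0) < dotv ((x - x0) *m Q) N0.
  move=> xr Ux; have := (hU x xr).1 Ux.
  set w := (x - x0) *m Q.
  have xw : x *m Q = w + x0 *m Q by rewrite /w mulmxBl subrK.
  have cw : col' k (x *m Q) = col' k w + p by rewrite xw; apply/rowP => j; rewrite !mxE.
  rewrite cw xw dN0 => h1; have h2 := hL (col' k w).
  have h3 : `|col' k w| ^+ 2 <= dotv (x - x0) (x - x0).
    rewrite -(dotv_orthogonal _ _ hQ) -/w; apply: le_trans (norm_sqr_le_dotv w).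
    rewrite lerXn2r ?nnegrE//; apply: rV_norm_le => // j; rewrite mxE.
    exact: coord_le_norm.
  have h4 := ler_wpM2l L0 h3; rewrite [X in h _ < X]mxE in h1.
  by move: h1 h2 h4 hp; lra.
pose m : R := Num.sqrt (dotv N0 N0).
have mN : 0 < dotv N0 N0.
  apply: lt_le_trans (_ : 1 <= _) => //; rewrite /dotv (bigD1 k)//= /N0 mxE unlift_none mulr1.
  by rewrite lerDl; apply: sumr_ge0 => i _; rewrite -expr2 sqr_ge0.
have m0 : 0 < m by rewrite sqrtr_gt0.
pose N := m^-1 *: (N0 *m Q^T).
have hQ' : Q^T *m Q = 1%:M by exact: mulmx1C.
have dN x : dotv x N = m^-1 * dotv (x *m Q) N0.
  rewrite -(dotv_orthogonal x N hQ) /N -scalemxAl -mulmxA hQ' mulmx1.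
  by rewrite /dotv mulr_sumr; apply: eq_bigr => i _; rewrite !mxE mulrCA.
have NN : dotv N N = 1.
  rewrite dN /N -scalemxAl -mulmxA hQ' mulmx1.
  have -> : dotv (m^-1 *: N0) N0 = m^-1 * dotv N0 N0.
    by rewrite /dotv mulr_sumr; apply: eq_bigr => i _; rewrite !mxE mulrA.
  have eN : dotv N0 N0 = m ^+ 2 by rewrite sqr_sqrtr// ltW.
  by rewrite eN; field; rewrite gt_eqF.
pose K : R := m^-1 * L; have K0 : 0 <= K by rewrite mulr_ge0// invr_ge0 ltW.
(* The third bound handles points near [x0], where the quadratic lower bound for the normal
   component applies; the first two handle points at distance at least [r]. *)
exists N, (Num.min (2^-1) (Num.min (r ^+ 2 / 4) (2 * K + 1)^-1)); split=> //.
  by rewrite !lt_min invr_gt0 ltr0n divr_gt0 ?exprn_gt0// invr_gt0 ltr_wpDl// mulr_ge0.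
move=> t x t0; rewrite !le_min => /and3P[t1 t2 t3] Ux.
rewrite dotvDZ NN mulr1 ltrDr.
set v := x - x0; set S := dotv v v.
have [xr|xr] := ltP `|x0 - x| r.
  have xb : ball x0 r x by rewrite rV_ballE.
  have hn := near x xb Ux; rewrite -/v -/S in hn.
  have h2 : - K * S < dotv v N.
    by rewrite dN (_ : - K * S = m^-1 * (- L * S)); [rewrite ltr_pM2l ?invr_gt0|rewrite /K; ring].
  have S0 : 0 <= S by exact: dotv_ge0.
  have h3 : 2 * K * t <= 1.
    have : t * (2 * K + 1) <= 1 by rewrite -ler_pdivlMr ?div1r//; lra.
    by lra.
  have h4 : 0 <= S * (1 - 2 * K * t) by rewrite mulr_ge0// subr_ge0.
  have h5 : 0 < t * (dotv v N + K * S) by rewrite mulr_gt0//; lra.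
  by move: h4 h5; lra.
have S1 : r ^+ 2 <= S.
  apply: le_trans (norm_sqr_le_dotv v); rewrite lerXn2r ?nnegrE ?(ltW r0)// /v distrC//.
have hy := dotv_young v N; rewrite NN -/S in hy.
have h1 : - (S + 1) <= 2 * dotv v N by have := ler_norm (- dotv v N); rewrite normrN; lra.
have h2 := ler_wpM2l (ltW t0) h1.
have h3 : t * S <= 2^-1 * S by rewrite ler_wpM2r//; apply: le_trans S1; exact: sqr_ge0.
have r20 : 0 < r ^+ 2 by rewrite exprn_gt0.
by move: h2 h3 t2 S1 r20; lra.
Qed.

End exterior_ball.

(** Transfers the closure properties of [smooth] to functions of one variable. *)
Lemma smooth1_line (R : realType) (m : nat) (Phi : 'rV[R]_m -> R) (i : 'I_m) (x : 'rV[R]_m) : smooth Phi ->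
  smooth1 (fun t : R => Phi (t *: delta_mx ord0 i + x)).
Proof.
move=> sPhi; exists (fun k t => dpart (nseq k i) Phi (t *: delta_mx ord0 i + x)); split=> // k t.
by apply/is_derive_line; apply: smooth_derive; exact: smooth_dpart.
Qed.

Section barrier.
Context {R : realType} {n : nat}.
Local Notation V := 'rV[R]_n.
Implicit Types (x y z : V).

(** A normalised and rescaled primitive of the bump einv(t) einv(1 - t). *)
Lemma smooth_step (a b : R) : a < b -> exists T : R -> R, [/\ smooth1 T, forall r, 0 <= T r <= 1,
  forall r, r <= a -> T r = 0 & forall r, b <= r -> T r = 1].
Proof.
move=> ab; pose P0 (t : R) : R := einv t * einv (1 - t).
have ba : 0 < b - a by rewrite subr_gt0.
have hP0 : profile P0.
  split; last by move=> t t1; rewrite /P0 [einv (1 - t)]einv_le0 ?mulr0// subr_le0.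
  pose Phi (x : 'rV[R]_1) : R := einv (x ord0 ord0) * einv (1 - x ord0 ord0).
  have sPhi : smooth Phi.
    apply: smoothM; first by apply: (smooth_comp smooth1_einv); exact: smooth_coord.
    apply: (smooth_comp smooth1_einv); apply: smoothB; first exact: smooth_cst.
    exact: smooth_coord.
  have := smooth1_line ord0 0 sPhi; congr smooth1; apply/funext => t.
  by rewrite /Phi !mxE /= mulr1 addr0.
have [Q hQ dQ] := profile_primitive hP0.
have P00 t : 0 <= P0 t by rewrite mulr_ge0// einv_ge0.
have mono (x y : R) : x <= y -> Q y <= Q x.
  move=> xy; have [c e] := @MVT_line R Q (fun t => - 2^-1 * P0 t) x y dQ.
  by rewrite -subr_le0 e mulr_le0_ge0 ?subr_ge0// mulNr oppr_le0 mulr_ge0.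
have Q1 : Q 1 = 0 by apply: hQ.2.
have Qle0 (x : R) : x <= 0 -> Q x = Q 0.
  rewrite le_eqVlt => /orP[/eqP->//|x0].
  have cQ : {within `[x, 0], continuous Q} by apply: derivable_within_continuous => t _; have [] := dQ t.
  have [c] := @MVT R Q _ x 0 x0 (fun t _ => dQ t) cQ; rewrite in_itv /= => /andP[_ c0].
  by rewrite /P0 (einv_le0 (ltW c0)) mul0r mulr0 mul0r => /eqP; rewrite subr_eq0 => /eqP.
have Q00 : 0 < Q 0.
  have cQ : {within `[0, 1], continuous Q} by apply: derivable_within_continuous => t _; have [] := dQ t.
  have [c] := @MVT R Q _ 0 1 ltr01 (fun t _ => dQ t) cQ; rewrite in_itv /= => /andP[c0 c1].
  rewrite Q1 subr0 mulr1 sub0r mulNr => /oppr_inj ->.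
  by rewrite mulr_gt0// /P0 mulr_gt0 ?einv_gt0// subr_gt0.
exists (fun r => 1 - (Q 0)^-1 * Q ((b - a)^-1 * r + - a / (b - a))); split.
- have [D [D0 hD]] := smooth1_comp_affine (b - a)^-1 (- a / (b - a)) hQ.1.
  exists (fun k => if k is k'.+1 then fun r => - (Q 0)^-1 * D k'.+1 r else fun r => 1 - (Q 0)^-1 * D 0%N r).
  split; first by rewrite D0.
  move=> [|k] x.
    have h1 := is_deriveZ (Q 0)^-1 (hD 0%N x).
    have h2 := is_deriveB (is_derive_cst (1 : R) x 1) h1.
    by move: h2; congr is_derive; rewrite sub0r mulNr.
  by have h1 := is_deriveZ (- (Q 0)^-1) (hD k.+1 x); exact: h1.
- move=> r; set q := Q (_ * r + _).
  have q0 : 0 <= q.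
    have [h|/ltW h] := leP ((b - a)^-1 * r + - a / (b - a)) 1; first by rewrite -Q1; exact: mono.
    by rewrite /q hQ.2.
  have q1 : q <= Q 0.
    have [h|/ltW h] := leP ((b - a)^-1 * r + - a / (b - a)) 0; first by rewrite /q Qle0.
    exact: mono.
  have h1 : 0 <= (Q 0)^-1 * q by rewrite mulr_ge0// invr_ge0 ltW.
  have h2 : (Q 0)^-1 * q <= 1 by rewrite ler_pdivrMl// mulr1.
  by rewrite subr_ge0 h2 gerBl.
- move=> r ra; rewrite Qle0 ?mulVf ?subrr ?gt_eqF//.
  by rewrite [leLHS](_ : _ = (b - a)^-1 * (r - a)); [rewrite mulr_ge0_le0 ?invr_ge0 ?(ltW ba)// subr_le0|ring].
- move=> r rb; have e1 : Q ((b - a)^-1 * r + - a / (b - a)) = 0.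
    apply: hQ.2; rewrite [leRHS](_ : _ = (b - a)^-1 * (r - a)); last by ring.
    by rewrite mulrC ler_pdivlMr// mul1r lerD2r.
  by rewrite e1 mulr0 subr0.
Qed.

Local Notation sq := (fun y : V => \sum_(i < n) y ord0 i ^+ 2).

Lemma smooth1_exp (c e : R) : smooth1 (fun r : R => expR (c * r + e)) /\
  forall r : R, is_derive r (1 : R) (fun r : R => expR (c * r + e)) (c * expR (c * r + e)).
Proof.
have h (r : R) : is_derive r (1 : R) (fun r : R => expR (c * r + e)) (c * expR (c * r + e)).
  have h1 : is_derive r (1 : R) (fun r : R => c * r + e) c.
    have := is_deriveD (is_deriveZ c (is_derive_id r (1 : R))) (is_derive_cst e r (1 : R)).
    by congr is_derive; rewrite addr0 /GRing.scale /= mulr1.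
  have := @is_derive1_comp _ (@expR R) (fun r : R => c * r + e) r _ _ (is_derive_expR (c * r + e)) h1.
  by congr is_derive; rewrite mulrC.
split=> //; exists (fun k r => c ^+ k * expR (c * r + e)); split.
  by apply/funext => r; rewrite expr0 mul1r.
move=> k r; have := is_deriveZ (c ^+ k) (h r); congr is_derive.
by rewrite /GRing.scale /= mulrA -exprSr.
Qed.

Lemma lapl_exp_sqnorm (c e : R) : smooth (fun y : V => expR (c * sq y + e)) /\
  forall y, lapl (fun y : V => expR (c * sq y + e)) y = (2 * n%:R * c + 4 * c ^+ 2 * sq y) * expR (c * sq y + e).
Proof.
have [s1 d1] := smooth1_exp c e; have ssq := @smooth_sqnorm R n.
have sE : smooth (fun y : V => expR (c * sq y + e)) := smooth_comp s1 ssq.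
split=> // y.
have p1 i : partial i (fun y : V => expR (c * sq y + e)) = fun y => (2 * c * y ord0 i) * expR (c * sq y + e).
  by apply/funext => z; rewrite (partial_comp1 i z d1 ssq) partial_sqnorm; ring.
have p2 i : partial i (partial i (fun y : V => expR (c * sq y + e))) y =
    (2 * c + 4 * c ^+ 2 * y ord0 i ^+ 2) * expR (c * sq y + e).
  rewrite p1 partialM//; last by apply: smoothZ; exact: smooth_coord.
  rewrite partialZ; last exact: smooth_coord.
  by rewrite partial_coord eqxx p1 mulr1 /=; ring.
rewrite /lapl (eq_bigr _ (fun i _ => p2 i)) -mulr_suml; congr (_ * _).
by rewrite big_split /= sumr_const card_ord -mulr_natl -mulr_sumr; congr (_ + _); ring.
Qed.

(** For 1 < |y|^2 < 2 the function is the Gaussian exp(-n (|y|^2 - 1 + eta)), whose Laplacian 2 n^2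
    (2 |y|^2 - 1) b is at least n^2 where b > 1/2. Inside it is flattened to 1, which keeps b <= 1,
    and outside it is cut off. *)
Lemma barrier (eps : R) : (0 < n)%N -> 0 < eps -> exists b : V -> R,
  [/\ Cc_smooth setT b, forall y, 0 <= b y <= 1, forall N, dotv N N = 1 -> 1 - b N <= eps &
      forall y, 1 < dotv y y -> 2^-1 < b y -> 1 <= lapl b y].
Proof.
move=> n0 eps0; have dE y : dotv y y = sq y by apply: eq_bigr => i _; rewrite expr2.
have nn : 1 <= n%:R :> R by rewrite ler1n.
(* On the unit sphere the Gaussian is exp(-n eta) >= 1 - n eta >= 1 - eps. *)
pose eta := Num.min 2^-1 (eps / n%:R).
have eta0 : 0 < eta by rewrite lt_min invr_gt0 ltr0n divr_gt0// ltr0n.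
have [T [sT T01 Ta Tb]] : exists T : R -> R, [/\ smooth1 T, forall r, 0 <= T r <= 1,
  forall r, r <= 1 - eta -> T r = 0 & forall r, 1 <= r -> T r = 1] by apply: smooth_step; lra.
have [S [sS S01 Sa Sb]] : exists T : R -> R, [/\ smooth1 T, forall r, 0 <= T r <= 1,
  forall r, r <= 2 -> T r = 0 & forall r, 3 <= r -> T r = 1] by apply: smooth_step; lra.
pose c : R := - n%:R; pose e : R := n%:R * (1 - eta).
pose E (y : V) := expR (c * sq y + e).
have [sE lE] := lapl_exp_sqnorm c e.
have ssq := @smooth_sqnorm R n.
have E0 y : 0 < E y by exact: expR_gt0.
pose b (y : V) := (1 - T (sq y) * (1 - E y)) * (1 - S (sq y)).
have sb : smooth b.
  apply: smoothM; apply: smoothB; try exact: smooth_cst; last exact: smooth_comp.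
  by apply: smoothM; [exact: smooth_comp|apply: smoothB => //; exact: smooth_cst].
have f01 y : 0 <= 1 - T (sq y) * (1 - E y) <= 1.
  have /andP[T0 T1] := T01 (sq y); have Ey := ltW (E0 y).
  apply/andP; split.
    have h : 0 <= T (sq y) * E y by exact: mulr_ge0.
    by move: h T1; lra.
  rewrite gerBl; have [h|h] := leP (sq y) (1 - eta); first by rewrite Ta// mul0r.
  rewrite mulr_ge0// subr_ge0 -[leRHS]expR0 ler_expR /c /e mulNr addrC -mulrBr.
  by rewrite mulr_ge0_le0// subr_le0 ltW.
exists b; split.
- apply: (@Cc_out _ _ _ 3) => // y y3; rewrite /b Sb ?subrr ?mulr0//.
  have := norm_sqr_le_dotv y; rewrite dE => h; apply: le_trans h.
  rewrite expr2; apply: le_trans (_ : 3 * 1 <= _); first by rewrite mulr1.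
  by apply: ler_pM => //; [exact: ltW|lra].
- move=> y; have /andP[h1 h2] := f01 y; have /andP[h3 h4] := S01 (sq y).
  have h5 : 0 <= 1 - S (sq y) by rewrite subr_ge0.
  by rewrite /b mulr_ge0//=; apply: mulr_ile1 => //; rewrite gerBl.
- move=> N; rewrite dE => N1; rewrite /b Tb ?N1// Sa ?subr0 ?mulr1 ?mul1r; last lra.
  rewrite /E N1; have := expR_ge1Dx (c * 1 + e).
  have h : n%:R * eta <= eps.
    by rewrite -ler_pdivlMl ?ltr0n// mulrC ge_min lexx orbT.
  by move: h; rewrite /c /e; lra.
move=> y; rewrite dE => y1 by1.
have ET : b y <= E y.
  have /andP[h3 h4] := S01 (sq y); rewrite /b Tb ?(ltW y1)// mul1r opprB addrCA subrr addr0.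
  by rewrite ler_piMr ?(ltW (E0 y))// gerBl.
have Eh : 2^-1 < E y by exact: lt_le_trans ET.
(* At |y|^2 >= 2 the Gaussian is at most exp(-1) <= 1/2, so the condition b > 1/2 confines [y] to
   the region without cutoff. *)
have y2 : sq y < 2.
  rewrite ltNge; apply/negP => y2; have : E y <= 2^-1; last by rewrite leNgt Eh.
  apply: le_trans (_ : expR (-1) <= _).
    rewrite ler_expR /c /e; have h : n%:R * 1 <= n%:R * (sq y - 1 + eta).
      by rewrite ler_wpM2l//; move: eta0 y2; lra.
    by move: h nn; lra.
  by rewrite expRN lef_pV2 ?posrE ?expR_gt0//; have := @expR_ge1Dx R 1; lra.
have -> : lapl b y = lapl E y.
  pose O : set V := [set z | 1 < sq z < 2].
  have oO : open O.
    rewrite (_ : O = sq @^-1` [set t | 1 < t < 2]); last by [].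
    apply: open_comp => [z _|]; first exact: (smooth_continuous ssq).
    rewrite (_ : [set _ | _] = `]1, 2[%classic); last by apply/seteqP; split=> t /=; rewrite in_itv.
    exact: interval_open.
  have bE z : O z -> E z = b z.
    move=> /andP[z1 z2]; rewrite /b Tb ?(ltW z1)// Sa ?(ltW z2)// mul1r subr0 mulr1; ring.
  rewrite /lapl; apply: eq_bigr => i _.
  have Oy : O y by rewrite /O /= y1 y2.
  have p1 z : O z -> partial i E z = partial i b z.
    by move=> Oz; rewrite (is_derive_partialE (is_derive_open oO bE Oz (smooth_derive i z sE))).
  by rewrite (is_derive_partialE (is_derive_open oO p1 Oy (smooth_derive i y (smooth_partial i sE)))).
rewrite /E lE -/(E y); have h1 : n%:R ^+ 2 <= n%:R ^+ 2 * (2 * E y).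
  by rewrite ler_peMr ?exprn_ge0//; move: Eh; lra.
have h2 : 1 <= n%:R ^+ 2 :> R by rewrite -[leLHS](expr1n _ 2) lerXn2r ?nnegrE.
have h3 : 0 <= n%:R ^+ 2 * (E y * (sq y - 1)) by rewrite !mulr_ge0 ?exprn_ge0 ?(ltW (E0 y))// subr_ge0 ltW.
by move: h1 h2 h3; rewrite /c; lra.
Qed.

End barrier.

Section boundary.
Context {R : realType} {n : nat}.
Local Notation V := 'rV[R]_n.
Local Notation mu := (leb R n).
Implicit Types (x y z : V).
Variables (s : R) (s01 : 0 < s < 1) (n0 : (0 < n)%N).
Variables (U : set V) (oU : open U) (bU : norm_bounded U).

Lemma ae_le_continuous (v w : V -> R) (N : set V) x : measurable N -> mu N = 0%E ->
  (forall y, ~ N y -> v y <= w y) -> {for x, continuous v} -> {for x, continuous w} -> v x <= w x.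
Proof.
move=> mN N0 vw cv cw; rewrite leNgt; apply/negP => wv.
have e0 : 0 < (v x - w x) / 2 by rewrite divr_gt0// subr_gt0.
have nv := cv _ (nbhsx_ballx (v x) _ e0); have nw := cw _ (nbhsx_ballx (w x) _ e0).
have /nbhs_ballP[r /= r0 hr] : nbhs x ((v @^-1` ball (v x) ((v x - w x) / 2)) `&` (w @^-1` ball (w x) ((v x - w x) / 2))).
  exact: filterI.
have nN : mu.-negligible N by exists N; split.
have [y yb yN] := negligible_ball x nN r0.
have [h1 h2] := hr y yb; have h3 := vw y yN; move: h1 h2.
by rewrite /ball /= !ltr_norml; move: h3; lra.
Qed.

(** The barrier is rescaled to an exterior ball of radius [r]: its Laplacian grows like r^-2 and its
    fractional term only like r^(-2s), so a small radius makes it a supersolution. At [x0] the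
    majorant is at most [eps]. *)
Lemma boundary_majorant f u d (M : R) x0 : weak_sol U s f u d -> measurable_fun setT f -> 0 < M ->
  (forall x, `|f x| <= M) -> (forall x, u x <= M) -> C11_boundary_at U x0 -> ~ U x0 ->
  forall eps : R, 0 < eps -> exists w N, [/\ continuous w, w x0 <= eps, measurable N, mu N = 0%E &
    forall x, ~ N x -> u x <= w x].
Proof.
move=> hs mf M0 bf uM hx0 Ux0 eps eps0.
have [Nu [R0 [N1 R00 hR]]] := exterior_ball hx0 Ux0.
have e20 : 0 < eps / (2 * M) by rewrite divr_gt0// mulr_gt0.
have [b [hb b01 bN bl]] := barrier n0 e20.
have sb := Cc_smoothW hb.
have [C2 C20 hC2] := Cc_second_bound hb.
have near0 := near_const_ge0 (n := n) s; have far0 := far_const_ge0 (n := n) s.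
set near := near_const s in near0; set far := far_const s in far0.
pose Kn := n%:R ^+ 2 * C2 * near + 4 * far.
have Kn0 : 0 <= Kn by rewrite addr_ge0// !mulr_ge0.
have s2 : 0 < 2 - 2 * s by have /andP[_ h] := s01; move: h; lra.
have K10 : 0 <= 1 + 2 * Kn by rewrite addr_ge0// mulr_ge0.
(* After the two scalings this is the requirement that the Laplacian dominates both the fractional
   term and the bound on [f]. *)
have [r1 /andP[r10 r11] hr1] := powR_le1_ex K10 s2 ltr01.
pose r := Num.min r1 R0.
have r0 : 0 < r by rewrite lt_min r10.
have rr1 : r <= r1 by rewrite ge_min lexx.
have r01 : r <= 1 by exact: le_trans r11.
have hr : (1 + 2 * Kn) * r `^ (2 - 2 * s) <= 1.
  apply: le_trans hr1; rewrite ler_wpM2l//; apply: powR_le_base => //; exact: ltW.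
(* The affine map sends the exterior ball with centre x0 - r Nu to the unit ball and [x0] to
   [Nu]. *)
pose p := Nu - r^-1 *: x0.
pose B (x : V) := b (r^-1 *: x + p).
have Bx x : r^-1 *: x + p = r^-1 *: (x - x0 + r *: Nu).
  rewrite /p scalerDr scalerBr scalerA mulVf ?gt_eqF// scale1r.
  by rewrite addrA addrAC.
have r_1 : 0 < r^-1 by rewrite invr_gt0.
have sB : smooth B by exact: smooth_affine.
have hB : Cc_smooth setT B.
  have := Cc_translate p hb => h1; rewrite (_ : B = fun x => (fun y => b (p + y)) (r^-1 *: x)).
    have := Cc_dilate 0 r0 h1; congr Cc_smooth; apply/funext => x.
    by rewrite /dilate expr0 mul1r.
  by apply/funext => x; rewrite /B addrC.
have B2 i j x : partial i (partial j B) x = r^-1 ^+ 2 * partial i (partial j b) (r^-1 *: x + p).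
  by have := dpart_affine [:: i; j] r^-1 p sb => /(congr1 (@^~ x)).
have [N [mN N0 hN]] : [ae mu, x | u x <= 2 * M * (1 - B x)].
  apply: (@comparison R n s s01 n0 U oU bU f u d M (2 * M) (r^-1 ^+ 2 * C2) 1 r B) => //.
  - by rewrite mulr_ge0// ltW.
  - by move=> x; case/andP: (b01 (r^-1 *: x + p)).
  - by rewrite mulr_ge0// exprn_ge0// ltW.
  - by move=> i j x; rewrite B2 normrM ger0_norm ?exprn_ge0 ?(ltW r_1)// ler_wpM2l ?exprn_ge0 ?(ltW r_1).
  - by move=> x; have /andP[h1 h2] := b01 (r^-1 *: x + p); rewrite ger0_norm.
  move=> x Ux hx.
  (* The amplitude 2M makes the condition 2M (1 - B) < M of the comparison equivalent to B > 1/2,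
     the range in which the barrier was constructed. *)
  have B12 : 2^-1 < B x by rewrite -(ltr_pM2l M0); move: hx; lra.
  have y1 : 1 < dotv (r^-1 *: x + p) (r^-1 *: x + p).
    have := hR r x r0 _ Ux; rewrite ge_min lexx orbT => /(_ isT) h.
    have -> : dotv (r^-1 *: x + p) (r^-1 *: x + p) = r^-1 ^+ 2 * dotv (x - x0 + r *: Nu) (x - x0 + r *: Nu).
      by rewrite Bx /dotv mulr_sumr; apply: eq_bigr => i _; rewrite [LHS]/= !(mxE, scaler_nat) ; ring.
    by rewrite exprVn mulrC ltr_pdivlMr ?exprn_gt0// mul1r.
  have l1 := bl _ y1 B12.
  have -> : lapl B x = r^-1 ^+ 2 * lapl b (r^-1 *: x + p).
    by rewrite /lapl mulr_sumr; apply: eq_bigr => i _; exact: B2.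
  have e1 : r^-1 ^+ 2 * r `^ (2 - 2 * s) = r `^ (- (2 * s)).
    by rewrite exprV_powR// -powR_add//; congr (_ `^ _); ring.
  have h1 : 1 <= r `^ (- (2 * s)).
    rewrite -[leLHS](powRr0 r); apply: powR_le_exp; first by rewrite r0.
    by have /andP[h _] := s01; move: h; lra.
  have h2 : (1 + 2 * Kn) * r `^ (- (2 * s)) <= r^-1 ^+ 2.
    by rewrite -e1 mulrCA ler_piMr// exprn_ge0// ltW.
  have h3 : 1 + 2 * Kn * r `^ (- (2 * s)) <= r^-1 ^+ 2 * lapl b (r^-1 *: x + p).
    apply: le_trans (_ : r^-1 ^+ 2 * 1 <= _); last by rewrite ler_wpM2l// exprn_ge0// ltW.
    by move: h1 h2; lra.
  have h4 := ler_wpM2l (ltW M0) h3.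
  have h5 : 0 <= M * (r^-1 ^+ 2 * lapl b (r^-1 *: x + p)).
    by rewrite !mulr_ge0 ?exprn_ge0 ?(ltW M0) ?(ltW r_1)// (le_trans _ l1).
  rewrite -/near -/far mulr1.
  have -> : n%:R ^+ 2 * (r^-1 ^+ 2 * C2) * (r `^ (2 - 2 * s) * near) + 4 * (r `^ (- (2 * s)) * far) = Kn * r `^ (- (2 * s)).
    by rewrite -e1 /Kn; ring.
  by move: h4 h5; lra.
exists (fun x => 2 * M * (1 - B x)), N; split=> //.
  by apply: smooth_continuous; apply: smoothZ; apply: smoothB => //; exact: smooth_cst.
have -> : B x0 = b Nu by rewrite /B /p addrCA subrr addr0.
by rewrite mulrC -ler_pdivlMr ?mulr_gt0//; exact: bN.
Qed.

(** Away from the closure of [U] the function is locally 0; at a boundary point the almost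
    everywhere majorant holds pointwise in [U] because both functions are continuous there. *)
Lemma boundary_continuity f u d (M : R) : weak_sol U s f u d -> measurable_fun setT f -> 0 < M ->
  (forall x, `|f x| <= M) -> (forall x, 0 <= u x <= M) -> (forall x, U x -> {for x, continuous u}) ->
  (forall x0, (closure U `\` U) x0 -> C11_boundary_at U x0) -> continuous u.
Proof.
move=> hs mf M0 bf uM cu hb x0.
have zu : zoff U u by case: hs => -[].
have [Ux0|Ux0] := pselect (U x0); first exact: cu.
move=> A /nbhs_ballP[e /= e0 hA]; rewrite zu// in hA.
have [cl|ncl] := pselect (closure U x0); last first.
  have : nbhs x0 (~` closure U) by apply: open_nbhs_nbhs; split=> //; apply: closed_openC; exact: closed_closure.
  apply: filterS => y /= ny; apply: hA; rewrite zu; first exact: ballxx.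
  by move=> Uy; apply: ny; exact: subset_closure.
have e20 : 0 < e / 2 by rewrite divr_gt0.
have [w [N [cw wx0 mN N0 hN]]] := boundary_majorant hs mf M0 bf (fun x => let: conj _ h := andP (uM x) in h) (hb x0 (conj cl Ux0)) Ux0 e20.
have hw : nbhs x0 (w @^-1` ball (w x0) (e / 2)) := cw x0 _ (nbhsx_ballx (w x0) _ e20).
suff : nbhs x0 (u @^-1` A) by [].
move: hw; apply: filterS => y /=; rewrite /ball /= ltr_norml => /andP[h1 h2]; apply: hA.
rewrite /ball /= sub0r normrN.
have /andP[u0 uM'] := uM y; rewrite ger0_norm//.
have [Uy|Uy] := pselect (U y); last by rewrite zu.
have := ae_le_continuous mN N0 hN (cu y Uy) (cw y).
by move: h1 h2 wx0; lra.
Qed.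

End boundary.

Lemma no_decrease (R : realType) (G G' : R -> R) (K b : R) : 0 < b -> 0 <= K ->
  (forall t : R, 0 < t -> is_derive t (1 : R) G (G' t)) -> (forall t, 0 < t -> t <= b -> G' t < 0) ->
  (forall t, 0 < t -> 0 <= G t) -> (forall t, 0 < t -> t <= b -> G t <= K * t) -> False.
Proof.
move=> b0 K0 dG neg G0 GK.
have mono x y : 0 < x -> x < y -> y <= b -> G y < G x.
  move=> x0 xy yb.
  have cG : {within `[x, y], continuous G}.
    apply: derivable_within_continuous => t; rewrite in_itv /= => /andP[xt _].
    by have [] := dG t (lt_le_trans x0 xt).
  have [t|c] := @MVT R G G' x y xy _ cG.
    by rewrite in_itv /= => /andP[xt _]; apply: dG; exact: lt_trans xt.
  rewrite in_itv /= => /andP[xc cy] e; rewrite -subr_lt0 e pmulr_llt0 ?subr_gt0//.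
  by apply: neg; [exact: lt_trans xc|apply: le_trans yb; exact: ltW].
have b2 : b / 2 < b by lra.
have b20 : 0 < b / 2 by lra.
have g2 : 0 < G (b / 2) by apply: le_lt_trans (mono _ _ b20 b2 (lexx _)); exact: G0.
pose a := Num.min (b / 4) (G (b / 2) / (K + 1)).
have c1 : 0 < K + 1 by rewrite ltr_wpDl.
have a0 : 0 < a by rewrite lt_min !divr_gt0.
have a4 : a < b / 2 by apply: le_lt_trans (_ : b / 4 < _); [rewrite ge_min lexx|lra].
have g3 := mono _ _ a0 a4 (ltW b2).
have g4 := GK a a0 (ltW (lt_trans a4 b2)).
have g5 : a * (K + 1) <= G (b / 2) by rewrite -ler_pdivlMr// ge_min lexx orbT.
by move: g3 g4 g5 a0; lra.
Qed.

(** * Strong maximum principle *)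
Section strong_maximum.
Context {R : realType} {n : nat}.
Local Notation V := 'rV[R]_n.
Local Notation mu := (leb R n).
Implicit Types (x y z h : V) (t r : R).

Lemma conv_le_local (a zeta : V -> R) z t (K : R) : rint mu a -> Cc_smooth setT zeta -> (forall x, 0 <= zeta x) ->
  (forall x, t < `|x| -> zeta x = 0) -> (forall x, `|x - z| <= t -> a x <= K) ->
  conv a zeta z <= K * \int[mu]_x zeta x.
Proof.
move=> ia hz z0 zt aK; have iz := Cc_rint hz.
rewrite /conv -(Rintegral_sub z iz) -RintegralZl//; last exact: integrable_sub.
apply: le_rint; [exact: rint_conv|by apply: rintZ; exact: integrable_sub|] => x.
have [h|h] := leP `|z - x| t; last by rewrite zt// !mulr0.
by rewrite ler_wpM2r//; apply: aK; rewrite distrC.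
Qed.

Lemma conv_ge_local (a zeta : V -> R) z t (K : R) : rint mu a -> Cc_smooth setT zeta -> (forall x, 0 <= zeta x) ->
  (forall x, t < `|x| -> zeta x = 0) -> (forall x, `|x - z| <= t -> K <= a x) ->
  K * \int[mu]_x zeta x <= conv a zeta z.
Proof.
move=> ia hz z0 zt aK; have iz := Cc_rint hz.
rewrite /conv -(Rintegral_sub z iz) -RintegralZl//; last exact: integrable_sub.
apply: le_rint; [by apply: rintZ; exact: integrable_sub|exact: rint_conv|] => x.
have [h|h] := leP `|z - x| t; last by rewrite zt// !mulr0.
by rewrite ler_wpM2r//; apply: aK; rewrite distrC.
Qed.

Lemma levy_ball_integral (s : R) h0 (del : R) : 0 < s < 1 -> 0 < del -> 2 * del <= `|h0| ->
  rint mu (fun h => levy s h * \1_(ball h0 del) h) /\ 0 < \int[mu]_h (levy s h * \1_(ball h0 del) h).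
Proof.
move=> s01 d0 dh; have mB : measurable (ball h0 del : set V) := measurable_rV_ball _ _.
have d20 : 0 < del / 2 by rewrite divr_gt0.
have far h : ball h0 del h -> del < `|h|.
  rewrite rV_ballE /= => hb; have := ler_normD (h0 - h) h; rewrite subrK; move: hb dh; lra.
have [i1 _] := levy_far (n := n) s01 d20.
have i2 : rint mu (fun h => levy s h * \1_(ball h0 del) h).
  apply: (rint_le _ _ i1).
    by apply: measurable_funM; [exact: measurable_levy|exact: measurable_indic].
  move=> h; rewrite normrM (ger0_norm (levy_ge0 _ _)) ler_wpM2l ?levy_ge0// !indicE.
  have [hb|hb] := pselect (ball h0 del h).
    rewrite !mem_set ?normr1//=; apply: lt_trans (far h hb); rewrite ltr_pdivrMr//; lra.
  have -> : (h \in (ball h0 del : set V)) = false by exact: memNset.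
  by rewrite normr0; case: (_ \in _).
split=> //; rewrite lt_neqAle Rintegral_ge0 ?andbT//; last by move=> h _; rewrite mulr_ge0// levy_ge0.
apply/negP => /eqP/esym e0.
have [N [mN N0 hN]] := Rintegral0_null measurableT i2 (fun h _ => mulr_ge0 (levy_ge0 s h) (ler0n _ _)) e0.
have nN : mu.-negligible N by exists N; split.
have [y yb yN] := negligible_ball h0 nN d0.
have := hN y yN I; rewrite indicE mem_set// mulr1 => /eqP; apply/negP; rewrite gt_eqF// levy_gt0//.
by rewrite -normr_gt0; apply: lt_trans (far y yb).
Qed.

Variables (s : R) (s01 : 0 < s < 1) (n0 : (0 < n)%N).
Variables (U : set V) (oU : open U) (bU : norm_bounded U).
Variables (f v : V -> R) (d : 'I_n -> V -> R) (M : R).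
Hypotheses (hs : weak_sol U s f v d) (mf : measurable_fun setT f) (fU : zoff U f).
Hypotheses (f0M : forall x, 0 <= f x <= M) (v0M : forall x, 0 <= v x <= M).
Hypothesis lipv : holder_strong U v 1.

(** Near [x0] the Lipschitz bound gives v <= C |x - x0|, so the mollified value there is O(t), while
    a ball around [x1] contributes a fixed negative amount to the fractional term. Everything else
    in the scale derivative tends to 0. *)
Lemma strong_maximum_principle x0 x1 : U x0 -> v x0 = 0 -> v x1 = 0.
Proof.
move=> Ux0 vx0; have [/eqP//|vx1] := boolP (v x1 == 0); exfalso.
have zu : zoff U v by case: hs => -[].
have Ux1 : U x1 by apply: contrapT => h; move: vx1; rewrite zu// eqxx.
have bf x : `|f x| <= M by have /andP[h1 h2] := f0M x; rewrite ger0_norm.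
have bv x : `|v x| <= M by have /andP[h1 h2] := v0M x; rewrite ger0_norm.
have v0 x : 0 <= v x by case/andP: (v0M x).
have iv : rint mu v by case: hs => hv _ _; exact: (h10_rint oU bU hv).
have vx1p : 0 < v x1 by rewrite lt_neqAle eq_sym vx1 v0.
have x01 : 0 < `|x1 - x0|.
  by rewrite normr_gt0 subr_eq0; apply/eqP => e; move: vx1; rewrite e vx0 eqxx.
pose m0 := v x1 / 2; have m00 : 0 < m0 by rewrite divr_gt0.
have [e1 e10 hv1] : exists2 e : R, 0 < e & forall x, `|x - x1| < e -> m0 <= v x.
  have cv := holder_continuous oU ltr01 lipv Ux1.
  have /nbhs_ballP[e /= e0 he] : nbhs x1 (v @^-1` ball (v x1) m0) := cv _ (nbhsx_ballx (v x1) _ m00).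
  exists e => // x xe; have xb : ball x1 e x by rewrite rV_ballE /= distrC.
  by have := he x xb; rewrite /ball /= ltr_norml /m0; lra.
(* The ball of radius [del] around x1 - x0 avoids |h| <= del, and mollification at scale at most
   [del] stays where v >= m0. *)
have [del [del0 del1 del2]] : exists del : R, [/\ 0 < del, 4 * del <= e1 & 2 * del <= `|x1 - x0|].
  exists (Num.min (e1 / 4) (`|x1 - x0| / 2)); split; first by rewrite lt_min !divr_gt0.
    by rewrite mulrC -ler_pdivlMr// ge_min lexx.
  by rewrite mulrC -ler_pdivlMr// ge_min lexx orbT.
have [iS JS0] := levy_ball_integral s01 del0 del2.
set S := ball (x1 - x0) del in iS JS0; set J := \int[mu]_h _ in JS0.
have [r0 r00 xr0] := open_inner oU Ux0.
have r20 : 0 < r0 / 2 by rewrite divr_gt0.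
have [C C0 hC] := lipv r20.
have xr2 : inner U (r0 / 2) x0 by apply: inner_le xr0; lra.
have vlip x : `|x - x0| <= r0 / 2 -> v x <= C * `|x - x0|.
  move=> xx; have xr : inner U (r0 / 2) x.
    by have h := inner_near xr0 xx; apply: inner_le h; lra.
  have := hC x x0 xr xr2; rewrite vx0 subr0 powRr1//.
  exact: le_trans (ler_norm _).
(* Here [Q] is chosen first and P = -2 Q'; both are nonnegative, and the integral of [Q] is
   positive. *)
pose Q : R -> R := bump_profile.
pose P (q : R) : R := 2 * einv1 (1 - q).
have hQ : profile Q := bump_profileP.
have dQ (q : R) : is_derive q (1 : R) Q (- 2^-1 * P q).
  have h1 : is_derive q (1 : R) (fun q : R => 1 - q) (- 1).
    by have := is_deriveB (is_derive_cst (1 : R) q (1 : R)) (is_derive_id q (1 : R)); rewrite sub0r.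
  have := @is_derive1_comp _ (@einv R) (fun q : R => 1 - q) q _ _ (is_derive_einv (1 - q)) h1.
  by congr is_derive; rewrite /P mulrN1 mulNr mulKf.
have hP : profile P.
  split; last by move=> q q1; rewrite /P einv1_le0 ?mulr0// subr_le0.
  have [D [D0 hD]] := smooth1_comp_affine (-1) 1 (@smooth1_einv1 R).
  exists (fun k q => 2 * D k q); split.
    by apply/funext => q; rewrite D0 /P mulN1r addrC.
  by move=> k q; have := is_deriveZ 2 (hD k q).
have P0 q : 0 <= P q by rewrite mulr_ge0// einv1_ge0.
have Q0 q : 0 <= Q q by exact: einv_ge0.
set IQ := \int[mu]_x (rad Q x : R); have IQ0 : 0 < IQ by exact: Rintegral_bump_gt0.
have hzQ : Cc_smooth setT (rad Q : V -> R) := Cc_rad hQ.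
have [s0 s1] := andP s01.
(* A decay just below 2: second derivatives at scale [t] are then O(t^(-(1-s)/2)). *)
pose B : R := 2 - (1 - s) / 2.
have hB : decays U v B 2.
  apply: (decays_iter s01 oU bU hs mf fU bf bv (sigma := 0)); rewrite /B; try lra.
  move=> rho rho0; apply: decays0; have [L L0 hL] := truncated_rhs_bound s01 oU bU hs bf bv rho0.
  by split; [exact: (rint_truncated_rhs s01 oU bU hs mf bf bv rho0)|exists L].
have [C2 C20 hC2] : exists2 C2 : R, 0 <= C2 & forall i j z t, inner U (r0 / 2) z -> 0 < t <= 1 ->
    `|dpart [:: i; j] (mollify v Q t) z| <= C2 * t `^ (B - 2).
  have [|[i j]|C2 C20 hC2] := @finite_bound R ('I_n * 'I_n)%type (fun ij C2 => forall z t, inner U (r0 / 2) z -> 0 < t <= 1 ->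
    `|dpart [:: ij.1; ij.2] (mollify v Q t) z| <= C2 * t `^ (B - 2)).
  - by move=> ij D D' DD h z t zr t1; apply: le_trans (h z t zr t1) _; rewrite ler_wpM2r// powR_ge0.
  - exact: (decays_mollify_bound iv hQ (l := [:: i; j]) hB).
  - by exists C2 => // i j; exact: (hC2 (i, j)).
have near0 := near_const_ge0 (n := n) s; have far0 := far_const_ge0 (n := n) s.
set near := near_const s in near0; set far := far_const s in far0.
have key t : 0 < t <= 1 -> t <= del -> t <= r0 / 2 -> t `^ (1 / 2) <= del -> t `^ (1 / 2) <= r0 / 4 ->
    conv v (lapl (dilate n t (rad Q))) x0 <=
    (n%:R ^+ 2 * C2 * near + 2 * C * IQ * far) * t `^ ((1 - s) / 2) - m0 * IQ * J.
  move=> t01 td tr tau1 tau2; have t0 : 0 < t by case/andP: t01.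
  pose psi : V -> R := dilate n t (rad Q).
  have hpsi : Cc_smooth setT psi by exact: Cc_dilate.
  have out x : t < `|x| -> psi x = 0.
    by move=> tx; apply: (@dilate_out _ _ n t (rad Q) 1) => //; [move=> y; exact: rad_out|rewrite mulr1].
  have psi0 x : 0 <= psi x by rewrite mulr_ge0 ?exprn_ge0 ?invr_ge0 ?(ltW t0)//; exact: Q0.
  have Ipsi : \int[mu]_x psi x = IQ by exact: (Rintegral_dilate t0 (Cc_rint hzQ)).
  pose c : V -> R := mollify v Q t.
  have c0 x : 0 <= c x.
    have := conv_ge_local (K := 0) iv hpsi psi0 out (fun y _ => v0 y).
    by rewrite mul0r; exact.
  have cx0 : c x0 <= C * t * IQ.
    rewrite -Ipsi; apply: (conv_le_local iv hpsi psi0 out) => x xt.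
    by apply: le_trans (vlip x (le_trans xt tr)) _; exact: ler_wpM2l.
  have cS h : S h -> m0 * IQ <= c (x0 + h).
    move=> Sh; rewrite -Ipsi; apply: (conv_ge_local iv hpsi psi0 out) => y yt; apply: hv1.
    have -> : y - x1 = (y - (x0 + h)) + (h - (x1 - x0)).
      by apply/rowP => i; rewrite !mxE; ring.
    apply: le_lt_trans (ler_normD _ _) _; move: Sh; rewrite /S rV_ballE /= distrC => Sh.
    by move: yt td del1 Sh del0; lra.
  (* The near part is then t^(-(1-s)/2) tau^(2-2s) = t^((1-s)/2), and the far part t tau^(-2s) =
     t^(1-s); both tend to 0. *)
  pose tau := t `^ (1 / 2); have tau0 : 0 < tau by exact: powR_gt0.
  have A0 : 0 <= C2 * t `^ (B - 2) by rewrite mulr_ge0 ?powR_ge0.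
  pose D h := 2 * c x0 - c (x0 + h) - c (x0 - h).
  have sc : smooth c by exact: smooth_mollify.
  have hA h : `|h| <= tau -> `|D h| <= n%:R ^+ 2 * (C2 * t `^ (B - 2)) * `|h| ^+ 2.
    move=> ht; rewrite /D diff2_opp normrN.
    apply: (smooth_diff2_local sc A0) => i j y hy; apply: (hC2 i j y t _ t01).
    have hy2 : `|y - x0| <= r0 / 2 by apply: le_trans hy _; move: ht tau2; rewrite -/tau; lra.
    by have h2 := inner_near xr0 hy2; apply: inner_le h2; lra.
  have xt : inner U t x0 by apply: inner_le xr0; lra.
  have [iD eD] := conv_equation s01 oU bU hs hpsi out xt.
  have f0 : 0 <= conv f psi x0.
    by apply: Rintegral_ge0 => x _; rewrite mulr_ge0//; case/andP: (f0M x).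
  have {}eD : conv v (lapl psi) x0 <= \int[mu]_h (levy s h * D h) by move: eD f0; rewrite /D /c /mollify -/psi; lra.
  apply: le_trans eD _.
  have [in1 en1] := levy_near (n := n) s01 tau0; have [if1 ef1] := levy_far (n := n) s01 tau0.
  pose g1 (h : V) := `|h| ^+ 2 * levy s h * \1_[set h : V | `|h| <= tau] h.
  pose g2 (h : V) := levy s h * \1_[set h : V | tau < `|h|] h.
  pose g3 (h : V) := levy s h * \1_S h.
  have ig : rint mu (fun h => n%:R ^+ 2 * (C2 * t `^ (B - 2)) * g1 h + 2 * c x0 * g2 h - m0 * IQ * g3 h).
    by apply: rintB; [apply: rintD; exact: rintZ|exact: rintZ].
  (* For |h| <= tau second derivatives are used; for larger [h] only the nonnegativity of the
     mollified values at x0 + h and x0 - h, except on [S], where the first is at least m0 IQ. *)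
  have le1 : \int[mu]_h (levy s h * D h) <=
      \int[mu]_h (n%:R ^+ 2 * (C2 * t `^ (B - 2)) * g1 h + 2 * c x0 * g2 h - m0 * IQ * g3 h).
    apply: le_rint => // h; rewrite /g1 /g2 /g3 !indicE.
    have [ht|ht] := leP `|h| tau.
      rewrite mem_set// memNset; last by rewrite /= ltNge ht.
      rewrite memNset; last first.
        rewrite /S rV_ballE /= => Sh; have := ler_normD (x1 - x0 - h) h; rewrite subrK.
        by move: Sh ht tau1 del2 del0; rewrite -/tau; lra.
      rewrite !mulr0 subr0 addr0 mulr1 [leRHS](_ : _ = levy s h * (n%:R ^+ 2 * (C2 * t `^ (B - 2)) * `|h| ^+ 2)); last by ring.
      by rewrite ler_wpM2l ?levy_ge0//; apply: le_trans (hA h ht); exact: ler_norm.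
    rewrite memNset; last by rewrite /= leNgt ht.
    rewrite mem_set// !mulr0 add0r mulr1.
    have cm := c0 (x0 - h); have cp := c0 (x0 + h).
    have [Sh|Sh] := pselect (S h).
      rewrite mem_set// mulr1 [leRHS](_ : _ = levy s h * (2 * c x0 - m0 * IQ)); last by ring.
      rewrite ler_wpM2l ?levy_ge0// /D; move: (cS h Sh) cm.
      move: (c (x0 + h)) (c (x0 - h)) (c x0) => a1 a2 a3 ha1 ha2.
      by rewrite -addrA -opprD lerD2l lerN2 (le_trans ha1)// lerDl.
    rewrite memNset// !mulr0 subr0 mulrC ler_wpM2r ?levy_ge0// /D; move: cp cm.
    move: (c (x0 + h)) (c (x0 - h)) (c x0) => a1 a2 a3 ha1 ha2.
    by rewrite -addrA gerDl -opprD oppr_le0 addr_ge0.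
  apply: le_trans le1 _.
  rewrite RintegralB; [|by []|by apply: rintD; exact: rintZ|exact: rintZ].
  rewrite RintegralD; [|by []|exact: rintZ|exact: rintZ].
  rewrite RintegralZl// RintegralZl// RintegralZl// en1 ef1 -/near -/far -/J.
  rewrite lerD2r [leRHS]mulrDl; apply: lerD.
    have e : t `^ (B - 2) * tau `^ (2 - 2 * s) = t `^ ((1 - s) / 2).
      by rewrite /tau -powRrM -powR_add//; congr (_ `^ _); rewrite /B; ring.
    by rewrite -e; apply: le_of_eq; ring.
  have e : t * tau `^ (- (2 * s)) = t `^ (1 - s).
    have -> : 1 - s = 1 + 1 / 2 * (- (2 * s)) by field.
    by rewrite powR_add// powRr1 ?(ltW t0)// /tau -powRrM.
  apply: le_trans (_ : 2 * (C * t * IQ) * (tau `^ (- (2 * s)) * far) <= _).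
    by rewrite ler_wpM2r ?mulr_ge0 ?powR_ge0// ler_wpM2l.
  rewrite [leLHS](_ : _ = 2 * C * IQ * far * (t * tau `^ (- (2 * s)))); last by ring.
  rewrite e ler_wpM2l ?mulr_ge0 ?(ltW IQ0)//; apply: powR_le_exp => //; lra.
(* The mollified value at [x0] as a function of the scale: nonnegative, at most C IP t for small
   [t], and decreasing by the estimate just proved, which is contradictory. *)
pose G t := conv v (dilate n t (rad P)) x0.
have dG t : 0 < t -> is_derive t (1 : R) G (t * conv v (lapl (dilate n t (rad Q))) x0).
  by move=> t0; have := conv_rad_derive [::] x0 iv hP hQ dQ t0; rewrite /= addn0.
have outP t x : 0 < t -> t < `|x| -> dilate n t (rad P) x = 0.
  by move=> t0 tx; apply: (@dilate_out _ _ n t (rad P) 1) => //; [move=> y; exact: rad_out|rewrite mulr1].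
have dP0 t x : 0 < t -> 0 <= dilate n t (rad P) x.
  by move=> t0; rewrite mulr_ge0 ?exprn_ge0 ?invr_ge0 ?(ltW t0)//; exact: P0.
have G0 t : 0 < t -> 0 <= G t.
  move=> t0; have := @conv_ge_local v _ x0 t 0 iv (Cc_dilate n t0 (Cc_rad hP)) (fun x => dP0 t x t0) (fun x => outP t x t0).
  by rewrite mul0r; apply=> x _.
set IP := \int[mu]_x (rad P x : R).
have IP0 : 0 <= IP by apply: Rintegral_ge0 => x _; exact: P0.
have GL t : 0 < t -> t <= r0 / 2 -> G t <= C * t * IP.
  move=> t0 tr; rewrite /IP -(Rintegral_dilate t0 (Cc_rint (Cc_rad hP))).
  apply: (conv_le_local iv (Cc_dilate n t0 (Cc_rad hP)) (fun x => dP0 t x t0) (fun x => outP t x t0)).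
  move=> x xt; apply: le_trans (vlip x (le_trans xt tr)) _; exact: ler_wpM2l.
pose mJ := m0 * IQ * J; have mJ0 : 0 < mJ by rewrite !mulr_gt0.
have K0 : 0 <= n%:R ^+ 2 * C2 * near + 2 * C * IQ * far.
  by rewrite addr_ge0// !mulr_ge0// ltW.
have s20 : 0 < (1 - s) / 2 by lra.
have half0 : 0 < 1 / 2 :> R by lra.
have [t1 /andP[t10 t11] ht1] := powR_le1_ex K0 s20 (divr_gt0 mJ0 (ltr0n R 2)).
have q0 : 0 < Num.min del (r0 / 4) by rewrite lt_min del0 divr_gt0.
have [t2 /andP[t20 t21] ht2] := powR_le1_ex ler01 half0 q0.
have [t3 [t30 t3t1 t3t2 t3d t3r]] : exists t3 : R, [/\ 0 < t3, t3 <= t1, t3 <= t2, t3 <= del & t3 <= r0 / 2].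
  exists (Num.min (Num.min t1 t2) (Num.min del (r0 / 2))); split; first by rewrite !lt_min t10 t20 del0.
  - by rewrite !ge_min lexx.
  - by rewrite !ge_min lexx orbT.
  - by rewrite !ge_min lexx !orbT.
  - by rewrite !ge_min lexx !orbT.
have neg t : 0 < t -> t <= t3 -> t * conv v (lapl (dilate n t (rad Q))) x0 < 0.
  move=> t0 tt3; have h1 := le_trans tt3 t3t1; have h2 := le_trans tt3 t3t2.
  have h3 := le_trans tt3 t3d; have h4 := le_trans tt3 t3r.
  rewrite pmulr_rlt0//.
  have p2 : t `^ (1 / 2) <= Num.min del (r0 / 4).
    by apply: le_trans ht2; rewrite -[leLHS]mul1r ler_wpM2l//; exact: (powR_le_base t0 h2 (ltW half0)).
  move: p2; rewrite le_min => /andP[p2 p3].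
  have := key t _ h3 h4 p2 p3; rewrite t0 (le_trans h1 t11) => /(_ isT) h.
  have p1 : t `^ ((1 - s) / 2) <= t1 `^ ((1 - s) / 2) by apply: powR_le_base => //; exact: ltW.
  have := ler_wpM2l K0 p1; move: h ht1 mJ0; rewrite -/mJ; lra.
apply: (@no_decrease R G (fun t => t * conv v (lapl (dilate n t (rad Q))) x0) (C * IP) t3) => //.
- exact: mulr_ge0.
- by move=> t t0 tt3; rewrite mulrAC; apply: GL => //; exact: le_trans tt3 t3r.
Qed.

End strong_maximum.

Theorem theoremA1 (R : realType) (n : nat) (n_gt0 : (0 < n)%N)
    (Omega : set 'rV[R]_n) (Omega_domain : bounded_C11_domain Omega)
    (s : R) (s01 : 0 < s < 1) (alpha : R) (alpha01 : 0 < alpha < 1)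
    (g : 'rV[R]_n -> R -> R)
    (g_holder : holder_loc alpha (Omega `*` [set: R]) (fun p => g p.1 p.2))
    (g_ge0 : forall x t, Omega x -> 0 <= g x t)
    (c q : R) (c_gt0 : 0 < c) (q_ge1 : 1 <= q)
    (q_le : (q%:E <= critical_exponent n)%E)
    (g_growth : {ae lebesgue_rV n, forall x, Omega x ->
       forall t, `|g x t| <= c * (1 + `|t| `^ (q - 1))})
    (u : 'rV[R]_n -> R) (u_sol : weak_solution s Omega g u) :
  exists v : 'rV[R]_n -> R,
    [/\ {ae lebesgue_rV n, forall x, u x = v x},
        continuous v,
        C2_holder_loc alpha Omega v &
        (exists x, v x != 0) -> forall x, Omega x -> 0 < v x].
Proof.
have [oU _ _ bdU hbd] := Omega_domain; have /andP[a0 _] := alpha01.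
have bU : exists M : R, forall x, Omega x -> `|x| <= M.
  by have [M _ hM] := bounded_set_le bdU; exists M.
have [f [u1 [d [M [hs mf M0 bnd [N [mN N0 hN]]]]]]] :=
  bounded_solution n_gt0 oU a0 g_holder bU g_ge0 c_gt0 q_ge1 q_le g_growth u_sol.
have fg x : ~ N x -> Omega x -> f x = g x (u1 x) by move=> xN; have [_] := hN x xN; exact.
have [v [mv zv vM C2v [lipv [N' [mN' N'0 hN']]]]] :=
  interior_regularity s01 n_gt0 oU bU alpha01 g_holder g_ge0 hs mf bnd mN N0 fg.
have hsv : weak_sol Omega s f v d := weak_sol_null mN' N'0 mv zv hN' hs.
have cv x : Omega x -> {for x, continuous v} by case: C2v => -[h _] _; exact: h.
have v0 x : 0 <= v x.
  have [Ux|Ux] := pselect (Omega x); last by rewrite zv.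
  apply: (@ae_le_continuous R n (cst 0) v N' x mN' N'0 _ _ (cv x Ux)).
    by move=> y yN; rewrite -(hN' y yN); case: (bnd y) => /andP[].
  exact: cst_continuous.
have v0M x : 0 <= v x <= M by rewrite v0 (le_trans (ler_norm _))//.
have bf x : `|f x| <= M by have [_ /andP[h1 h2]] := bnd x; rewrite ger0_norm.
exists v; split.
- apply: (null_set_ae (N := N `|` N')); [exact: measurableU|by rewrite measureU0|].
  by move=> x /not_orP[xN xN']; have [-> _] := hN x xN; exact: hN'.
- exact: (boundary_continuity s01 n_gt0 oU bU hsv mf M0 bf v0M cv hbd).
- exact: C2v.
- move=> [x1 vx1] x0 Ux0; rewrite lt_neqAle v0 andbT eq_sym; apply/negP => /eqP vx0.
  (* The equation constrains [f] only inside [Omega]; the maximum principle takes a right-hand side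
     vanishing outside. *)
  pose f1 x := f x * \1_Omega x.
  have mU := open_measurable oU.
  have hs1 : weak_sol Omega s f1 v d.
    apply: (conv_rhs_null measurable0 (measure0 _) _ hsv) => x _ Ux.
    by rewrite /f1 indicE mem_set// mulr1.
  have mf1 : measurable_fun setT f1 by apply: measurable_funM => //; exact: measurable_indic.
  have f1M x : 0 <= f1 x <= M.
    rewrite /f1 indicE; case: (x \in Omega); last by rewrite mulr0 lexx ltW.
    by rewrite mulr1; case: (bnd x).
  have z1 : zoff Omega f1 by move=> x Ux; rewrite /f1 indicE memNset// mulr0.
  have := strong_maximum_principle s01 oU bU hs1 mf1 z1 f1M v0M lipv x1 Ux0 vx0.
  by move: vx1 => /eqP.
Qed.
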